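(* Let $n\ge2$, $1\le k\le n$, $\theta\in(0,\pi)$, $1<p<k+1$, and let $f$ be a positive smooth function on $\mathcal{C}_\theta$. Then the positive admissible solution of $$\sigma_k(\nabla^2h+h\sigma)=f\,h^{p-1}\ \text{ in }\mathcal{C}_\theta,\qquad \nabla_\mu h=\cot\theta\, h\ \text{ on }\partial\mathcal{C}_\theta$$ is unique.
   Context: Let $e=-E_{n+1}$, $E_1,\dots,E_{n+1}$ the standard basis of $\mathbb{R}^{n+1}$, $\overline{\mathbb{R}^{n+1}_+}=\{x_{n+1}\ge0\}$. $\mathcal{C}_\theta=\{\xi\in\overline{\mathbb{R}^{n+1}_+}:|\xi-\cos\theta\,e|=1\}$ with round metric $\sigma$, connection $\nabla$, unit outward conormal $\mu$ of $\partial\mathcal{C}_\theta$. $\sigma_k(W)$ is the $k$-th elementary symmetric function of the eigenvalues of $W$; $\Gamma_k=\{\lambda\in\mathbb{R}^n:\sigma_i(\lambda)>0,1\le i\le k\}$; $h\in C^2(\mathcal{C}_\theta)$ is admissible if the eigenvalues of $\nabla^2h+h\sigma$ lie in $\Gamma_k$ everywhere. *)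

(* Defs.v *)
From HB Require Import structures.
From mathcomp Require Import all_boot all_order all_algebra.
From mathcomp Require Import all_classical all_reals all_analysis.
Set Implicit Arguments. Unset Strict Implicit. Unset Printing Implicit Defensive.
Import Order.TTheory GRing.Theory Num.Theory.
Import numFieldNormedType.Exports.
Local Open Scope classical_set_scope.
Local Open Scope ring_scope.

(* Euclidean inner product (the built-in norm on 'rV is the max norm). *)
Definition dotp (R : realType) (m : nat) (u v : 'rV[R]_m) : R :=
  \sum_(i < m) u 0 i * v 0 i.

Definition basisv (R : realType) (m : nat) (i : 'I_m) : 'rV[R]_m :=
  \row_j (i == j)%:R.

Definition iterD (R : realType) (m : nat) (s : seq 'I_m)
  (F : 'rV[R]_m -> R) : 'rV[R]_m -> R :=
  foldr (fun i G => fun x => 'D_(basisv R i) G x) F s.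

Definition Ck_on (R : realType) (m : nat) (U : set 'rV[R]_m) (k : nat)
  (F : 'rV[R]_m -> R) : Prop :=
  forall s : seq 'I_m, (size s <= k)%N -> forall x, U x ->
    {for x, continuous (iterD s F)} /\
    ((size s < k)%N -> forall i, derivable (iterD s F) x (basisv R i)).

Definition sigmak (R : realType) (n k : nat) (lam : 'I_n -> R) : R :=
  \sum_(A : {set 'I_n} | #|A| == k) \prod_(i in A) lam i.

Definition in_Gamma (R : realType) (n k : nat) (lam : 'I_n -> R) : Prop :=
  forall i : nat, (1 <= i <= k)%N -> 0 < sigmak i lam.

Definition Elast (R : realType) (n : nat) : 'rV[R]_n.+1 := basisv R ord_max.

Definition capcenter (R : realType) (n : nat) (theta : R) : 'rV[R]_n.+1 :=
  cos theta *: (- Elast R n).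

Definition cap (R : realType) (n : nat) (theta : R) : set 'rV[R]_n.+1 :=
  [set xi : 'rV[R]_n.+1 | 0 <= xi 0 ord_max /\
            dotp (xi - capcenter n theta) (xi - capcenter n theta) = 1].

Arguments cap {R} n theta.

Definition capbdry (R : realType) (n : nat) (theta : R) : set 'rV[R]_n.+1 :=
  [set xi : 'rV[R]_n.+1 | cap n theta xi /\ xi 0 ord_max = 0].

Arguments capbdry {R} n theta.

Definition capnormal (R : realType) (n : nat) (theta : R) (xi : 'rV[R]_n.+1)
  : 'rV[R]_n.+1 := xi - capcenter n theta.

(* unit outward conormal of the boundary of C_theta (tangent to the sphere,
   normal to the boundary, pointing out of C_theta): the normalised
   tangential projection of -E_{n+1}. *)
Definition conormal (R : realType) (n : nat) (theta : R) (xi : 'rV[R]_n.+1)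
  : 'rV[R]_n.+1 :=
  (sin theta)^-1 *: (cos theta *: capnormal theta xi - Elast R n).

Definition ambHess (R : realType) (n : nat) (h : 'rV[R]_n.+1 -> R)
  (xi : 'rV[R]_n.+1) : 'M[R]_n.+1 :=
  \matrix_(i, j) 'D_(basisv R i) ('D_(basisv R j) h) xi.

Definition tanproj (R : realType) (n : nat) (theta : R) (xi : 'rV[R]_n.+1)
  : 'M[R]_n.+1 :=
  1%:M - (capnormal theta xi)^T *m capnormal theta xi.

(* Gauss formula: nabla^2 h (X,Y) = D^2 h (X,Y) - <X,Y> d_nu h for X,Y
   tangent.  W represents (nabla^2 h + h sigma) on T_xi, extended by 0 on
   the normal line. *)
Definition Wmat (R : realType) (n : nat) (theta : R) (h : 'rV[R]_n.+1 -> R)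
  (xi : 'rV[R]_n.+1) : 'M[R]_n.+1 :=
  tanproj theta xi *m
    (ambHess h xi + (h xi - 'D_(capnormal theta xi) h xi)%:M)
  *m tanproj theta xi.

(* lam lists (with multiplicity) the n eigenvalues of the restriction of W
   to the tangent space (W kills the normal line, giving the extra root 0). *)
Definition tangent_eigs (R : realType) (n : nat) (W : 'M[R]_n.+1)
  (lam : 'I_n -> R) : Prop :=
  char_poly W = 'X * \prod_(i < n) ('X - (lam i)%:P).

Definition pos_admissible_solution (R : realType) (n k : nat) (theta p : R)
  (f h : 'rV[R]_n.+1 -> R) : Prop :=
  (exists U : set 'rV[R]_n.+1, open U /\ cap n theta `<=` U /\ Ck_on U 2 h) /\
  (forall xi, cap n theta xi ->
     0 < h xi /\
     exists lam : 'I_n -> R,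
       tangent_eigs (Wmat theta h xi) lam /\ in_Gamma k lam /\
       sigmak k lam = f xi * h xi `^ (p - 1)) /\
  (forall xi, capbdry n theta xi ->
     'D_(conormal theta xi) h xi = cos theta / sin theta * h xi).

Definition pos_smooth_on_cap (R : realType) (n : nat) (theta : R)
  (f : 'rV[R]_n.+1 -> R) : Prop :=
  (exists U : set 'rV[R]_n.+1, open U /\ cap n theta `<=` U /\
     forall k, Ck_on U k f) /\
  (forall xi, cap n theta xi -> 0 < f xi).

Arguments pos_admissible_solution {R} n k theta p f h.
Arguments pos_smooth_on_cap {R} n theta f.

(* Main.v *)
(** Stereographic projection turns the cap into a Euclidean ball with conformal
    factor [phi], the boundary condition into a Robin condition, and
    [sigma_k(nabla^2 h + h)] into [sg k (Sh h)]. The linearisation [Lop k h] of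
    this operator at [h] is a symmetric divergence-form operator, and
    [V(u, v, h, ..., h)], the integral of [u * Lop k h v], is a symmetric mixed volume.

    Alexandrov-Fenchel for [V]: with the weight [m] such that [h] has eigenvalue
    [1], the operator [A = m^-1 L_h] has [1] as simple largest eigenvalue (ground
    state substitution and the Poincare inequality), while Bochner's formula gives
    [|A u|^2 >= <A u, u>], so that [A] has no spectrum in (0, 1). Hence [A <= 0] on
    the complement of [h]. No spectral theorem is used: only the density of
    the range of [A - mu], obtained by the continuity method along a segment of
    base functions, and near-maximisers of the Rayleigh quotient.

    For two solutions [h1], [h2], Gaarding's inequality, the equation and a tangent
    line inequality for powers (this is where [1 < p < k + 1] enters) bound
    [V(h1, h1, h2, ...)] from below in terms of [V(h1, h2, ...)] and
    [V(h2, h2, ...)]; with Alexandrov-Fenchel this gives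
    [V(h1, h2, ..., h2) >= V(h2, h2, ..., h2)], that is, up to a positive weight,
    the integral of [(h1 - h2) * h2 `^ (p - 1)] is nonnegative. Adding the same inequality
    with [h1] and [h2] exchanged forces [h1 = h2]. *)

Require Import Defs.
From HB Require Import structures.
From mathcomp Require Import all_boot all_order all_algebra all_fingroup.
From mathcomp Require Import polyrcf spectral complex.
From mathcomp Require Import ring lra zify.
Set Implicit Arguments. Unset Strict Implicit. Unset Printing Implicit Defensive.
Import Order.TTheory GRing.Theory Num.Theory.
Local Open Scope ring_scope.

(** * Elementary symmetric functions and Gaarding's inequality *)

(** Solutions are only C^2, whereas the divergence identity behind the symmetry of [Lop]
    differentiates the base function three times. It is therefore proved for polynomial base
    functions and carried over by C^2 approximation, in a weak form ([weak_div]) that differentiates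
    no flux. Of integration only linearity, positivity, strict positivity on continuous functions
    and the vanishing of the integral of a compactly supported derivative are used; a
    translation-invariant mean has these properties, and radial cutoffs turn the last one into the
    divergence theorem on a ball. At the boundary the Robin condition [qf h = 0] makes the position
    vector [w] an eigenvector of [Sh h w], hence of every Newton tensor, and this kills the normal
    flux. The continuity method starts at [ell], whose [Sh] is a multiple of the identity; there the
    problem is compared with a Laplace equation that polynomials solve degree by degree. The
    spectral argument for Alexandrov-Fenchel needs the order of the equation to be at least 2. In
    order 1 the operator [Lop 0] does not depend on its base, and the inequality is deduced from the
    one with base [ell]. *)

Section Esym.
Variables (R : comNzRingType) (I : finType).
Implicit Types (D B : {set I}) (lam : I -> R).

Definition elsym (k : nat) D lam : R :=
  \sum_(B : {set I} | (B \subset D) && (#|B| == k)) \prod_(i in B) lam i.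

Lemma elsym0 D lam : elsym 0 D lam = 1.
Proof.
rewrite /elsym (big_pred1 set0) ?big_set0 // => B /=.
by rewrite cards_eq0; case: eqP => [->|]; rewrite ?sub0set ?andbF.
Qed.

Lemma elsym_card_lt k D lam : (#|D| < k)%N -> elsym k D lam = 0.
Proof.
move=> Dk; rewrite /elsym big_pred0 // => B; apply/negbTE/negP => /andP[BD /eqP Bk].
by have := subset_leq_card BD; rewrite Bk leqNgt Dk.
Qed.

Lemma elsymS k D lam i : i \in D ->
  elsym k.+1 D lam = elsym k.+1 (D :\ i) lam + lam i * elsym k (D :\ i) lam.
Proof.
move=> iD; rewrite /elsym (bigID (fun B : {set I} => i \in B)) /= addrC; congr (_ + _).
  apply: eq_bigl => B; rewrite subsetD1 -!andbA; congr (_ && _); exact: andbC.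
rewrite mulr_sumr (reindex_onto (fun B => i |: B) (fun B => B :\ i)) /=; last first.
  by move=> B /andP[_ iB]; rewrite setD1K.
apply: eq_big => [B|B /andP[/andP[_ _] /eqP iB]].
  rewrite setU11 andbT subUset sub1set iD /=.
  apply/idP/idP => [/andP[/andP[BD /eqP Bk] /eqP iB]|/andP[]].
    have niB : i \notin B by rewrite -iB setD11.
    by rewrite subsetD1 BD niB /=; move: Bk; rewrite cardsU1 niB add1n => -[->].
  rewrite subsetD1 => /andP[-> niB] /eqP <-.
  by rewrite cardsU1 niB add1n eqxx /= setU1K.
by rewrite big_setU1 //= -iB setD11.
Qed.

(** Euler's identity: [elsym k (D :\ i)] is the partial derivative of [elsym k.+1 D] in the variable
    [i], and a subset of size [k.+1] is counted once for each of its elements. *)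
Lemma elsym_sum_mul k D lam :
  \sum_(i in D) lam i * elsym k (D :\ i) lam = elsym k.+1 D lam *+ k.+1.
Proof.
move: {2}#|D| (erefl #|D|) => m; elim: m D k => [|m IH] D k Dm.
  rewrite [in RHS]elsym_card_lt ?Dm // mul0rn big_pred0 // => i.
  by rewrite (cards0_eq Dm) inE.
have [i iD] : exists i, i \in D by apply/set0Pn; rewrite -cards_eq0 Dm.
have Dim : #|D :\ i| = m by move: Dm; rewrite (cardsD1 i) iD add1n => -[].
rewrite (bigD1 i) //= (elsymS k lam iD).
have -> : \sum_(j in D | j != i) lam j * elsym k (D :\ j) lam =
    \sum_(j in D :\ i) lam j * elsym k (D :\ j) lam.
  by apply: eq_bigl => j; rewrite !inE andbC.
case: k => [|k].
  under eq_bigr do rewrite elsym0 -(elsym0 (D :\ i :\ i) lam).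
  under eq_bigr => j _ do rewrite [elsym 0 _ _]elsym0 -(elsym0 (D :\ i :\ j) lam).
  by rewrite IH // !elsym0 addrC.
have -> : \sum_(j in D :\ i) lam j * elsym k.+1 (D :\ j) lam =
    \sum_(j in D :\ i) lam j * elsym k.+1 (D :\ i :\ j) lam +
    lam i * \sum_(j in D :\ i) lam j * elsym k (D :\ i :\ j) lam.
  rewrite mulr_sumr -big_split /=; apply: eq_bigr => j; rewrite !inE => /andP[ji jD].
  rewrite (@elsymS k (D :\ j) lam i); last by rewrite !inE eq_sym ji.
  have -> : D :\ j :\ i = D :\ i :\ j by apply/setP => l; rewrite !inE; do 2!case: eqP.
  ring.
rewrite !IH //; move: (elsym _ _ _) (elsym _ _ _) => a b; rewrite !mulrS -mulr_natl -[b *+ k]mulr_natl; ring.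
Qed.

(** Up to the factor, this is the derivative of [elsym k.+1] along (1, ..., 1); it governs shifts of
    all variables by one constant. *)
Lemma elsym_sum k D lam :
  \sum_(i in D) elsym k (D :\ i) lam = elsym k D lam *+ (#|D| - k).
Proof.
have [kD|Dk] := leqP #|D| k.
  rewrite (eqP kD) mulr0n big1 // => i iD.
  by rewrite elsym_card_lt // (leq_trans _ kD) // [in X in (_ < X)%N](cardsD1 i) iD.
case: k Dk => [_|k Dk].
  by rewrite elsym0 subn0; under eq_bigr do rewrite elsym0; rewrite sumr_const.
have : \sum_(i in D) (elsym k.+1 D lam) = elsym k.+1 D lam *+ #|D| by rewrite sumr_const.
have -> : \sum_(i in D) elsym k.+1 D lam =
    \sum_(i in D) (elsym k.+1 (D :\ i) lam + lam i * elsym k (D :\ i) lam).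
  by apply: eq_bigr => i iD; rewrite (elsymS k lam iD).
rewrite big_split /= elsym_sum_mul => /(canRL (addrK _)) ->.
by rewrite -mulrnBr // ltnW.
Qed.

Lemma eq_elsym k D lam lam' : {in D, lam =1 lam'} -> elsym k D lam = elsym k D lam'.
Proof.
move=> e; apply: eq_bigr => B /andP[/subsetP BD _].
by apply: eq_bigr => i iB; apply: e; apply: BD.
Qed.

Lemma elsymZ k D c lam : elsym k D (fun i => c * lam i) = c ^+ k * elsym k D lam.
Proof.
rewrite /elsym mulr_sumr; apply: eq_bigr => B /andP[_ /eqP Bk].
by rewrite big_split /= prodr_const Bk.
Qed.

Lemma elsym1 D lam : elsym 1 D lam = \sum_(i in D) lam i.
Proof.
have := elsym_sum_mul 0 D lam; rewrite mulr1n => <-.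
by apply: eq_bigr => i _; rewrite elsym0 mulr1.
Qed.

End Esym.

Lemma rmorph_elsym (R S : comNzRingType) (f : {rmorphism R -> S}) (I : finType) k
    (D : {set I}) lam : f (elsym k D lam) = elsym k D (f \o lam).
Proof. by rewrite rmorph_sum; apply: eq_bigr => B _; rewrite rmorph_prod. Qed.

Lemma horner_elsym (R : comNzRingType) (I : finType) k (D : {set I}) (f : I -> {poly R}) x :
  (elsym k D f).[x] = elsym k D (fun i => (f i).[x]).
Proof. exact: (rmorph_elsym (horner_eval x)). Qed.

Lemma deriv_elsym (R : comNzRingType) (I : finType) k (D : {set I}) (f : I -> {poly R}) :
  (elsym k.+1 D f)^`() = \sum_(i in D) (f i)^`() * elsym k (D :\ i) f.
Proof.
move: {2}#|D| (erefl #|D|) => m; elim: m D k => [|m IH] D k Dm.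
  rewrite elsym_card_lt ?Dm // deriv0 big_pred0 // => i.
  by rewrite (cards0_eq Dm) inE.
have [i iD] : exists i, i \in D by apply/set0Pn; rewrite -cards_eq0 Dm.
have Dim : #|D :\ i| = m by move: Dm; rewrite (cardsD1 i) iD add1n => -[].
rewrite (bigD1 i) //= (elsymS k f iD) derivD derivM IH //.
have -> : \sum_(j in D | j != i) (f j)^`() * elsym k (D :\ j) f =
    \sum_(j in D :\ i) (f j)^`() * elsym k (D :\ j) f.
  by apply: eq_bigl => j; rewrite !inE andbC.
case: k => [|k].
  rewrite !elsym0 derivC mulr0 addr0 !mulr1 addrC; congr (_ + _).
  by apply: eq_bigr => j _; rewrite !elsym0.
have -> : \sum_(j in D :\ i) (f j)^`() * elsym k.+1 (D :\ j) f =
    \sum_(j in D :\ i) (f j)^`() * elsym k.+1 (D :\ i :\ j) f +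
    f i * \sum_(j in D :\ i) (f j)^`() * elsym k (D :\ i :\ j) f.
  rewrite mulr_sumr -big_split /=; apply: eq_bigr => j; rewrite !inE => /andP[ji jD].
  rewrite (@elsymS _ _ k (D :\ j) f i); last by rewrite !inE eq_sym ji.
  have -> : D :\ j :\ i = D :\ i :\ j by apply/setP => l; rewrite !inE; do 2!case: eqP.
  ring.
by rewrite IH //; ring.
Qed.

Section Gamma.
Variables (R : rcfType) (I : finType).
Implicit Types (D : {set I}) (lam : I -> R).

(** Index 0, where [elsym] is 1, is included so that quotients of consecutive functions need no case
    distinction. *)
Definition Gam k D lam := forall j, (j <= k)%N -> 0 < elsym j D lam.

Lemma Gam_le k k' D lam : (k' <= k)%N -> Gam k D lam -> Gam k' D lam.
Proof. by move=> kk G j jk; apply: G; apply: leq_trans kk. Qed.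

Lemma Gam_card k D lam : Gam k D lam -> (k <= #|D|)%N.
Proof.
by move=> G; rewrite leqNgt; apply/negP => h; have := G k (leqnn _); rewrite elsym_card_lt // ltxx.
Qed.

Lemma poly_ge0_near (p : {poly R}) d : 0 < d ->
  (forall e, 0 < e < d -> 0 <= p.[e]) -> 0 <= p.[0].
Proof.
move=> d0 h; rewrite leNgt; apply/negP => p0.
have [d' d'0 hd] := @poly_cont R 0 p (- p.[0]) (ltac:(by rewrite oppr_gt0)).
pose e := Num.min d d' / 2.
have m0 : 0 < Num.min d d' by rewrite lt_min d0.
have e0 : 0 < e by rewrite divr_gt0.
have em : e < Num.min d d' by rewrite ltr_pdivrMr // mulr_natr mulr2n ltrDl.
move: em; rewrite lt_min => /andP[ed ed'].
have := hd e; rewrite subr0 gtr0_norm // => /(_ ed'); rewrite ltr_norml => /andP[_].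
by have := h e (ltac:(by rewrite e0)); lra.
Qed.

Lemma poly_ge0_at0 (p : {poly R}) : (forall e, 0 < e -> 0 <= p.[e]) -> 0 <= p.[0].
Proof. by move=> h; apply: (@poly_ge0_near _ 1) => // e /andP[e0 _]; apply: h. Qed.

(** Polynomials in the shift replace real functions, so that the intermediate and mean value
    theorems of real closed fields apply. *)
Definition shiftp lam : I -> {poly R} := fun i => (lam i)%:P + 'X.

Lemma horner_shiftp k D lam s :
  (elsym k D (shiftp lam)).[s] = elsym k D (fun i => lam i + s).
Proof. by rewrite horner_elsym; apply: eq_elsym => i _; rewrite !hornerE. Qed.

Lemma deriv_shiftp k D lam :
  (elsym k.+1 D (shiftp lam))^`() = elsym k D (shiftp lam) *+ (#|D| - k).
Proof.
rewrite deriv_elsym -elsym_sum; apply: eq_bigr => i _.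
by rewrite /shiftp derivD derivC derivX add0r mul1r.
Qed.

(** Induction on [k]: the derivative in the shift is a positive multiple of the function of lower
    order, positive by induction, so by the mean value theorem the function grows strictly from a
    nonnegative value. *)
Lemma elsym_shift_gt0 k D lam s : (k <= #|D|)%N -> 0 < s ->
  (forall j, (j <= k)%N -> 0 <= elsym j D lam) -> 0 < elsym k D (fun i => lam i + s).
Proof.
move=> kD s0 h; rewrite -horner_shiftp; elim: k kD s s0 h => [|k IH] kD s s0 h.
  by rewrite elsym0 hornerC.
have [c] := @poly_mvt R 0 s (elsym k.+1 D (shiftp lam)) s0.
rewrite in_itv /= => /andP[c0 cs] e.
have e0 : 0 <= (elsym k.+1 D (shiftp lam)).[0].
  rewrite horner_shiftp; have := h _ (leqnn k.+1).
  by rewrite (@eq_elsym _ _ _ _ lam (fun i => lam i + 0)) // => i _; rewrite addr0.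
rewrite -(subrK (elsym k.+1 D (shiftp lam)).[0] (_.[s])) e ltr_wpDr //.
rewrite subr0 mulr_gt0 // deriv_shiftp hornerMn pmulrn_lgt0 ?subn_gt0 //.
by apply: IH => // [|j jk]; [apply: ltnW|apply: h; apply: leqW].
Qed.

Lemma Gam_shift k D lam s : 0 <= s -> Gam k D lam -> Gam k D (fun i => lam i + s).
Proof.
rewrite le_eqVlt => /orP[/eqP <-|s0] G j jk.
  by rewrite (@eq_elsym _ _ _ _ _ lam) ?G // => i _; rewrite addr0.
apply: elsym_shift_gt0 => // [|l lj]; last by apply/ltW/G; apply: leq_trans jk.
by apply: leq_trans jk _; apply: Gam_card G.
Qed.

Lemma elsym_pos k D lam : (k <= #|D|)%N -> (forall i, 0 < lam i) -> 0 < elsym k D lam.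
Proof.
move=> kD h; have [B BD Bk] : exists2 B : {set I}, B \subset D & #|B| = k.
  exists [set x in take k (enum D)]; last first.
    by rewrite cardsE (card_uniqP _) ?take_uniq ?enum_uniq // size_takel // -cardE.
  by apply/subsetP => x; rewrite inE => /mem_take; rewrite mem_enum.
rewrite /elsym (bigD1 B) ?BD ?Bk ?eqxx //= ltr_pwDl ?prodr_gt0 //.
by apply: sumr_ge0 => C _; apply: prodr_ge0 => i _; apply: ltW.
Qed.

(* Move lam along (1, ..., 1) until the first zero of e_j(lam | i); there
   e_{j+1}(lam | i) would have to be both positive and nonpositive. *)
Lemma Gam_del k D lam i : Gam k.+1 D lam -> i \in D -> Gam k (D :\ i) lam.
Proof.
elim: k D lam i => [|k IH] D lam i G iD j; first by rewrite leqn0 => /eqP ->; rewrite elsym0.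
move: (j) => {j}; suff top : 0 < elsym k.+1 (D :\ i) lam.
  move=> j; rewrite leq_eqVlt => /orP[/eqP -> //|]; rewrite ltnS => jk.
  by apply: (IH D lam i) => //; apply: Gam_le G.
rewrite ltNge; apply/negP => le0.
have kDi : (k.+1 <= #|D :\ i|)%N.
  by have := Gam_card G; rewrite (cardsD1 i) iD add1n ltnS.
pose P := elsym k.+1 (D :\ i) (shiftp lam).
pose s1 := 1 + \sum_l `|lam l|.
have s1gt : forall l, 0 < lam l + s1.
  move=> l; rewrite /s1 (bigD1 l) //=.
  have : 0 <= \sum_(x | x != l) `|lam x| by apply: sumr_ge0.
  by have := ler_norm (- lam l); rewrite normrN; lra.
have s10 : 0 <= s1 by rewrite addr_ge0 // sumr_ge0.
have P0 : P.[0] <= 0.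
  by rewrite horner_shiftp (@eq_elsym _ _ _ _ _ lam) // => l _; rewrite addr0.
have P1 : 0 < P.[s1] by rewrite horner_shiftp; apply: elsym_pos.
have [s] := @poly_ivt R P 0 s1 s10 (ltac:(by rewrite P0 ltW)).
move=> /andP[s0 _] /rootP; rewrite horner_shiftp.
pose nu l := lam l + s; rewrite -/nu => nu0.
have Gn : Gam k.+2 D nu by apply: Gam_shift.
have Gni : Gam k (D :\ i) nu by apply: (IH D) => //; apply: Gam_le Gn.
have := Gn _ (leqnn _); rewrite (elsymS _ _ iD) nu0 mulr0 addr0; apply/negP; rewrite -leNgt.
rewrite -(@pmulrn_lle0 _ _ k.+2) // -elsym_sum_mul.
have -> : \sum_(l in D :\ i) nu l * elsym k.+1 (D :\ i :\ l) nu =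
   - \sum_(l in D :\ i) nu l ^+ 2 * elsym k (D :\ i :\ l) nu.
  rewrite -sumrN; apply: eq_bigr => l lD.
  by have := elsymS k nu lD; rewrite nu0 => /eqP; rewrite eq_sym addr_eq0 => /eqP ->; ring.
rewrite oppr_le0; apply: sumr_ge0 => l lD; apply: mulr_ge0; first exact: sqr_ge0.
(* On [D :\ i] the vector [nu] is only on the boundary of the cone of order [k.+1], so the induction
   hypothesis is applied to its shifts by e > 0 and e tends to 0. *)
have -> : elsym k (D :\ i :\ l) nu = (elsym k (D :\ i :\ l) (shiftp nu)).[0].
  by rewrite horner_shiftp; apply: eq_elsym => x _; rewrite addr0.
apply: poly_ge0_at0 => e e0; rewrite horner_shiftp; apply/ltW.
apply: (IH (D :\ i) (fun l => nu l + e) l _ lD) => // j.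
rewrite leq_eqVlt => /orP[/eqP ->|].
  apply: elsym_shift_gt0 => // j'; rewrite leq_eqVlt => /orP[/eqP -> |]; first by rewrite nu0.
  by rewrite ltnS => jk; apply/ltW/Gni.
rewrite ltnS => jk; exact: (Gam_shift (ltW e0) Gni jk).
Qed.

End Gamma.

Section Garding.
Variables (R : rcfType) (I : finType).
Implicit Types (D : {set I}) (lam al be : I -> R).

(** These quotients are superadditive and homogeneous of degree 1 on the cone, and their product
    telescopes to an [elsym]; Gaarding's inequality is assembled from them. *)
Definition fq k D lam := elsym k.+1 D lam / elsym k D lam.

Lemma fq_gt0 k D lam : Gam k.+1 D lam -> 0 < fq k D lam.
Proof. by move=> G; rewrite divr_gt0 ?G. Qed.

Lemma fqS_den k D lam i : Gam k.+1 D lam -> i \in D ->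
  0 < lam i + fq k (D :\ i) lam /\
  elsym k.+1 D lam = elsym k (D :\ i) lam * (lam i + fq k (D :\ i) lam).
Proof.
move=> G iD; have e0 : 0 < elsym k (D :\ i) lam by apply: (Gam_del G iD).
have e : elsym k.+1 D lam = elsym k (D :\ i) lam * (lam i + fq k (D :\ i) lam).
  by rewrite (elsymS _ _ iD) /fq; field; rewrite gt_eqF.
by split=> //; rewrite -(pmulr_rgt0 _ e0) -e G.
Qed.

(** The Marcus-Lopes recursion: the quotient of order [k.+1] in terms of the quotients of order [k]
    with one variable deleted, through the convex function x^2 / y. *)
Lemma fqS k D lam : Gam k.+1 D lam ->
  fq k.+1 D lam *+ k.+2 =
  \sum_(i in D) (lam i - lam i ^+ 2 / (lam i + fq k (D :\ i) lam)).
Proof.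
move=> G; rewrite /fq -mulrnAl -elsym_sum_mul mulr_suml; apply: eq_bigr => i iD.
have [y0 e] := fqS_den G iD; have := elsymS k lam iD; have e0 := G k.+1 (leqnn _).
have a0 : 0 < elsym k (D :\ i) lam by apply: (Gam_del G iD).
move: y0 e e0 a0; rewrite -/(fq k (D :\ i) lam).
move: (fq _ _ _) (elsym k _ _) (elsym k.+1 (D :\ i) lam) (elsym _ _ _) => f a b c y0 e e0 a0 c1.
have -> : b = a * f by move: c1; rewrite e mulrDr [lam i * _]mulrC addrC => /(addIr _) ->.
by rewrite e; field; rewrite (gt_eqF y0) (gt_eqF a0).
Qed.

(** The Marcus-Lopes inequality. In [fqS] the function x^2 / y is subadditive for y > 0 and
    decreasing in y, and the denominators are superadditive by induction. Convexity of the cone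
    comes out of the same induction, because the quotient of the sum is positive. *)
Lemma fq_superadditive k D al be : Gam k D al -> Gam k D be ->
  Gam k D (fun i => al i + be i) /\
  fq k D al + fq k D be <= fq k D (fun i => al i + be i).
Proof.
elim: k D => [|k IH] D Ga Gb.
  split; first by move=> j; rewrite leqn0 => /eqP ->; rewrite elsym0.
  by rewrite /fq !elsym0 !elsym1 big_split /= !divr1.
have [Gab fab] := IH D (Gam_le (leqnSn _) Ga) (Gam_le (leqnSn _) Gb).
have Gs : Gam k.+1 D (fun i => al i + be i).
  move=> j; rewrite leq_eqVlt => /orP[/eqP ->|]; last by rewrite ltnS; apply: Gab.
  have e0 := Gab k (leqnn _).
  rewrite -(pmulr_lgt0 _ (_ : 0 < (elsym k D (fun i => al i + be i))^-1)) ?invr_gt0 //.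
  by apply: lt_le_trans fab; rewrite addr_gt0 ?fq_gt0.
split=> //; rewrite -(@ler_pMn2r _ k.+2) // mulrnDl !fqS // -big_split /=.
apply: ler_sum => i iD.
have [ya _] := fqS_den Ga iD; have [yb _] := fqS_den Gb iD.
have [_ fi] := IH _ (Gam_del Ga iD) (Gam_del Gb iD).
move: ya yb fi; set y := al i + _; set z := be i + _ => y0 z0 fi.
rewrite addrACA lerD2l -opprD lerN2.
apply: (@le_trans _ _ ((al i + be i) ^+ 2 / (y + z))).
  have le : y + z <= al i + be i + fq k (D :\ i) (fun j => al j + be j).
    by rewrite /y /z addrACA lerD2l.
  have yz0 : 0 < y + z by exact: addr_gt0.
  rewrite ler_wpM2l ?sqr_ge0 // lef_pV2 ?posrE //.
  exact: lt_le_trans yz0 le.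
have yz0 : 0 < y + z by exact: addr_gt0.
rewrite ler_pdivrMr // -subr_ge0.
have -> : (al i ^+ 2 / y + be i ^+ 2 / z) * (y + z) - (al i + be i) ^+ 2 =
   (al i * z - be i * y) ^+ 2 / (y * z) by field; rewrite !gt_eqF.
by rewrite divr_ge0 ?sqr_ge0 ?mulr_ge0 // ltW.
Qed.

(** The derivative of [elsym k.+1 D] at [be] in the direction [al]. *)
Definition Dsym k D be al := \sum_(i in D) al i * elsym k (D :\ i) be.

Lemma Dsym_self k D be : Dsym k D be be = elsym k.+1 D be *+ k.+1.
Proof. exact: elsym_sum_mul. Qed.

Lemma GamZ k D lam c : 0 < c -> Gam k D lam -> Gam k D (fun i => c * lam i).
Proof. by move=> c0 G j jk; rewrite elsymZ mulr_gt0 ?exprn_gt0 ?G. Qed.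

Lemma fqZ k D lam c : 0 < c -> fq k D (fun i => c * lam i) = c * fq k D lam.
Proof.
move=> c0; rewrite /fq !elsymZ exprS.
have c1 : c ^+ k != 0 by rewrite expf_neq0 // gt_eqF.
by rewrite -!mulrA; congr (_ * _); rewrite invfM [LHS]mulrA mulrACA mulfV // mul1r.
Qed.

Lemma poly_deriv_ge0 (p : {poly R}) : p.[0] = 0 -> (forall e, 0 < e -> 0 <= p.[e]) ->
  0 <= p^`().[0].
Proof.
move=> p0 h; have /factor_theorem[q pq] : root p 0 by apply/rootP.
rewrite pq derivM derivB derivX derivC !hornerE oppr0 mulr0 add0r addr0 mulr1.
apply: poly_ge0_at0 => e e0; have := h e e0.
by rewrite pq !hornerE subr0 pmulr_lge0.
Qed.

(** Superadditivity along the ray [be + x * al], differentiated at x = 0, bounds the derivative of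
    [fq k.+1] below by [fq k.+1 D al]; the claim is this bound for the logarithmic derivative of
    [elsym k.+2], the product of [elsym k.+1] and [fq k.+1]. With denominators cleared it concerns a
    polynomial [r] that is 0 at 0 and nonnegative for x > 0. *)
Lemma Dsym_ge k D al be : Gam k.+2 D al -> Gam k.+2 D be ->
  fq k.+1 D al / fq k.+1 D be + Dsym k D be al / elsym k.+1 D be <=
  Dsym k.+1 D be al / elsym k.+2 D be.
Proof.
move=> Ga Gb.
pose l : I -> {poly R} := fun i => (be i)%:P + (al i)%:P * 'X.
pose r := elsym k.+2 D l - elsym k.+1 D l * ((fq k.+1 D be)%:P + (fq k.+1 D al)%:P * 'X).
have hl j x : (elsym j D l).[x] = elsym j D (fun i => be i + x * al i).
  by rewrite horner_elsym; apply: eq_elsym => i _; rewrite /l !hornerE mulrC.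
have h0 j A : (elsym j A l).[0] = elsym j A be.
  by rewrite horner_elsym; apply: eq_elsym => i _; rewrite /l !hornerE ?mulr0 ?addr0.
have dl j : (elsym j.+1 D l)^`().[0] = Dsym j D be al.
  rewrite deriv_elsym horner_sum; apply: eq_bigr => i _.
  by rewrite hornerM h0 /l !derivE !hornerE.
have eb : elsym k.+2 D be = elsym k.+1 D be * fq k.+1 D be.
  by rewrite mulrC divfK // gt_eqF // Gb.
have b1 := Gb k.+1 (leqnSn _); have fb := fq_gt0 Gb.
have : 0 <= r^`().[0].
  apply: poly_deriv_ge0 => [|x x0].
    by rewrite /r hornerD hornerN hornerM hornerD hornerM !hornerC hornerX !h0 eb mulr0 addr0 subrr.
  rewrite /r hornerD hornerN hornerM hornerD hornerM !hornerC hornerX !hl.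
  have [Gs fs] := fq_superadditive (Gam_le (leqnSn _) Gb) (GamZ x0 (Gam_le (leqnSn _) Ga)).
  have e1 := Gs _ (leqnn _); rewrite subr_ge0.
  have -> : elsym k.+2 D (fun i => be i + x * al i) = elsym k.+1 D (fun i => be i + x * al i) *
      fq k.+1 D (fun i => be i + x * al i) by rewrite mulrC divfK // gt_eqF.
  by rewrite ler_pM2l //; apply: le_trans fs; rewrite fqZ // mulrC.
have -> : r^`().[0] = Dsym k.+1 D be al - (Dsym k D be al * fq k.+1 D be + elsym k.+1 D be * fq k.+1 D al).
  rewrite /r derivB derivM derivD derivM !derivC derivX hornerD hornerN hornerD !hornerM !hornerD.
  by rewrite !hornerM !hornerC hornerX !dl !h0 mulr0 addr0 mul0r add0r mulr1 add0r.
move=> h.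
rewrite eb ler_pdivlMr; last exact: mulr_gt0.
move: h; set a := Dsym k.+1 _ _ _; set b := Dsym k _ _ _; set fa := fq _ _ al => h.
suff -> : (fa / fq k.+1 D be + b / elsym k.+1 D be) * (elsym k.+1 D be * fq k.+1 D be) =
  fa * elsym k.+1 D be + b * fq k.+1 D be by move: h; lra.
by field; rewrite !gt_eqF.
Qed.

Lemma prod_fq k D lam : Gam k D lam -> \prod_(j < k.+1) fq j D lam = elsym k.+1 D lam.
Proof.
elim: k => [|k IH] G; first by rewrite big_ord1 /fq elsym0 divr1.
by rewrite big_ord_recr /= IH ?/fq; [rewrite mulrC divfK // gt_eqF // G|apply: Gam_le G].
Qed.

Lemma Dsym_ge_sum k D al be : Gam k.+1 D al -> Gam k.+1 D be ->
  \sum_(j < k.+1) fq j D al / fq j D be <= Dsym k D be al / elsym k.+1 D be.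
Proof.
elim: k => [|k IH] Ga Gb.
  have -> : Dsym 0 D be al = elsym 1 D al.
    by rewrite elsym1; apply: eq_bigr => i _; rewrite elsym0 mulr1.
  by rewrite big_ord1 /fq !elsym0 !divr1.
rewrite big_ord_recr /= addrC; apply: le_trans (Dsym_ge Ga Gb).
by rewrite lerD2l; apply: IH; [apply: Gam_le Ga|apply: Gam_le Gb].
Qed.

(** Arithmetic-geometric mean inequality for the ratios [fq j D al / fq j D be]: their sum is
    bounded by the logarithmic derivative through [Dsym_ge_sum], and their product telescopes. *)
Lemma garding_vector k D al be : Gam k.+1 D al -> Gam k.+1 D be ->
  0 < Dsym k D be al /\
  elsym k.+1 D al * elsym k.+1 D be ^+ k <= (Dsym k D be al / k.+1%:R) ^+ k.+1.
Proof.
move=> Ga Gb; have h := Dsym_ge_sum Ga Gb.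
have y0 (j : 'I_k.+1) : 0 < fq j D al / fq j D be.
  by rewrite divr_gt0 // fq_gt0 //; [apply: Gam_le Ga|apply: Gam_le Gb].
have eb := Gb _ (leqnn k.+1).
have [agm _] := @leif_AGM R 'I_k.+1 predT (fun j => fq j D al / fq j D be)
  (fun j _ => ltW (y0 j)).
move: agm; have [Ga' Gb'] := (Gam_le (leqnSn _) Ga, Gam_le (leqnSn _) Gb).
rewrite /= card_ord prodf_div !prod_fq // => agm.
have s0 : 0 < \sum_(j < k.+1) fq j D al / fq j D be.
  by rewrite big_ord_recl ltr_pwDl // sumr_ge0 // => j _; apply/ltW/y0.
have D0 : 0 < Dsym k D be al.
  by rewrite -(@pmulr_lgt0 _ (elsym k.+1 D be)^-1) ?invr_gt0 //; apply: lt_le_trans h.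
split=> //; rewrite -(@ler_pM2r _ (elsym k.+1 D be ^+ k.+1)^-1) ?invr_gt0 ?exprn_gt0 //.
rewrite -exprVn -exprMn.
have -> : elsym k.+1 D al * elsym k.+1 D be ^+ k * (elsym k.+1 D be)^-1 ^+ k.+1 =
   elsym k.+1 D al / elsym k.+1 D be.
  by rewrite exprS exprVn -mulrA; congr (_ * _); rewrite mulrCA mulfV ?mulr1 // expf_neq0 // gt_eqF.
apply: le_trans agm _; rewrite lerXn2r ?nnegrE //.
- exact: divr_ge0 (ltW s0) (ler0n _ _).
- by apply: divr_ge0 (ltW eb); apply: divr_ge0 (ltW D0) (ler0n _ _).
- by rewrite mulrAC ler_wpM2r ?invr_ge0.
Qed.

Lemma elsym2 D lam : elsym 2 D lam *+ 2 = elsym 1 D lam ^+ 2 - \sum_(i in D) lam i ^+ 2.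
Proof.
rewrite -elsym_sum_mul expr2 {2}elsym1 mulr_sumr -sumrB; apply: eq_bigr => i iD.
have := elsymS 0 lam iD; rewrite elsym0 mulr1 => ->; ring.
Qed.

(* Gaarding's inequality keeping the exact first variation of e_2 / e_1. *)
Lemma garding_defect k D al be : Gam k.+2 D al -> Gam k.+2 D be ->
  Dsym k.+1 D be al = elsym k.+2 D be *+ k.+2 ->
  elsym k.+2 D al * (fq 1 D al + elsym 1 D al / 2 *
      \sum_(i in D) (al i / elsym 1 D al - be i / elsym 1 D be) ^+ 2)
    <= elsym k.+2 D be * fq 1 D al.
Proof.
move=> Ga Gb E.
have a1 := Ga 1%N isT; have b1 := Gb 1%N isT; have a2 := Ga 2%N isT; have b2 := Gb 2%N isT.
set Z := _ * \sum_(i in D) _.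
(* The logarithmic derivative of [fq 1] at [be], kept exactly; its excess [Z] over the bound of
   [Dsym_ge] is computed from e_2 = (e_1^2 - sum of squares) / 2. *)
pose y2 := Dsym 1 D be al / elsym 2 D be - elsym 1 D al / elsym 1 D be.
have hy2 : y2 * fq 1 D be = fq 1 D al + Z.
  have [sa sb] := (elsym2 D al, elsym2 D be).
  have -> : Z = elsym 1 D al / 2 * ((\sum_(i in D) al i ^+ 2) / elsym 1 D al ^+ 2 -
      2 * (\sum_(i in D) al i * be i) / (elsym 1 D al * elsym 1 D be) +
      (\sum_(i in D) be i ^+ 2) / elsym 1 D be ^+ 2).
    rewrite /Z; congr (_ * _); move: (elsym 1 D al) (elsym 1 D be) a1 b1 => a b a1 b1.
    rewrite mulr_sumr !mulr_suml -sumrB -big_split /=; apply: eq_bigr => i _.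
    by field; rewrite !gt_eqF.
  have -> : \sum_(i in D) al i ^+ 2 = elsym 1 D al ^+ 2 - elsym 2 D al *+ 2 by rewrite sa; ring.
  have -> : \sum_(i in D) be i ^+ 2 = elsym 1 D be ^+ 2 - elsym 2 D be *+ 2 by rewrite sb; ring.
  rewrite /y2 /fq.
  have -> : Dsym 1 D be al = elsym 1 D al * elsym 1 D be - \sum_(i in D) al i * be i.
    rewrite /Dsym elsym1 mulr_suml -sumrB; apply: eq_bigr => i iD.
    by have := elsymS 0 be iD; rewrite elsym0 mulr1 => ->; ring.
  by field; rewrite !gt_eqF.
have Z0 : 0 <= Z.
  by apply: mulr_ge0; [apply: divr_ge0 => //; exact: ltW|apply: sumr_ge0 => i _; apply: sqr_ge0].
have fa := fq_gt0 (Gam_le (isT : 2 <= k.+2)%N Ga).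
have fb := fq_gt0 (Gam_le (isT : 2 <= k.+2)%N Gb).
have y20 : 0 < y2 by rewrite -(pmulr_lgt0 _ fb) hy2 ltr_pwDl.
(* The means argument of [garding_vector] again, with the larger number [y2] in place of the ratio
   of index 1. *)
pose y (j : 'I_k.+2) := if j == 1%N :> nat then y2 else fq j D al / fq j D be.
have y0 j : 0 < y j.
  rewrite /y; case: ifP => // _; rewrite divr_gt0 // fq_gt0 //.
    by apply: Gam_le Ga. by apply: Gam_le Gb.
have yS : \sum_j y j <= k.+2%:R.
  have -> : k.+2%:R = Dsym k.+1 D be al / elsym k.+2 D be.
    by rewrite E -[elsym _ _ _ *+ _]mulr_natl mulfK // gt_eqF // Gb.
  rewrite big_ord_recl big_ord_recl /= {1 2}/y /=.
  have : forall m, (m <= k)%N -> fq 0 D al / fq 0 D be + (y2 +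
     \sum_(i < m) fq i.+2 D al / fq i.+2 D be) <= Dsym m.+1 D be al / elsym m.+2 D be.
    elim=> [_|m IH mk].
      by rewrite big_ord0 addr0 /y2 /fq !elsym0 !divr1 addrC subrK.
    rewrite big_ord_recr /= !addrA addrC.
    apply: le_trans (@Dsym_ge m.+1 D al be (Gam_le (_ : m.+3 <= k.+2)%N Ga) (Gam_le (_ : m.+3 <= k.+2)%N Gb)) => //.
    by rewrite lerD2l; have := IH (ltnW mk); rewrite /y2 !addrA.
  move=> /(_ k (leqnn _)).
  by have -> : \sum_(i < k) y (lift ord0 (lift ord0 i)) =
    \sum_(i < k) fq i.+2 D al / fq i.+2 D be by apply: eq_bigr => i _; rewrite /y.
have [agm _] := @leif_AGM R 'I_k.+2 predT y (fun j _ => ltW (y0 j)).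
move: agm; rewrite /= card_ord => agm.
have : \prod_j y j <= 1.
  apply: le_trans agm _; apply: exprn_ile1.
    by apply: divr_ge0 => //; apply: sumr_ge0 => j _; apply/ltW/y0.

  by rewrite ler_pdivrMr // mul1r.
have -> : \prod_j y j = y2 * (\prod_(j < k.+2) (fq j D al / fq j D be)) / (fq 1 D al / fq 1 D be).
  rewrite (bigD1 (Ordinal (isT : 1 < k.+2)%N)) //= [X in _ * X / _](bigD1 (Ordinal (isT : 1 < k.+2)%N)) //=.
  rewrite {1}/y /= -[RHS]mulrA; congr (_ * _).
  rewrite mulrAC mulfV ?mul1r; last by rewrite mulf_neq0 ?invr_neq0 // gt_eqF.
  by apply: eq_bigr => j; rewrite /y -val_eqE /= => /negbTE ->.
have [Ga' Gb'] := (Gam_le (leqnSn _) Ga, Gam_le (leqnSn _) Gb).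
rewrite prodf_div !prod_fq // -hy2.
have eb := Gb _ (leqnn k.+2).
have -> : y2 * (elsym k.+2 D al / elsym k.+2 D be) / (fq 1 D al / fq 1 D be) =
  (elsym k.+2 D al * (y2 * fq 1 D be)) / (elsym k.+2 D be * fq 1 D al) by field; rewrite !gt_eqF.
by rewrite ler_pdivrMr ?mul1r //; exact: mulr_gt0.
Qed.

End Garding.

(** * Newton tensors of symmetric matrices *)

Section RealSpectral.
Variable R : rcfType.

Lemma rv_sq n (v : 'rV[R]_n) : (v *m v^T) 0 0 = \sum_j v 0 j ^+ 2.
Proof. by rewrite mxE; apply: eq_bigr => j _; rewrite mxE expr2. Qed.

Lemma rv_sq_eq0 n (v : 'rV[R]_n) : (v *m v^T) 0 0 = 0 -> v = 0.
Proof.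
rewrite rv_sq => /psumr_eq0P h; apply/rowP => j; rewrite mxE; apply/eqP.
by rewrite -sqrf_eq0; apply/eqP/h => // i _; apply: sqr_ge0.
Qed.

(** The complex spectral theorem for Hermitian matrices provides a real eigenvalue; being an
    eigenvalue descends from [R[i]] to [R], which yields a real eigenvector. *)
Lemma symmetric_eigenvector n (M : 'M[R]_n.+1) : M^T = M ->
  exists (v : 'rV[R]_n.+1) a, v *m M = a *: v /\ v *m v^T = 1%:M.
Proof.
move=> sM; pose C : numClosedFieldType := R[i].
pose MC : 'M[C]_n.+1 := map_mx (real_complex R) M.
have hM : MC \is hermsymmx.
  apply/is_hermitianmxP; rewrite expr0 scale1r; apply/matrixP => i j.
  rewrite /MC !mxE -[in LHS]sM mxE; apply/esym/CrealP/complex_realP.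
  by exists (M j i).
have /mxOverP dr := hermitian_spectral_diag_real hM.
have /orthomx_spectralP eM := hermitian_normalmx hM.
have [a ea] : exists a : R, eigenvalue MC (real_complex R a).
  have /complex_realP[a da] := dr 0 0; exists a.
  apply/eigenvalueP; exists (row 0 (spectralmx MC)).
    rewrite -da -row_mul.
    have -> : spectralmx MC *m MC = diag_mx (spectral_diag MC) *m spectralmx MC.
      by rewrite {2}eM !mulmxA mulmxV ?spectral_unit // mul1mx.
    by rewrite row_mul row_diag_mx -scalemxAl -rowE.
  apply/eqP => r0; have := spectral_unit MC.
  rewrite unitmxE.
  by rewrite (expand_det_row _ 0) big1 ?unitr0 // => j _; move/rowP: r0 => /(_ j); rewrite !mxE => ->; rewrite mul0r.
rewrite eigenvalue_map in ea; have /eigenvalueP[v vM v0] := ea.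
have s0 : 0 < (v *m v^T) 0 0.
  rewrite lt_neqAle rv_sq sumr_ge0 => [|j _]; last exact: sqr_ge0.
  by rewrite andbT eq_sym -rv_sq; apply: contra v0 => /eqP/rv_sq_eq0 ->.
exists ((Num.sqrt ((v *m v^T) 0 0))^-1 *: v), a; split.
  by rewrite -scalemxAl vM !scalerA mulrC.
rewrite linearZ /= -scalemxAl -scalemxAr scalerA -invfM -expr2 sqr_sqrtr ?ltW //.
by apply/matrixP => i j; rewrite !ord1 mxE [RHS]mxE eqxx mulVf // gt_eqF.
Qed.

(** The witness is the Householder reflection that exchanges the first basis vector [e] with [v]. *)
Lemma orthogonal_with_row n (v : 'rV[R]_n.+1) : v *m v^T = 1%:M ->
  exists Q : 'M[R]_n.+1, Q *m Q^T = 1%:M /\ row 0 Q = v.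
Proof.
move=> v1; pose e : 'rV[R]_n.+1 := delta_mx 0 0.
have e1 : e *m e^T = 1%:M.
  apply/matrixP => i j; rewrite !ord1 !mxE (bigD1 0) //= big1 ?addr0 => [|k k0].
    by rewrite !mxE eqxx mulr1.
  by rewrite !mxE (negbTE k0) mul0r.
have [ev|ev] := eqVneq e v.
  by exists 1%:M; rewrite trmx1 mulmx1 -ev; split=> //; rewrite row1.
pose u := v - e; pose c := (u *m u^T) 0 0.
have uu : u *m u^T = c%:M by apply/matrixP => i j; rewrite !ord1 !mxE eqxx mulr1n /c mxE.
have c0 : c != 0.
  by apply: contra_neq ev => /rv_sq_eq0/eqP; rewrite subr_eq0 => /eqP.
have ve : e *m v^T = v *m e^T.
  by apply/matrixP => i j; rewrite !ord1 !mxE; apply: eq_bigr => k _; rewrite !mxE mulrC.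
have eu : e *m u^T = (- (c / 2))%:M.
  have : u *m u^T = 2%:M - (e *m v^T) - (e *m v^T).
    rewrite {2}/u linearB /= mulmxBr {1 2}/u !mulmxBl v1 e1 ve opprB.
    by apply/matrixP => i j; rewrite !mxE; case: eqP => _ /=; ring.
  rewrite uu => h; rewrite /u linearB /= mulmxBr e1; apply/matrixP => i j; rewrite !ord1.
  by move/matrixP: h => /(_ 0 0); rewrite !mxE eqxx !mulr1n => ->; field.
have vu : e + u = v by rewrite /u addrCA subrr addr0.
clearbody c; clearbody u.
exists (1%:M - (2 / c) *: (u^T *m u)); split.
  have -> : (1%:M - (2 / c) *: (u^T *m u))^T = 1%:M - (2 / c) *: (u^T *m u).
    by rewrite linearB /= linearZ /= trmx1 trmx_mul trmxK.
  rewrite mulmxBl mul1mx mulmxBr mulmx1.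
  rewrite -scalemxAl -scalemxAr -mulmxA [u *m (u^T *m u)]mulmxA uu mul_scalar_mx -scalemxAr !scalerA.
  have -> : 2 / c * (2 / c * c) = 2 / c + 2 / c by field.
  by rewrite scalerDl opprB addrK subrK.
rewrite rowE mulmxBr mulmx1 -scalemxAr mulmxA -/e eu mul_scalar_mx scalerA.
have -> : 2 / c * - (c / 2) = -1 :> R by field.
by rewrite scaleN1r opprK.
Qed.

Theorem real_spectral n (M : 'M[R]_n) : M^T = M ->
  exists (O : 'M[R]_n) (d : 'rV[R]_n), O *m O^T = 1%:M /\ M = O^T *m diag_mx d *m O.
Proof.
elim: n M => [|n IH] M sM.
  by exists 1%:M, 0; split; apply/matrixP => -[].
have [v [a [vM v1]]] := symmetric_eigenvector sM.
have [Q [Q1 Qv]] := orthogonal_with_row v1.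
have QtQ : Q^T *m Q = 1%:M by apply: mulmx1C.
pose B : 'M[R]_(1 + n) := Q *m M *m Q^T.
have sB : B^T = B by rewrite /B !trmx_mul trmxK sM mulmxA.
have B0 j : B 0 j = a * (0 == j)%:R.
  have -> : B 0 j = (row 0 B) 0 j by rewrite [RHS]mxE.
  by rewrite /B !row_mul Qv vM -scalemxAl mxE -Qv -row_mul Q1 !mxE.
have eB : B = block_mx a%:M 0 0 (drsubmx B).
  rewrite -{1}[B]submxK; congr block_mx.
  - by apply/matrixP => i j; rewrite !ord1 [LHS]mxE [LHS]mxE lshift0 B0 mxE !eqxx mulr1.
  - by apply/matrixP => i j; rewrite !ord1 [LHS]mxE [LHS]mxE lshift0 B0 mxE mulr0.
  - by apply/matrixP => i j; rewrite !ord1 -[B]sB [LHS]mxE [LHS]mxE [LHS]mxE lshift0 B0 mxE mulr0.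
have [O' [d' [O1 e']]] := IH (drsubmx B) (ltac:(by rewrite trmx_drsub sB)).
pose P : 'M[R]_(1 + n) := block_mx 1%:M 0 0 O'.
have P1 : P *m P^T = 1%:M.
  rewrite /P tr_block_mx mulmx_block.
  by rewrite !trmx0 trmx1 !mulmx0 !mul0mx !addr0 !add0r mulmx1 O1 -scalar_mx_block.
have PB : P^T *m diag_mx (row_mx a%:M d') *m P = B.
  rewrite /P diag_mx_row tr_block_mx !mulmx_block !trmx0 trmx1 !mulmx0 !mul0mx !addr0 !add0r.
  rewrite mulmx1 mul1mx !mul0mx -e' [RHS]eB; congr block_mx.
  by apply/matrixP => i j; rewrite !ord1 !mxE eqxx.
exists (P *m Q), (row_mx a%:M d'); split.
  by rewrite trmx_mul mulmxA -(mulmxA P Q) Q1 mulmx1.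
have -> : M = Q^T *m B *m Q by rewrite /B !mulmxA QtQ mul1mx -mulmxA QtQ mulmx1.
by rewrite trmx_mul -PB !mulmxA.
Qed.

End RealSpectral.

Lemma sum_setT (V : nmodType) (I : finType) (F : I -> V) :
  \sum_(i in [set: I]) F i = \sum_i F i.
Proof. by apply: eq_bigl => i; rewrite inE. Qed.

(** * Newton tensors, their derivatives, and their values in an eigenbasis *)

Section Newton.
Variables (R : numFieldType) (n : nat).
Implicit Types (M N O : 'M[R]_n).

(* Newton tensors, by the Faddeev-LeVerrier recursion. *)
Fixpoint NT (k : nat) M : 'M[R]_n :=
  if k is k'.+1 then (\tr (M *m NT k' M) / k'.+1%:R)%:M - M *m NT k' M else 1%:M.

(** Newton's identity tr(M T_k) = (k+1) sigma_{k+1} taken as a definition: it avoids eigenvalues, so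
    [sg] of a matrix field can be differentiated entrywise. [sg_conj] and [sg_diag] identify it with
    the symmetric function of the eigenvalues. *)
Definition sg (k : nat) M : R :=
  if k is k'.+1 then \tr (M *m NT k' M) / k'.+1%:R else 1.

Lemma NTS k M : NT k.+1 M = (sg k.+1 M)%:M - M *m NT k M.
Proof. by []. Qed.

(** Derivative of [NT k] at [M] in the direction [N], by the product rule in the recursion; the
    order of the factors matters because [M] and [N] need not commute. *)
Fixpoint dNT (k : nat) M N : 'M[R]_n :=
  if k is k'.+1 then
    ((\tr (N *m NT k' M) + \tr (M *m dNT k' M N)) / k'.+1%:R)%:M
      - N *m NT k' M - M *m dNT k' M N
  else 0.

Definition dsg (k : nat) M N : R :=
  if k is k'.+1 then (\tr (N *m NT k' M) + \tr (M *m dNT k' M N)) / k'.+1%:R else 0.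

Lemma dNTS k M N : dNT k.+1 M N = (dsg k.+1 M N)%:M - N *m NT k M - M *m dNT k M N.
Proof. by []. Qed.

Arguments NT : simpl never.
Arguments sg : simpl never.
Arguments dNT : simpl never.
Arguments dsg : simpl never.

Lemma NT_comm k M : M *m NT k M = NT k M *m M.
Proof.
elim: k => [|k IH]; first by rewrite mulmx1 mul1mx.
by rewrite NTS mulmxBl mulmxBr scalar_mxC -mulmxA -IH.
Qed.

Lemma NT_sym k M : M^T = M -> (NT k M)^T = NT k M.
Proof.
move=> sM; elim: k => [|k IH]; first by rewrite trmx1.
by rewrite NTS linearB /= tr_scalar_mx trmx_mul IH sM -NT_comm.
Qed.

Lemma sg1 M : sg 1 M = \tr M.
Proof. by rewrite /sg mulmx1 divr1. Qed.

Lemma tr_NT k M : (k <= n)%N -> \tr (NT k M) = (n - k)%:R * sg k M.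
Proof.
case: k => [|k] kn; first by rewrite mxtrace1 subn0 mulr1.
have -> : \tr (NT k.+1 M) = sg k.+1 M *+ n - \tr (M *m NT k M).
  by rewrite NTS linearB /= mxtrace_scalar.
have -> : \tr (M *m NT k M) = k.+1%:R * sg k.+1 M.
  by rewrite /sg mulrC divfK // pnatr_eq0.
by rewrite natrB // mulrBl -[sg _ _ *+ n]mulr_natl.
Qed.

Section Conj.
Variable O : 'M[R]_n.
Hypothesis O1 : O *m O^T = 1%:M.

Lemma conj_mul M N : O^T *m M *m O *m (O^T *m N *m O) = O^T *m (M *m N) *m O.
Proof. by rewrite !mulmxA -(mulmxA _ O) O1 mulmx1. Qed.

Lemma conj_tr M : \tr (O^T *m M *m O) = \tr M.
Proof. by rewrite mxtrace_mulC mulmxA O1 mul1mx. Qed.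

Lemma conj_scalar a : O^T *m a%:M *m O = a%:M.
Proof. by rewrite scalar_mxC -mulmxA (mulmx1C O1) mulmx1. Qed.

Lemma NT_conj k M : NT k (O^T *m M *m O) = O^T *m NT k M *m O.
Proof.
elim: k => [|k IH]; first by rewrite conj_scalar.
by rewrite !NTS /sg IH conj_mul conj_tr mulmxBr mulmxBl conj_scalar.
Qed.

Lemma sg_conj k M : sg k (O^T *m M *m O) = sg k M.
Proof. by case: k => [|k] //; rewrite /sg NT_conj conj_mul conj_tr. Qed.

Lemma dNT_conj k M N :
  dNT k (O^T *m M *m O) (O^T *m N *m O) = O^T *m dNT k M N *m O.
Proof.
elim: k => [|k IH]; first by rewrite mulmx0 mul0mx.
by rewrite !dNTS /dsg IH NT_conj !conj_mul !conj_tr !mulmxBr !mulmxBl conj_scalar.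
Qed.

End Conj.

Lemma mul_diagE (d : 'rV[R]_n) M i j : (diag_mx d *m M) i j = d 0 i * M i j.
Proof. by rewrite mul_diag_mx mxE. Qed.

Section Diag.
Variable d : 'rV[R]_n.
Local Notation lam := (fun i => d 0 i).
Local Notation es k A := (elsym k (~: A) lam).

Lemma setT_del1 (i : 'I_n) : [set: 'I_n] :\ i = ~: [set i].
Proof. by rewrite setTD. Qed.
Lemma setC1_del (i j : 'I_n) : ~: [set i] :\ j = ~: [set i; j].
Proof. by apply/setP => x; rewrite !inE negb_or andbC. Qed.

Lemma NT_diag k i j : NT k (diag_mx d) i j = (es k [set i]) *+ (i == j).
Proof.
elim: k i j => [|k IH] i j; first by rewrite mxE elsym0.
have tr : \tr (diag_mx d *m NT k (diag_mx d)) / k.+1%:R = elsym k.+1 setT lam.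
  apply: (canLR (mulfK _)); first by rewrite pnatr_eq0.
  rewrite mulr_natr -elsym_sum_mul /mxtrace sum_setT; apply: eq_bigr => l _.
  by rewrite mul_diagE IH eqxx setT_del1.
rewrite NTS /sg tr mxE [X in X + _]mxE [X in _ + X]mxE mul_diagE IH; case: eqP => [->|_]; last first.
  by rewrite mulr0n mulr0 subr0.
by rewrite !mulr1n (@elsymS _ _ k setT _ j) ?inE // setT_del1 addrK.
Qed.

Lemma sg_diag k : sg k (diag_mx d) = elsym k setT lam.
Proof.
case: k => [|k]; first by rewrite elsym0.
apply: (canLR (mulfK _)); first by rewrite pnatr_eq0.
rewrite mulr_natr -elsym_sum_mul /mxtrace sum_setT; apply: eq_bigr => l _.
by rewrite mul_diagE NT_diag eqxx setT_del1.
Qed.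

(** Paired with [N] this is the second derivative of sigma_{k+2} at a diagonal matrix: diagonal
    entries of [N] see the function of the eigenvalues, off-diagonal ones contribute minus a
    coefficient times their square. *)
Lemma dNT_diag k N i j : dNT k.+1 (diag_mx d) N i j =
  if i == j then \sum_(l | l != i) es k [set i; l] * N l l else - es k [set i; j] * N i j.
Proof.
elim: k i j => [|k IH] i j.
  have -> : dNT 1 (diag_mx d) N = (\tr N)%:M - N.
    by rewrite dNTS /dsg /NT /dNT !mulmx1 !mulmx0 mxtrace0 addr0 divr1 subr0.
  rewrite !mxE; case: eqP => [<-|_]; last by rewrite elsym0 mulr0n add0r mulN1r.
  rewrite mulr1n /mxtrace (bigD1 i) //= addrC addKr.
  by apply: eq_bigr => l _; rewrite elsym0 mul1r.
have trN : \tr (N *m NT k.+1 (diag_mx d)) = \sum_l es k.+1 [set l] * N l l.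
  rewrite /mxtrace; apply: eq_bigr => l _; rewrite mxE (bigD1 l) //= NT_diag eqxx mulr1n.
  rewrite big1 ?addr0 1?mulrC // => m ml; by rewrite NT_diag (negbTE ml) mulr0n mulr0.
have trM : \tr (diag_mx d *m dNT k.+1 (diag_mx d) N) = \sum_l (es k.+1 [set l] * N l l) *+ k.+1.
  rewrite /mxtrace; under eq_bigr do rewrite mul_diagE IH eqxx mulr_sumr.
  rewrite (exchange_big_dep predT) //=; apply: eq_bigr => l _.
  rewrite -mulrnAl -elsym_sum_mul mulr_suml.
  rewrite (eq_bigl (fun i => i \in ~: [set l])) => [|m]; last by rewrite !inE eq_sym.
  apply: eq_bigr => m _; rewrite mulrA setC1_del; congr (_ * elsym _ (~: _) _ * _).
  by rewrite setUC.
have ds : dsg k.+2 (diag_mx d) N = \sum_l es k.+1 [set l] * N l l.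
  apply: (canLR (mulfK _)); first by rewrite pnatr_eq0.
  by rewrite trN trM sumrMnl mulr_natr [RHS]mulrS.
rewrite dNTS ds; rewrite [LHS]mxE [X in _ + X]mxE mul_diagE IH [X in X + _]mxE [X in X + _ + _]mxE.
have NN : (N *m NT k.+1 (diag_mx d)) i j = N i j * es k.+1 [set j].
  rewrite mxE (bigD1 j) //= NT_diag eqxx mulr1n big1 ?addr0 // => l lj.
  by rewrite NT_diag (negbTE lj) mulr0n mulr0.
rewrite [X in _ + X - _]mxE NN; case: eqP => [<-|/eqP ij]; last first.
  have := @elsymS _ _ k (~: [set j]) lam i; rewrite !inE ij setC1_del [[set j; i]]setUC => /(_ isT).
  move=> e; by rewrite e mulr0n add0r; ring.
rewrite mulr1n (bigD1 i) //= [X in _ - X - _]mulrC [X in X - _ - _]addrC addrK mulr_sumr -sumrB.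
apply: eq_bigr => l li; rewrite mulrA -mulrBl; congr (_ * _).
have := @elsymS _ _ k (~: [set l]) lam i; rewrite !inE eq_sym li setC1_del [[set l; i]]setUC => /(_ isT).
by move=> ->; rewrite addrK.
Qed.

Lemma tr_NT_diag k N : \tr (NT k (diag_mx d) *m N) = \sum_l es k [set l] * N l l.
Proof.
rewrite mxtrace_mulC /mxtrace; apply: eq_bigr => l _; rewrite mxE (bigD1 l) //= NT_diag eqxx mulr1n.
by rewrite big1 ?addr0 1?mulrC // => m ml; rewrite NT_diag (negbTE ml) mulr0n mulr0.
Qed.

Lemma dsg_diag k N : dsg k.+1 (diag_mx d) N = \tr (NT k (diag_mx d) *m N).
Proof.
rewrite tr_NT_diag; case: k => [|k].
  rewrite /dsg /NT /dNT mulmx1 mulmx0 mxtrace0 addr0 divr1.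
  by apply: eq_bigr => l _; rewrite elsym0 mul1r.
apply: (canLR (mulfK _)); first by rewrite pnatr_eq0.
rewrite mxtrace_mulC tr_NT_diag mulr_natr [RHS]mulrS; congr (_ + _).
rewrite /mxtrace; under eq_bigr do rewrite mul_diagE dNT_diag eqxx mulr_sumr.
rewrite (exchange_big_dep predT) //= -sumrMnl; apply: eq_bigr => l _.
rewrite -mulrnAl -elsym_sum_mul mulr_suml.
rewrite (eq_bigl (fun i => i \in ~: [set l])) => [|m]; last by rewrite !inE eq_sym.
apply: eq_bigr => m _; rewrite mulrA setC1_del; congr (_ * elsym _ (~: _) _ * _).
by rewrite setUC.
Qed.

End Diag.
End Newton.

(** * Strict concavity on the Gaarding cone *)

Section Strict.
Variables (R : rcfType) (I : finType).
Implicit Types (D : {set I}) (be m : I -> R).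

Lemma Gam_near k D be m : Gam k D be ->
  exists2 d, 0 < d & forall e, 0 < e < d -> Gam k D (fun i => be i + e * m i).
Proof.
pose P j := elsym j D (fun i => (be i)%:P + m i *: 'X).
have PE j e : (P j).[e] = elsym j D (fun i => be i + e * m i).
  by rewrite horner_elsym; apply: eq_elsym => i _; rewrite !hornerE mulrC.
have P0 j : (P j).[0] = elsym j D be.
  by rewrite PE; apply: eq_elsym => i _; rewrite mul0r addr0.
elim: k => [|k IH] G.
  by exists 1 => // e _ j; rewrite leqn0 => /eqP ->; rewrite elsym0.
have [d d0 hd] := IH (Gam_le (leqnSn _) G).
have [d' d'0 hd'] := @poly_cont R 0 (P k.+1) (P k.+1).[0] (ltac:(by rewrite P0 G)).
exists (Num.min d d') => [|e]; first by rewrite lt_min d0.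
rewrite lt_min => /andP[e0 /andP[ed ed']] j; rewrite leq_eqVlt => /orP[/eqP ->|].
  have := hd' e; rewrite subr0 gtr0_norm // => /(_ ed'); rewrite ltr_norml -PE => /andP[+ _].
  by lra.
by rewrite ltnS; apply: hd; rewrite e0.
Qed.

(** On the kernel of the first derivative, Gaarding's inequality along [be + e * m] is an equality
    to first order; the defect kept in [garding_defect] is of order e^2 and forces the second
    derivative to be strictly negative. *)
Lemma elsym_hessian_lt0 k D be m : Gam k.+2 D be -> Dsym k.+1 D be m = 0 ->
  (exists2 i, i \in D & m i != 0) ->
  \sum_(i in D) m i * Dsym k (D :\ i) be m < 0.
Proof.
move=> G D0 [i0 i0D mi0].
pose l i : {poly R} := (be i)%:P + m i *: 'X.
have lE j A e : (elsym j A l).[e] = elsym j A (fun i => be i + e * m i).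
  by rewrite horner_elsym; apply: eq_elsym => i _; rewrite !hornerE mulrC.
have l0 j A : (elsym j A l).[0] = elsym j A be.
  by rewrite lE; apply: eq_elsym => i _; rewrite mul0r addr0.
have dl i : (l i)^`() = (m i)%:P by rewrite /l derivD derivC derivZ derivX add0r alg_polyC.
pose p := elsym k.+2 D l; set H := \sum_(i in D) _.
have p1 : p^`().[0] = 0.
  rewrite -[RHS]D0 deriv_elsym horner_sum; apply: eq_bigr => i _.
  by rewrite hornerM l0 dl hornerC.
have p2 : p^`()^`().[0] = H.
  rewrite deriv_elsym raddf_sum horner_sum; apply: eq_bigr => i _ /=.
  rewrite derivM dl derivC mul0r add0r hornerM hornerC deriv_elsym horner_sum; congr (_ * _).
  by apply: eq_bigr => j _; rewrite hornerM dl hornerC l0.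
(* The first derivative vanishes at 0, so [q.[0]] is half of the second derivative [H]. *)
have [q pq] : exists q, p = (p.[0])%:P + q * 'X^2.
  have /factor_theorem[q1 e1] : root (p - (p.[0])%:P) 0.
    by apply/rootP; rewrite hornerD hornerN hornerC subrr.
  have e2 : p = (p.[0])%:P + q1 * 'X by rewrite -[LHS](subrK (p.[0])%:P) e1 subr0 addrC.
  have /factor_theorem[q2 e3] : root q1 0.
    apply/rootP; move: p1; rewrite e2 derivD derivC add0r derivM derivX mulr1.
    by rewrite hornerD hornerM hornerX mulr0 add0r.
  by exists q2; rewrite {1}e2 e3 subr0 expr2 mulrA.
have qH : q.[0] *+ 2 = H.
  rewrite -p2 pq derivD derivC add0r derivM derivXn /= expr1 derivD !derivM derivMn !derivX.
  by rewrite !(hornerD, hornerM, hornerMn, hornerX, hornerXn, hornerC); ring.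
have b1 := G 1%N isT; have b2 := G 2%N isT; have b3 := G _ (leqnn k.+2).
pose e1m := \sum_(i in D) m i.
pose W := \sum_(i in D) (m i - be i * e1m / elsym 1 D be) ^+ 2.
have [d d0 hd] := Gam_near m G.
(* The factor e^2 common to both sides of the defect inequality is divided out; what is left is
   polynomial in e and survives at e = 0. *)
have key : 0 <= (- (2%:P * elsym 2 D l * q + W%:P * p)).[0].
  apply: (poly_ge0_near d0) => e ed; have Ga := hd e ed; have /andP[e0 _] := ed.
  set al := fun i => _ in Ga.
  have := garding_defect Ga G; rewrite (_ : Dsym k.+1 D be al = elsym k.+2 D be *+ k.+2); last first.
    rewrite -Dsym_self -[RHS]addr0 -[X in _ + X](mulr0 e) -[X in e * X]D0 /Dsym mulr_sumr -big_split /=.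
    by apply: eq_bigr => i _; rewrite /al mulrDl mulrA.
  move=> /(_ erefl).
  have a1 := Ga 1%N isT; have a2 := Ga 2%N isT.
  have a1E : elsym 1 D al = elsym 1 D be + e * e1m.
    by rewrite !elsym1 /e1m mulr_sumr -big_split.
  have -> : \sum_(i in D) (al i / elsym 1 D al - be i / elsym 1 D be) ^+ 2 =
      e ^+ 2 * W / elsym 1 D al ^+ 2.
    rewrite /W mulr_sumr mulr_suml; apply: eq_bigr => i _.
    rewrite -exprMn -expr_div_n; congr (_ ^+ 2); rewrite /al.
    move: a1; rewrite a1E; move: (elsym 1 D be) b1 => b b1 a1; field.
    by rewrite !gt_eqF.
  rewrite hornerN oppr_ge0 hornerD hornerM hornerM hornerM !hornerC !lE -/al.
  have pe : p.[e] = elsym k.+2 D be + e ^+ 2 * q.[e].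
    by rewrite pq hornerD hornerC l0 hornerM hornerXn mulrC.
  have pe' : p.[e] = elsym k.+2 D al by rewrite lE.
  have a3 := Ga _ (leqnn k.+2).
  rewrite /fq -pe'; rewrite -pe' in a3; move: pe a3.
  move: (elsym 2 D al) (elsym 1 D al) a1 a2 => x2 x1 a1 a2.
  move=> pe a3 h; have x10 : 0 < 2 * x1 by rewrite mulr_gt0.
  have {h} : p.[e] * (x2 / x1 + x1 / 2 * (e ^+ 2 * W / x1 ^+ 2)) * (2 * x1) <=
     elsym k.+2 D be * (x2 / x1) * (2 * x1) by rewrite ler_pM2r.
  have -> : p.[e] * (x2 / x1 + x1 / 2 * (e ^+ 2 * W / x1 ^+ 2)) * (2 * x1) =
    p.[e] * 2 * x2 + p.[e] * e ^+ 2 * W by field; rewrite gt_eqF.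
  have -> : elsym k.+2 D be * (x2 / x1) * (2 * x1) = (p.[e] - e ^+ 2 * q.[e]) * 2 * x2.
    by rewrite pe; field; rewrite gt_eqF.
  move=> h; rewrite -(ler_pM2l (_ : 0 < e ^+ 2)) ?exprn_gt0 // mulr0.
  by move: h; lra.
move: key; rewrite hornerN oppr_ge0 hornerD hornerM hornerM hornerM !hornerC !l0 => key.
(* If [W] were 0, [m] would be a nonzero multiple of [be], along which the first derivative does not
   vanish. *)
have W0 : 0 < W.
  rewrite lt_neqAle; apply/andP; split; last by apply: sumr_ge0 => i _; apply: sqr_ge0.
  rewrite eq_sym; apply/eqP => /psumr_eq0P h.
  have {}h i : i \in D -> m i = e1m / elsym 1 D be * be i.
    move=> iD; have /eqP := h (fun j _ => sqr_ge0 _) i iD; rewrite sqrf_eq0 subr_eq0 => /eqP ->.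
    by rewrite [be i * _]mulrC mulrAC.
  have : Dsym k.+1 D be m = e1m / elsym 1 D be * (elsym k.+2 D be *+ k.+2).
    rewrite -Dsym_self /Dsym mulr_sumr; apply: eq_bigr => i iD.
    by rewrite h // mulrA.
  rewrite D0 => /esym/eqP; rewrite mulf_eq0 mulrn_eq0 /= (gt_eqF b3) orbF => /eqP c0.
  by move: mi0; rewrite h // c0 mul0r eqxx.
have : 0 < W * elsym k.+2 D be by rewrite mulr_gt0.
move=> WE; have : 2 * elsym 2 D be * q.[0] < 0 by move: key; lra.
by rewrite -mulrA pmulr_rlt0 // pmulr_rlt0 // -qH pmulrn_llt0.
Qed.

End Strict.

(** The consequence of Birkhoff's theorem for linear functionals, proved greedily: pair the largest
    [c] with the smallest [al], delete that row and column, spread their mass over the rest, and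
    apply induction. *)
Lemma doubly_stochastic_perm (R : realFieldType) n (c al : 'I_n -> R) (P : 'I_n -> 'I_n -> R) :
  (forall i j, 0 <= P i j) -> (forall i, \sum_j P i j = 1) -> (forall j, \sum_i P i j = 1) ->
  exists s : 'S_n, \sum_i c i * al (s i) <= \sum_i \sum_j c i * P i j * al j.
Proof.
elim: n c al P => [|n IH] c al P P0 Pr Pc.
  by exists 1%g; rewrite !big_ord0.
pose i0 := [arg max_(i > ord0) c i]%O; pose j0 := [arg min_(j < ord0) al j]%O.
have ci i : c i <= c i0 by rewrite /i0; case: arg_maxP => // k _; apply.
have aj j : al j0 <= al j by rewrite /j0; case: arg_minP => // k _; apply.
pose x := 1 - P i0 j0.
have xr : \sum_j P i0 (lift j0 j) = x by rewrite /x -(Pr i0) (bigD1_ord j0) //= [RHS]addrC addKr.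
have xc : \sum_i P (lift i0 i) j0 = x by rewrite /x -(Pc j0) (bigD1_ord i0) //= [RHS]addrC addKr.
have x0 : 0 <= x by rewrite -xr sumr_ge0.
have rz j : x = 0 -> P i0 (lift j0 j) = 0.
  by move=> xz; move: xr; rewrite xz => /psumr_eq0P; apply.
have cz i : x = 0 -> P (lift i0 i) j0 = 0.
  by move=> xz; move: xc; rewrite xz => /psumr_eq0P; apply.
(* The deleted mass returns as a rank-one term that keeps [P'] doubly stochastic. If [x = 0], its
   quotient is 0 by convention, and so are the deleted entries. *)
pose P' i j := P (lift i0 i) (lift j0 j) + P (lift i0 i) j0 * P i0 (lift j0 j) / x.
have [|||s hs] := IH (fun i => c (lift i0 i)) (fun j => al (lift j0 j)) P'.
- by move=> i j; rewrite addr_ge0 // divr_ge0 // mulr_ge0.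
- move=> i; rewrite big_split /= -mulr_suml -mulr_sumr xr -[RHS](Pr (lift i0 i)) [RHS](bigD1_ord j0) //= addrC.
  by congr (_ + _); have [xz|xz] := eqVneq x 0; [rewrite xz mulr0 mul0r cz|rewrite mulfK].
- move=> j; rewrite big_split /= -mulr_suml -mulr_suml xc -[RHS](Pc (lift j0 j)) [RHS](bigD1_ord i0) //= addrC.
  by congr (_ + _); have [xz|xz] := eqVneq x 0; [rewrite xz !mul0r rz|rewrite mulrAC mulfV ?mul1r].
exists (lift_perm i0 j0 s); rewrite (bigD1_ord i0) //= lift_perm_id.
under eq_bigr do rewrite lift_perm_lift.
apply: le_trans (_ : c i0 * al j0 + \sum_i \sum_j c (lift i0 i) * P' i j * al (lift j0 j) <= _).
  by rewrite lerD2l.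
pose a := \sum_j P i0 (lift j0 j) * al (lift j0 j).
pose b := \sum_i c (lift i0 i) * P (lift i0 i) j0.
pose S := \sum_i \sum_j c (lift i0 i) * P (lift i0 i) (lift j0 j) * al (lift j0 j).
have -> : \sum_i \sum_j c (lift i0 i) * P' i j * al (lift j0 j) = S + b * a / x.
  rewrite /S /b mulr_suml mulr_suml -big_split; apply: eq_bigr => i _ /=.
  rewrite /a mulr_sumr mulr_suml -big_split; apply: eq_bigr => j _ /=.
  by rewrite /P'; ring.
have -> : \sum_i \sum_j c i * P i j * al j = c i0 * P i0 j0 * al j0 + c i0 * a + (b * al j0 + S).
  rewrite (bigD1_ord i0) //= (bigD1_ord j0) //=; congr (_ + _ + _).
    by rewrite /a mulr_sumr; apply: eq_bigr => j _; rewrite mulrA.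
  rewrite /b mulr_suml /S -big_split; apply: eq_bigr => i _.
  by rewrite (bigD1_ord j0).
have ax : al j0 * x <= a.
  by rewrite -xr mulr_sumr ler_sum // => j _; rewrite mulrC ler_wpM2l.
have bx : b <= c i0 * x.
  by rewrite -xc mulr_sumr ler_sum // => i _; rewrite ler_wpM2r.
have -> : P i0 j0 = 1 - x by rewrite /x opprB addrC subrK.
have [xz|xz] := eqVneq x 0.
  have -> : a = 0 by rewrite /a big1 // => j _; rewrite rz // mul0r.
  have -> : b = 0 by rewrite /b big1 // => j _; rewrite cz // mulr0.
  by rewrite xz; lra.
have xp : 0 < x by rewrite lt_def xz.
rewrite -subr_ge0; set A := (X in 0 <= X).
have -> : A = (c i0 * x - b) * (a - al j0 * x) / x by rewrite /A; field.
by rewrite divr_ge0 // mulr_ge0 // subr_ge0.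
Qed.

(** * From vectors of eigenvalues to symmetric matrices *)

Section GardingMx.
Variables (R : rcfType) (n : nat).
Implicit Types (A B M N : 'M[R]_n).

Definition GamM k M := forall j, (j <= k)%N -> 0 < sg j M.

Lemma GamM_le k k' M : (k' <= k)%N -> GamM k M -> GamM k' M.
Proof. by move=> kk G j jk; apply: G; apply: leq_trans kk. Qed.

Lemma conjE (O M : 'M[R]_n) : O *m O^T = 1%:M -> M = O^T *m (O *m M *m O^T) *m O.
Proof.
by move=> O1; rewrite !mulmxA (mulmx1C O1) mul1mx -mulmxA (mulmx1C O1) mulmx1.
Qed.

Lemma dsgE k M N : M^T = M -> dsg k.+1 M N = \tr (NT k M *m N).
Proof.
move=> /real_spectral[O [d [O1 ->]]]; rewrite (conjE N O1).
set N' := O *m N *m O^T; rewrite NT_conj // conj_mul // conj_tr // -dsg_diag.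
by rewrite /dsg NT_conj // dNT_conj // !conj_mul // !conj_tr.
Qed.

(** In an eigenbasis of [M] the tensor is diagonal, its entries being [elsym k] of the eigenvalues
    with one deleted; these are positive by [Gam_del]. *)
Lemma NT_posdef k M (x : 'rV_n) : M^T = M -> GamM k.+1 M -> x != 0 ->
  0 < (x *m NT k M *m x^T) 0 0.
Proof.
move=> /real_spectral[O [d [O1 ->]]] G x0; rewrite NT_conj //.
have Gd : Gam k.+1 setT (fun i => d 0 i) by move=> j jk; rewrite -sg_diag -(sg_conj O1); apply: G.
have ck i : 0 < elsym k (~: [set i]) (fun i => d 0 i).
  by rewrite -setT_del1; apply: (Gam_del Gd).
have [y yE] : exists y, y = x *m O^T by eexists.
have -> : (x *m (O^T *m NT k (diag_mx d) *m O) *m x^T) 0 0 =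
   \sum_i elsym k (~: [set i]) (fun i => d 0 i) * y 0 i ^+ 2.
  have -> : x *m (O^T *m NT k (diag_mx d) *m O) *m x^T = y *m (NT k (diag_mx d) *m y^T).
    by rewrite yE trmx_mul trmxK !mulmxA.
  rewrite mxE; apply: eq_bigr => i _; rewrite mxE (bigD1 i) //= NT_diag eqxx mulr1n big1.
    by rewrite addr0 mxE; ring.
  by move=> j ji; rewrite NT_diag eq_sym (negbTE ji) mulr0n mul0r.
have y0 : y != 0.
  apply: contra x0 => /eqP yz; have : y *m O = 0 by rewrite yz mul0mx.
  by rewrite yE -mulmxA (mulmx1C O1) mulmx1 => ->.
rewrite lt_def sumr_ge0 ?andbT => [|i _]; last by rewrite mulr_ge0 ?sqr_ge0 // ltW.
apply: contra y0 => /eqP/psumr_eq0P h; apply/eqP/rowP => i; rewrite mxE; apply/eqP.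
have /eqP := h (fun j _ => mulr_ge0 (ltW (ck j)) (sqr_ge0 _)) i isT.
by rewrite mulf_eq0 (gt_eqF (ck i)) sqrf_eq0.
Qed.

Lemma elsym_perm k (al : 'I_n -> R) (s : 'S_n) :
  elsym k [set: 'I_n] (fun i => al (s i)) = elsym k [set: 'I_n] al.
Proof.
rewrite /elsym [RHS](reindex_inj (imset_inj (@perm_inj _ s))) /=.
apply: eq_big => [B|B _]; first by rewrite !subsetT card_imset //; apply: perm_inj.
by rewrite big_imset //= => x y _ _; apply: perm_inj.
Qed.

(** In an eigenbasis of [B] the diagonal of [A] is a doubly stochastic average of the eigenvalues of
    [A]. The trace is therefore at least its value for some matching of the two spectra, and
    [garding_vector] applies to that matching. *)
Lemma garding_mx k A B : A^T = A -> B^T = B -> GamM k.+1 A -> GamM k.+1 B ->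
  0 < \tr (NT k B *m A) /\
  sg k.+1 A * sg k.+1 B ^+ k <= (\tr (NT k B *m A) / k.+1%:R) ^+ k.+1.
Proof.
move=> /real_spectral[OA [a [OA1 ->]]] /real_spectral[O [b [O1 ->]]] GA GB.
rewrite (conjE (OA^T *m diag_mx a *m OA) O1) NT_conj // conj_mul // conj_tr // tr_NT_diag.
rewrite -(conjE _ O1) !sg_conj // !sg_diag.
have Ga : Gam k.+1 setT (fun i => a 0 i) by move=> j jk; rewrite -sg_diag -(sg_conj OA1); apply: GA.
have Gb : Gam k.+1 setT (fun i => b 0 i) by move=> j jk; rewrite -sg_diag -(sg_conj O1); apply: GB.
pose U := O *m OA^T; have U1 : U *m U^T = 1%:M.
  by rewrite /U trmx_mul trmxK mulmxA -(mulmxA O) (mulmx1C OA1) mulmx1.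
pose c l := elsym k (~: [set l]) (fun i => b 0 i).
have dE l : (O *m (OA^T *m diag_mx a *m OA) *m O^T) l l = \sum_j U l j ^+ 2 * a 0 j.
  have -> : O *m (OA^T *m diag_mx a *m OA) *m O^T = U *m (diag_mx a *m U^T).
    by rewrite /U trmx_mul trmxK !mulmxA.
  by rewrite mxE; apply: eq_bigr => j _; rewrite mul_diagE [U^T _ _]mxE; ring.
clearbody U.
have [|||s hs] := @doubly_stochastic_perm _ _ c (fun i => a 0 i) (fun i j => U i j ^+ 2).
- by move=> i j; apply: sqr_ge0.
- move=> i; have /matrixP/(_ i i) := U1; rewrite !mxE eqxx mulr1n => <-.
  by apply: eq_bigr => j _; rewrite mxE expr2.
- move=> j; have /matrixP/(_ j j) := mulmx1C U1; rewrite !mxE eqxx mulr1n => <-.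
  by apply: eq_bigr => i _; rewrite mxE expr2.
have Gs : Gam k.+1 setT (fun i => a 0 (s i)).
  by move=> j jk; rewrite (elsym_perm j (fun i => a 0 i)); apply: Ga.
have [D0 gv] := garding_vector Gs Gb.
rewrite (elsym_perm k.+1 (fun i => a 0 i)) in gv.
have DE : Dsym k [set: 'I_n] (fun i => b 0 i) (fun i => a 0 (s i)) = \sum_i c i * a 0 (s i).
  by rewrite /Dsym sum_setT; apply: eq_bigr => i _; rewrite setT_del1 mulrC.
rewrite DE in D0 gv.
have le : \sum_i c i * a 0 (s i) <=
   \sum_l elsym k (~: [set l]) (fun i => b 0 i) * (O *m (OA^T *m diag_mx a *m OA) *m O^T) l l.
  apply: le_trans hs _; apply: ler_sum => l _; rewrite dE mulr_sumr; apply: ler_sum => j _.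
  by rewrite -mulrA.
split; first exact: lt_le_trans le.
apply: le_trans gv _; apply: lerXn2r; rewrite ?nnegrE ?divr_ge0 ?(ltW D0) //.
  by rewrite (le_trans _ le) // ltW.
by rewrite ler_wpM2r ?invr_ge0.
Qed.

(** The Lorentz signature behind Alexandrov-Fenchel. In an eigenbasis of [B] the diagonal of [N] is
    handled by [elsym_hessian_lt0], and the off-diagonal entries enter as negative multiples of
    squares. *)
Lemma NT_lorentz k B N : B^T = B -> N^T = N -> GamM k.+2 B ->
  \tr (NT k.+1 B *m N) = 0 -> N != 0 -> \tr (dNT k.+1 B N *m N) < 0.
Proof.
move=> /real_spectral[O [b [O1 ->]]] sN GB; rewrite (conjE N O1).
set N' := O *m N *m O^T.
have sN' : N'^T = N' by rewrite /N' !trmx_mul trmxK sN mulmxA.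
clearbody N'.
have Gb : Gam k.+2 setT (fun i => b 0 i) by move=> j jk; rewrite -sg_diag -(sg_conj O1); apply: GB.
rewrite NT_conj // dNT_conj // !conj_mul // !conj_tr // tr_NT_diag => D0 N0.
have {N0}N0 : N' != 0 by apply: contra N0 => /eqP ->; rewrite mulmx0 mul0mx.
pose m i := N' i i.
have D1 : Dsym k.+1 [set: 'I_n] (fun i => b 0 i) m = 0.
  by rewrite -D0 /Dsym sum_setT; apply: eq_bigr => i _; rewrite setT_del1 mulrC.
pose c i j := elsym k (~: [set i; j]) (fun i => b 0 i).
have c0 i j : i != j -> 0 < c i j.
  move=> ij; rewrite /c -setC1_del -setT_del1; apply: (Gam_del (Gam_del Gb _)) => //.
  by rewrite !inE eq_sym ij.
have -> : \tr (dNT k.+1 (diag_mx b) N' *m N') =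
  \sum_(i in [set: 'I_n]) m i * Dsym k ([set: 'I_n] :\ i) (fun i => b 0 i) m
   - \sum_i \sum_(j | j != i) c i j * N' i j ^+ 2.
  rewrite sum_setT -sumrB; apply: eq_bigr => i _; rewrite mxE (bigD1 i) //= dNT_diag eqxx.
  congr (_ + _).
    rewrite mulrC; congr (_ * _); rewrite /Dsym setT_del1.
    rewrite (eq_bigl (fun l => l \in ~: [set i])) => [|l]; last by rewrite !inE.
    by apply: eq_bigr => l _; rewrite setC1_del mulrC.
  rewrite -sumrN; apply: eq_bigr => j ji; rewrite dNT_diag eq_sym (negbTE ji).
  have -> : N' j i = N' i j by rewrite -[in LHS]sN' mxE.
  by rewrite /c; ring.
have s0 : 0 <= \sum_i \sum_(j | j != i) c i j * N' i j ^+ 2.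
  by apply: sumr_ge0 => i _; apply: sumr_ge0 => j ji; rewrite mulr_ge0 ?sqr_ge0 // ltW // c0 // eq_sym.
have [/existsP[i mi]|/existsPn mz] := boolP [exists i, m i != 0].
  rewrite subr_lt0; apply: lt_le_trans s0; apply: elsym_hessian_lt0 => //.
  by exists i; rewrite ?inE.
rewrite big1 => [|i _]; last by have := mz i; rewrite negbK => /eqP ->; rewrite mul0r.
rewrite sub0r oppr_lt0 lt_def s0 andbT; apply: contra N0 => /eqP/psumr_eq0P h.
apply/eqP/matrixP => i j; rewrite mxE; have [->|ij] := eqVneq i j.
  by have := mz j; rewrite negbK => /eqP.
have p0 a l : l != a -> 0 <= c a l * N' a l ^+ 2.
  by move=> la; rewrite mulr_ge0 ?sqr_ge0 // ltW // c0 // eq_sym.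
have h1 : forall a, true -> 0 <= \sum_(l | l != a) c a l * N' a l ^+ 2.
  by move=> a _; apply: sumr_ge0 => l; apply: p0.
have /psumr_eq0P h2 := h h1 i isT.
have : c i j * N' i j ^+ 2 = 0.
  by apply: h2; rewrite 1?eq_sym // => l; apply: p0.
by move/eqP; rewrite mulf_eq0 (gt_eqF (c0 _ _ ij)) sqrf_eq0 => /eqP.
Qed.

End GardingMx.

Arguments NT : simpl never.
Arguments sg : simpl never.
Arguments dNT : simpl never.
Arguments dsg : simpl never.

Section Cone.
Variables (R : rcfType) (n : nat).
Implicit Types (M N P Q : 'M[R]_n) (a s : R).

Lemma NTZ k a M : NT k (a *: M) = a ^+ k *: NT k M /\ sg k (a *: M) = a ^+ k * sg k M.
Proof.
elim: k => [|k [IH1 _]]; first by rewrite !expr0 scale1r mul1r.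
have s : sg k.+1 (a *: M) = a ^+ k.+1 * sg k.+1 M.
  by rewrite /sg IH1 -scalemxAl -scalemxAr !mxtraceZ exprS; ring.
split=> //; rewrite !NTS s IH1 -scalemxAl -scalemxAr scalerA -exprS scalerBr.
by congr (_ - _); apply/matrixP => i j; rewrite !mxE mulrnAr.
Qed.

Lemma GamMZ k a M : 0 < a -> GamM k M -> GamM k (a *: M).
Proof. by move=> a0 h j jk; rewrite (NTZ j a M).2 mulr_gt0 ?exprn_gt0 //; exact: h. Qed.

Lemma GamM_shift k M s : M^T = M -> 0 <= s -> GamM k M -> GamM k (M + s%:M).
Proof.
move=> sM s0 hM; case: (real_spectral sM) => Q [x [Q1 xE]].
have Gx : Gam k setT (fun i => x 0 i) by move=> j jk; rewrite -sg_diag -(sg_conj Q1) -xE; apply: hM.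
have -> : M + s%:M = Q^T *m diag_mx (\row_i (x 0 i + s)) *m Q.
  rewrite xE (_ : diag_mx (\row_i (x 0 i + s)) = diag_mx x + s%:M).
    by rewrite mulmxDr mulmxDl mul_mx_scalar -scalemxAl (mulmx1C Q1) scalemx1.
  by apply/matrixP => i j; rewrite !mxE; case: eqP => [->|_]; rewrite ?mulr1n ?mulr0n ?addr0.
move=> j jk; rewrite (sg_conj Q1) sg_diag (eq_elsym j (lam' := fun i => x 0 i + s)); last by move=> i _; rewrite mxE.
exact: (Gam_shift s0 Gx jk).
Qed.

Lemma sg1_gt0 k : (k <= n)%N -> 0 < sg k (1%:M : 'M[R]_n).
Proof.
move=> kn; have -> : 1%:M = diag_mx (const_mx 1) :> 'M[R]_n.
  by apply/matrixP => i j; rewrite !mxE.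
rewrite sg_diag elsym_pos ?cardsT ?card_ord // => i; by rewrite mxE.
Qed.

(** Monotonicity on the cone. With B = P + Q both parts pair positively with T_k(B), so tr(T_k(B) P)
    is at most (k+1) sigma_{k+1}(B), and Gaarding's inequality for [P] and [B] gives the claim after
    division by a power of sigma_{k+1}(B). *)
Lemma sg_le_add k P Q : P^T = P -> Q^T = Q -> GamM k P -> GamM k Q -> GamM k (P + Q) -> sg k P <= sg k (P + Q).
Proof.
case: k => [|k] // sP sQ hP hQ hB; set B := P + Q in hB *.
have sB : B^T = B by rewrite /B linearD /= sP sQ.
have [q0 _] := garding_mx sQ sB hQ hB; have [p0 h] := garding_mx sP sB hP hB.
have b0 : 0 < sg k.+1 B by exact: hB.
have tB : \tr (NT k B *m B) = k.+1%:R * sg k.+1 B by rewrite -NT_comm /sg mulrC divfK // pnatr_eq0.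
have : \tr (NT k B *m P) <= k.+1%:R * sg k.+1 B by rewrite -tB {2}/B mulmxDr linearD /= lerDl ltW.
rewrite mulrC -ler_pdivrMr ?ltr0Sn // => h2.
have : sg k.+1 P * sg k.+1 B ^+ k <= sg k.+1 B * sg k.+1 B ^+ k.
  rewrite -exprS; apply: le_trans h _; apply: lerXn2r => //; rewrite nnegrE; last exact: ltW.
  by rewrite divr_ge0 // ltW.
by rewrite ler_pM2r // exprn_gt0.
Qed.

End Cone.

(** * Eigenvalues of the tangential block *)

Section CharPoly.
Variable R : rcfType.

Lemma char_poly_orth n (Q W : 'M[R]_n) : Q *m Q^T = 1%:M -> char_poly (Q *m W *m Q^T) = char_poly W.
Proof.
move=> Q1; rewrite /char_poly /char_poly_mx.
have mQ : map_mx polyC Q *m map_mx polyC Q^T = 1%:M :> 'M[{poly R}]_n.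
  by rewrite -map_mxM Q1 map_mx1.
rewrite !map_mxM (_ : 'X%:M - _ = map_mx polyC Q *m ('X%:M - map_mx polyC W) *m map_mx polyC Q^T).
  by rewrite !det_mulmx mulrC mulrA [\det (map_mx _ _^T) * _]mulrC -det_mulmx mQ det1 mul1r.
by rewrite mulmxBr mulmxBl mul_mx_scalar -scalemxAl mQ scalemx1.
Qed.

(** [N] together with the rows of [J] divided by [c] is an orthonormal frame in which [W] is block
    diagonal with blocks 0 and [B]; this matches the extra root 0 in [tangent_eigs]. *)
Lemma char_poly_tangent n (N : 'rV[R]_n.+1) (J : 'M[R]_(n, n.+1)) (W : 'M[R]_n.+1) (B : 'M[R]_n) (c : R) :
  c != 0 -> N *m N^T = 1%:M -> J *m J^T = (c ^+ 2)%:M -> J *m N^T = 0 ->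
  N *m W = 0 -> W *m N^T = 0 -> J *m W *m J^T = c ^+ 2 *: B ->
  char_poly W = 'X * char_poly B.
Proof.
move=> c0 N1 J1 JN NW WN JW; pose Q : 'M[R]_(1 + n, n.+1) := col_mx N (c^-1 *: J).
have NJ : N *m J^T = 0 by rewrite -[LHS]trmxK trmx_mul trmxK JN trmx0.
have QT : Q^T = row_mx N^T (c^-1 *: J^T).
  by rewrite /Q tr_col_mx; congr row_mx; apply/matrixP => i j; rewrite !mxE.
have Q1 : Q *m Q^T = 1%:M.
  rewrite QT /Q mul_col_row N1 -!scalemxAl -!scalemxAr JN NJ J1 !scaler0 scalerA scale_scalar_mx.
  rewrite (_ : c^-1 * c^-1 * c ^+ 2 = 1); last by field.
  by rewrite -scalar_mx_block.
have QW : Q *m W *m Q^T = block_mx (0 : 'M[R]_1) 0 0 B.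
  rewrite QT /Q mul_col_mx NW mul_col_row !mul0mx; congr block_mx.
    by rewrite -!scalemxAl -mulmxA WN mulmx0 scaler0.
  by rewrite -!scalemxAl -!scalemxAr JW !scalerA (_ : _ * _ * _ = 1) ?scale1r //; field.
have e : char_poly (Q *m W *m Q^T) = char_poly W := @char_poly_orth n.+1 Q W Q1.
rewrite -e QW /char_poly char_block_diag_mx det_ublock; congr (_ * _).
by rewrite /char_poly_mx map_mx0 subr0 det_scalar1.
Qed.

(** Equal characteristic polynomials make the two lists of eigenvalues permutations of each other,
    and [elsym] is invariant under permutations. *)
Lemma sg_char_poly n k (B : 'M[R]_n) (lam : 'I_n -> R) : B^T = B ->
  char_poly B = \prod_(i < n) ('X - (lam i)%:P) ->
  sg k B = \sum_(A : {set 'I_n} | #|A| == k) \prod_(i in A) lam i.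
Proof.
move=> sB; have [Q [d [Q1 BE]]] := real_spectral sB.
have Q1' : Q^T *m Q = 1%:M by exact: mulmx1C.
rewrite BE (sg_conj Q1) sg_diag => cp.
have cp' : \prod_(i < n) ('X - (d 0 i)%:P) = \prod_(i < n) ('X - (lam i)%:P).
  rewrite -cp -{2}[Q]trmxK char_poly_orth ?trmxK // char_poly_trig ?diag_mx_is_trig //.
  by apply: eq_bigr => i _; rewrite mxE eqxx.
have pe : perm_eq [tuple d 0 i | i < n] [tuple lam i | i < n].
  apply: prod_XsubC_eq; rewrite !big_tuple.
  rewrite (eq_bigr (fun i => 'X - (d 0 i)%:P)) => [|i _]; last by rewrite tnth_mktuple.
  by rewrite cp'; apply: eq_bigr => i _; rewrite tnth_mktuple.
have /tuple_permP[s sE] := pe.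
have dl i : d 0 i = lam (s i).
  have : tnth [tuple d 0 i | i < n] i = tnth [tuple tnth [tuple lam i | i < n] (s i) | i < n] i.
    by congr tnth; apply: val_inj.
  by rewrite !tnth_mktuple.
rewrite (eq_elsym k (lam' := fun i => lam (s i))) => [|i _]; last exact: dl.
by rewrite elsym_perm /elsym; apply: eq_bigl => A; rewrite subsetT.
Qed.

End CharPoly.

From mathcomp Require Import all_classical all_reals all_analysis.
Import numFieldNormedType.Exports.
Local Open Scope classical_set_scope.
Local Open Scope ring_scope.

(** * Calculus on [R^n] *)

Lemma cont_sum (R : realType) (T : topologicalType) (I : Type) (r : seq I) (P : pred I)
    (F : I -> T -> R) : (forall i, continuous (F i)) ->
  continuous (fun x => \sum_(i <- r | P i) F i x).
Proof.
move=> cF; elim: r => [|i r IH].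
  by under eq_fun do rewrite big_nil; move=> x; apply: cvg_cst.
under eq_fun do rewrite big_cons.
by case: (P i) => // x; exact: (cvgD (cF i x) (IH x)).
Qed.

Lemma differentiable_of_estimate (R : realType) (V W : normedModType R) (f : V -> W)
    (df : {linear V -> W}) x : continuous df ->
  (forall e, 0 < e -> \forall h \near (0 : V), `|f (h + x) - f x - df h| <= e * `|h|) ->
  differentiable f x /\ 'd f x = df :> (V -> W).
Proof.
move=> cdf h; have ho : f \o shift x = cst (f x) + df +o_ (0 : V) id.
  apply/eqaddoP => _/posnumP[e]; have := h e%:num (ltac:(by [])).
  by apply: filterS => v; rewrite !fctE /= opprD addrA.
have dfE := diff_unique cdf ho.
by split=> //; apply/diff_locallyP; rewrite dfE; split.
Qed.

Lemma continuous_at_delta (R : realType) m (G : 'rV[R]_m -> R) a e :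
  {for a, continuous G} -> 0 < e ->
  exists2 d : R, 0 < d & forall x, `|x - a| < d -> `|G x - G a| <= e.
Proof.
move=> cG e0; have /cvgrPdist_le /(_ _ e0) := cG.
move=> /nbhs_ballP[d /= d0 hd]; exists d => // x xa.
by rewrite distrC; apply: hd; rewrite -ball_normE /= distrC.
Qed.

Lemma delta_forall (R : realType) (I : finType) (P : I -> R -> Prop) :
  (forall i d d', d' <= d -> P i d -> P i d') ->
  (forall i, exists2 d, 0 < d & P i d) -> exists2 d, 0 < d & forall i, P i d.
Proof.
move=> mono h; have /boolp.choice[f hf] : forall i, exists d, 0 < d /\ P i d.
  by move=> i; have [d d0 Pd] := h i; exists d.
exists (\big[Num.min/1]_i f i) => [|i].
  by apply/bigmin_gtP; split=> // i _; have [] := hf i.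
by apply: mono (hf i).2; apply: bigmin_le_cond.
Qed.

Section Partial.
Variables (R : realType) (m : nat).
Implicit Types (F G : 'rV[R]_m -> R) (w a b v : 'rV[R]_m) (i j : 'I_m).

(* Sealed behind an opaque proof, so that unification never unfolds derivatives. *)
Lemma pd_subproof : {d : 'I_m -> ('rV[R]_m -> R) -> 'rV[R]_m -> R |
  forall i F w, d i F w = 'D_(basisv R i) F w}.
Proof. by exists (fun i F w => 'D_(basisv R i) F w). Qed.

Definition pd i F : 'rV[R]_m -> R := sval pd_subproof i F.

Lemma pdE i F w : pd i F w = 'D_(basisv R i) F w.
Proof. exact: (svalP pd_subproof). Qed.

Lemma basisvE i j : basisv R i 0 j = (i == j)%:R.
Proof. by rewrite mxE. Qed.

Lemma coord_le_norm w i : `|w 0 i| <= `|w|.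
Proof. by rewrite [leRHS]/Num.norm /= mx_normrE; apply/bigmax_geP; right => /=; exists (0, i). Qed.

Lemma norm_le_coord w c : 0 <= c -> (forall i, `|w 0 i| <= c) -> `|w| <= c.
Proof.
move=> c0 h; rewrite [leLHS]/Num.norm /= mx_normrE; apply/bigmax_leP; split=> // -[i j] _ /=.
by rewrite ord1.
Qed.

Lemma norm_basisv i : `|basisv R i| <= 1 :> R.
Proof. by apply: norm_le_coord => // j; rewrite basisvE; case: eqP => _; rewrite ?normr1 ?normr0. Qed.

Lemma is_derive_line F b v t : derivable F (t *: v + b) v ->
  is_derive t 1 (fun s => F (s *: v + b)) ('D_v F (t *: v + b)).
Proof.
move=> dF; have e : (fun h => h^-1 *: (((fun s => F (s *: v + b)) \o shift t) (h *: 1) - F (t *: v + b))) =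
    (fun h => h^-1 *: ((F \o shift (t *: v + b)) (h *: v) - F (t *: v + b))).
  by apply/funext => h /=; rewrite scalerDl addrA [h *: 1]mulr1.
by apply: DeriveDef; rewrite ?/derivable ?/derive e.
Qed.

Lemma line_MVT F b v s : (forall t, `|t| <= `|s| -> derivable F (t *: v + b) v) ->
  exists2 t, `|t| <= `|s| & F (s *: v + b) - F b = s * 'D_v F (t *: v + b).
Proof.
move=> dF; pose g t := F (t *: v + b).
have g0 : g 0 = F b by rewrite /g scale0r add0r.
have dg (t : R) : `|t| <= `|s| -> is_derive t 1 g ('D_v F (t *: v + b)).
  by move=> ts; apply: is_derive_line; apply: dF.
have cg (x y : R) : (forall t, t \in `[x, y] -> `|t| <= `|s|) -> {within `[x, y], continuous g}.
  move=> h; apply: derivable_within_continuous => t /h ts.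
  by have [] := dg t ts.
have [s0|s0|s0] := ltgtP 0 s.
- have sn : `|s| = s by rewrite gtr0_norm.
  have h (t : R) : t \in `[0, s] -> `|t| <= `|s|.
    by rewrite in_itv /= => /andP[t0 ts]; rewrite sn ger0_norm.
  have [t|t tI] := @MVT R g (fun t => 'D_v F (t *: v + b)) 0 s s0 _ (cg _ _ h).
    by move=> tI; apply: dg; apply: h; apply: subset_itv_oo_cc.
  rewrite g0 subr0 mulrC => e; exists t => //; apply: h; exact: subset_itv_oo_cc.
- have sn : `|s| = - s by rewrite ltr0_norm.
  have h (t : R) : t \in `[s, 0] -> `|t| <= `|s|.
    by rewrite in_itv /= => /andP[t0 ts]; rewrite sn ler0_norm // lerN2.
  have [t|t tI] := @MVT R g (fun t => 'D_v F (t *: v + b)) s 0 s0 _ (cg _ _ h).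
    by move=> tI; apply: dg; apply: h; apply: subset_itv_oo_cc.
  rewrite g0 sub0r mulrN => e; exists t; first by apply: h; exact: subset_itv_oo_cc.
  by rewrite -/(g s) mulrC; apply: oppr_inj; rewrite opprB.
- by exists 0; rewrite ?normr0 // -s0 scale0r add0r subrr mul0r.
Qed.

Definition trunc (k : nat) v : 'rV[R]_m := \row_j (if (j < k)%N then v 0 j else 0).

Lemma truncS v i : trunc i.+1 v = v 0 i *: basisv R i + trunc i v.
Proof.
apply/rowP => j; rewrite !mxE ltnS leq_eqVlt -val_eqE /= eq_sym.
by case: eqP => [/val_inj <-|_] /=; rewrite ?ltnn ?mulr1 ?mulr0 ?addr0 ?add0r.
Qed.

(** Walk from [a] to [v + a] along the coordinate axes and use the mean value theorem on each leg;
    in the maximum norm all intermediate points stay within [|v|] of [a]. *)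
Lemma partial_increment F a (e d : R) : 0 < d ->
  (forall x, `|x - a| < d -> forall i, derivable F x (basisv R i) /\ `|pd i F x - pd i F a| <= e) ->
  forall v, `|v| < d -> `|F (v + a) - F a - \sum_i v 0 i * pd i F a| <= m%:R * e * `|v|.
Proof.
move=> d0 h v vd.
have -> : F (v + a) - F a = \sum_(i < m) (F (trunc i.+1 v + a) - F (trunc i v + a)).
  rewrite -(big_mkord xpredT (fun i : nat => F (trunc i.+1 v + a) - F (trunc i v + a))).
  rewrite telescope_sumr //; congr (F (_ + a) - F _).
    by apply/rowP => j; rewrite mxE ltn_ord.
  by rewrite (_ : trunc 0 v = 0) ?add0r //; apply/rowP => j; rewrite !mxE.
rewrite -sumrB; apply: le_trans (ler_norm_sum _ _ _) _.
have -> : m%:R * e * `|v| = \sum_(i < m) e * `|v|.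
  by rewrite sumr_const card_ord -mulrA mulr_natl.
apply: ler_sum => i _.
have near t : `|t| <= `|v 0 i| -> `|t *: basisv R i + (trunc i v + a) - a| < d.
  move=> tv; rewrite addrA addrK; apply: le_lt_trans vd; apply: norm_le_coord => // j.
  rewrite !mxE; have vj := coord_le_norm v j.
  have [->|ij] := eqVneq i j; first by rewrite ltnn addr0 mulr1 (le_trans tv) // coord_le_norm.
  by rewrite mulr0 add0r; case: ifP => // _; rewrite normr0.
have [t tv] := @line_MVT F (trunc i v + a) (basisv R i) (v 0 i) (fun t tv => (h _ (near t tv) i).1).
rewrite addrA -truncS => ->; rewrite -mulrBr normrM mulrC ler_pM //.
  by rewrite -pdE; have [_] := h _ (near t tv) i.
exact: coord_le_norm.
Qed.

Lemma partial_differentiable F a :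
  (exists2 d, 0 < d & forall x, `|x - a| < d -> forall i, derivable F x (basisv R i)) ->
  (forall i, {for a, continuous (pd i F)}) ->
  differentiable F a /\ forall v, 'D_v F a = \sum_i v 0 i * pd i F a.
Proof.
move=> dF cF; pose L v := \sum_i v 0 i * pd i F a.
have lL : linear (L : 'rV[R]_m -> R).
  move=> c x y; rewrite /L scaler_sumr -big_split /=; apply: eq_bigr => i _.
  by rewrite !mxE mulrDl /GRing.scale /= mulrA.
have [df dfL] : {df : {linear 'rV[R]_m -> R} | df = L :> ('rV[R]_m -> R)}.
  pose df : {linear 'rV[R]_m -> R} := HB.pack L (GRing.isLinear.Build R 'rV[R]_m R *:%R L lL).
  by exists df.
have cL : continuous (df : 'rV[R]_m -> R).
  rewrite dfL /L; apply: cont_sum => i x.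
  exact: (cvgMr_tmp (@coord_continuous R 1 m 0 i x)).
have [dd dE] : differentiable F a /\ 'd F a = df :> ('rV[R]_m -> R).
  apply: differentiable_of_estimate => // e e0; rewrite dfL.
  pose e' := e / m.+1%:R; have e'0 : 0 < e' by rewrite divr_gt0.
  have [d1 d10 hd1] := dF.
  have [d2 d20 hd2] : exists2 d, 0 < d & forall i x, `|x - a| < d -> `|pd i F x - pd i F a| <= e'.
    apply: (@delta_forall R 'I_m (fun i d => forall x, `|x - a| < d -> `|pd i F x - pd i F a| <= e')).
      by move=> i d d' dd h x xa; apply: h; apply: lt_le_trans dd.
    by move=> i; apply: continuous_at_delta.
  pose d := Num.min d1 d2; have d0 : 0 < d by rewrite lt_min d10.
  have hd x : `|x - a| < d -> forall i, derivable F x (basisv R i) /\ `|pd i F x - pd i F a| <= e'.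
    by rewrite lt_min => /andP[x1 x2] i; split; [apply: hd1|apply: hd2].
  apply/nbhs_ballP; exists d => // v; rewrite -ball_normE /= sub0r normrN => vd.
  apply: (@le_trans _ _ (m%:R * e' * `|v|)).
    apply: (@partial_increment F a e' d).
  - exact: d0.
  - exact: hd.
  - exact: vd.
  apply: ler_wpM2r => //; rewrite /e' mulrCA ler_piMr //; first exact: ltW.
  by rewrite ler_pdivrMr ?ltr0Sn // mul1r ler_nat.
by split=> // v; rewrite deriveE // dE dfL.
Qed.

End Partial.

Section CkTheory.
Variables (R : realType) (m : nat).
Implicit Types (F G : 'rV[R]_m -> R) (w : 'rV[R]_m) (i j : 'I_m) (k : nat).

(** Differentiability on the whole space, recursive in the order so that closure properties go by
    induction. Functions given near the cap are made global by a cutoff ([cap_extension]). *)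
Fixpoint Ck k F : Prop :=
  continuous F /\
  if k is k'.+1 then forall i, (forall w, derivable F w (basisv R i)) /\ Ck k' (pd i F) else True.

Lemma Ck_cont k F : Ck k F -> continuous F. Proof. by case: k => [|k] []. Qed.
Lemma Ck_der k F i w : Ck k.+1 F -> derivable F w (basisv R i).
Proof. by case=> _ /(_ i)[]. Qed.
Lemma Ck_pd k F i : Ck k.+1 F -> Ck k (pd i F).
Proof. by case=> _ /(_ i)[]. Qed.
Lemma CkW k F : Ck k.+1 F -> Ck k F.
Proof.
elim: k F => [|k IH] F [cF h]; split=> // i.
by have [d c] := h i; split=> //; apply: IH.
Qed.
Lemma Ck_le k l F : (k <= l)%N -> Ck l F -> Ck k F.
Proof.
by move=> /subnK <-; elim: (l - k)%N => // d IH; rewrite addSn => /CkW.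
Qed.

Lemma pdD F G i : (forall w, derivable F w (basisv R i)) ->
  (forall w, derivable G w (basisv R i)) -> pd i (F \+ G) = pd i F \+ pd i G.
Proof. by move=> dF dG; apply/funext => w; rewrite [RHS]/= !pdE; exact: (deriveD (dF w) (dG w)). Qed.
Lemma pdM F G i : (forall w, derivable F w (basisv R i)) ->
  (forall w, derivable G w (basisv R i)) -> pd i (F \* G) = (F \* pd i G) \+ (G \* pd i F).
Proof. by move=> dF dG; apply/funext => w; rewrite [RHS]/= !pdE; exact: (deriveM (dF w) (dG w)). Qed.
Lemma pd_cst c i : pd i (fun=> c) = fun=> 0 :> R.
Proof. by apply/funext => w; rewrite !pdE derive_cst. Qed.

Lemma Ck_cst k c : Ck k (fun=> c).
Proof.
elim: k c => [|k IH] c; split=> //; try exact: cst_continuous.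
by move=> i; split=> [w|]; [apply: derivable_cst|rewrite pd_cst; apply: IH].
Qed.

Lemma is_derive_coord i j w : is_derive w (basisv R j) (fun x : 'rV[R]_m => x 0 i) ((j == i)%:R).
Proof.
have d : forall (i' : 'I_1) (j' : 'I_m), derivable (fun x : 'rV[R]_m => x i' j') w (basisv R j).
  by apply/derivable_mxP; apply: derivable_id.
apply: DeriveDef => //.
have := @derive_mx R _ _ _ id w (basisv R j) (@derivable_id R _ w (basisv R j)).
rewrite derive_id => /matrixP/(_ 0 i); rewrite !mxE => ->.
by [].
Qed.

Lemma pd_coord i j : pd j (fun x : 'rV[R]_m => x 0 i) = fun=> (j == i)%:R.
Proof. by apply/funext => w; rewrite pdE; have [_] := is_derive_coord i j w. Qed.

Lemma Ck_coord k i : Ck k (fun w => w 0 i).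
Proof.
case: k => [|k]; split=> //; try exact: coord_continuous.
move=> j; split=> [w|]; first by have [] := is_derive_coord i j w.
by rewrite pd_coord; apply: Ck_cst.
Qed.

Lemma CkD k F G : Ck k F -> Ck k G -> Ck k (F \+ G).
Proof.
elim: k F G => [|k IH] F G [cF hF] [cG hG]; (split=> [w|]; first exact: (cvgD (cF w) (cG w))) => //.
move=> i; have [dF kF] := hF i; have [dG kG] := hG i; split=> [w|].
  by apply: derivableD.
by rewrite pdD //; apply: IH.
Qed.

Lemma CkM k F G : Ck k F -> Ck k G -> Ck k (F \* G).
Proof.
elim: k F G => [|k IH] F G hF hG; have [cF hF'] := hF; have [cG hG'] := hG;
  (split=> [w|]; first exact: (cvgM (cF w) (cG w))) => //.
move=> i; have [dF kF] := hF' i; have [dG kG] := hG' i; split=> [w|].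
  by apply: derivableM.
by rewrite pdM //; apply: CkD; apply: IH => //; apply: CkW.
Qed.

Lemma CkZ k c F : Ck k F -> Ck k (fun w => c * F w).
Proof. by move=> hF; apply: CkM hF; apply: Ck_cst. Qed.

Lemma CkN k F : Ck k F -> Ck k (fun w => - F w).
Proof. by move=> hF; under eq_fun do rewrite -mulN1r; apply: CkZ. Qed.

Lemma CkB k F G : Ck k F -> Ck k G -> Ck k (fun w => F w - G w).
Proof. by move=> hF hG; apply: CkD hF (CkN hG). Qed.

Lemma big_cons_fun (I : Type) a (r : seq I) (P : pred I) (F : I -> 'rV[R]_m -> R) :
  (fun w => \sum_(l <- a :: r | P l) F l w) =
  if P a then F a \+ (fun w => \sum_(l <- r | P l) F l w) else fun w => \sum_(l <- r | P l) F l w.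
Proof. by apply/funext => w; rewrite big_cons; case: (P a). Qed.

Lemma big_nil_fun (I : Type) (P : pred I) (F : I -> 'rV[R]_m -> R) :
  (fun w => \sum_(l <- [::] | P l) F l w) = fun=> 0.
Proof. by apply/funext => w; rewrite big_nil. Qed.

Lemma Ck_sum k (I : Type) (r : seq I) (P : pred I) (F : I -> 'rV[R]_m -> R) :
  (forall l, Ck k (F l)) -> Ck k (fun w => \sum_(l <- r | P l) F l w).
Proof.
move=> hF; elim: r => [|a r IH]; first by rewrite big_nil_fun; apply: Ck_cst.
by rewrite big_cons_fun; case: (P a) => //; apply: CkD.
Qed.

Lemma pdV F i : (forall w, F w != 0) -> (forall w, derivable F w (basisv R i)) ->
  pd i (fun w => (F w)^-1) = fun w => - (F w)^-1 ^+ 2 * pd i F w.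
Proof. by move=> F0 dF; apply/funext => w; rewrite !pdE deriveV // exprVn. Qed.

Lemma CkV k F : (forall w, F w != 0) -> Ck k F -> Ck k (fun w => (F w)^-1).
Proof.
move=> F0; elim: k => [|k IH] hF; have [cF hF'] := hF;
  (split=> [w|]; first exact: (cvgV (F0 w) (cF w))) => //.
move=> i; have [dF kF] := hF' i; split=> [w|]; first exact: derivableV.
rewrite pdV //; apply: CkM => //.
have h : Ck k (fun w => (F w)^-1) by apply: IH; apply: CkW.
by apply: CkN; under eq_fun do rewrite expr2; apply: CkM.
Qed.

Lemma Ck_derivable_dir F w v : Ck 1 F -> differentiable F w /\
  'D_v F w = \sum_i v 0 i * pd i F w.
Proof.
move=> hF; have [] := @partial_differentiable R m F w.
- by exists 1 => // x _ i; apply: Ck_der hF.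
- by move=> i; exact: (Ck_cont (Ck_pd i hF) (x := w)).
by move=> h1 h2; split.
Qed.

Lemma pdZ c F i : (forall w, derivable F w (basisv R i)) ->
  pd i (fun w => c * F w) = fun w => c * pd i F w.
Proof. by move=> dF; apply/funext => w; rewrite !pdE; exact: (deriveZ c (dF w)). Qed.

Lemma pdN F i : (forall w, derivable F w (basisv R i)) ->
  pd i (fun w => - F w) = fun w => - pd i F w.
Proof. by move=> dF; apply/funext => w; rewrite !pdE deriveN. Qed.

Lemma pd_sum (I : Type) (r : seq I) (P : pred I) (F : I -> 'rV[R]_m -> R) i :
  (forall l w, derivable (F l) w (basisv R i)) ->
  pd i (fun w => \sum_(l <- r | P l) F l w) = fun w => \sum_(l <- r | P l) pd i (F l) w.
Proof.
move=> dF; elim: r => [|a r IH]; first by rewrite !big_nil_fun pd_cst.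
have ds : forall w, derivable (fun w => \sum_(l <- r | P l) F l w) w (basisv R i).
  move=> w; elim: r {IH} => [|b r IH]; first by rewrite big_nil_fun; apply: derivable_cst.
  by rewrite big_cons_fun; case: (P b) => //; exact: (derivableD (dF b w) IH).
by rewrite !big_cons_fun; case: (P a) => //; rewrite (pdD (dF a) ds) IH.
Qed.

End CkTheory.

(** * A translation-invariant mean in place of the Lebesgue integral *)

Lemma fmap_ultra (T U : Type) (f : T -> U) (F : set_system T) :
  UltraFilter F -> UltraFilter (f @ F).
Proof.
move=> FU; split; first exact: fmap_proper_filter.
move=> G GP FG; rewrite eqEsubset; split=> // A GA.
have [//|FnA] := in_ultra_setVsetC (f @^-1` A) FU.
have GnA : G (~` A) by apply: FG.
by have [x []] := @filter_ex _ G GP _ (filterI GA GnA).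
Qed.

Lemma cube_compact (R : realType) n (r : R) : compact [set w : 'rV[R]_n | `|w| <= r].
Proof.
apply: bounded_closed_compact.
  by exists r; split; [exact: num_real|move=> x rx w /= wr; apply: le_trans wr (ltW rx)].
by apply: (@closed_comp _ _ (fun w : 'rV[R]_n => `|w|) [set x | x <= r]) => [w _|];
  [exact: norm_continuous|exact: closed_le].
Qed.

(** The pairs at which [G] varies by at least [e] form a compact set off the diagonal, so their
    distance has a positive minimum. *)
Lemma uniform_on_cube (R : realType) n (G : 'rV[R]_n -> R) (r e : R) :
  continuous G -> 0 < e -> exists2 d : R, 0 < d &
  forall x y, `|x| <= r -> `|y| <= r -> `|x - y| < d -> `|G x - G y| < e.
Proof.
move=> cG e0; pose K := [set w : 'rV[R]_n | `|w| <= r].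
pose h (p : 'rV[R]_n * 'rV[R]_n) := `|G p.1 - G p.2|.
pose C := (K `*` K) `&` [set p | e <= h p].
have ch : continuous h.
  have c1 : continuous (fun p : 'rV[R]_n * 'rV[R]_n => G p.1).
    by move=> p; apply: continuous_comp; [exact: cvg_fst|exact: cG].
  have c2 : continuous (fun p : 'rV[R]_n * 'rV[R]_n => G p.2).
    by move=> p; apply: continuous_comp; [exact: cvg_snd|exact: cG].
  by move=> p; exact: (cvg_norm (cvgB (c1 p) (c2 p))).
have cC : compact C.
  apply: compact_closedI; first by apply: compact_setX; apply: cube_compact.
  by apply: (@closed_comp _ _ h [set x | e <= x]) => [p _|]; [exact: ch|exact: closed_ge].
have [C0|/set0P C0] := eqVneq C set0.
  exists 1 => // x y xr yr _; rewrite ltNge; apply/negP => exy.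
  by have : C (x, y) by []; rewrite C0.
pose dist (p : 'rV[R]_n * 'rV[R]_n) := `|p.1 - p.2|.
have cd : continuous dist.
  have c1 : continuous (fun p : 'rV[R]_n * 'rV[R]_n => p.1) by move=> p; exact: cvg_fst.
  have c2 : continuous (fun p : 'rV[R]_n * 'rV[R]_n => p.2) by move=> p; exact: cvg_snd.
  by move=> p; exact: (cvg_norm (cvgB (c1 p) (c2 p))).
have [p + pmin] := @compact_EVT_min _ R dist C C0 cC (continuous_subspaceT cd).
rewrite inE => -[_ hp].
exists (dist p).
  rewrite normr_gt0 subr_eq0; apply/eqP => p12.
  by move: hp; rewrite /h /= p12 subrr normr0 leNgt e0.
move=> x y xr yr xy; rewrite ltNge; apply/negP => exy.
have : (x, y) \in C by rewrite inE.
by move=> /pmin; rewrite leNgt xy.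
Qed.

(* A positive linear functional on functions bounded on the cube [-Q, Q]^n:
   the limit, along an ultrafilter, of averages over cyclic grids. *)
Definition ultra_nat : {U : set_system nat | UltraFilter U /\ \oo `<=` U} :=
  cid (ultraFilterLemma _).
Definition ultra : set_system nat := sval ultra_nat.

#[global] Instance ultra_ultra : UltraFilter ultra.
Proof. exact: (svalP ultra_nat).1. Qed.

Section GridMean.
Variables (R : realType) (n : nat) (Q : R).
Hypothesis Q0 : 0 < Q.
Implicit Types (f g : 'rV[R]_n -> R) (w : 'rV[R]_n).

Definition bounded_on (A : set 'rV[R]_n) f := exists C : R, forall w, A w -> `|f w| <= C.

Definition cube : set 'rV[R]_n := [set w | `|w| <= Q].

Definition step (M : nat) : R := 2 * Q / M.+1%:R.

Definition gpt (M : nat) (z : {ffun 'I_n -> 'I_M.+1}) : 'rV[R]_n :=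
  \row_i (- Q + step M * (z i)%:R).

Lemma step_gt0 M : 0 < step M.
Proof. by rewrite divr_gt0 // mulr_gt0. Qed.

Lemma gpt_cube M z : cube (@gpt M z).
Proof.
apply: norm_le_coord => [|i]; first exact: ltW.
rewrite mxE ler_norml lerDl mulr_ge0 ?(ltW (step_gt0 M)) //=.
have : step M * (z i)%:R <= 2 * Q.
  rewrite /step mulrAC ler_pdivrMr ?ltr0Sn // ler_pM2l ?mulr_gt0 // ler_nat.
  exact: ltnW.
by lra.
Qed.

Definition gmean f (M : nat) : R := (\sum_z f (@gpt M z)) / #|{ffun 'I_n -> 'I_M.+1}|%:R.

Lemma card_grid M : 0 < #|{ffun 'I_n -> 'I_M.+1}|%:R :> R.
Proof. by rewrite ltr0n card_ffun card_ord expn_gt0. Qed.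

Lemma gmean_lin c f g M : gmean (fun w => c * f w + g w) M = c * gmean f M + gmean g M.
Proof. by rewrite /gmean big_split /= -mulr_sumr mulrDl mulrA. Qed.

Lemma gmean_le f g M : (forall w, cube w -> f w <= g w) -> gmean f M <= gmean g M.
Proof.
move=> h; rewrite ler_wpM2r ?invr_ge0 ?ler0n // ler_sum // => z _; apply: h; exact: gpt_cube.
Qed.

Lemma gmean_cst c M : gmean (fun=> c) M = c.
Proof. apply: (canLR (mulfK _)); first by rewrite gt_eqF // card_grid.
by rewrite sumr_const mulr_natr. Qed.

Lemma ultra_sub P : (\forall M \near \oo, P M) -> ultra P.
Proof. by apply: (svalP ultra_nat).2. Qed.

(** A mean, hence normalised: constants are reproduced. For bounded [f] the limit along the
    ultrafilter exists by compactness of a segment. *)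
Definition gI f : R := lim (gmean f M @[M --> ultra]).

Lemma gmean_cvg f : bounded_on cube f -> gmean f M @[M --> ultra] --> gI f.
Proof.
move=> [C hC]; have := @segment_compact R (- C) C; rewrite compact_ultra.
move=> /(_ (gmean f @ ultra) (fmap_ultra _ _)); case.
  rewrite /fmap /=; apply: filterE => M; rewrite /= in_itv /=; apply/andP; split.
    by rewrite -(gmean_cst (- C) M); apply: gmean_le => w /hC; rewrite ler_norml => /andP[].
  by rewrite -(gmean_cst C M); apply: gmean_le => w /hC; rewrite ler_norml => /andP[].
by move=> p [_ hp]; rewrite /gI (cvg_lim _ hp).
Qed.

Lemma gI_lin c f g : bounded_on cube f -> bounded_on cube g ->
  gI (fun w => c * f w + g w) = c * gI f + gI g.
Proof.
move=> bf bg; apply: cvg_lim => //.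
rewrite (_ : (fun M => gmean _ M) = (fun M => c * gmean f M + gmean g M)); last first.
  by apply/funext => M; apply: gmean_lin.
exact: (cvgD (cvgMl_tmp (gmean_cvg bf)) (gmean_cvg bg)).
Qed.

Lemma gI_le f g : bounded_on cube f -> bounded_on cube g ->
  (forall w, cube w -> f w <= g w) -> gI f <= gI g.
Proof.
move=> bf bg fg; apply: (ler_cvg_to (gmean_cvg bf) (gmean_cvg bg)).
by apply: filterE => M; apply: gmean_le.
Qed.

Lemma gI_cst c : gI (fun=> c) = c.
Proof.
apply: cvg_lim => //; rewrite (_ : (fun M => gmean _ M) = fun=> c); first exact: cvg_cst.
by apply/funext => M; apply: gmean_cst.
Qed.

Lemma gI_small f e : bounded_on cube f ->
  (\forall M \near \oo, `|gmean f M| <= e) -> `|gI f| <= e.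
Proof.
move=> bf h; have h' := ultra_sub h.
rewrite ler_norml; apply/andP; split.
  apply: (ler_cvg_to (cvg_cst (- e)) (gmean_cvg bf)).
  by apply: filterS h' => M; rewrite ler_norml => /andP[].
apply: (ler_cvg_to (gmean_cvg bf) (cvg_cst e)).
by apply: filterS h' => M; rewrite ler_norml => /andP[].
Qed.

(** Wrapping around makes the shift a bijection of the grid, so a shifted sum is the same sum. *)
Definition shiftz (M : nat) (i : 'I_n) (z : {ffun 'I_n -> 'I_M.+1}) : {ffun 'I_n -> 'I_M.+1} :=
  [ffun j => if j == i then ordS (z j) else z j].

Lemma shiftz_inj M i : injective (@shiftz M i).
Proof.
move=> z z' /ffunP h; apply/ffunP => j; have := h j; rewrite !ffunE.
by case: ifP => // _; apply: ordS_inj.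
Qed.

Lemma gpt_shiftz M i (z : {ffun 'I_n -> 'I_M.+1}) : (z i < M)%N ->
  gpt (shiftz i z) = gpt z + step M *: basisv R i.
Proof.
move=> zi; apply/rowP => j; rewrite !mxE ffunE eq_sym; case: eqP => [<-|_]; last by rewrite mulr0 addr0.
by rewrite /= modn_small ?ltnS // -addrA mulr1 -natr1 mulrDr mulr1.
Qed.

(* F vanishes outside a compact subset of the open cube, so the shifted sums agree. *)
Lemma gmean_diff_zero (F : 'rV[R]_n -> R) i d M : 0 < d ->
  (forall w, Q - d <= `|w| -> F w = 0) -> step M <= d ->
  gmean (fun w => F (w + step M *: basisv R i) - F w) M = 0.
Proof.
move=> d0 F0 sd; rewrite /gmean big_split /= sumrN.
suff -> : \sum_z F (@gpt M z + step M *: basisv R i) = \sum_z F (@gpt M z).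
  by rewrite subrr mul0r.
rewrite [RHS](reindex_inj (@shiftz_inj M i)); apply: eq_bigr => z _.
have [zi|zi] := ltnP (z i) M; first by rewrite gpt_shiftz.
have ziM : z i = M :> nat by apply/eqP; rewrite eqn_leq zi -ltnS ltn_ord.
rewrite !F0 //.
  apply: le_trans (coord_le_norm _ i); rewrite mxE ffunE eqxx /= ziM modnn mulr0 addr0 normrN.
  by rewrite gtr0_norm // gerBl ltW.
apply: le_trans (coord_le_norm _ i); rewrite !mxE eqxx mulr1 ziM -addrA -[X in _ + (_ + X)]mulr1 -mulrDr natr1.
have -> : step M * M.+1%:R = 2 * Q by rewrite /step divfK // pnatr_eq0.
rewrite (_ : - Q + 2 * Q = Q); last by ring.
by rewrite gtr0_norm // gerBl ltW.
Qed.

Lemma step_small e : 0 < e -> \forall M \near \oo, step M <= e.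
Proof.
move=> e0; have e1 : 0 < e / (2 * Q) by rewrite divr_gt0 // mulr_gt0.
have := near_infty_natSinv_lt (PosNum e1); apply: filterS => M /= h; rewrite /step mulrC.
by rewrite -ler_pdivlMr ?mulr_gt0 // ltW.
Qed.

(** Difference quotients with the grid step as increment have grid mean exactly 0 and converge
    uniformly to the derivative. *)
Lemma gI_pd (F : 'rV[R]_n -> R) i d : 0 < d ->
  (forall w, Q - d <= `|w| -> F w = 0) -> (forall w, derivable F w (basisv R i)) ->
  continuous (pd i F) -> gI (pd i F) = 0.
Proof.
move=> d0 F0 dF cF.
have bF : bounded_on cube (pd i F).
  have [||c _ hc] := @compact_EVT_max _ R (fun w => `|pd i F w|) cube _ (@cube_compact R n Q).
  - by exists 0; rewrite /cube /= normr0 ltW.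
  - by apply: continuous_subspaceT => w; exact: (cvg_norm (cF w)).
  - by exists `|pd i F c| => w cw; apply: hc; rewrite inE.
apply/eqP; rewrite -normr_le0; apply/ler_addgt0Pr => e e0; rewrite add0r.
apply: gI_small => //.
have [d' d'0 hd'] := uniform_on_cube (Q + 1) cF e0.
have m0 : 0 < Num.min 1 (Num.min d (d' / 2)) by rewrite !lt_min d0 divr_gt0 // ltr01.
apply: filterS (step_small m0) => M; rewrite !le_min => /andP[s1 /andP[sd sd']].
set s := step M in s1 sd sd' *; have s0 : 0 < s by apply: step_gt0.
have -> : gmean (pd i F) M = gmean (fun w => - s^-1 * (F (w + s *: basisv R i) - F w) + pd i F w) M.
  by rewrite gmean_lin (@gmean_diff_zero F i d M d0 F0 sd) mulr0 add0r.
have key w : cube w -> `|- s^-1 * (F (w + s *: basisv R i) - F w) + pd i F w| <= e.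
  move=> cw; have [t ts] := @line_MVT R n F w (basisv R i) s (fun t _ => dF _).
  rewrite [w + _]addrC => ->; rewrite -pdE mulNr mulKf ?gt_eqF // addrC ltW //; apply: hd'.
  - by apply: le_trans cw _; rewrite lerDl.
  - apply: le_trans (ler_normD _ _) _; rewrite addrC lerD //.
    rewrite normrZ; apply: le_trans (_ : `|t| * 1 <= _).
      by rewrite ler_wpM2l // norm_basisv.
    by rewrite mulr1 (le_trans ts) // gtr0_norm.
  - rewrite opprD addrCA subrr addr0 normrN normrZ.
    apply: le_lt_trans (_ : `|t| * 1 < _).
      by rewrite ler_wpM2l // norm_basisv.
    rewrite mulr1 (le_lt_trans ts) // gtr0_norm // (le_lt_trans sd') //.
    by rewrite ltr_pdivrMr // mulr_natr mulr2n ltrDl.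
rewrite ler_norml; apply/andP; split.
  rewrite -(gmean_cst (- e) M); apply: gmean_le => w /key.
  by rewrite ler_norml => /andP[].
rewrite -(gmean_cst e M); apply: gmean_le => w /key.
by rewrite ler_norml => /andP[].
Qed.

End GridMean.

(** * Strict positivity of the mean *)

Section Positivity.
Variables (R : realType) (n : nat) (Q : R).
Hypothesis Q0 : 0 < Q.

Lemma grid_interval (c s : R) (M : nat) : - Q <= c - s -> c + s <= Q -> 0 < s ->
  s - step Q M <= step Q M * #|[pred j : 'I_M.+1 | `|- Q + step Q M * j%:R - c| <= s]|%:R.
Proof.
move=> cs1 cs2 s0; set h := step Q M; have h0 : 0 < h by apply: step_gt0.
have hM : h * M.+1%:R = 2 * Q by rewrite /h /step divfK // pnatr_eq0.
set J := [pred j : 'I_M.+1 | _].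
pose j0 := (Num.truncn ((c + Q - s) / h)).+1.
have j01 : c + Q - s < h * j0%:R by rewrite mulrC -ltr_pdivrMr // truncnS_gt.
have j02 : h * j0%:R <= c + Q - s + h.
  have : (Num.truncn ((c + Q - s) / h))%:R <= (c + Q - s) / h.
    by rewrite truncn_le; apply: divr_ge0; [lra|exact: ltW].
  rewrite ler_pdivlMr // => t1; rewrite /j0 -natr1 mulrDr mulr1; lra.
pose L := Num.truncn (s / h).
have L1 : h * L%:R <= s.
  have : L%:R <= s / h by rewrite truncn_le divr_ge0 // ltW.
  by rewrite ler_pdivlMr // mulrC.
have L2 : s < h * L%:R + h.
  have : s / h < L.+1%:R by rewrite truncnS_gt.
  by rewrite ltr_pdivrMr // mulrC -natr1 mulrDr mulr1.
have LJ : (L <= #|J|)%N.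
  have key (l : 'I_L) : c + Q - s < h * (j0 + l)%:R /\ h * (j0 + l)%:R <= c + Q.
    have lL : h * (l%:R + 1) <= h * L%:R.
      by rewrite ler_pM2l // natr1 ler_nat.
    rewrite natrD mulrDr; split; last by rewrite mulrDr mulr1 in lL; lra.
    by have := mulr_ge0 (ltW h0) (ler0n R l); lra.
  have lt_M (l : 'I_L) : (j0 + l < M.+1)%N.
    have [_ k2] := key l; rewrite -(ltr_nat R) -(ltr_pM2l h0) hM; lra.
  pose f (l : 'I_L) : 'I_M.+1 := Ordinal (lt_M l).
  have fi : injective f by move=> l l' /(congr1 val) /= /addnI /val_inj.
  have sub : {subset codom f <= J}; last first.
    by rewrite -[L]card_ord -(card_codom fi); apply: subset_leq_card; apply/fintype.subsetP.
  move=> _ /codomP[l ->]; rewrite inE /= ler_norml; have [k1 k2] := key l; apply/andP; split; lra.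
have : h * L%:R <= h * #|J|%:R by rewrite ler_pM2l // ler_nat.
by lra.
Qed.

Lemma gI_cell_gt0 (w0 : 'rV[R]_n) (s e : R) (f : 'rV[R]_n -> R) :
  0 < s -> 0 < e -> `|w0| + s <= Q -> bounded_on (cube Q) f ->
  (forall w, cube Q w -> 0 <= f w) -> (forall w, `|w - w0| <= s -> e <= f w) -> 0 < gI Q f.
Proof.
(* Once the step is at most [s / 2], a fraction of at least [s / (4 * Q)] of the grid coordinates
   lies within [s] of any given coordinate of [w0]; the power [n] accounts for all coordinates. *)
move=> s0 e0 w0Q bf f0 fe; pose q := s / (4 * Q).
have q0 : 0 < q by rewrite divr_gt0 // mulr_gt0.
apply: lt_le_trans (_ : e * q ^+ n <= _); first by rewrite mulr_gt0 // exprn_gt0.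
have s2 : 0 < s / 2 by rewrite divr_gt0.
apply: (ler_cvg_to (cvg_cst (e * q ^+ n)) (gmean_cvg Q0 bf)).
apply: filterS (ultra_sub (step_small Q0 s2)) => M hs.
pose J (i : 'I_n) : pred 'I_M.+1 := [pred j : 'I_M.+1 | `|- Q + step Q M * j%:R - w0 0 i| <= s].
have J1 i : q * M.+1%:R <= #|J i|%:R.
  have hw : `|w0 0 i| <= Q - s by apply: le_trans (coord_le_norm _ _) _; lra.
  move: hw; rewrite ler_norml => /andP[hw1 hw2].
  have := @grid_interval (w0 0 i) s M.
  move=> /(_ ltac:(lra) ltac:(lra) s0) => h.
  have h0 := @step_gt0 R Q Q0 M.
  rewrite -(ler_pM2l h0); apply: le_trans h; rewrite mulrCA.
  have -> : step Q M * M.+1%:R = 2 * Q by rewrite /step divfK // pnatr_eq0.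
  have -> : q * (2 * Q) = s / 2 by rewrite /q; field; rewrite gt_eqF.
  by lra.
have fam : e * #|family J|%:R <= \sum_z f (@gpt R n Q M z).
  rewrite (bigID (mem (family J))) /= -[leLHS]addr0 lerD //.
    rewrite mulr_natr -sumr_const; apply: ler_sum => z /familyP zJ.
    apply: fe; apply: norm_le_coord => [|i]; first exact: ltW.
    by have := zJ i; rewrite inE /= !mxE.
  by apply: sumr_ge0 => z _; apply: f0; apply: gpt_cube.
rewrite /gmean ler_pdivlMr ?card_grid //; apply: le_trans fam.
rewrite -mulrA ler_pM2l // card_ffun !card_ord natrX -exprMn card_family.
rewrite foldrE big_map big_enum /= natr_prod -[X in _ ^+ X]card_ord -prodr_const.
apply: ler_prod => i _; apply/andP; split; last exact: J1.
by apply: mulr_ge0; [exact: ltW|exact: ler0n].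
Qed.
End Positivity.

(** * A cutoff function of class C^2 *)

Section Cutoff.
Variable R : realType.
Implicit Types x : R.

Lemma is_derive_mul_abs x : is_derive x 1 (fun y : R => y * `|y|) (2 * `|x|).
Proof.
have [x0|x0|->] := ltgtP x 0.
- apply: (@near_eq_is_derive _ _ _ (fun y : R => - (y * y))).
    by apply: filterS (lt_nbhsl x0) => y y0; rewrite ltr0_norm ?mulrN.
  by apply: is_derive_eq; rewrite ltr0_norm // /GRing.scale /=; ring.
- apply: (@near_eq_is_derive _ _ _ (fun y : R => y * y)).
    by apply: filterS (lt_nbhsr x0) => y y0; rewrite gtr0_norm.
  by apply: is_derive_eq; rewrite gtr0_norm // /GRing.scale /=; ring.
- have e : (fun h : R => h^-1 *: (((fun y : R => y * `|y|) \o shift 0) (h *: 1) - 0 * `|0 : R|))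
     @ (0 : R)^' --> (0 : R).
    apply/cvgrPdist_le => e e0; rewrite near_withinE; apply/nbhs_ballP; exists e => // h.
    rewrite -ball_normE /= sub0r normrN => he h0.
    by rewrite addr0 [h *: 1]mulr1 mul0r subr0 /GRing.scale /= mulKf // sub0r normrN normr_id ltW.
  apply: DeriveDef; first by apply/cvg_ex; exists 0.
  by rewrite normr0 mulr0; apply: cvg_lim.
Qed.

(** [pos1], [pos2] and [pos3] are max(x, 0) and its square and cube, written with |x| so that their
    derivatives follow from the single fact about x |x|. *)
Definition pos1 x := (x + `|x|) / 2.
Definition pos2 x := (x * x + x * `|x|) / 2.
Definition pos3 x := (x * (x * x) + x * (x * `|x|)) / 2.

Lemma is_derive_pos2 x : is_derive x 1 pos2 (2 * pos1 x).
Proof.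
have h := is_derive_mul_abs x.
rewrite /pos2; apply: is_derive_eq; rewrite /pos1 /GRing.scale /=; field; by [].
Qed.

Lemma is_derive_pos3 x : is_derive x 1 pos3 (3 * pos2 x).
Proof.
have h := is_derive_mul_abs x.
rewrite /pos3; apply: is_derive_eq; rewrite /pos2 /GRing.scale /=; field; by [].
Qed.

Lemma pos1_cont : continuous pos1.
Proof. by move=> x; apply: cvgMr_tmp; apply: cvgD; [exact: cvg_id|exact: (cvg_norm cvg_id)]. Qed.

Lemma pos3_le0 x : x <= 0 -> pos3 x = 0.
Proof. by move=> x0; rewrite /pos3 ler0_norm //; field. Qed.
Lemma pos3_ge0E x : 0 <= x -> pos3 x = x ^+ 3.
Proof. by move=> x0; rewrite /pos3 ger0_norm //; field. Qed.
Lemma pos2_le0 x : x <= 0 -> pos2 x = 0.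
Proof. by move=> x0; rewrite /pos2 ler0_norm //; field. Qed.
Lemma pos2_ge0E x : 0 <= x -> pos2 x = x ^+ 2.
Proof. by move=> x0; rewrite /pos2 ger0_norm //; field. Qed.

(** Twice the truncated cube turns the line into a step from 0 on x <= 0 to 1 on x >= 1. It is only
    C^2, which is all the regularity that is ever cut off. *)
Definition smoothstep x := 1 - pos3 (1 - pos3 x).
Definition dsmoothstep x := 9 * pos2 (1 - pos3 x) * pos2 x.

Lemma smoothstep_le0 x : x <= 0 -> smoothstep x = 0.
Proof. by move=> x0; rewrite /smoothstep (pos3_le0 x0) subr0 pos3_ge0E // expr1n subrr. Qed.

Lemma smoothstep_ge1 x : 1 <= x -> smoothstep x = 1.
Proof.
move=> x1; rewrite /smoothstep (pos3_ge0E (le_trans ler01 x1)) pos3_le0 ?subr0 // subr_le0.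
by rewrite exprn_ege1.
Qed.

Lemma pos3_ge0 x : 0 <= pos3 x.
Proof. by have [x0|x0] := leP 0 x; [rewrite pos3_ge0E ?exprn_ge0|rewrite pos3_le0 // ltW]. Qed.
Lemma pos2_ge0 x : 0 <= pos2 x.
Proof. by have [x0|x0] := leP 0 x; [rewrite pos2_ge0E ?exprn_ge0|rewrite pos2_le0 // ltW]. Qed.

Lemma smoothstep_ge0 x : 0 <= smoothstep x.
Proof.
rewrite /smoothstep; have [h|h] := leP 0 (1 - pos3 x); last by rewrite pos3_le0 ?subr0 // ltW.
by rewrite pos3_ge0E // subr_ge0 exprn_ile1 // gerBl pos3_ge0.
Qed.

Lemma smoothstep_le1 x : smoothstep x <= 1.
Proof. by rewrite /smoothstep gerBl pos3_ge0. Qed.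

Lemma dsmoothstep_bound x : 0 <= dsmoothstep x <= 9 /\ (x <= 0 -> dsmoothstep x = 0) /\ (1 <= x -> dsmoothstep x = 0).
Proof.
split; last first.
  split=> h; first by rewrite /dsmoothstep (pos2_le0 h) mulr0.
  by rewrite /dsmoothstep (pos3_ge0E (le_trans ler01 h)) pos2_le0 ?mulr0 ?mul0r // subr_le0 exprn_ege1.
rewrite /dsmoothstep; apply/andP; split; first by rewrite mulr_ge0 ?pos2_ge0 // mulr_ge0 ?pos2_ge0.
have [h|h] := leP x 0; first by rewrite (pos2_le0 h) mulr0.
have [h1|h1] := leP 1 x.
  by rewrite (pos3_ge0E (ltW h)) (@pos2_le0 (1 - _)) ?mulr0 ?mul0r // subr_le0 exprn_ege1.
have x3 : pos3 x <= 1 by rewrite (pos3_ge0E (ltW h)) exprn_ile1 // ltW.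
have p2 : pos2 x <= 1 by rewrite (pos2_ge0E (ltW h)) exprn_ile1 // ltW.
have y0 : 0 <= 1 - pos3 x by rewrite subr_ge0.
have p3 : pos2 (1 - pos3 x) <= 1 by rewrite (pos2_ge0E y0) exprn_ile1 // gerBl pos3_ge0.
have p23 : pos2 (1 - pos3 x) * pos2 x <= 1 by rewrite mulr_ile1 ?pos2_ge0.
by rewrite -mulrA; lra.
Qed.

Variable m : nat.
Implicit Types (F : 'rV[R]_m -> R) (w : 'rV[R]_m) (i : 'I_m).

Lemma is_derive_comp1 (g : R -> R) dg F w v :
  is_derive (F w) 1 g dg -> derivable F w v ->
  is_derive w v (g \o F) (dg * 'D_v F w).
Proof.
move=> hg dF; have e u : ((g \o F) \o shift w) (u *: v) = g ((fun t => F (t *: v + w)) u) by [].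
have d0 : derivable F (0 *: v + w) v by rewrite scale0r add0r.
have h1 : is_derive (0 : R) 1 (fun t : R => F (t *: v + w)) ('D_v F w).
  by have := is_derive_line d0; rewrite scale0r add0r.
have h2 : is_derive (0 : R) 1 (g \o (fun t : R => F (t *: v + w))) (dg * 'D_v F w).
  by apply: is_derive1_comp; rewrite scale0r add0r.
have [h3 h4] := h2.
have E : (fun h : R => h^-1 *: (((g \o F) \o shift w) (h *: v) - (g \o F) w)) =
   (fun h : R => h^-1 *: (((g \o (fun t : R => F (t *: v + w))) \o shift 0) (h *: 1) - (g \o (fun t : R => F (t *: v + w))) 0)).
  by apply/funext => h /=; rewrite addr0 scale0r add0r [h *: 1]mulr1.
by apply: DeriveDef; rewrite /derivable /derive E.
Qed.

Lemma pd_comp1 (g dg : R -> R) F i : (forall x, is_derive x 1 g (dg x)) ->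
  (forall w, derivable F w (basisv R i)) ->
  (forall w, derivable (g \o F) w (basisv R i)) /\
  pd i (g \o F) = fun w => dg (F w) * pd i F w.
Proof.
move=> hg dF; have h w := is_derive_comp1 (hg (F w)) (dF w).
by split=> [w|]; [have [] := h w|apply/funext => w; rewrite !pdE; have [_] := h w].
Qed.

Lemma is_derive_cont1 (g dg : R -> R) : (forall x, is_derive x 1 g (dg x)) -> continuous g.
Proof. by move=> h x; apply/differentiable_continuous/derivable1_diffP; have [] := h x. Qed.

Lemma Ck_comp1 k (g dg : R -> R) F : (forall x, is_derive x 1 g (dg x)) ->
  Ck k.+1 F -> Ck k (dg \o F) -> Ck k.+1 (g \o F).
Proof.
move=> hg hF hdg; split; first by move=> w; apply: continuous_comp; [apply: (Ck_cont hF)|apply: (is_derive_cont1 hg)].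
move=> i; have [d ->] := pd_comp1 hg (fun w => @Ck_der R m k F i w hF); split=> //.
by apply: CkM => //; apply: Ck_pd.
Qed.

Lemma Ck_pos3 F : Ck 2 F -> Ck 2 (pos3 \o F).
Proof.
move=> hF; apply: (Ck_comp1 is_derive_pos3 hF).
apply: (@CkZ _ _ 1 3 (pos2 \o F)); apply: (Ck_comp1 is_derive_pos2 (CkW hF)).
apply: (@CkZ _ _ 0 2 (pos1 \o F)); split=> // w.
by apply: continuous_comp; [apply: (Ck_cont hF)|apply: pos1_cont].
Qed.

Lemma Ck_smoothstep F : Ck 2 F -> Ck 2 (smoothstep \o F).
Proof.
move=> hF; have h : Ck 2 (fun w => 1 - (pos3 \o F) w) by apply: CkB; [apply: Ck_cst|apply: Ck_pos3].
by apply: (@CkB _ _ 2 (fun=> 1) (pos3 \o (fun w => 1 - (pos3 \o F) w))); [apply: Ck_cst|apply: Ck_pos3].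
Qed.

Lemma is_derive_smoothstep x : is_derive x 1 smoothstep (dsmoothstep x).
Proof.
have h1 := is_derive_pos3 x.
have h2 : is_derive x 1 (fun y => 1 - pos3 y) (- (3 * pos2 x)) by apply: is_derive_eq; rewrite /GRing.scale /=; ring.
have h3 := is_derive_pos3 (1 - pos3 x).
have h4 : is_derive x 1 (pos3 \o (fun y => 1 - pos3 y)) (3 * pos2 (1 - pos3 x) * (- (3 * pos2 x))).
  exact: is_derive1_comp.
rewrite (_ : smoothstep = fun y => 1 - (pos3 \o (fun y => 1 - pos3 y)) y) //.
by apply: is_derive_eq; rewrite /dsmoothstep; ring.
Qed.

End Cutoff.

(** * Weierstrass approximation in C^2 *)

Section Polynomials.
Variables (R : realType) (n : nat).
Implicit Types (F G : 'rV[R]_n -> R) (w : 'rV[R]_n) (i j : 'I_n).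

Lemma derivable_coord i j w : derivable (fun w : 'rV[R]_n => w 0 j) w (basisv R i).
Proof. by have [] := is_derive_coord j i w. Qed.

(** Homogeneous polynomial functions rather than formal polynomials, since they are only used
    through values and partial derivatives. The zero function is homogeneous of every degree. *)
Inductive hpoly : nat -> ('rV[R]_n -> R) -> Prop :=
| hpoly_cst c : hpoly 0 (fun=> c)
| hpoly_0 m : hpoly m (fun=> 0)
| hpoly_X i m F : hpoly m F -> hpoly m.+1 (fun w => w 0 i * F w)
| hpoly_D m F G : hpoly m F -> hpoly m G -> hpoly m (F \+ G).

Lemma Ck_hpoly k m F : hpoly m F -> Ck k F.
Proof.
by elim=> *; [apply: Ck_cst|apply: Ck_cst|apply: CkM => //; apply: Ck_coord|apply: CkD].
Qed.

Lemma hpolyZ c m F : hpoly m F -> hpoly m (fun w => c * F w).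
Proof.
elim=> [d|l|i l G _ IH|l G H _ IG _ IH].
- exact: hpoly_cst.
- by under eq_fun do rewrite mulr0; exact: hpoly_0.
- by under eq_fun do rewrite mulrCA; exact: hpoly_X.
- by under eq_fun do rewrite /= mulrDr; exact: hpoly_D.
Qed.

Lemma hpolyM m l F G : hpoly m F -> hpoly l G -> hpoly (m + l) (F \* G).
Proof.
move=> hF hG; elim: hF => [c|d|i d H _ IH|d H K _ IH _ IK].
- exact: hpolyZ.
- by rewrite (_ : _ \* _ = fun=> 0); [exact: hpoly_0|apply/funext => w /=; rewrite mul0r].
- rewrite (_ : _ \* _ = fun w => w 0 i * (H \* G) w); first exact: hpoly_X.
  by apply/funext => w /=; rewrite mulrA.
- rewrite (_ : _ \* _ = (H \* G) \+ (K \* G)); first exact: hpoly_D.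
  by apply/funext => w /=; rewrite mulrDl.
Qed.

Lemma hpoly_sum (I : Type) (r : seq I) (P : pred I) m (F : I -> 'rV[R]_n -> R) :
  (forall l, hpoly m (F l)) -> hpoly m (fun w => \sum_(l <- r | P l) F l w).
Proof.
move=> hF; elim: r => [|a r IH]; first by rewrite big_nil_fun; apply: hpoly_0.
by rewrite big_cons_fun; case: (P a) => //; apply: hpoly_D.
Qed.

Lemma hpoly_pd i m F : hpoly m F -> hpoly m.-1 (pd i F).
Proof.
elim=> [c|d|j d H hH IH|d H K hH IH hK IK].
- by rewrite pd_cst; exact: hpoly_0.
- by rewrite pd_cst; exact: hpoly_0.
- have d1 w := @derivable_coord i j w.
  have d2 w : derivable H w (basisv R i) by apply: Ck_der (Ck_hpoly 1 hH).
  rewrite (pdM d1 d2) pd_coord; apply: hpoly_D.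
    case: d hH IH => [|d] hH IH /=; last exact: hpoly_X.
    suff -> : pd i H = fun=> 0.
      by rewrite (_ : _ \* _ = fun=> 0); [exact: hpoly_0|apply/funext => w /=; rewrite mulr0].
    move: (erefl 0%N) hH; move: {1 3}0%N => z + hH; elim: hH => [c _|z' _|//|z' F1 F2 h1 I1 h2 I2 e].
    + exact: pd_cst.
    + exact: pd_cst.
    + rewrite pdD; first by rewrite I1 // I2 //; apply/funext => w /=; rewrite addr0.
        by move=> w; apply: Ck_der (Ck_hpoly 1 h1).
      by move=> w; apply: Ck_der (Ck_hpoly 1 h2).
  rewrite (_ : _ \* _ = fun w => (i == j)%:R * H w) //; first exact: hpolyZ.
  by apply/funext => w /=; rewrite mulrC.
- rewrite pdD; first exact: hpoly_D.
    by move=> w; apply: Ck_der (Ck_hpoly 1 hH).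
  by move=> w; apply: Ck_der (Ck_hpoly 1 hK).
Qed.

Definition euler F w := \sum_i w 0 i * pd i F w.

Lemma hpoly_euler m F w : hpoly m F -> euler F w = m%:R * F w.
Proof.
elim=> [c|d|j d H hH IH|d H K hH IH hK IK]; rewrite /euler.
- by rewrite mul0r big1 // => i _; rewrite pd_cst mulr0.
- by rewrite mulr0 big1 // => i _; rewrite pd_cst mulr0.
- have d1 i x := @derivable_coord i j x.
  have d2 i x : derivable H x (basisv R i) by apply: Ck_der (Ck_hpoly 1 hH).
  rewrite (eq_bigr (fun i => w 0 j * (w 0 i * pd i H w) + (i == j)%:R * (w 0 i * H w))); last first.
    by move=> i _; rewrite (pdM (d1 i) (d2 i)) /= pd_coord; ring.
  rewrite big_split /= -mulr_sumr -[X in _ * X + _]/(euler H w) IH (bigD1 j) //= eqxx mul1r.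
  rewrite big1 ?addr0 => [|i /negbTE ->]; last by rewrite mul0r.
  by rewrite -natr1; ring.
- have d1 i x : derivable H x (basisv R i) by apply: Ck_der (Ck_hpoly 1 hH).
  have d2 i x : derivable K x (basisv R i) by apply: Ck_der (Ck_hpoly 1 hK).
  under eq_bigr do rewrite (pdD (d1 _) (d2 _)) /= mulrDr.
  by rewrite big_split /= mulrDr -IH -IK.
Qed.

(** Degree strictly below the index, as a sum of homogeneous components; index 0 leaves only the
    zero function. *)
Inductive polyd : nat -> ('rV[R]_n -> R) -> Prop :=
| polyd0 : polyd 0 (fun=> 0)
| polydS d F G : polyd d F -> hpoly d G -> polyd d.+1 (F \+ G).

Lemma Ck_polyd k d F : polyd d F -> Ck k F.
Proof. by elim=> [|e G H _ hG hH]; [apply: Ck_cst|apply: CkD => //; apply: Ck_hpoly hH]. Qed.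

Lemma polydW d F : polyd d F -> polyd d.+1 F.
Proof.
move=> h; rewrite (_ : F = F \+ fun=> 0); first by apply: polydS h (hpoly_0 _).
by apply/funext => w /=; rewrite addr0.
Qed.

Lemma polyd_le d e F : (d <= e)%N -> polyd d F -> polyd e F.
Proof. by move=> /subnK <- h; elim: (e - d)%N => // k IH; rewrite addSn; apply: polydW. Qed.

Lemma polydS_inv d F : polyd d.+1 F -> exists G H, [/\ polyd d G, hpoly d H & F = G \+ H].
Proof. by move=> h; inversion h; subst; exists F0, G. Qed.

Lemma polyd0_inv F : polyd 0 F -> F = fun=> 0.
Proof. by move=> h; inversion h. Qed.

Lemma polydD d F G : polyd d F -> polyd d G -> polyd d (F \+ G).
Proof.
elim: d F G => [|d IH] F G.
  by move=> /polyd0_inv -> /polyd0_inv ->; rewrite (_ : _ \+ _ = fun=> 0); [exact: polyd0|apply/funext => w /=; rewrite addr0].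
move=> /polydS_inv[F1 [F2 [p1 p2 ->]]] /polydS_inv[G1 [G2 [q1 q2 ->]]].
rewrite (_ : _ \+ _ = (F1 \+ G1) \+ (F2 \+ G2)); last by apply/funext => w /=; ring.
by apply: polydS; [apply: IH|apply: hpoly_D].
Qed.

Lemma hpoly_polyd m F : hpoly m F -> polyd m.+1 F.
Proof.
move=> h; rewrite (_ : F = (fun=> 0) \+ F); last by apply/funext => w /=; rewrite add0r.
by apply: polydS h; apply: polyd_le (polyd0); rewrite leq0n.
Qed.

Lemma polydZ c d F : polyd d F -> polyd d (fun w => c * F w).
Proof.
elim=> [|e G H _ IH hH]; first by under eq_fun do rewrite mulr0; exact: polyd0.
rewrite (_ : (fun w => _) = (fun w => c * G w) \+ (fun w => c * H w)).
  by apply: polydS => //; apply: hpolyZ.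
by apply/funext => w /=; rewrite mulrDr.
Qed.

Lemma polyd_hmul m d F G : hpoly m F -> polyd d G -> polyd (m + d) (F \* G).
Proof.
move=> hF; elim=> [|e H K _ IH hK].
  rewrite (_ : _ \* _ = fun=> 0); last by apply/funext => w /=; rewrite mulr0.
  by apply: polyd_le (polyd0); rewrite leq0n.
rewrite (_ : _ \* _ = (F \* H) \+ (F \* K)); last by apply/funext => w /=; rewrite mulrDr.
by rewrite addnS; apply: polydS => //; apply: hpolyM.
Qed.

Lemma polyd_pd i d F : polyd d.+1 F -> polyd d (pd i F).
Proof.
elim: d F => [|d IH] F /polydS_inv[G [H [hG hH ->]]].
  have := hpoly_pd i hH; rewrite (polyd0_inv hG).
  have -> : (fun=> 0) \+ H = H by apply/funext => w /=; rewrite add0r.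
  move=> _; suff -> : pd i H = fun=> 0 by exact: polyd0.
  have hpd : forall m F, hpoly m F -> m = 0%N -> pd i F = fun=> 0.
    move=> m F'; elim=> [c _|z' _|//|z' F1 F2 h1 I1 h2 I2 e]; rewrite ?pd_cst //.
    rewrite pdD; first by rewrite I1 // I2 //; apply/funext => w /=; rewrite addr0.
      by move=> w; apply: Ck_der (Ck_hpoly 1 h1).
    by move=> w; apply: Ck_der (Ck_hpoly 1 h2).
  exact: hpd hH erefl.
rewrite pdD.
- by apply: polydS; [apply: IH|exact: hpoly_pd hH].
- by move=> w; apply: Ck_der (Ck_polyd 1 hG).
- by move=> w; apply: Ck_der (Ck_hpoly 1 hH).
Qed.

Definition polyf F := exists d, polyd d F.

Lemma Ck_polyf k F : polyf F -> Ck k F. Proof. by case=> d; apply: Ck_polyd. Qed.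
Lemma polyfD F G : polyf F -> polyf G -> polyf (F \+ G).
Proof.
move=> [d hF] [e hG]; exists (maxn d e).
by apply: polydD; [apply: polyd_le hF; apply: leq_maxl|apply: polyd_le hG; apply: leq_maxr].
Qed.
Lemma polyfZ c F : polyf F -> polyf (fun w => c * F w).
Proof. by case=> d hF; exists d; apply: polydZ. Qed.
Lemma polyf_cst c : polyf (fun=> c).
Proof. by exists 1%N; apply: hpoly_polyd; apply: hpoly_cst. Qed.
Lemma polyf_coord i : polyf (fun w => w 0 i).
Proof.
exists 2%N; apply: hpoly_polyd; rewrite (_ : (fun w => _) = fun w => w 0 i * 1).
  by apply: (@hpoly_X i 0 (fun=> 1)); apply: hpoly_cst.
by apply/funext => w; rewrite mulr1.
Qed.
Lemma polyfM F G : polyf F -> polyf G -> polyf (F \* G).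
Proof.
case=> d hF [e hG]; elim: hF => [|a H K _ IH hK].
  by rewrite (_ : _ \* _ = fun=> 0); [exact: polyf_cst|apply/funext => w /=; rewrite mul0r].
rewrite (_ : _ \* _ = (H \* G) \+ (K \* G)); last by apply/funext => w /=; rewrite mulrDl.
by apply: polyfD => //; exists (a + e)%N; apply: polyd_hmul.
Qed.
Lemma polyf_pd i F : polyf F -> polyf (pd i F).
Proof. by case=> d hF; exists d; apply: polyd_pd; apply: polydW. Qed.
Lemma polyfB F G : polyf F -> polyf G -> polyf (fun w => F w - G w).
Proof.
move=> hF hG; rewrite (_ : (fun w => _) = F \+ (fun w => - 1 * G w)).
  by apply: polyfD => //; apply: polyfZ.
by apply/funext => w /=; rewrite mulN1r.
Qed.
Lemma polyf_sum (I : Type) (r : seq I) (P : pred I) (F : I -> 'rV[R]_n -> R) :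
  (forall l, polyf (F l)) -> polyf (fun w => \sum_(l <- r | P l) F l w).
Proof.
move=> hF; elim: r => [|a r IH]; first by rewrite big_nil_fun; apply: polyf_cst.
by rewrite big_cons_fun; case: (P a) => //; apply: polyfD.
Qed.

Definition nsq w := dotp w w.

Lemma nsqE w : nsq w = \sum_i w 0 i * w 0 i. Proof. by []. Qed.
Lemma nsq_ge0 w : 0 <= nsq w. Proof. by apply: sumr_ge0 => i _; rewrite -expr2 sqr_ge0. Qed.
Lemma norm_sq_le_nsq w : `|w| ^+ 2 <= nsq w.
Proof.
have h i : `|w 0 i| ^+ 2 <= nsq w.
  rewrite nsqE (bigD1 i) //= real_normK ?num_real // expr2 lerDl sumr_ge0 // => j _.
  by rewrite -expr2 sqr_ge0.
have : `|w| <= Num.sqrt (nsq w).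
  apply: norm_le_coord => [|i]; first exact: sqrtr_ge0.
  by rewrite -(ler_pXn2r (n := 2)) ?nnegrE ?sqrtr_ge0 // sqr_sqrtr ?nsq_ge0 // h.
by move=> hh; rewrite -[leRHS](sqr_sqrtr (nsq_ge0 w)); apply: lerXn2r; rewrite ?nnegrE // sqrtr_ge0.
Qed.
Lemma nsq_le_norm w : nsq w <= n%:R * `|w| ^+ 2.
Proof.
rewrite nsqE mulr_natl (_ : _ *+ n = \sum_(i < n) `|w| ^+ 2); last by rewrite sumr_const card_ord.
apply: ler_sum => i _.
by rewrite -expr2 -[w 0 i ^+ 2]real_normK ?num_real // ler_pXn2r ?nnegrE // coord_le_norm.
Qed.
Lemma nsqB_le x y : nsq (x - y) <= 2 * nsq x + 2 * nsq y.
Proof.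
rewrite !nsqE !mulr_sumr -big_split /=; apply: ler_sum => i _; rewrite !mxE.
by have := sqr_ge0 (x 0 i + y 0 i); lra.
Qed.
Lemma nsqN w : nsq (- w) = nsq w.
Proof. by rewrite !nsqE; apply: eq_bigr => i _; rewrite mxE mulrNN. Qed.
Lemma nsq_split x y : nsq x <= 2 * nsq y + 2 * nsq (x - y).
Proof. by have := nsqB_le y (y - x); rewrite opprB addrCA subrr addr0 -(nsqN (y - x)) opprB. Qed.
Lemma Ck_nsq k : Ck k nsq.
Proof. by apply: Ck_sum => i; apply: CkM; apply: Ck_coord. Qed.
Lemma polyf_nsq : polyf nsq.
Proof. by apply: polyf_sum => i; apply: polyfM; apply: polyf_coord. Qed.
Lemma hpoly_nsq : hpoly 2 nsq.
Proof.
apply: hpoly_sum => i; apply: hpoly_X.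
rewrite (_ : (fun w => _) = fun w => w 0 i * 1).
  by apply: (@hpoly_X i 0 (fun=> 1)); apply: hpoly_cst.
by apply/funext => w; rewrite mulr1.
Qed.
Lemma pd_nsq i : pd i nsq = fun w => 2 * w 0 i.
Proof.
have d j k w := @derivable_coord k j w.
have d2 j k w : derivable ((fun w : 'rV[R]_n => w 0 j) \* (fun w : 'rV[R]_n => w 0 j)) w (basisv R k).
  by apply: derivableM.
rewrite (_ : nsq = fun w => \sum_j ((fun w : 'rV[R]_n => w 0 j) \* (fun w : 'rV[R]_n => w 0 j)) w) //.
rewrite pd_sum //; apply/funext => w; rewrite (bigD1 i) //= big1 => [|j ji].
  by rewrite (pdM (d i i) (d i i)) pd_coord /= eqxx /=; ring.
by rewrite (pdM (d j i) (d j i)) pd_coord /= eq_sym (negbTE ji) /=; ring.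
Qed.

Definition cutf (b : R) w := smoothstep (2 - nsq w / b ^+ 2).

Lemma Ck_cutf b : Ck 2 (cutf b).
Proof.
apply: (Ck_smoothstep (F := fun w => 2 - nsq w / b ^+ 2)); apply: CkB; first exact: Ck_cst.
by under eq_fun do rewrite mulrC; apply: CkZ; apply: Ck_nsq.
Qed.
Lemma cutf_ge0 b w : 0 <= cutf b w. Proof. exact: smoothstep_ge0. Qed.
Lemma cutf_le1 b w : cutf b w <= 1. Proof. exact: smoothstep_le1. Qed.
Lemma cutf_eq1 b w : 0 < b -> nsq w <= b ^+ 2 -> cutf b w = 1.
Proof.
move=> b0 h; apply: smoothstep_ge1; have : nsq w / b ^+ 2 <= 1 by rewrite ler_pdivrMr ?exprn_gt0 // mul1r.
by lra.
Qed.
Lemma cutf_eq0 b w : 0 < b -> 2 * b ^+ 2 <= nsq w -> cutf b w = 0.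
Proof.
move=> b0 h; apply: smoothstep_le0; have : 2 <= nsq w / b ^+ 2 by rewrite ler_pdivlMr ?exprn_gt0.
by lra.
Qed.

End Polynomials.

Lemma cont_bounded (R : realType) n (Q : R) (f : 'rV[R]_n -> R) :
  continuous f -> bounded_on (cube Q) f.
Proof.
move=> cf; have [Q0|Q0] := ltP Q 0.
  by exists 0 => w; rewrite /cube /= => wQ; have := le_lt_trans wQ Q0; rewrite normr_lt0.
have [||c _ hc] := @compact_EVT_max _ R (fun w => `|f w|) (cube Q) _ (@cube_compact R n Q).
- by exists 0; rewrite /cube /= normr0.
- by apply: continuous_subspaceT => w; exact: (cvg_norm (cf w)).
- by exists `|f c| => w cw; apply: hc; rewrite inE.
Qed.

Lemma cont_lin (R : realType) (T : topologicalType) (c : R) (F G : T -> R) :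
  continuous F -> continuous G -> continuous (fun y => c * F y + G y).
Proof. by move=> cF cG y; exact: (cvgD (cvgMl_tmp (cF y)) (cG y)). Qed.

Lemma geometric_small (R : realType) (q p c e : R) : 0 <= q < p -> 0 < c -> 0 < e ->
  exists N0, forall N, (N0 <= N)%N -> q ^+ N <= e * (c * p ^+ N).
Proof.
move=> /andP[q0 qp] c0 e0; have p0 : 0 < p by apply: le_lt_trans qp.
have r1 : `|q / p| < 1.
  by rewrite ger0_norm ?divr_ge0 // ?(ltW p0) // ltr_pdivrMr // mul1r.
have /cvgrPdist_le /(_ (e * c) (mulr_gt0 e0 c0)) := cvg_expr r1.
move=> [N0 _ h]; exists N0 => N N0N; have := h N N0N.
rewrite /= sub0r normrN normrX ger0_norm ?divr_ge0 // ?(ltW p0) //.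
rewrite expr_div_n ler_pdivrMr ?exprn_gt0 //.
by rewrite mulrA.
Qed.

(** * Convolution with Landau kernels *)

Section Convolution.
Variables (R : realType) (n : nat) (b : R).
Hypothesis b1 : 1 <= b.
Implicit Types (F G : 'rV[R]_n -> R) (w y : 'rV[R]_n) (i j : 'I_n).

(** [Q] leaves a margin of width 1 around the support of the cutoff of radius [2 * b], which
    vanishes once [nsq] reaches 8 b^2 while [Q - 1 <= |w|] already gives 16 b^2. The constant [rho]
    exceeds the squared distance between a point of the cube and a point of the ball of radius [b],
    so that [kern] is nonnegative there. *)
Let Q := 4 * b + 1.
Let rho := 2 * n%:R * Q ^+ 2 + 2 * b ^+ 2 + 1.
Let b0 : 0 < b. Proof. by apply: lt_le_trans b1. Qed.
Let Q0 : 0 < Q. Proof. by rewrite /Q; have := b0; lra. Qed.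
Let rho1 : 1 <= rho.
Proof.
rewrite /rho lerDr addr_ge0 //; last by rewrite mulr_ge0 ?sqr_ge0.
by apply: mulr_ge0; [exact: mulr_ge0|exact: sqr_ge0].
Qed.
Let rho0 : 0 < rho. Proof. exact: lt_le_trans rho1. Qed.

(** The Landau kernel: its powers are polynomials in [w] and concentrate at y = w. *)
Definition kern w y : R := 1 - nsq (y - w) / rho.

Lemma kernE w y : kern w y = 1 - rho^-1 * \sum_i (y 0 i * y 0 i - 2 * w 0 i * y 0 i + w 0 i * w 0 i).
Proof.
by rewrite /kern nsqE mulrC; congr (1 - _ * _); apply: eq_bigr => i _; rewrite !mxE; ring.
Qed.

Lemma Ck_kern w k : Ck k (kern w).
Proof.
rewrite (_ : kern w = fun y => 1 - rho^-1 * \sum_i (y 0 i * y 0 i - 2 * w 0 i * y 0 i + w 0 i * w 0 i)).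
  apply: CkB; first exact: Ck_cst.
  apply: CkZ; apply: Ck_sum => i; apply: CkD; last exact: Ck_cst.
  by apply: CkB; [apply: CkM; apply: Ck_coord|apply: CkZ; apply: Ck_coord].
by apply/funext => y; rewrite kernE.
Qed.

Lemma Ck_exp k F N : Ck k F -> Ck k (fun y => F y ^+ N).
Proof.
move=> hF; elim: N => [|N IH]; first by under eq_fun do rewrite expr0; apply: Ck_cst.
by under eq_fun do rewrite exprS; apply: CkM.
Qed.

Lemma gI_c F G c : continuous F -> continuous G -> gI Q (fun y => c * F y + G y) = c * gI Q F + gI Q G.
Proof. by move=> cF cG; apply: gI_lin => //; apply: cont_bounded. Qed.

Lemma gI_0 : gI Q (fun _ : 'rV[R]_n => 0) = 0. Proof. exact: (@gI_cst R n Q 0). Qed.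

Lemma gI_Z F c : continuous F -> gI Q (fun y => c * F y) = c * gI Q F.
Proof.
have c0 : continuous (fun _ : 'rV[R]_n => 0 : R) by exact: cst_continuous.
move=> cF; have := @gI_c F (fun=> 0) c cF c0.
by rewrite gI_0 addr0 => <-; congr gI; apply/funext => y; rewrite addr0.
Qed.

Lemma gI_D F G : continuous F -> continuous G -> gI Q (F \+ G) = gI Q F + gI Q G.
Proof.
move=> cF cG; rewrite -[gI Q F]mul1r -gI_c //; congr gI; apply/funext => y /=; by rewrite mul1r.
Qed.

Lemma gI_sum (I : Type) (r : seq I) (F : I -> 'rV[R]_n -> R) : (forall l, continuous (F l)) ->
  gI Q (fun y => \sum_(l <- r) F l y) = \sum_(l <- r) gI Q (F l).
Proof.
move=> cF; elim: r => [|a r IH]; first by rewrite big_nil_fun big_nil gI_0.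
by rewrite big_cons_fun big_cons gI_D ?IH //; apply: cont_sum.
Qed.

Definition Phi N F w := gI Q (fun y => F y * kern w y ^+ N).

Definition cX i : 'rV[R]_n -> R := fun y => y 0 i.

Lemma cPhi N F w : continuous F -> continuous (fun y => F y * kern w y ^+ N).
Proof. by move=> cF; apply: (@Ck_cont _ _ 0); apply: CkM => //; apply: Ck_exp; apply: Ck_kern. Qed.

Lemma cMX F i : continuous F -> continuous (F \* cX i).
Proof. by move=> cF; apply: (@Ck_cont _ _ 0); apply: CkM => //; apply: Ck_coord. Qed.

Lemma PhiD N F G w : continuous F -> continuous G -> Phi N (F \+ G) w = Phi N F w + Phi N G w.
Proof.
move=> cF cG; rewrite /Phi -gI_D; [|exact: cPhi..].
by congr gI; apply/funext => y /=; rewrite mulrDl.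
Qed.

Lemma PhiZ N F c w : continuous F -> Phi N (fun y => c * F y) w = c * Phi N F w.
Proof.
move=> cF; rewrite /Phi -gI_Z; [|exact: cPhi].
by congr gI; apply/funext => y /=; rewrite mulrA.
Qed.

(** Expanding one factor of the kernel expresses [Phi N.+1] through [Phi N] of [F] times
    coordinates, with coefficients polynomial in [w]. Both polynomiality and differentiation of
    [Phi] are proved by induction on [N] through this formula. *)
Lemma PhiS N F : continuous F ->
  Phi N.+1 F = fun w => Phi N F w - rho^-1 * \sum_i
    (Phi N (F \* cX i \* cX i) w - 2 * w 0 i * Phi N (F \* cX i) w + w 0 i * w 0 i * Phi N F w).
Proof.
move=> cF; apply/funext => w.
pose k y := kern w y ^+ N.
pose T i y := (F \* cX i \* cX i) y * k y - 2 * w 0 i * ((F \* cX i) y * k y) + w 0 i * w 0 i * (F y * k y).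
have cT1 i : continuous (fun y => (F \* cX i \* cX i) y * k y) by apply: cPhi; apply: cMX; apply: cMX.
have cT2 i : continuous (fun y => (F \* cX i) y * k y) by apply: cPhi; apply: cMX.
have cT3 : continuous (fun y => F y * k y) by apply: cPhi.
have ck c (G : 'rV[R]_n -> R) : continuous G -> continuous (fun y => c * G y).
  by move=> cG y; exact: (cvgMl_tmp (cG y)).
have cT i : continuous (T i).
  rewrite (_ : T i = fun y => (w 0 i * w 0 i) * (F y * k y) + (- (2 * w 0 i) * ((F \* cX i) y * k y) + (F \* cX i \* cX i) y * k y)).
    by move=> y; exact: (cvgD (ck _ _ cT3 y) (cvgD (ck _ _ (cT2 i) y) (cT1 i y))).
  by apply/funext => y; rewrite /T; ring.
have E i : gI Q (T i) = Phi N (F \* cX i \* cX i) w - 2 * w 0 i * Phi N (F \* cX i) w + w 0 i * w 0 i * Phi N F w.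
  rewrite (_ : T i = fun y => (w 0 i * w 0 i) * (F y * k y) + (- (2 * w 0 i) * ((F \* cX i) y * k y) + (F \* cX i \* cX i) y * k y)).
    rewrite gI_c //; last by move=> y; exact: (cvgD (ck _ _ (cT2 i) y) (cT1 i y)).
    by rewrite gI_c // -!/(Phi _ _ _); ring.
  by apply/funext => y; rewrite /T; ring.
under eq_bigr do rewrite -E; rewrite -gI_sum // -[Phi N F w]/(gI Q (fun y => F y * k y)).
rewrite addrC -mulNr -gI_c //; last exact: cont_sum.
congr gI; apply/funext => y; rewrite exprS -/(k y) mulrA [F y * kern w y]mulrC kernE.
rewrite mulrDl mul1r mulrDl addrC mulNr mulNr mulNr -mulrA -mulrA; congr (- (_ * _) + _).
by rewrite mulr_suml; apply: eq_bigr => i _; rewrite /T /= /cX; ring.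
Qed.

Lemma polyf_Phi N F : continuous F -> polyf (Phi N F).
Proof.
elim: N F => [|N IH] F cF.
  rewrite (_ : Phi 0 F = fun=> gI Q F); first exact: polyf_cst.
  by apply/funext => w; congr gI; apply/funext => y; rewrite expr0 mulr1.
rewrite PhiS //; apply: polyfB; first exact: IH.
apply: polyfZ; apply: polyf_sum => i; apply: polyfD.
  apply: polyfB; first by apply: IH; apply: cMX; apply: cMX.
  by apply: polyfM; [apply: polyfZ; apply: polyf_coord|apply: IH; apply: cMX].
by apply: polyfM; [apply: polyfM; apply: polyf_coord|apply: IH].
Qed.

(** Derivatives move from the convolution onto [F] without differentiation under the mean: for N = 0
    this says that the mean of a compactly supported derivative is 0, and [PhiS] carries it to all
    [N]. *)
Lemma pd_Phi N F j d : 0 < d -> Ck 1 F -> (forall w, Q - d <= `|w| -> F w = 0) ->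
  pd j (Phi N F) = Phi N (pd j F).
Proof.
move=> d0; elim: N F => [|N IH] F hF F0.
  have e G : Phi 0 G = fun=> gI Q G.
    by apply/funext => w; congr gI; apply/funext => y; rewrite expr0 mulr1.
  rewrite !e pd_cst (@gI_pd R n Q Q0 F j d) //; first by move=> w; apply: Ck_der hF.
  exact: (Ck_cont (Ck_pd j hF)).
have cF := Ck_cont hF; have cdF := Ck_cont (Ck_pd j hF).
have hX i : Ck 1 (F \* cX i) := CkM hF (Ck_coord R 1 i).
have hXX i : Ck 1 (F \* cX i \* cX i) := CkM (hX i) (Ck_coord R 1 i).
have zX i w : Q - d <= `|w| -> (F \* cX i) w = 0 by move=> /F0 /= ->; rewrite mul0r.
have zXX i w : Q - d <= `|w| -> (F \* cX i \* cX i) w = 0 by move=> /(zX i) /= ->; rewrite mul0r.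
have dF i x : derivable F x (basisv R i) by apply: Ck_der hF.
have dX i k x : derivable (cX i) x (basisv R k) := @derivable_coord R n k i x.
have dFX i k x : derivable (F \* cX i) x (basisv R k) by apply: Ck_der (hX i).
have eX i : pd j (F \* cX i) = (fun y => (j == i)%:R * F y) \+ (pd j F \* cX i).
  rewrite (pdM (dF j) (dX i j)) pd_coord; apply/funext => y /=; rewrite /cX; ring.
have eXX i : pd j (F \* cX i \* cX i) = (fun y => 2 * (j == i)%:R * (F \* cX i) y) \+ (pd j F \* cX i \* cX i).
  rewrite (pdM (dFX i j) (dX i j)) eX pd_coord; apply/funext => y /=; rewrite /cX; ring.
have cZ c G : continuous G -> continuous (fun y => c * G y).
  by move=> cG y; exact: (cvgMl_tmp (cG y)).
rewrite (PhiS N cF) (PhiS N cdF).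
have dP G x : continuous G -> derivable (Phi N G) x (basisv R j).
  by move=> cG; apply: Ck_der (Ck_polyf 1 (polyf_Phi N cG)).
pose A i := Phi N (F \* cX i \* cX i); pose B i := Phi N (F \* cX i); pose C := Phi N F.
have hA i : polyf (A i) by apply: polyf_Phi; apply: Ck_cont (hXX i).
have hB i : polyf (B i) by apply: polyf_Phi; apply: Ck_cont (hX i).
have hC : polyf C by apply: polyf_Phi.
pose T i := ((A i) \+ (fun w => - 2 * (cX i \* B i) w)) \+ ((cX i \* cX i) \* C).
have hT i : polyf (T i).
  apply: polyfD; last by apply: polyfM => //; apply: polyfM; apply: polyf_coord.
  by apply: polyfD => //; apply: polyfZ; apply: polyfM => //; apply: polyf_coord.
have pC1 G x : polyf G -> derivable G x (basisv R j) by move=> hG; apply: Ck_der (Ck_polyf 1 hG).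
rewrite [X in pd j X](_ : _ = C \+ (fun w => - rho^-1 * \sum_i T i w)); last first.
  apply/funext => w; rewrite /= mulNr; congr (_ - _ * _); apply: eq_bigr => i _.
  rewrite /T /= /A /B /C /cX; ring.
have hS : polyf (fun w => \sum_i T i w) by apply: polyf_sum.
rewrite pdD; [|by move=> x; apply: pC1|by move=> x; apply: pC1; apply: polyfZ].
rewrite pdZ; [|by move=> x; apply: pC1].
rewrite pd_sum; [|by move=> l x; apply: pC1].
rewrite /C IH //; apply/funext => w /=; rewrite mulNr; congr (_ - _ * _); apply: eq_bigr => i _.
rewrite /T pdD; [|by move=> x; apply: pC1; apply: polyfD => //; apply: polyfZ; apply: polyfM => //; apply: polyf_coord
  |by move=> x; apply: pC1; apply: polyfM => //; apply: polyfM; apply: polyf_coord].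
rewrite pdD; [|by move=> x; apply: pC1|by move=> x; apply: pC1; apply: polyfZ; apply: polyfM => //; apply: polyf_coord].
rewrite pdZ; [|by move=> x; apply: pC1; apply: polyfM => //; apply: polyf_coord].
rewrite (pdM (dX i j)); [|by move=> x; apply: pC1].
rewrite pdM; [|by move=> x; apply: pC1; apply: polyfM; apply: polyf_coord|by move=> x; apply: pC1].
rewrite (pdM (dX i j) (dX i j)) pd_coord /A /B /C (IH _ (hXX i) (zXX i)) (IH _ (hX i) (zX i)) IH //.
rewrite eX eXX /= !PhiD ?PhiZ //; try by [apply: cZ|do ?apply: cMX|apply: cZ; apply: cMX].
by rewrite /= /cX; case: eqP => [->|_]; ring.
Qed.

Lemma kern_bound w y : nsq w <= b ^+ 2 -> cube Q y -> 0 <= kern w y.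
Proof.
move=> wb yQ; rewrite /kern subr_ge0 ler_pdivrMr // mul1r.
apply: le_trans (nsqB_le _ _) _.
have h : nsq y <= n%:R * Q ^+ 2.
  apply: le_trans (nsq_le_norm _) _; apply: ler_wpM2l => //.
  by apply: lerXn2r; rewrite ?nnegrE // ltW.
by rewrite /rho; lra.
Qed.

Lemma kern_le w y s N : nsq w <= b ^+ 2 -> cube Q y -> s <= nsq (y - w) ->
  0 <= kern w y ^+ N <= (1 - s / rho) ^+ N.
Proof.
move=> wb yQ sn; have k0 := kern_bound wb yQ; rewrite exprn_ge0 //=.
have h : kern w y <= 1 - s / rho by rewrite /kern lerD2l lerN2 ler_pM2r ?invr_gt0.
apply: lerXn2r => //; rewrite nnegrE //; exact: le_trans h.
Qed.

Lemma Phi_le N G H w : continuous G -> continuous H ->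
  (forall y, cube Q y -> `|G y * kern w y ^+ N| <= H y) -> `|Phi N G w| <= gI Q H.
Proof.
move=> cG cH h; have b1' := cont_bounded Q (@cPhi N G w cG); have b2 := cont_bounded Q cH.
have cN : continuous (fun y => -1 * H y) by move=> y; exact: (cvgMl_tmp (cH y)).
rewrite ler_norml; apply/andP; split.
  rewrite -mulN1r -gI_Z //; apply: gI_le => // [|y /h]; first exact: cont_bounded.
  by rewrite ler_norml mulN1r => /andP[].
by apply: gI_le => // y /h; rewrite ler_norml => /andP[].
Qed.

(** The mass of the kernel against [X] depends on the centre [w]; its value [c N] at the centre 0
    serves as normalisation, and [mass_diff] bounds the variation. *)
Let X := cutf (n := n) (2 * b).
Let c N := Phi N X 0.
Let nsq0 : nsq (0 : 'rV[R]_n) = 0.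
Proof. by rewrite nsqE big1 // => i _; rewrite mxE mul0r. Qed.
Let b2 : 0 < 2 * b. Proof. by rewrite mulr_gt0. Qed.
Let CX : Ck 2 X. Proof. exact: Ck_cutf. Qed.
Let cXc : continuous X. Proof. exact: Ck_cont CX. Qed.

Lemma mass_ge s : 0 < s <= b ->
  exists2 c0, 0 < c0 & forall N : nat, c0 * (1 - 2 * s ^+ 2 / rho) ^+ N <= c N.
Proof.
move=> /andP[s0 sb]; pose Y := cutf (n := n) s; have cY : continuous Y by apply: (@Ck_cont _ _ 2); exact: Ck_cutf.
have nb : nsq (0 : 'rV[R]_n) <= b ^+ 2 by rewrite nsq0 sqr_ge0.
exists (gI Q Y) => [|M].
  pose t := s / n.+1%:R; have t0 : 0 < t by rewrite divr_gt0.
  apply: (@gI_cell_gt0 R n Q Q0 0 t 1 Y) => //; try exact: cont_bounded.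
  - rewrite normr0 add0r; apply: le_trans (_ : s <= _).
      by rewrite ler_pdivrMr // ler_peMr ?ler1n // ltW.
    by rewrite /Q; have := b0; lra.
  - by move=> w _; apply: cutf_ge0.
  move=> w; rewrite subr0 => wt; rewrite /Y cutf_eq1 //.
  apply: le_trans (nsq_le_norm _) _; apply: le_trans (_ : n%:R * t ^+ 2 <= _).
    by apply: ler_wpM2l => //; apply: lerXn2r; rewrite ?nnegrE // ltW.
  rewrite /t expr_div_n mulrCA ler_piMr ?sqr_ge0 // ler_pdivrMr ?exprn_gt0 // mul1r.
  by rewrite -natrX ler_nat expnS expn1 (leq_trans (leqnSn n)) // leq_pmulr.
rewrite mulrC -gI_Z //; apply: gI_le.
- exact: Q0.
- by apply: cont_bounded => y; exact: (cvgMl_tmp (cY y)).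
- by apply: cont_bounded; apply: cPhi.
move=> y yQ; have [yl|yl] := leP (2 * s ^+ 2) (nsq y).
  rewrite /Y cutf_eq0 // mulr0 mulr_ge0 ?cutf_ge0 // exprn_ge0 // kern_bound //.
have sb2 : s ^+ 2 <= b ^+ 2 by apply: lerXn2r; rewrite ?nnegrE // ltW.
rewrite /X (@cutf_eq1 _ _ (2 * b)) //; last first.
  rewrite exprMn; apply: (le_trans (ltW yl)); have := sqr_ge0 b; lra.
rewrite mul1r; apply: le_trans (_ : (1 - 2 * s ^+ 2 / rho) ^+ M * 1 <= _).
  apply: ler_wpM2l; last exact: cutf_le1.
  apply: exprn_ge0; rewrite subr_ge0 ler_pdivrMr // mul1r /rho.
  have : 0 <= 2 * n%:R * Q ^+ 2 by apply: mulr_ge0; [exact: mulr_ge0|exact: sqr_ge0].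
  by lra.
rewrite mulr1; apply: lerXn2r; rewrite ?nnegrE.
- rewrite subr_ge0 ler_pdivrMr // mul1r /rho.
  have : 0 <= 2 * n%:R * Q ^+ 2 by apply: mulr_ge0; [exact: mulr_ge0|exact: sqr_ge0].
  by lra.
- exact: kern_bound.
- by rewrite /kern subr0 lerD2l lerN2 ler_pM2r ?invr_gt0 // ltW.
Qed.

Lemma Q1_nsq w : Q - 1 <= `|w| -> 16 * b ^+ 2 <= nsq w.
Proof.
rewrite /Q addrK => h; apply: le_trans (norm_sq_le_nsq _).
have -> : 16 * b ^+ 2 = (4 * b) ^+ 2 by ring.
by apply: lerXn2r => //; rewrite nnegrE ?mulr_ge0 // ltW.
Qed.

Lemma pdX i y : nsq y <= (2 * b) ^+ 2 -> pd i X y = 0.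
Proof.
move=> yb; pose F w : R := 2 - nsq w / (2 * b) ^+ 2.
have hF : Ck 1 F.
  by apply: CkB; [exact: Ck_cst|under eq_fun do rewrite mulrC; apply: CkZ; apply: Ck_nsq].
have [_ e] := pd_comp1 (F := F) (i := i) (@is_derive_smoothstep R) (fun w => @Ck_der _ _ 0 F i w hF).
rewrite /X (_ : cutf (2 * b) = @smoothstep R \o F) // e.
have [_ [_ h]] := dsmoothstep_bound (F y); rewrite h ?mul0r // /F.
have : nsq y / (2 * b) ^+ 2 <= 1 by rewrite ler_pdivrMr ?exprn_gt0 // mul1r.
by lra.
Qed.

(** The derivative of the mass in [w] is the convolution with a derivative of [X], which vanishes
    for nsq y <= 4 b^2; elsewhere y is at distance at least [b] from the centre, so the kernel is
    exponentially smaller than its mass. *)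
Lemma mass_diff : exists2 C, 0 <= C & forall N w, nsq w <= b ^+ 2 ->
  `|Phi N X w - c N| <= C * (1 - b ^+ 2 / rho) ^+ N.
Proof.
have dX i : continuous (pd i X) by apply: (@Ck_cont _ _ 1); apply: Ck_pd.
have /boolp.choice[B hB] : forall i, exists B, forall y, cube Q y -> `|pd i X y| <= B.
  by move=> i; exact: (cont_bounded Q (dX i)).
have B0 i : 0 <= B i.
  apply: le_trans (hB i 0 _) => //; by rewrite /cube /= normr0 ltW.
exists (\sum_i b * B i); first by apply: sumr_ge0 => i _; rewrite mulr_ge0 // ltW.
move=> N w wb; have hP : polyf (Phi N X) by apply: polyf_Phi.
have zX z : Q - 1 <= `|z| -> X z = 0.
  move=> /Q1_nsq h; apply: cutf_eq0 => //; apply: le_trans h.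
  by rewrite exprMn; have := sqr_ge0 b; lra.
have dP z v : derivable (Phi N X) z v by apply: diff_derivable; exact: (Ck_derivable_dir z 0 (Ck_polyf 1 hP)).1.
have [t t1] := @line_MVT R n (Phi N X) 0 w 1 (fun t _ => dP _ w).
rewrite scale1r !addr0 mul1r => ->; rewrite (Ck_derivable_dir _ _ (Ck_polyf 1 hP)).2 mulr_suml.
apply: le_trans (ler_norm_sum _ _ _) _; apply: ler_sum => i _; rewrite normrM -mulrA.
have bw : `|w| <= b.
  rewrite -(ler_pXn2r (n := 2)) ?nnegrE // ?(ltW b0) //; exact: le_trans (norm_sq_le_nsq _) wb.
apply: ler_pM => //; first exact: le_trans (coord_le_norm _ _) bw.
rewrite (pd_Phi N i (d := 1)) //; last by apply: CkW.
have tb : nsq (t *: w) <= b ^+ 2.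
  apply: le_trans wb; rewrite !nsqE; apply: ler_sum => l _; rewrite !mxE.
  have -> : t * w 0 l * (t * w 0 l) = t ^+ 2 * (w 0 l * w 0 l) by ring.
  rewrite ler_piMl -?expr2 ?sqr_ge0 // -real_normK ?num_real // expr_le1 //.
  by rewrite normr1 in t1.
have -> : B i * (1 - b ^+ 2 / rho) ^+ N = gI Q (fun _ : 'rV[R]_n => B i * (1 - b ^+ 2 / rho) ^+ N).
  by rewrite gI_cst.
apply: Phi_le => //; first exact: cst_continuous.
move=> y yQ; have q0 : 0 <= (1 - b ^+ 2 / rho) ^+ N.
  apply: exprn_ge0; rewrite subr_ge0 ler_pdivrMr // mul1r /rho.
  have : 0 <= 2 * n%:R * Q ^+ 2 by apply: mulr_ge0; [exact: mulr_ge0|exact: sqr_ge0].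
  have := sqr_ge0 b; lra.
have [yl|yl] := leP (nsq y) ((2 * b) ^+ 2).
  by rewrite pdX // mul0r normr0 mulr_ge0.
have yw : b ^+ 2 <= nsq (y - t *: w).
  have := nsq_split y (t *: w); move: yl; rewrite exprMn; lra.
have /andP[k0 k1] := kern_le N tb yQ yw.
by rewrite normrM (ger0_norm k0); apply: ler_pM => //; apply: hB.
Qed.

(** Near [w] uniform continuity makes [F] close to [F w]; away from [w], and in the variation of the
    mass, the errors are multiples of q^N, negligible against the mass, which is at least a multiple
    of p^N with p > q. *)
Lemma conv_approx F e : continuous F -> (forall w, 2 * b ^+ 2 <= nsq w -> F w = 0) -> 0 < e ->
  exists N0, forall N, (N0 <= N)%N -> 0 < c N /\
    forall w, nsq w <= b ^+ 2 -> `|(c N)^-1 * Phi N F w - F w| <= e.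
Proof.
move=> cF F0 e0; have [C1 C10 hC1] := mass_diff.
have [C hC] := cont_bounded Q cF.
have C0 : 0 <= C by apply: le_trans (hC 0 _) => //; rewrite /cube /= normr0 ltW.
pose e1 := e / 2; have e10 : 0 < e1 by rewrite divr_gt0.
have [d' d'0 hd'] := uniform_on_cube Q cF e10.
pose d := Num.min d' b; have d0 : 0 < d by rewrite lt_min d'0.
have dd' : d <= d' by rewrite ge_min lexx.
have db : d <= b by rewrite ge_min lexx orbT.
(* [q] bounds the kernel at distance at least [d], and [p] below bounds it from below on the ball of
   squared radius 2 s^2 = d^2 / 2; hence q < p. *)
pose q := 1 - d ^+ 2 / rho; pose s := d / 2.
have s0 : 0 < s by rewrite divr_gt0.
have sb : s <= b by rewrite /s; lra.
have [c0 c00 hc0] := @mass_ge s (introT andP (conj s0 sb)).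
pose p := 1 - 2 * s ^+ 2 / rho.
have d2b : d ^+ 2 <= b ^+ 2 by apply: lerXn2r; rewrite ?nnegrE // ltW.
have q0 : 0 <= q.
  rewrite /q subr_ge0 ler_pdivrMr // mul1r /rho.
  have : 0 <= 2 * n%:R * Q ^+ 2 by apply: mulr_ge0; [exact: mulr_ge0|exact: sqr_ge0].
  by have := sqr_ge0 b; lra.
have qp : q < p.
  rewrite /q /p ltrD2l ltrN2 ltr_pM2r ?invr_gt0 // /s expr_div_n.
  by have : 0 < d ^+ 2 by [rewrite exprn_gt0]; lra.
pose D := 2 * C + e1 * C1 + C * C1.
have D0 : 0 <= D by rewrite /D !addr_ge0 // ?mulr_ge0 // ltW.
pose e2 := e1 / (D + 1); have e20 : 0 < e2 by rewrite divr_gt0 // ltr_wpDl.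
have [N0 hN0] := @geometric_small R q p c0 e2 (introT andP (conj q0 qp)) c00 e20.
exists N0 => N /hN0 hN; have p0 : 0 < p by apply: le_lt_trans qp.
have cN : 0 < c N by apply: lt_le_trans (hc0 N); rewrite mulr_gt0 ?exprn_gt0.
split=> // w wb.
have qN : q ^+ N <= e2 * c N by apply: le_trans hN _; rewrite ler_pM2l //; exact: hc0.
have bq : (1 - b ^+ 2 / rho) ^+ N <= q ^+ N.
  apply: lerXn2r; rewrite ?nnegrE //; last by rewrite /q lerD2l lerN2 ler_pM2r ?invr_gt0.
  rewrite subr_ge0 ler_pdivrMr // mul1r /rho.
  have : 0 <= 2 * n%:R * Q ^+ 2 by apply: mulr_ge0; [exact: mulr_ge0|exact: sqr_ge0].
  by have := sqr_ge0 b; lra.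
have bw : `|w| <= b.
  rewrite -(ler_pXn2r (n := 2)) ?nnegrE // ?(ltW b0) //; exact: le_trans (norm_sq_le_nsq _) wb.
have wQ : `|w| <= Q by apply: (le_trans bw); rewrite /Q; have := b0; lra.
have m1 := le_trans (hC1 N w wb) (ler_wpM2l C10 bq).
(* [X] stands in for the constant function 1, so [G] is small near [w] and its convolution is the
   error up to the variation of the mass. *)
pose G y := - F w * X y + F y.
have cG : continuous G.
  exact: cont_lin.
have PG : Phi N G w = - F w * Phi N X w + Phi N F w.
  rewrite /Phi -gI_c; [|exact: cPhi..]; congr gI; apply/funext => y; rewrite /G; ring.
have bG : `|Phi N G w| <= e1 * Phi N X w + 2 * C * q ^+ N.
  have -> : e1 * Phi N X w + 2 * C * q ^+ N =
      gI Q (fun y => e1 * (X y * kern w y ^+ N) + 2 * C * q ^+ N).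
    by rewrite gI_c ?gI_cst //; [exact: cPhi|exact: cst_continuous].
  apply: Phi_le => //.
    by apply: cont_lin; [exact: cPhi|exact: cst_continuous].
  move=> y yQ; have k0 := exprn_ge0 N (kern_bound wb yQ).
  have X0 : 0 <= X y by apply: cutf_ge0.
  have qN0 : 0 <= q ^+ N by apply: exprn_ge0.
  rewrite normrM (ger0_norm k0).
  have [yl|yl] := ltP (nsq (y - w)) (d ^+ 2).
    have X1 : X y = 1.
      apply: cutf_eq1 => //; rewrite exprMn; have := nsq_split y w; lra.
    rewrite X1 mul1r /G X1 mulr1 addrC; apply: (@le_trans _ _ (e1 * kern w y ^+ N)).
      apply: ler_wpM2r => //; apply: ltW; apply: hd' => //.
      rewrite -(ltr_pXn2r (n := 2)) ?nnegrE // ?(ltW d'0) //.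
      apply: (le_lt_trans (norm_sq_le_nsq _)); apply: (lt_le_trans yl).
      by apply: lerXn2r; rewrite ?nnegrE // ltW.
    by rewrite lerDl !mulr_ge0.
  have /andP[_ k1] := kern_le N wb yQ yl; apply: (@le_trans _ _ (2 * C * q ^+ N)).
    apply: ler_pM => //; apply: le_trans (ler_normD _ _) _; rewrite normrM normrN.
    have h1 : `|F w| <= C by apply: hC.
    have h2 : `|F y| <= C by apply: hC.
    have : `|F w| * `|X y| <= C * 1.
      by apply: ler_pM => //; rewrite ger0_norm //; apply: cutf_le1.
    by lra.
  by rewrite lerDr mulr_ge0 ?(ltW e10) // mulr_ge0.
have -> : (c N)^-1 * Phi N F w - F w = (c N)^-1 * (Phi N G w + F w * (Phi N X w - c N)).
  by rewrite PG; field; rewrite gt_eqF.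
rewrite normrM gtr0_norm ?invr_gt0 // mulrC ler_pdivrMr //.
apply: le_trans (ler_normD _ _) _; rewrite normrM.
have h1 : `|F w| <= C by apply: hC.
have h2 : `|F w| * `|Phi N X w - c N| <= C * (C1 * q ^+ N) by apply: ler_pM.
have h3 : Phi N X w <= c N + C1 * q ^+ N.
  by move: m1; rewrite ler_norml => /andP[_]; lra.
have h4 : e1 * Phi N X w <= e1 * (c N + C1 * q ^+ N) by rewrite ler_pM2l.
have h5 : D * q ^+ N <= e1 * c N.
  apply: (@le_trans _ _ ((D + 1) * q ^+ N)).
    by rewrite ler_wpM2r ?exprn_ge0 // lerDl.
  apply: (@le_trans _ _ ((D + 1) * (e2 * c N))).
    by rewrite ler_pM2l // ltr_wpDl.
  rewrite mulrA /e2 mulrCA divff ?mulr1 // gt_eqF // ltr_wpDl //.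
have e2e : e = e1 + e1 by rewrite /e1; field.
move: h5; rewrite /D e2e; lra.
Qed.

Lemma pd_on (U : set 'rV[R]_n) i F G w : open U -> (forall x, U x -> F x = G x) -> U w -> pd i F w = pd i G w.
Proof.
move=> oU h Uw; rewrite !pdE; apply: near_eq_derive; near=> x; apply: h; near: x.
exact: open_nbhs_nbhs.
Unshelve. all: by end_near. Qed.

(** [conv_approx] is applied to [F] and to all its first and second derivatives with one common [N];
    by [pd_Phi] these are the derivatives of a single polynomial. *)
Lemma conv_C2 F b' e : Ck 2 F -> 0 <= b' < b -> (forall w, 2 * b' ^+ 2 < nsq w -> F w = 0) -> 0 < e ->
  exists2 P, polyf P & forall w, nsq w <= b ^+ 2 ->
  [/\ `|P w - F w| <= e, forall i, `|pd i P w - pd i F w| <= e &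
      forall i j, `|pd i (pd j P) w - pd i (pd j F) w| <= e].
Proof.
move=> hF /andP[b'0 b'b] F0 e0.
have bb : 2 * b' ^+ 2 < 2 * b ^+ 2.
  by rewrite ltr_pM2l // ltr_pXn2r // nnegrE // ltW.
have oV : open [set w : 'rV[R]_n | 2 * b' ^+ 2 < nsq w].
  by apply: (@open_comp _ _ (@nsq R n) [set x | 2 * b' ^+ 2 < x]) => [w _|];
    [exact: (Ck_cont (Ck_nsq R n 0))|exact: open_gt].
have pd0 i G : (forall w, 2 * b' ^+ 2 < nsq w -> G w = 0) -> forall w, 2 * b' ^+ 2 < nsq w -> pd i G w = 0.
  by move=> G0 w wV; rewrite (@pd_on _ i G (fun=> 0) w oV G0 wV) pd_cst.
have F1 i := pd0 i F F0; have F2 i j := pd0 i _ (F1 j).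
have w2 G : (forall w, 2 * b' ^+ 2 < nsq w -> G w = 0) -> forall w, 2 * b ^+ 2 <= nsq w -> G w = 0.
  by move=> G0 w wb; apply: G0; apply: lt_le_trans wb.
have wQ G : (forall w, 2 * b' ^+ 2 < nsq w -> G w = 0) -> forall w, Q - 1 <= `|w| -> G w = 0.
  move=> G0 w /Q1_nsq wb; apply: (w2 G G0); apply: le_trans wb; have := sqr_ge0 b; lra.
have [N0 h0] := conv_approx (Ck_cont hF) (w2 F F0) e0.
have /boolp.choice[N1 h1] i := conv_approx (Ck_cont (Ck_pd i hF)) (w2 _ (F1 i)) e0.
have /boolp.choice[N2 h2] (ij : 'I_n * 'I_n) :=
  conv_approx (Ck_cont (Ck_pd ij.1 (Ck_pd ij.2 hF))) (w2 _ (F2 ij.1 ij.2)) e0.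
pose N := maxn N0 (maxn (\max_i N1 i) (\max_ij N2 ij)).
have N0N : (N0 <= N)%N by exact: leq_maxl.
have N1N i : (N1 i <= N)%N.
  by apply: leq_trans (leq_maxr _ _); apply: leq_trans (leq_maxl _ _); exact: leq_bigmax.
have N2N (i : 'I_n * 'I_n) : (N2 i <= N)%N.
  by apply: leq_trans (leq_maxr _ _); apply: leq_trans (leq_maxr _ _); exact: leq_bigmax.
have pP G : continuous G -> polyf (Phi N G) by apply: polyf_Phi.
have dP G i x : continuous G -> derivable (Phi N G) x (basisv R i).
  by move=> cG; apply: Ck_der (Ck_polyf 1 (pP _ cG)).
have e1 j : pd j (fun w => (c N)^-1 * Phi N F w) = fun w => (c N)^-1 * Phi N (pd j F) w.
  rewrite pdZ; last by move=> x; apply: dP; exact: Ck_cont hF.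
  by rewrite (pd_Phi N j (d := 1) _ (CkW hF) (wQ _ F0)).
have e2 i j : pd i (pd j (fun w => (c N)^-1 * Phi N F w)) = fun w => (c N)^-1 * Phi N (pd i (pd j F)) w.
  rewrite e1 pdZ; last by move=> x; apply: dP; exact: (Ck_cont (Ck_pd j hF)).
  by rewrite (pd_Phi N i (d := 1) _ (Ck_pd j hF) (wQ _ (F1 j))).
exists (fun w => (c N)^-1 * Phi N F w); first by apply: polyfZ; apply: pP; exact: Ck_cont hF.
move=> w wb; split.
- by have [_] := h0 N N0N; apply.
- by move=> i; rewrite e1; have [_] := h1 i N (N1N i); apply.
- by move=> i j; rewrite e2; have [_] := h2 (i, j) N (N2N _); apply.
Qed.

End Convolution.

Lemma C2_approx (R : realType) n (F : 'rV[R]_n -> R) (a e : R) : Ck 2 F -> 0 < e ->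
  exists2 P, polyf P & forall w, `|w| <= a ->
  [/\ `|P w - F w| <= e, forall i, `|pd i P w - pd i F w| <= e &
      forall i j, `|pd i (pd j P) w - pd i (pd j F) w| <= e].
Proof.
move=> hF e0; pose b := 1 + n%:R * `|a|; have b1 : 1 <= b by rewrite lerDl mulr_ge0.
have b0 : 0 < b by apply: lt_le_trans b1.
have hG : Ck 2 (cutf b \* F) by exact: (CkM (@Ck_cutf R n b) hF).
have b'1 : 1 <= b + 1 by apply: le_trans b1 _; rewrite lerDl.
have [|w bw|P hP h] := @conv_C2 R n (b + 1) b'1 (cutf b \* F) b e hG _ _ e0.
- by rewrite (ltW b0) ltrDl ltr01.
- by rewrite /= cutf_eq0 ?mul0r // ltW.
exists P => // w wa.
have wb : nsq w < b ^+ 2.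
  apply: le_lt_trans (nsq_le_norm _) _.
  apply: (@le_lt_trans _ _ (n%:R * `|a| ^+ 2)).
    by apply: ler_wpM2l => //; apply: lerXn2r; rewrite ?nnegrE // (le_trans wa) ?ler_norm.
  apply: (@le_lt_trans _ _ ((n%:R * `|a|) ^+ 2)).
    by rewrite exprMn; apply: ler_wpM2r; rewrite ?sqr_ge0 // -natrX ler_nat; case: (n) => // m; rewrite expnS expn1 leq_pmulr.
  rewrite ltr_pXn2r // ?nnegrE ?mulr_ge0 // ?(ltW b0) //.
  by rewrite /b ltrDr.
have oU : open [set w : 'rV[R]_n | nsq w < b ^+ 2].
  by apply: (@open_comp _ _ (@nsq R n) [set x | x < b ^+ 2]) => [x _|];
    [exact: (Ck_cont (Ck_nsq R n 0))|exact: open_lt].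
have eq0 x : nsq x < b ^+ 2 -> (cutf b \* F) x = F x by move=> xb; rewrite /= cutf_eq1 ?mul1r // ltW.
have eq1 i x : nsq x < b ^+ 2 -> pd i (cutf b \* F) x = pd i F x.
  by move=> xb; apply: (@pd_on _ _ _ i _ _ _ oU eq0).
have eq2 i j x : nsq x < b ^+ 2 -> pd i (pd j (cutf b \* F)) x = pd i (pd j F) x.
  by move=> xb; apply: (@pd_on _ _ _ i _ _ _ oU (eq1 j)).
have [|h0 h1 h2] := h w.
  by apply: (le_trans (ltW wb)); apply: lerXn2r; rewrite ?nnegrE ?addr_ge0 // ?(ltW b0) // lerDl.
split; first by rewrite -(eq0 w wb).
- by move=> i; rewrite -(eq1 i w wb).
- by move=> i j; rewrite -(eq2 i j w wb).
Qed.

(** * Integration by parts on the ball *)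

Lemma le_of_sqr (R : realDomainType) (a b : R) : 0 <= b -> a ^+ 2 <= b ^+ 2 -> a <= b.
Proof.
move=> b0 ab; rewrite leNgt; apply/negP => ba; move: ab; rewrite leNgt.
by apply/negP; rewrite negbK; apply: ltrXn2r.
Qed.

Section Continuity.
Variables (R : realType) (n : nat).
Implicit Types (f g : 'rV[R]_n -> R).

(** A wrapper of [continuous] that does not unfold, so that the tactic [ctn] can recurse on the
    syntax of a function. *)
Variant cts f : Prop := Cts of continuous f.

Lemma ctsE f : cts f -> continuous f. Proof. by case. Qed.
Lemma ctsD f g : cts f -> cts g -> cts (fun w => f w + g w).
Proof. by move=> [cf] [cg]; split=> w; exact: (cvgD (cf w) (cg w)). Qed.
Lemma ctsM f g : cts f -> cts g -> cts (fun w => f w * g w).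
Proof. by move=> [cf] [cg]; split=> w; exact: (cvgM (cf w) (cg w)). Qed.
Lemma ctsN f : cts f -> cts (fun w => - f w).
Proof. by move=> [cf]; split=> w; exact: (cvgN (cf w)). Qed.
Lemma cts_cst (c : R) : cts (fun _ => c).
Proof. by split; exact: cst_continuous. Qed.
Lemma ctsX f k : cts f -> cts (fun w => f w ^+ k).
Proof.
move=> cf; elim: k => [|k IH]; first by under eq_fun do rewrite expr0; exact: cts_cst.
by under eq_fun do rewrite exprS; exact: ctsM.
Qed.
Lemma cts_coord i : cts (fun w : 'rV[R]_n => w 0 i).
Proof. by split; exact: coord_continuous. Qed.
Lemma cts_nsq : cts (@nsq R n). Proof. by split; exact: (Ck_cont (Ck_nsq R n 0)). Qed.
Lemma cts_sum (I : Type) (s : seq I) (P : pred I) (F : I -> 'rV[R]_n -> R) :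
  (forall i, cts (F i)) -> cts (fun w => \sum_(i <- s | P i) F i w).
Proof. by move=> cF; split; apply: cont_sum => i; apply: ctsE. Qed.
Lemma Ck_cts k f : Ck k f -> cts f. Proof. by move=> h; split; exact: Ck_cont h. Qed.

End Continuity.

Create HintDb cont.
Ltac ctn := cbv beta; lazymatch goal with
 | |- cts (fun w => @?ff w + @?gg w) => refine (@ctsD _ _ ff gg _ _); ctn
 | |- cts (fun w => - @?ff w) => refine (@ctsN _ _ ff _); ctn
 | |- cts (fun w => @?ff w * @?gg w) => refine (@ctsM _ _ ff gg _ _); ctn
 | |- cts (fun w => @?ff w ^+ ?kk) => refine (@ctsX _ _ ff kk _); ctn
 | |- cts (fun w => \sum_(i <- ?ss | @?PP i) @?ff w i) =>
     refine (@cts_sum _ _ _ ss PP (fun i w => ff w i) _); let i := fresh "i" in intro i; ctn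
 | |- cts (fun w => fun_of_matrix w _ _) => exact: cts_coord
 | |- cts _ => try solve [assumption|auto with cont|exact: cts_cst|exact: cts_nsq]
 | _ => idtac
 end.

Section Ball.
Variables (R : realType) (n : nat) (r : R).
Hypothesis r0 : 0 < r.
Implicit Types (f g : 'rV[R]_n -> R) (w : 'rV[R]_n).

Let Q := r + 2.
Let Q0 : 0 < Q. Proof. by rewrite /Q; have := r0; lra. Qed.

Definition ball2 w := nsq w <= r ^+ 2.
(** The indicator of the ball is discontinuous, but boundedness on the cube is all the mean
    requires; the margin in [Q] leaves room for cutoffs around the ball. *)
Definition IB f := gI Q (fun w => (ball2 w)%:R * f w).

Let bB f : cts f -> bounded_on (cube Q) (fun w => (ball2 w)%:R * f w).
Proof.
move=> [/(cont_bounded Q)[C hC]]; exists C => w wQ; have := hC w wQ.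
by case: (ball2 w) => h; rewrite ?mul1r // mul0r normr0 (le_trans _ h).
Qed.

Lemma IB_lin c f g : cts f -> cts g -> IB (fun w => c * f w + g w) = c * IB f + IB g.
Proof.
move=> cf cg; rewrite -(gI_lin Q0 c (bB cf) (bB cg)); congr gI; apply/funext => w; ring.
Qed.

Lemma IB_ext f g : (forall w, ball2 w -> f w = g w) -> IB f = IB g.
Proof.
by move=> h; congr gI; apply/funext => w; case: (boolP (ball2 w)) => [/h -> //|]; rewrite !mul0r.
Qed.

Lemma IB0 : IB (fun=> 0) = 0.
Proof. rewrite /IB -[RHS](@gI_cst R n Q 0); congr gI; apply/funext => w; exact: mulr0. Qed.

Lemma IBZ c f : cts f -> IB (fun w => c * f w) = c * IB f.
Proof.
move=> cf; have := IB_lin c cf (cts_cst n 0); rewrite IB0 addr0 => <-.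
by apply: IB_ext => w _; rewrite addr0.
Qed.

Lemma IBD f g : cts f -> cts g -> IB (fun w => f w + g w) = IB f + IB g.
Proof. by move=> cf cg; rewrite -[IB f]mul1r -IB_lin //; apply: IB_ext => w _; rewrite mul1r. Qed.

Lemma IBN f : cts f -> IB (fun w => - f w) = - IB f.
Proof. by move=> cf; rewrite -mulN1r -IBZ //; apply: IB_ext => w _; rewrite mulN1r. Qed.

Lemma IBB f g : cts f -> cts g -> IB (fun w => f w - g w) = IB f - IB g.
Proof. by move=> cf cg; rewrite IBD ?IBN //; ctn. Qed.

Lemma IB_le f g : cts f -> cts g -> (forall w, ball2 w -> f w <= g w) -> IB f <= IB g.
Proof.
move=> cf cg h; apply: gI_le => //; [exact: bB|exact: bB|] => w _.
by case: (boolP (ball2 w)) => [/h|]; rewrite ?mul1r ?mul0r.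
Qed.

Lemma IB_ge0 f : cts f -> (forall w, ball2 w -> 0 <= f w) -> 0 <= IB f.
Proof. by move=> cf h; rewrite -IB0; apply: IB_le => //; exact: cts_cst. Qed.

Lemma IB_norm_le f g : cts f -> cts g ->
  (forall w, ball2 w -> `|f w| <= g w) -> `|IB f| <= IB g.
Proof.
move=> cf cg h; rewrite ler_norml -IBN //; apply/andP; split; apply: IB_le => //; try by ctn.
  by move=> w /h; rewrite ler_norml => /andP[].
by move=> w /h; rewrite ler_norml => /andP[].
Qed.

Lemma ball2_norm w : ball2 w -> `|w| <= r.
Proof.
move=> wb; rewrite -(ler_pXn2r (n := 2)) ?nnegrE // ?(ltW r0) //.
exact: le_trans (norm_sq_le_nsq _) wb.
Qed.

Lemma IB_gt0 f w0 : cts f -> (forall w, ball2 w -> 0 <= f w) -> ball2 w0 -> 0 < f w0 -> 0 < IB f.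
Proof.
move=> cf f0 bw0 fw0; pose e := f w0 / 2; have e0 : 0 < e by rewrite divr_gt0.
have [d d0 hd] := continuous_at_delta (ctsE cf (x := w0)) e0.
pose t := Num.min (1 / 2) (d / (2 * (r + 1))).
have r1 : 0 < 2 * (r + 1) by have := r0; lra.
have t0 : 0 < t by rewrite lt_min !divr_gt0.
have t12 : t <= 1 / 2 by rewrite ge_min lexx.
have td : t * (2 * (r + 1)) <= d by rewrite -ler_pdivlMr // ge_min lexx orbT.
(* The point [w0] may lie on the sphere, where no cube around it fits into the ball; it is moved
   inwards to [w1], and a cube of radius [s0] around [w1] stays inside the ball and close to
   [w0]. *)
pose w1 := (1 - t) *: w0.
pose s0 := Num.min (d / 2) (Num.min 1 (t * r / n.+1%:R)).
have n1 : 0 < n.+1%:R :> R by rewrite ltr0Sn.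
have s00 : 0 < s0 by rewrite !lt_min !divr_gt0 // ?mulr_gt0 // ltr01.
have s0d : s0 <= d / 2 by rewrite ge_min lexx.
have s01 : s0 <= 1 by rewrite !ge_min lexx orbT.
have s0t : s0 * n.+1%:R <= t * r by rewrite -ler_pdivlMr // !ge_min lexx !orbT.
have w0r := ball2_norm bw0.
have w1r : `|w1| <= r.
  rewrite /w1 normrZ ger0_norm; last by lra.
  by apply: le_trans w0r; rewrite ler_piMl //; lra.
have near w : `|w - w1| <= s0 -> `|w - w0| < d /\ ball2 w.
  move=> ww1; split.
    have -> : w - w0 = (w - w1) - t *: w0.
      by apply/rowP => i; rewrite !mxE; ring.
    apply: le_lt_trans (ler_normB _ _) _; rewrite normrZ (gtr0_norm t0).
    have : t * `|w0| <= t * r by rewrite ler_pM2l.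
    by have := mulr_gt0 t0 r0; lra.
  (* |w|^2 <= ((1-t) r)^2 + 2 sum |w1_i| s0 + n s0^2, and n s0 <= t r. *)
  rewrite /ball2; pose z := w - w1.
  have wE i : w 0 i = (1 - t) * w0 0 i + z 0 i by rewrite !mxE; ring.
  have zi i : `|z 0 i| <= s0 by apply: le_trans (coord_le_norm _ _) ww1.
  (* Convexity of the square for w = (1 - t) w0 + t (z / t). *)
  have c2 i : w 0 i * w 0 i <= (1 - t) * (w0 0 i * w0 0 i) + (z 0 i * z 0 i) / t.
    rewrite -subr_ge0 wE (_ : _ - _ = (1 - t) / t * (t * w0 0 i - z 0 i) ^+ 2).
      by rewrite mulr_ge0 ?sqr_ge0 // divr_ge0 ?(ltW t0) //; lra.
    by field; rewrite gt_eqF.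
  apply: (@le_trans _ _ (\sum_i ((1 - t) * (w0 0 i * w0 0 i) + (z 0 i * z 0 i) / t))).
    by apply: ler_sum => i _.
  rewrite big_split /= -mulr_sumr -mulr_suml -!nsqE.
  have h1 : (1 - t) * nsq w0 <= (1 - t) * r ^+ 2 by apply: ler_wpM2l => //; lra.
  have h2 : nsq z <= t * (t * r ^+ 2).
    apply: (le_trans (nsq_le_norm z)).
    have zs : `|z| ^+ 2 <= s0 ^+ 2 by apply: lerXn2r; rewrite ?nnegrE // ltW.
    apply: (@le_trans _ _ ((s0 * n.+1%:R) ^+ 2)).
      rewrite exprMn mulrC; apply: ler_pM => //.
      by rewrite -natrX ler_nat expnS expn1 (leq_trans (leqnSn n)) // leq_pmulr.
    rewrite (_ : t * (t * r ^+ 2) = (t * r) ^+ 2); last by ring.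
    by apply: lerXn2r; rewrite ?nnegrE // ?mulr_ge0 // ltW.
  have h3 : nsq z / t <= t * r ^+ 2 by rewrite ler_pdivrMr // mulrC.
  lra.
apply: (@gI_cell_gt0 R n Q Q0 w1 s0 e) => //.
- by rewrite /Q; lra.
- exact: bB.
- by move=> w _; case: (boolP (ball2 w)) => [/f0|]; rewrite ?mul1r ?mul0r.
- move=> w /near[wd wB]; rewrite wB mul1r; have := hd w wd.
  by rewrite ler_norml /e => /andP[]; lra.
Qed.

Lemma IB1_gt0 : 0 < IB (fun=> 1).
Proof.
apply: (@IB_gt0 _ 0) => //; [exact: cts_cst|].
by rewrite /ball2 nsqE big1 ?sqr_ge0 // => i _; rewrite mxE mul0r.
Qed.

Lemma IB_eq0 f : cts f -> (forall w, ball2 w -> 0 <= f w) -> IB f = 0 ->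
  forall w, ball2 w -> f w = 0.
Proof.
move=> cf f0 f1 w wB; apply/eqP; rewrite eq_le (f0 w wB) andbT leNgt; apply/negP => fw.
by have := IB_gt0 cf f0 wB fw; rewrite f1 ltxx.
Qed.

Lemma IB_close f g e : cts f -> cts g ->
  (forall w, ball2 w -> `|f w - g w| <= e) -> `|IB f - IB g| <= e * IB (fun=> 1).
Proof.
move=> cf cg h; rewrite -IBB // -IBZ; last exact: cts_cst.
by apply: IB_norm_le => [||w /h]; rewrite ?mulr1 //; ctn.
Qed.

Lemma IB_CS f g : cts f -> cts g ->
  IB (fun w => f w * g w) ^+ 2 <= IB (fun w => f w ^+ 2) * IB (fun w => g w ^+ 2).
Proof.
move=> cf cg; set A := IB (fun w => f w ^+ 2); set B := IB (fun w => f w * g w); set C := IB _.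
have A0 : 0 <= A by apply: IB_ge0 => [|w _]; [ctn|exact: sqr_ge0].
have C0 : 0 <= C by apply: IB_ge0 => [|w _]; [ctn|exact: sqr_ge0].
have q t : 0 <= t ^+ 2 * A + 2 * t * B + C.
  have -> : t ^+ 2 * A + 2 * t * B + C = IB (fun w => (t * f w + g w) ^+ 2).
    rewrite -IBZ; last by ctn.
    rewrite -IBZ; last by ctn.
    rewrite -IBD; [|by ctn|by ctn]; rewrite -IBD; [|by ctn|by ctn].
    by apply: IB_ext => w _; ring.
  by apply: IB_ge0 => [|w _]; [ctn|exact: sqr_ge0].
have [A1|A1] := eqVneq A 0.
  rewrite A1 mul0r; suff -> : B = 0 by rewrite expr0n.
  apply/eqP; apply: contraT => B0.
  have := q (- (C + 1) / (2 * B)); rewrite A1 mulr0 add0r.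
  rewrite (_ : 2 * _ * B = - (C + 1)); [lra|by field].
have A2 : 0 < A by rewrite lt_neqAle eq_sym A1.
have := q (- B / A); rewrite (_ : _ + C = (A * C - B ^+ 2) / A); last by field; rewrite gt_eqF.
by rewrite pmulr_lge0 ?invr_gt0 // subr_ge0.
Qed.

Definition divf (X : 'I_n -> 'rV[R]_n -> R) w := \sum_i pd i (X i) w.

(** A radial cutoff that drops from 1 to 0 while [nsq w] runs from [a - e] to [a]; [deta] lives on
    that shell and carries its gradient. *)
Let eta (a e : R) w := smoothstep ((a - nsq w) / e).
Let deta (a e : R) w := dsmoothstep ((a - nsq w) / e).

Lemma Ck_eta (a e : R) : Ck 2 (eta a e).
Proof.
apply: (@Ck_smoothstep _ _ (fun w => (a - nsq w) / e)); under eq_fun do rewrite mulrC.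
by apply: CkZ; apply: CkB; [exact: Ck_cst|exact: Ck_nsq].
Qed.

Lemma cts_deta a e : cts (deta a e).
Proof.
split; have c1 : continuous (fun w : 'rV[R]_n => (a - nsq w) / e).
  by apply: ctsE; ctn.
have c2 : continuous (@dsmoothstep R).
  have cp2 := is_derive_cont1 (@is_derive_pos2 R); have cp3 := is_derive_cont1 (@is_derive_pos3 R).
  have cp4 : continuous (fun x : R => pos2 (1 - pos3 x)).
    move=> x; apply: (@continuous_comp _ _ _ (fun x => 1 - pos3 x) (@pos2 R)); last exact: cp2.
    by apply: cvgB; [exact: cvg_cst|exact: cp3].
  by move=> x; exact: (cvgM (cvgMl_tmp (cp4 x)) (cp2 x)).
by move=> w; apply: (@continuous_comp _ _ _ (fun w => (a - nsq w) / e)); [exact: c1|exact: c2].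
Qed.

Lemma pd_eta a e i w : pd i (eta a e) w = - (2 / e) * deta a e w * w 0 i.
Proof.
pose F w : R := e^-1 * (a - nsq w).
have hN : Ck 1 (fun w : 'rV[R]_n => a - nsq w) by apply: CkB; [exact: Ck_cst|exact: Ck_nsq].
have hF : Ck 1 F := CkZ e^-1 hN.
have [_ E] := pd_comp1 (F := F) (i := i) (@is_derive_smoothstep R) (fun w => @Ck_der _ _ 0 F i w hF).
rewrite (_ : eta a e = @smoothstep R \o F); last by apply/funext => x; rewrite /eta /= /F mulrC.
rewrite E pdZ; last by move=> x; apply: Ck_der hN.
rewrite (_ : pd i _ = fun w : 'rV[R]_n => - (2 * w 0 i)).
  by rewrite /deta /F [in RHS]mulrC [(a - nsq w) / e]mulrC; ring.
have hn x : derivable (@nsq R n) x (basisv R i) by apply: Ck_der (Ck_nsq R n 1).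
rewrite (_ : (fun w => _) = (fun=> a) \+ (fun w : 'rV[R]_n => - nsq w)) //.
rewrite pdD; [|by move=> x; exact: derivable_cst|by move=> x; exact: derivableN].
by rewrite pd_cst pdN // pd_nsq; apply/funext => x /=; rewrite add0r.
Qed.

Lemma gI_lin' c f g : cts f -> cts g -> gI Q (fun w => c * f w + g w) = c * gI Q f + gI Q g.
Proof. by move=> [cf] [cg]; apply: gI_lin => //; apply: cont_bounded. Qed.

Lemma gI_sum' (I : Type) (s : seq I) (F : I -> 'rV[R]_n -> R) : (forall l, cts (F l)) ->
  gI Q (fun y => \sum_(l <- s) F l y) = \sum_(l <- s) gI Q (F l).
Proof.
move=> cF; elim: s => [|a s IH]; first by rewrite big_nil_fun big_nil gI_cst.
rewrite big_cons -IH -[gI Q (F a)]mul1r -gI_lin' //; last by ctn.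
by congr gI; apply/funext => w; rewrite big_cons mul1r.
Qed.

(* The gradient of [eta] is radial. *)
Lemma div_cutoff a e X : 0 < e -> a <= (r + 1) ^+ 2 -> (forall i, Ck 1 (X i)) ->
  gI Q (fun w => eta a e w * divf X w) = 2 / e * gI Q (fun w => deta a e w * \sum_i w 0 i * X i w).
Proof.
move=> e0 ar hX; have hE := Ck_eta a e; have ce := Ck_cts hE; have cd := cts_deta a e.
have cX i : cts (X i) := Ck_cts (hX i).
have cdX i : cts (pd i (X i)) := Ck_cts (Ck_pd i (hX i)).
have z i : gI Q (pd i (eta a e \* X i)) = 0.
  have hEX : Ck 1 (eta a e \* X i) := CkM (CkW hE) (hX i).
  apply: (@gI_pd R n Q Q0 _ i 1) => //.
  - move=> w; rewrite /Q => hw; rewrite /= /eta smoothstep_le0 ?mul0r //.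
    rewrite pmulr_lle0 ?invr_gt0 // subr_le0; apply: (le_trans ar).
    apply: le_trans (norm_sq_le_nsq w); apply: lerXn2r; rewrite ?nnegrE //.
      by have := r0; lra.
    by lra.
  - by move=> w; apply: Ck_der hEX.
  - exact: (Ck_cont (Ck_pd i hEX)).
have s0 : \sum_i gI Q (pd i (eta a e \* X i)) = 0 by rewrite big1.
have E i : pd i (eta a e \* X i) = fun w => - (2 / e) * (deta a e w * (w 0 i * X i w)) + eta a e w * pd i (X i) w.
  rewrite pdM; [|by move=> w; apply: Ck_der hE|by move=> w; apply: Ck_der (hX i)].
  by apply/funext => w /=; rewrite pd_eta; ring.
have c1 i : cts (fun w => deta a e w * (w 0 i * X i w)) by ctn.
have c2 i : cts (fun w => eta a e w * pd i (X i) w) by ctn.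
have S1 : gI Q (fun w => eta a e w * divf X w) = \sum_i gI Q (fun w => eta a e w * pd i (X i) w).
  by rewrite -gI_sum' //; congr gI; apply/funext => w; rewrite /divf mulr_sumr.
have S2 : gI Q (fun w => deta a e w * \sum_i w 0 i * X i w) = \sum_i gI Q (fun w => deta a e w * (w 0 i * X i w)).
  by rewrite -gI_sum' //; congr gI; apply/funext => w; rewrite mulr_sumr.
rewrite S1 S2; move: s0.
under eq_bigr do rewrite E gI_lin' //; rewrite big_split /= -mulr_sumr mulNr => /eqP.
by rewrite addrC subr_eq0 => /eqP.
Qed.

Lemma gI_le' f g : cts f -> cts g -> (forall w, f w <= g w) -> gI Q f <= gI Q g.
Proof. by move=> [cf] [cg] h; apply: gI_le => //; apply: cont_bounded. Qed.

(** [div_cutoff] for the position field, whose divergence is n: the mean of [n * eta] is at most n,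
    and nsq w >= a - e >= a / 2 wherever [deta] is nonzero. *)
Lemma shell_density a e : 0 < e -> 2 * e <= a -> a <= (r + 1) ^+ 2 ->
  0 <= gI Q (deta a e) <= n%:R / a * e.
Proof.
move=> e0 ea ar; have cd := cts_deta a e; have a0 : 0 < a by lra.
have d0 w : 0 <= deta a e w by have [/andP[]] := dsmoothstep_bound ((a - nsq w) / e).
have G0 : 0 <= gI Q (deta a e).
  by rewrite -(@gI_cst R n Q 0); apply: gI_le' => //; exact: cts_cst.
rewrite G0 /=.
have ce := Ck_cts (Ck_eta a e).
have := div_cutoff e0 ar (fun i => Ck_coord R 1 i).
have -> : (fun w => eta a e w * divf (fun i w => w 0 i) w) = fun w => n%:R * eta a e w + 0.
  apply/funext => w; rewrite addr0 mulrC; congr (_ * _); rewrite /divf.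
  under eq_bigr do rewrite pd_coord eqxx; by rewrite sumr_const card_ord.
rewrite gI_lin' //; last exact: cts_cst.
rewrite (@gI_cst R n Q 0) addr0 => E.
have h1 : gI Q (eta a e) <= 1.
  rewrite -(@gI_cst R n Q 1); apply: gI_le' => //; first exact: cts_cst.
  by move=> w; exact: smoothstep_le1.
have h2 : a / 2 * gI Q (deta a e) <= gI Q (fun w => deta a e w * \sum_i w 0 i * w 0 i).
  have -> : a / 2 * gI Q (deta a e) = gI Q (fun w => a / 2 * deta a e w + 0).
    by rewrite gI_lin' //; [rewrite (@gI_cst R n Q 0) addr0|exact: cts_cst].
  apply: gI_le'; [by ctn|by ctn|] => w; rewrite addr0 -nsqE mulrC.
  have [x1|x1] := leP 1 ((a - nsq w) / e).
    have [_ [_ h]] := dsmoothstep_bound ((a - nsq w) / e).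
    by rewrite /deta h // !mul0r.
  apply: ler_wpM2l => //; move: x1; rewrite ltr_pdivrMr //; lra.
have h3 : n%:R * gI Q (eta a e) <= n%:R by rewrite ler_piMr.
rewrite mulrAC ler_pdivlMr //.
move: h2; rewrite -(ler_pM2l (_ : 0 < 2 / e)) ?divr_gt0 // -E => h2.
have := le_trans h2 h3; rewrite (_ : 2 / e * _ = gI Q (deta a e) * a / e).
  by rewrite ler_pdivrMr.
by field; rewrite gt_eqF.
Qed.

(** The indicator of the ball and [eta] differ only on a shell of width e in [nsq], whose mass is
    O(e) by [shell_density]. *)
Lemma cutoff_close f : cts f -> exists2 C, 0 <= C & forall e, 0 < e -> 6 * e <= r ^+ 2 -> e <= 1 ->
  `|IB f - gI Q (fun w => eta (r ^+ 2) e w * f w)| <= C * e.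
Proof.
move=> cf; have [M hM] := cont_bounded Q (ctsE cf).
have M0 : 0 <= M by apply: le_trans (hM 0 _) => //; rewrite /cube /= normr0 ltW.
have r20 : 0 < r ^+ 2 by rewrite exprn_gt0.
exists (9 * n%:R / r ^+ 2 * M).
  by apply: mulr_ge0 => //; apply: divr_ge0; [exact: mulr_ge0|exact: ltW].
(* The shell r^2 - e <= nsq w <= r^2 is the middle third of the shell carrying [D], where the
   derivative of [smoothstep] is at least 1/3. *)
move=> e e0 er e1; have ce := Ck_cts (Ck_eta (r ^+ 2) e); pose D := deta (r ^+ 2 + e) (3 * e).
have cD : cts D by exact: cts_deta.
have ar : r ^+ 2 + e <= (r + 1) ^+ 2 by rewrite sqrrD; have := r0; lra.
have e30 : 0 < 3 * e by lra.
have e3a : 2 * (3 * e) <= r ^+ 2 + e by lra.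
have /andP[_ hD] := shell_density e30 e3a ar.
have key w : `|(ball2 w)%:R - eta (r ^+ 2) e w| <= 3 * D w.
  have d0 : 0 <= D w by have [/andP[]] := dsmoothstep_bound ((r ^+ 2 + e - nsq w) / (3 * e)).
  rewrite /eta; have [h1|h1] := leP (r ^+ 2) (nsq w - 0).
    rewrite subr0 in h1; rewrite smoothstep_le0; last by rewrite pmulr_lle0 ?invr_gt0 // subr_le0.
    rewrite subr0; case: (boolP (ball2 w)) => [wb|_]; last by rewrite normr0; lra.
    have E : nsq w = r ^+ 2 by apply/eqP; rewrite eq_le h1 andbT.
    rewrite normr1 /D /deta E (_ : _ / _ = 1 / 3); last by field; rewrite gt_eqF.
    rewrite /dsmoothstep !(pos2_ge0E, pos3_ge0E) ?divr_ge0 //; first by lra.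
    by lra.
  rewrite subr0 in h1; have -> : ball2 w by rewrite /ball2 ltW.
  have [h2|h2] := leP (nsq w) (r ^+ 2 - e).
    rewrite smoothstep_ge1 ?subrr ?normr0; first by lra.
    by rewrite ler_pdivlMr //; lra.
  rewrite ger0_norm ?subr_ge0 ?smoothstep_le1 //.
  apply: le_trans (_ : 1 <= _); first by rewrite gerBl smoothstep_ge0.
  set x := (r ^+ 2 + e - nsq w) / (3 * e).
  have x1 : 1 / 3 <= x by rewrite ler_pdivlMr //; lra.
  have x2 : x <= 2 / 3 by rewrite ler_pdivrMr //; lra.
  have x0 : 0 <= x by lra.
  have x3 : x ^+ 3 <= 8 / 27.
    have -> : 8 / 27 = (2 / 3) ^+ 3 :> R by field.
    by apply: lerXn2r => //; rewrite nnegrE; lra.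
  have y0 : 0 <= 1 - pos3 x by rewrite pos3_ge0E //; lra.
  rewrite /D /deta -/x /dsmoothstep (pos2_ge0E x0) (pos2_ge0E y0) (pos3_ge0E x0).
  have a1 : (1 / 3) ^+ 2 <= x ^+ 2 by apply: lerXn2r => //; rewrite nnegrE; lra.
  have a2 : (19 / 27) ^+ 2 <= (1 - x ^+ 3) ^+ 2 by apply: lerXn2r => //; rewrite ?nnegrE; lra.
  have : (19 / 27) ^+ 2 * (1 / 3) ^+ 2 <= (1 - x ^+ 3) ^+ 2 * x ^+ 2.
    by apply: ler_pM => //; apply: sqr_ge0.
  by lra.
have bd g : (forall w, `|g w| <= 3 * D w) -> bounded_on (cube Q) (fun w => g w * f w).
  move=> hg; exists (27 * M) => w wQ; rewrite normrM; apply: ler_pM => //; last exact: hM.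
  apply: (le_trans (hg w)); have [/andP[_]] := dsmoothstep_bound ((r ^+ 2 + e - nsq w) / (3 * e)).
  by rewrite /D /deta; lra.
have cef : cts (fun w => eta (r ^+ 2) e w * f w) by ctn.
have -> : IB f - gI Q (fun w => eta (r ^+ 2) e w * f w) = gI Q (fun w => ((ball2 w)%:R - eta (r ^+ 2) e w) * f w).
  rewrite addrC -mulN1r -gI_lin //; [|exact: cont_bounded (ctsE cef)|exact: bB].
  by congr gI; apply/funext => w; ring.
have cDM : cts (fun w => 3 * M * D w) by ctn.
have cDMn : cts (fun w => - (3 * M) * D w) by ctn.
have E c : gI Q (fun w => c * D w) = c * gI Q D.
  transitivity (gI Q (fun w => c * D w + 0)); first by congr gI; apply/funext => w; rewrite addr0.
  by rewrite gI_lin' //; [rewrite (@gI_cst R n Q 0) addr0|exact: cts_cst].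
have up w : cube Q w -> `|((ball2 w)%:R - eta (r ^+ 2) e w) * f w| <= 3 * M * D w.
  move=> wQ; rewrite normrM mulrAC; apply: ler_pM => //; exact: hM.
have fin : 3 * M * gI Q D <= 9 * n%:R / r ^+ 2 * M * e.
  apply: le_trans (_ : 3 * M * (n%:R / (r ^+ 2 + e) * (3 * e)) <= _).
    by apply: ler_wpM2l => //; rewrite mulr_ge0.
  have : n%:R / (r ^+ 2 + e) <= n%:R / r ^+ 2.
    by apply: ler_wpM2l => //; rewrite lef_pV2 ?posrE //; lra.
  move=> h; apply: le_trans (_ : 3 * M * (n%:R / r ^+ 2 * (3 * e)) <= _).
    apply: ler_wpM2l; first by rewrite mulr_ge0.
    by rewrite ler_pM2r.
  by rewrite le_eqVlt; apply/orP; left; apply/eqP; ring.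
apply: le_trans fin; rewrite ler_norml; apply/andP; split.
  rewrite -mulNr -E; apply: gI_le => //; [exact: cont_bounded (ctsE cDMn)|exact: bd|].
  by move=> w /up; rewrite ler_norml mulNr => /andP[].
rewrite -E; apply: gI_le => //; [exact: bd|exact: cont_bounded (ctsE cDM)|].
by move=> w /up; rewrite ler_norml => /andP[].
Qed.

(** [D] stands for the divergence of a field and [N] for its product with the position vector.
    Nothing is differentiated, so the relation passes to uniform limits. *)
Definition weak_div D N := forall e, 0 < e ->
  gI Q (fun w => eta (r ^+ 2) e w * D w) = 2 / e * gI Q (fun w => deta (r ^+ 2) e w * N w).

Lemma weak_div_C1 X : (forall i, Ck 1 (X i)) -> weak_div (divf X) (fun w => \sum_i w 0 i * X i w).
Proof.
by move=> hX e e0; apply: div_cutoff => //; rewrite sqrrD; have := r0; lra.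
Qed.

Lemma gI_close f g d : cts f -> cts g -> (forall w, cube Q w -> `|f w - g w| <= d) ->
  `|gI Q f - gI Q g| <= d.
Proof.
move=> cf cg h; have cn : cts (fun w => d * 1 + g w) by ctn.
have cm : cts (fun w => - d * 1 + g w) by ctn.
have u : gI Q f <= d + gI Q g.
  rewrite -[d in leRHS]mulr1 -[X in _ * X](@gI_cst R n Q 1) -gI_lin' //; last exact: cts_cst.
  apply: gI_le; [exact: Q0|exact: cont_bounded (ctsE cf)|exact: cont_bounded (ctsE cn)|].
  by move=> w /h; rewrite ler_norml => /andP[]; lra.
have l : - d + gI Q g <= gI Q f.
  rewrite -[- d in leLHS]mulr1 -[X in _ * X](@gI_cst R n Q 1) -gI_lin' //; last exact: cts_cst.
  apply: gI_le; [exact: Q0|exact: cont_bounded (ctsE cm)|exact: cont_bounded (ctsE cf)|].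
  by move=> w /h; rewrite ler_norml => /andP[]; lra.
by rewrite ler_norml; apply/andP; split; lra.
Qed.

Lemma weak_div_lim D N : cts D -> cts N ->
  (forall d, 0 < d -> exists D' N', [/\ cts D', cts N', weak_div D' N' &
     forall w, `|w| <= r + 2 -> `|D' w - D w| <= d /\ `|N' w - N w| <= d]) -> weak_div D N.
Proof.
move=> cD cN h e e0; apply/eqP; rewrite -subr_eq0 -normr_le0; apply/ler_addgt0Pr => d d0.
have ce := Ck_cts (Ck_eta (r ^+ 2) e); have cd := cts_deta (r ^+ 2) e.
pose K := 1 + 2 / e * 9; have K0 : 0 < K.
  by rewrite /K ltr_pwDl // mulr_ge0 // divr_ge0 // ltW.
have [D' [N' [cD' cN' W hW]]] := h (d / K) (divr_gt0 d0 K0).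
set A := gI Q _; set B := gI Q _.
set A' := gI Q (fun w => eta (r ^+ 2) e w * D' w); set B' := gI Q (fun w => deta (r ^+ 2) e w * N' w).
have E : A' = 2 / e * B' by apply: W.
have hA : `|A' - A| <= d / K.
  apply: gI_close; [by ctn|by ctn|] => w wQ; rewrite -mulrBr normrM.
  apply: le_trans (_ : 1 * (d / K) <= _); last by rewrite mul1r.
  apply: ler_pM => //; last by have [] := hW w wQ.
  by rewrite ger0_norm ?smoothstep_le1 // smoothstep_ge0.
have hB : `|B' - B| <= 9 * (d / K).
  apply: gI_close; [by ctn|by ctn|] => w wQ; rewrite -mulrBr normrM.
  apply: ler_pM => //; last by have [] := hW w wQ.
  by have [/andP[h1 h2] _] := dsmoothstep_bound ((r ^+ 2 - nsq w) / e); rewrite ger0_norm.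
rewrite add0r (_ : A - _ = - (A' - A) + 2 / e * (B' - B)); last by rewrite mulrBr -E; ring.
apply: le_trans (ler_normD _ _) _; rewrite normrN normrM (ger0_norm (_ : 0 <= 2 / e)); last by rewrite divr_ge0 // ltW.
apply: (@le_trans _ _ (d / K + 2 / e * (9 * (d / K)))).
  by apply: lerD => //; apply: ler_wpM2l => //; rewrite divr_ge0 // ltW.
rewrite (_ : _ + _ = K * (d / K)); last by rewrite /K; ring.
by rewrite mulrCA divff ?mulr1 // gt_eqF.
Qed.

(** Radial projection to the sphere moves the points of a thin shell by less than the modulus of
    uniform continuity of [N]. *)
Lemma normal_small N d : cts N -> (forall w, nsq w = r ^+ 2 -> N w = 0) -> 0 < d ->
  exists2 e1, 0 < e1 & forall w, r ^+ 2 - e1 <= nsq w <= r ^+ 2 -> `|N w| <= d.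
Proof.
move=> cN N0 d0; have [t t0 ht] := uniform_on_cube r (ctsE cN) d0.
have r20 : 0 < r ^+ 2 by rewrite exprn_gt0.
pose e1 := Num.min (r ^+ 2 / 2) (r * t / 2).
have e11 : e1 <= r ^+ 2 / 2 by rewrite ge_min lexx.
have e12 : e1 <= r * t / 2 by rewrite ge_min lexx orbT.
exists e1; first by rewrite lt_min !divr_gt0 // mulr_gt0.
move=> w /andP[w1 w2]; pose s := Num.sqrt (nsq w).
have sE : s ^+ 2 = nsq w by rewrite sqr_sqrtr ?nsq_ge0.
have s0 : 0 < s by rewrite sqrtr_gt0; lra.
have sr : s <= r by apply: le_of_sqr; rewrite ?sE // ltW.
have rs : (r - s) * r <= e1.
  apply: le_trans (_ : r ^+ 2 - s ^+ 2 <= _); last by rewrite sE; lra.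
  rewrite -subr_ge0 (_ : _ - _ = (r - s) * s); last by ring.
  by apply: mulr_ge0; [rewrite subr_ge0|exact: ltW].
pose w' := (r / s) *: w.
have nw' : nsq w' = r ^+ 2.
  rewrite nsqE; under eq_bigr => i _.
    rewrite !mxE (_ : r / s * w 0 i * (r / s * w 0 i) = (r / s) ^+ 2 * (w 0 i * w 0 i)); last by ring.
  over.
  by rewrite -mulr_sumr -nsqE -sE; field; rewrite gt_eqF.
have ws : `|w| <= s.
  by apply: le_of_sqr; [exact: ltW|rewrite sE; exact: norm_sq_le_nsq].
have ww : `|w - w'| < t.
  have -> : w - w' = (1 - r / s) *: w by rewrite scalerBl scale1r.
  rewrite normrZ (_ : 1 - r / s = - ((r - s) / s)); last by field; rewrite gt_eqF.
  rewrite normrN ger0_norm; last by apply: divr_ge0; [rewrite subr_ge0|exact: ltW].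
  apply: (@le_lt_trans _ _ ((r - s) / s * s)).
    by apply: ler_wpM2l => //; apply: divr_ge0; [rewrite subr_ge0|exact: ltW].
  rewrite divfK ?gt_eqF // -(ltr_pM2r r0); apply: (le_lt_trans rs); apply: (le_lt_trans e12).
  by rewrite mulrC; have := mulr_gt0 t0 r0; lra.
have := ht w w' (ball2_norm (w := w) _) (ball2_norm (w := w') _) ww; rewrite (N0 _ nw') subr0 => h.
by apply: ltW; apply: h; rewrite /ball2 // nw'.
Qed.

(** The mass O(e) of the shell compensates the factor 2 / e, and [N] is small on the shell because
    it vanishes on the sphere; the right-hand side of [weak_div] thus tends to 0, the left-hand side
    to the integral of [D]. *)
Lemma weak_div_IB0 D N : cts D -> cts N -> weak_div D N ->
  (forall w, nsq w = r ^+ 2 -> N w = 0) -> IB D = 0.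
Proof.
move=> cD cN W N0; have [C C0 hC] := cutoff_close cD.
have r20 : 0 < r ^+ 2 by rewrite exprn_gt0.
apply/eqP; rewrite -normr_le0; apply/ler_addgt0Pr => d d0; rewrite add0r.
pose k : R := 2 * n%:R / r ^+ 2 + 1.
have k0 : 0 < k by rewrite /k ltr_wpDl // divr_ge0 // ?mulr_ge0 // ltW.
pose d1 := d / 2 / k; have d10 : 0 < d1 by rewrite !divr_gt0.
have [e1 e10 he1] := normal_small cN N0 d10.
pose d2 := d / 2 / (C + 1); have C1 : 0 < C + 1 by lra.
have d20 : 0 < d2 by rewrite !divr_gt0.
pose e := Num.min (Num.min e1 d2) (Num.min (r ^+ 2 / 6) 1).
have e0 : 0 < e by rewrite !lt_min e10 d20 divr_gt0 //= ltr01.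
have ee1 : e <= e1 by rewrite !ge_min lexx.
have ed2 : e <= d2 by rewrite !ge_min lexx !orbT.
have er : 6 * e <= r ^+ 2 by rewrite mulrC -ler_pdivlMr // !ge_min lexx !orbT.
have e1' : e <= 1 by rewrite !ge_min lexx !orbT.
have h := hC e e0 er e1'; rewrite (W e e0) in h.
have cd := cts_deta (r ^+ 2) e.
have ar : r ^+ 2 <= (r + 1) ^+ 2 by rewrite sqrrD; have := r0; lra.
have e2r : 2 * e <= r ^+ 2 by lra.
have /andP[G0 G1] := shell_density e0 e2r ar.
have b : `|gI Q (fun w => deta (r ^+ 2) e w * N w)| <= d1 * gI Q (deta (r ^+ 2) e).
  have Ec c : gI Q (fun w => c * deta (r ^+ 2) e w) = c * gI Q (deta (r ^+ 2) e).
    transitivity (gI Q (fun w => c * deta (r ^+ 2) e w + 0)); first by congr gI; apply/funext => w; rewrite addr0.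
    by rewrite gI_lin' //; [rewrite (@gI_cst R n Q 0) addr0|exact: cts_cst].
  have pt w : `|deta (r ^+ 2) e w * N w| <= d1 * deta (r ^+ 2) e w.
    have [/andP[p0 _] [p1 p2]] := dsmoothstep_bound ((r ^+ 2 - nsq w) / e).
    rewrite normrM (ger0_norm p0) mulrC.
    have [x0|x0] := leP ((r ^+ 2 - nsq w) / e) 0; first by rewrite /deta p1 // !mulr0.
    have [x1|x1] := leP 1 ((r ^+ 2 - nsq w) / e); first by rewrite /deta p2 // !mulr0.
    apply: ler_wpM2r => //; apply: he1; apply/andP; split.
      by move: x1; rewrite ltr_pdivrMr //; lra.
    by move: x0; rewrite pmulr_lgt0 ?invr_gt0 //; lra.
  rewrite ler_norml -mulNr -!Ec; apply/andP; split; apply: gI_le'; try by ctn.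
    by move=> w; have := pt w; rewrite ler_norml mulNr => /andP[].
  by move=> w; have := pt w; rewrite ler_norml => /andP[].
have fin1 : `|2 / e * gI Q (fun w => deta (r ^+ 2) e w * N w)| <= d / 2.
  rewrite normrM (ger0_norm (_ : 0 <= 2 / e)); last by rewrite divr_ge0 // ltW.
  apply: (@le_trans _ _ (2 / e * (d1 * (n%:R / r ^+ 2 * e)))).
    apply: ler_wpM2l; first by rewrite divr_ge0 // ltW.
    by apply: (le_trans b); apply: ler_wpM2l => //; exact: ltW.
  rewrite (_ : 2 / e * (d1 * (n%:R / r ^+ 2 * e)) = d1 * (k - 1)); last by rewrite /k; field; rewrite !gt_eqF.
  apply: (@le_trans _ _ (d1 * k)); first by rewrite ler_pM2l //; lra.
  by rewrite /d1 divfK // gt_eqF.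
have fin2 : C * e <= d / 2.
  apply: (@le_trans _ _ ((C + 1) * d2)).
    by apply: ler_pM => //; [exact: ltW|lra].
  by rewrite /d2 mulrC divfK // gt_eqF.
have := ler_normD (IB D - 2 / e * gI Q (fun w => deta (r ^+ 2) e w * N w)) (2 / e * gI Q (fun w => deta (r ^+ 2) e w * N w)).
rewrite subrK; lra.
Qed.

Lemma divergence X : (forall i, Ck 1 (X i)) ->
  (forall w, nsq w = r ^+ 2 -> \sum_i w 0 i * X i w = 0) -> IB (divf X) = 0.
Proof.
move=> hX X0; have cX i : cts (X i) := Ck_cts (hX i).
have cdX i : cts (pd i (X i)) := Ck_cts (Ck_pd i (hX i)).
apply: (weak_div_IB0 _ _ (weak_div_C1 hX) X0); last by ctn.
by rewrite /divf; ctn.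
Qed.

End Ball.

(** * The mixed operator, its symmetry and its Bochner formula *)

Section Sym.
Variables (R : realType) (n : nat).
Implicit Types (F G : 'rV[R]_n -> R) (w : 'rV[R]_n) (i j : 'I_n).

Lemma pd_sym_hpoly m F i j : hpoly m F -> pd i (pd j F) = pd j (pd i F).
Proof.
elim=> [c|d|l d H hH IH|d H K hH IH hK IK]; [by rewrite !pd_cst|by rewrite !pd_cst| |].
- have dl a x := @derivable_coord R n a l x.
  have dH a x : derivable H x (basisv R a) by apply: Ck_der (Ck_hpoly 1 hH).
  have E a : pd a (fun w => w 0 l * H w) = (fun w : 'rV[R]_n => w 0 l * pd a H w) \+ (fun w => (a == l)%:R * H w).
    by rewrite (pdM (dl a) (dH a)) pd_coord; apply/funext => w /=; rewrite [H w * _]mulrC.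
  have hp a : hpoly d.-1 (pd a H) by apply: hpoly_pd.
  have dp a b x : derivable (pd a H) x (basisv R b) by apply: Ck_der (Ck_hpoly 1 (hp a)).
  have E2 a b : pd a (pd b (fun w => w 0 l * H w)) = fun w : 'rV[R]_n =>
     w 0 l * pd a (pd b H) w + (a == l)%:R * pd b H w + (b == l)%:R * pd a H w.
    rewrite E pdD; last first.
    - by move=> w; apply: Ck_der (Ck_hpoly 1 (hpolyZ _ hH)).
    - by move=> w; apply: Ck_der (Ck_hpoly 1 (hpoly_X l (hp b))).
    rewrite (pdM (dl a) (dp b a)) pdZ; last exact: dH.
    by rewrite pd_coord; apply/funext => w /=; rewrite [pd b H w * _]mulrC.
  by rewrite !E2 IH; apply/funext => w; ring.
- have dH a x : derivable H x (basisv R a) by apply: Ck_der (Ck_hpoly 1 hH).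
  have dK a x : derivable K x (basisv R a) by apply: Ck_der (Ck_hpoly 1 hK).
  have dpH a b x : derivable (pd a H) x (basisv R b) by apply: Ck_der (Ck_hpoly 1 (hpoly_pd a hH)).
  have dpK a b x : derivable (pd a K) x (basisv R b) by apply: Ck_der (Ck_hpoly 1 (hpoly_pd a hK)).
  by rewrite (pdD (dH j) (dK j)) (pdD (dH i) (dK i)) (pdD (dpH j i) (dpK j i)) (pdD (dpH i j) (dpK i j)) IH IK.
Qed.

Lemma pd_sym_polyf F i j : polyf F -> pd i (pd j F) = pd j (pd i F).
Proof.
case=> d; elim=> [|e H K hH IH hK]; first by rewrite !pd_cst.
have dH a x : derivable H x (basisv R a) by apply: Ck_der (Ck_polyd 1 hH).
have dK a x : derivable K x (basisv R a) by apply: Ck_der (Ck_hpoly 1 hK).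
have dpH a b x : derivable (pd a H) x (basisv R b).
  by apply: Ck_der (Ck_polyf 1 (polyf_pd a (ex_intro _ e hH))).
have dpK a b x : derivable (pd a K) x (basisv R b) by apply: Ck_der (Ck_hpoly 1 (hpoly_pd a hK)).
by rewrite (pdD (dH j) (dK j)) (pdD (dH i) (dK i)) (pdD (dpH j i) (dpK j i)) (pdD (dpH i j) (dpK i j)) IH (pd_sym_hpoly i j hK).
Qed.

(** Schwarz's theorem, inherited from polynomials by approximation together with second
    derivatives. *)
Lemma pd_sym F i j w : Ck 2 F -> pd i (pd j F) w = pd j (pd i F) w.
Proof.
move=> hF; apply/eqP; rewrite -subr_eq0 -normr_le0; apply/ler_addgt0Pr => e e0; rewrite add0r.
have e20 : 0 < e / 2 by rewrite divr_gt0.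
have [P hP h] := C2_approx `|w| hF e20.
have [_ _ h2] := h w (lexx _); have a := h2 i j; have b := h2 j i.
rewrite (_ : _ - _ = (pd j (pd i P) w - pd j (pd i F) w) - (pd i (pd j P) w - pd i (pd j F) w)).
  by apply: le_trans (ler_normB _ _) _; lra.
by rewrite (pd_sym_polyf i j hP); ring.
Qed.

End Sym.

Section MatrixFields.
Variables (R : realType) (n : nat).
Implicit Types (F G : 'rV[R]_n -> R) (w : 'rV[R]_n) (i j a b : 'I_n) (M N : 'rV[R]_n -> 'M[R]_n).

Definition Cm k M := forall a b, Ck k (fun w => M w a b).
Definition pdm i M w : 'M[R]_n := \matrix_(a, b) pd i (fun w => M w a b) w.

Lemma Cm_der M i a b w : Cm 1 M -> derivable (fun w => M w a b) w (basisv R i).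
Proof. by move=> h; apply: Ck_der (h a b). Qed.

Lemma CmM k M N : Cm k M -> Cm k N -> Cm k (fun w => M w *m N w).
Proof.
move=> hM hN a b; rewrite (_ : (fun w => _) = fun w => \sum_c M w a c * N w c b).
  by apply: Ck_sum => c; exact: (CkM (hM a c) (hN c b)).
by apply/funext => w; rewrite mxE.
Qed.

Lemma CmB k M N : Cm k M -> Cm k N -> Cm k (fun w => M w - N w).
Proof.
move=> hM hN a b; rewrite (_ : (fun w => _) = fun w => M w a b - N w a b).
  exact: (CkB (hM a b) (hN a b)).
by apply/funext => w; rewrite !mxE.
Qed.

Lemma Cm_scalar k F : Ck k F -> Cm k (fun w => (F w)%:M).
Proof.
move=> hF a b; rewrite (_ : (fun w => _) = fun w => (a == b)%:R * F w); first exact: CkZ.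
by apply/funext => w; rewrite !mxE; case: eqP => _; rewrite ?mul1r ?mul0r.
Qed.

Lemma Ck_tr k M : Cm k M -> Ck k (fun w => \tr (M w)).
Proof. by move=> hM; apply: Ck_sum => a; exact: hM. Qed.

Lemma pdmM i M N w : Cm 1 M -> Cm 1 N ->
  pdm i (fun w => M w *m N w) w = pdm i M w *m N w + M w *m pdm i N w.
Proof.
move=> hM hN; apply/matrixP => a b; rewrite !mxE.
have dM c x := @Cm_der M i a c x hM; have dN c x := @Cm_der N i c b x hN.
rewrite (_ : (fun w => _) = fun w => \sum_c ((fun w => M w a c) \* (fun w => N w c b)) w); last first.
  by apply/funext => x; rewrite mxE.
rewrite pd_sum; last by move=> c x; apply: derivableM.
rewrite -big_split /=; apply: eq_bigr => c _; rewrite (pdM (dM c) (dN c)) /= !mxE; ring.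
Qed.

Lemma pdmB i M N w : Cm 1 M -> Cm 1 N -> pdm i (fun w => M w - N w) w = pdm i M w - pdm i N w.
Proof.
move=> hM hN; apply/matrixP => a b; rewrite !mxE.
have dM x := @Cm_der M i a b x hM; have dN x := @Cm_der N i a b x hN.
rewrite (_ : (fun w => _) = (fun w => M w a b) \+ (fun w => - N w a b)); last first.
  by apply/funext => x; rewrite !mxE.
by rewrite (pdD dM (fun x => derivableN (dN x))) (pdN dN).
Qed.

Lemma pdm_scalar i F w : Ck 1 F -> pdm i (fun w => (F w)%:M) w = (pd i F w)%:M.
Proof.
move=> hF; apply/matrixP => a b; rewrite !mxE.
rewrite (_ : (fun w => _) = fun w => (a == b)%:R * F w); last first.
  by apply/funext => x; rewrite !mxE; case: eqP => _; rewrite ?mul1r ?mul0r.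
by rewrite pdZ; [case: eqP => _; rewrite ?mul1r ?mul0r|move=> x; apply: Ck_der hF].
Qed.

Lemma pd_tr i M w : Cm 1 M -> pd i (fun w => \tr (M w)) w = \tr (pdm i M w).
Proof.
move=> hM; rewrite /mxtrace pd_sum; last by move=> a x; apply: Cm_der.
by apply: eq_bigr => a _; rewrite mxE.
Qed.

Lemma Ck_sg_NT l k M : Cm l M -> Ck l (fun w => sg k (M w)) /\ Cm l (fun w => NT k (M w)).
Proof.
move=> hM; elim: k => [|k [IH1 IH2]].
  by split; [exact: Ck_cst|exact: (Cm_scalar (Ck_cst n l (1 : R)))].
have h : Ck l (fun w => sg k.+1 (M w)).
  rewrite (_ : (fun w => _) = fun w => k.+1%:R^-1 * \tr (M w *m NT k (M w))).
    by apply: CkZ; apply: Ck_tr; apply: CmM.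
  by apply/funext => w; rewrite mulrC.
by split=> //; exact: (CmB (Cm_scalar h) (CmM hM IH2)).
Qed.

Lemma Ck_sg l k M : Cm l M -> Ck l (fun w => sg k (M w)). Proof. by move=> h; exact: (Ck_sg_NT k h).1. Qed.
Lemma Cm_NT l k M : Cm l M -> Cm l (fun w => NT k (M w)). Proof. by move=> h; exact: (Ck_sg_NT k h).2. Qed.

(** The chain rule along the recursion: it certifies that the algebraic [dsg] and [dNT] are the
    actual derivatives. *)
Lemma pd_sg_NT i k M : Cm 1 M -> (forall w, pd i (fun w => sg k (M w)) w = dsg k (M w) (pdm i M w)) /\
  (forall w, pdm i (fun w => NT k (M w)) w = dNT k (M w) (pdm i M w)).
Proof.
move=> hM; elim: k => [|k [IH1 IH2]].
  split=> w; first by rewrite pd_cst.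
  by rewrite (pdm_scalar i w (Ck_cst n 1 (1 : R))) pd_cst; apply/matrixP => a b; rewrite !mxE mul0rn.
have hN := Cm_NT k hM; have h : Ck 1 (fun w => sg k.+1 (M w)) by exact: Ck_sg.
have e w : pd i (fun w => sg k.+1 (M w)) w = dsg k.+1 (M w) (pdm i M w).
  rewrite (_ : (fun w => _) = fun w => k.+1%:R^-1 * \tr (M w *m NT k (M w))); last first.
    by apply/funext => x; rewrite mulrC.
  rewrite pdZ; last by move=> x; apply: Ck_der (Ck_tr (CmM hM hN)).
  rewrite pd_tr; last exact: CmM.
  by rewrite (pdmM i w hM hN) IH2 linearD /= mulrC.
split=> // w; rewrite (pdmB i w (Cm_scalar h) (CmM hM hN)) (pdm_scalar i w h) e (pdmM i w hM hN) IH2.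
by rewrite dNTS opprD addrA.
Qed.

Lemma pd_sg i k M w : Cm 1 M -> pd i (fun w => sg k (M w)) w = dsg k (M w) (pdm i M w).
Proof. by move=> h; exact: (pd_sg_NT i k h).1. Qed.

End MatrixFields.

(** * The Hessian operator in the chart and the divergence form of its linearisation *)

Section ShapeOperator.
Variables (R : realType) (n : nat).
Implicit Types (u v : 'rV[R]_n -> R) (w : 'rV[R]_n) (i j a b : 'I_n).

Definition phi w : R := 2 / (1 + nsq w).
Definition qf v w : R := v w - euler v w.
Definition hess v w : 'M[R]_n := \matrix_(i, j) pd i (pd j v) w.
(** If a function on the cap reads [phi * v] in the chart, then [Sh v w] divided by [phi w] is the
    matrix, in an orthonormal frame, of its Hessian plus the function times the metric (see
    [Sh_pull]), and the boundary condition reads [qf v = 0]. *)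
Definition Sh v w : 'M[R]_n := hess v w + (phi w * qf v w)%:M.

Lemma nsq1_gt0 w : 0 < 1 + nsq w. Proof. by rewrite ltr_pwDl // nsq_ge0. Qed.
Lemma phi_gt0 w : 0 < phi w. Proof. by rewrite divr_gt0 // nsq1_gt0. Qed.

Lemma Ck_phi k : Ck k phi.
Proof.
apply: CkZ; apply: CkV => [w|]; first by rewrite gt_eqF // nsq1_gt0.
exact: (CkD (Ck_cst n k (1 : R)) (Ck_nsq R n k)).
Qed.

Lemma pd_phi i w : pd i phi w = - phi w ^+ 2 * w 0 i.
Proof.
have h : Ck 1 (fun w : 'rV[R]_n => 1 + nsq w) := CkD (Ck_cst n 1 (1 : R)) (Ck_nsq R n 1).
have n0 (x : 'rV[R]_n) : 1 + nsq x != 0 by exact: lt0r_neq0 (nsq1_gt0 x).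
rewrite /phi pdZ; last by move=> x; apply: Ck_der (CkV n0 h).
rewrite pdV //; last by move=> x; apply: Ck_der h.
have dN x : derivable (@nsq R n) x (basisv R i) by apply: Ck_der (Ck_nsq R n 1).
rewrite (_ : (fun w => _) = (fun=> 1) \+ @nsq R n) // (pdD (fun x => derivable_cst _ _ _) dN) /=.
by rewrite pd_cst pd_nsq /= add0r; field.
Qed.

Lemma Ck_euler k v : Ck k.+1 v -> Ck k (euler v).
Proof. by move=> hv; apply: Ck_sum => i; exact: (CkM (Ck_coord R k i) (Ck_pd i hv)). Qed.

Lemma Ck_qf k v : Ck k.+1 v -> Ck k (qf v).
Proof. by move=> hv; exact: (CkB (CkW hv) (Ck_euler hv)). Qed.

Lemma Cm_Sh k v : Ck k.+2 v -> Cm k (Sh v).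
Proof.
move=> hv a b; rewrite (_ : (fun w => _) = fun w => pd a (pd b v) w + (phi w * qf v w)%:M a b).
  by apply: CkD (Ck_pd a (Ck_pd b hv)) _; apply: Cm_scalar; exact: (CkM (Ck_phi k) (CkW (Ck_qf hv))).
by apply/funext => w; rewrite !mxE.
Qed.

Lemma Sh_sym v w : Ck 2 v -> (Sh v w)^T = Sh v w.
Proof.
move=> hv; apply/matrixP => a b; rewrite !mxE (pd_sym _ _ _ hv) eq_sym.
by case: eqP.
Qed.

Lemma pd_qf i v w : Ck 2 v -> pd i (qf v) w = - (w *m hess v w) 0 i.
Proof.
move=> hv; have dv x : derivable v x (basisv R i) by apply: Ck_der hv.
have hE := Ck_euler hv; have dE x : derivable (euler v) x (basisv R i) by apply: Ck_der hE.
have dl a x := @derivable_coord R n i a x.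
have dp a x : derivable (pd a v) x (basisv R i) by apply: Ck_der (Ck_pd a hv).
rewrite /qf (_ : (fun w => _) = v \+ (fun w => - euler v w)) // (pdD dv (fun x => derivableN (dE x))) /=.
rewrite (pdN dE) /euler pd_sum; last by move=> a x; exact: (derivableM (dl a x) (dp a x)).
under eq_bigr do rewrite (pdM (dl _) (dp _)) /= pd_coord.
rewrite big_split /= (bigD1 i) //= [X in _ - (_ + X)](bigD1 i) //= eqxx mulr1.
rewrite [X in _ + (_ + X)]big1 ?addr0 => [|a ai]; last by rewrite eq_sym (negbTE ai) mulr0.
have hs a : hess v w a i = pd i (pd a v) w by rewrite mxE (pd_sym _ _ _ hv).
have -> : (w *m hess v w) 0 i = \sum_a w 0 a * pd i (pd a v) w.
  by rewrite mxE; apply: eq_bigr => a _; rewrite hs.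
rewrite [in RHS](bigD1 i) //=.
by ring.
Qed.

Lemma pd_phi_qf i v w : Ck 2 v -> pd i (phi \* qf v) w = - phi w * (w *m Sh v w) 0 i.
Proof.
move=> hv; have d1 x : derivable phi x (basisv R i) by apply: Ck_der (Ck_phi 1).
have d2 x : derivable (qf v) x (basisv R i) by apply: Ck_der (Ck_qf hv).
rewrite (pdM d1 d2) /= (pd_qf _ _ hv) pd_phi /Sh mulmxDr mul_mx_scalar !mxE; ring.
Qed.

(** Third derivatives of a polynomial commute, so the antisymmetric part of the derivative of [Sh v]
    only involves the gradient of [phi * qf v], which is again expressed by [Sh v]. Thus [Sh v]
    satisfies Codazzi's equation up to terms produced by the conformal factor. *)
Lemma codazzi v w i j l : polyf v ->
  pdm i (Sh v) w l j = pdm j (Sh v) w l i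
    - phi w * ((w *m Sh v w) 0 i * (l == j)%:R - (w *m Sh v w) 0 j * (l == i)%:R).
Proof.
move=> hv; have hv2 := Ck_polyf 2 hv.
have E (a b c : 'I_n) : pdm a (Sh v) w b c = pd a (pd b (pd c v)) w - phi w * ((w *m Sh v w) 0 a * (b == c)%:R).
  rewrite mxE (_ : (fun w => _) = (pd b (pd c v)) \+ (fun w => (b == c)%:R * (phi \* qf v) w)); last first.
    by apply/funext => x; rewrite !mxE /=; case: eqP => _; rewrite ?mul1r ?mul0r.
  have h3 := Ck_polyf 3 hv.
  have hpq : Ck 1 (phi \* qf v) := CkM (Ck_phi 1) (Ck_qf hv2).
  have d1 x : derivable (pd b (pd c v)) x (basisv R a) by apply: Ck_der (Ck_pd b (Ck_pd c h3)).
  have d2 x : derivable (phi \* qf v) x (basisv R a) by apply: Ck_der hpq.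
  have d3 x : derivable (fun w => (b == c)%:R * (phi \* qf v) w) x (basisv R a) by apply: Ck_der (CkZ _ hpq).
  by rewrite (pdD d1 d3) /= (pdZ _ d2) (pd_phi_qf a w hv2); ring.
rewrite (E i l j) (E j l i); have hp c := polyf_pd c hv.
rewrite (pd_sym_polyf l j hv) (pd_sym_polyf i j (hp l)) (pd_sym_polyf i l hv); ring.
Qed.

Definition Divm (M : 'rV[R]_n -> 'M[R]_n) w : 'rV[R]_n := \row_j \sum_i pdm i M w i j.

(** In flat coordinates the Newton tensors are not divergence free: Codazzi leaves an algebraic
    remainder proportional to [phi]. Induction on [k], each step differentiating the recursion and
    contracting [codazzi] with the symmetric tensor [T]. *)
Lemma Div_NT k v w : polyf v -> (k <= n)%N ->
  Divm (fun w => NT k (Sh v w)) w =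
  - ((n - k)%:R * phi w) *: (sg k (Sh v w) *: w - w *m NT k (Sh v w)).
Proof.
move=> hv; have hv2 := Ck_polyf 2 hv; have hv3 := Ck_polyf 3 hv.
have hS := Cm_Sh hv3; set S := Sh v w.
have sS : S^T = S by apply: Sh_sym.
elim: k => [|k IH] kn.
  have -> : Divm (fun w => NT 0 (Sh v w)) w = 0.
    apply/rowP => j; rewrite !mxE big1 // => i _; rewrite mxE.
    by rewrite (_ : (fun w => _) = fun=> (i == j)%:R) ?pd_cst //; apply/funext => x; rewrite mxE.
  by rewrite scale1r mulmx1 subrr scaler0.
have {IH} := IH (ltnW kn); set T := NT k S; set s := sg k S => IH.
have hT := Cm_NT k hS; have hs := Ck_sg k.+1 hS.
have sT : T^T = T by apply: NT_sym.
have E j : (Divm (fun w => NT k.+1 (Sh v w)) w) 0 j = - ((Divm (fun w => NT k (Sh v w)) w) *m S) 0 j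
    + phi w * ((w *m S *m T) 0 j - \tr T * (w *m S) 0 j).
  rewrite mxE.
  have F i : pdm i (fun w => NT k.+1 (Sh v w)) w i j =
      (i == j)%:R * \tr (T *m pdm i (Sh v) w) - (pdm i (fun w => NT k (Sh v w)) w *m S) i j
        - (T *m pdm i (Sh v) w) i j.
    have -> : (fun w => NT k.+1 (Sh v w)) = fun w => (sg k.+1 (Sh v w))%:M - NT k (Sh v w) *m Sh v w.
      by apply/funext => x; rewrite NTS NT_comm.
    rewrite (pdmB i w (Cm_scalar hs) (CmM hT hS)) (pdm_scalar i w hs) (pdmM i w hT hS).
    rewrite (pd_sg i k.+1 w hS) (dsgE k _ sS) !mxE opprD addrA.
    by case: eqP => _; rewrite ?mulr1n ?mulr0n ?mul1r ?mul0r.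
  under eq_bigr do rewrite F.
  rewrite !sumrB (bigD1 j) //= eqxx mul1r big1 ?addr0 => [|i /negbTE ->]; last by rewrite mul0r.
  have G1 : \sum_i (pdm i (fun w => NT k (Sh v w)) w *m S) i j = ((Divm (fun w => NT k (Sh v w)) w) *m S) 0 j.
    rewrite mxE; under eq_bigr do rewrite mxE.
    by rewrite exchange_big /=; apply: eq_bigr => l _; rewrite [Divm _ _ _ _]mxE mulr_suml.
  have G2 : \sum_i (T *m pdm i (Sh v) w) i j = \tr (T *m pdm j (Sh v) w)
     - phi w * ((w *m S *m T) 0 j - \tr T * (w *m S) 0 j).
    rewrite [\tr _]/mxtrace; under eq_bigr do rewrite mxE.
    under [X in _ = X - _]eq_bigr do rewrite mxE.
    have -> : (w *m S *m T) 0 j = \sum_i \sum_l T i l * ((w *m S) 0 i * (l == j)%:R).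
      rewrite mxE; apply: eq_bigr => i _; rewrite (bigD1 j) //= eqxx mulr1 big1 ?addr0 1?mulrC //.
      by move=> l /negbTE ->; rewrite !mulr0.
    have -> : \tr T * (w *m S) 0 j = \sum_i \sum_l T i l * ((w *m S) 0 j * (l == i)%:R).
      rewrite /mxtrace mulr_suml; apply: eq_bigr => i _; rewrite (bigD1 i) //= eqxx mulr1 big1 ?addr0 //.
      by move=> l /negbTE ->; rewrite !mulr0.
    rewrite -sumrB mulr_sumr -sumrB; apply: eq_bigr => i _; rewrite -sumrB mulr_sumr -sumrB.
    apply: eq_bigr => l _; rewrite (codazzi w i j l hv) -/S; ring.
  rewrite G1 G2; ring.
apply/rowP => j; rewrite E IH tr_NT ?(ltnW kn) // -/s -/T.
have TS : w *m T *m S = w *m S *m T by rewrite -!mulmxA NT_comm.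
have nk : (n - k)%:R = (n - k.+1)%:R + 1 :> R by rewrite natr1 subnSK.
have rZ (c : R) (x : 'rV[R]_n) : (c *: x) 0 j = c * x 0 j by rewrite mxE.
have rB (x y : 'rV[R]_n) : (x - y) 0 j = x 0 j - y 0 j by rewrite !mxE.
rewrite -scalemxAl mulmxBl -scalemxAl TS NTS mulmxBr mul_mx_scalar [w *m (S *m _)]mulmxA.
by rewrite !(rZ, rB) nk -/T; ring.
Qed.

(** The weight is dictated by [Div_NT]: the gradient of [phi ^+ (n - k)] cancels the part of the
    divergence of [NT k] that contains [NT k] itself. *)
Definition Lop k h v w := phi w ^+ (n - k) * \tr (NT k (Sh h w) *m Sh v w).

Definition wronsk u v w : 'rV[R]_n := \row_j (u w * pd j v w - v w * pd j u w).

Definition flux k h u v i w := phi w ^+ (n - k) * (wronsk u v w *m NT k (Sh h w)) 0 i.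

Lemma Ck_wronsk k u v j : Ck k.+1 u -> Ck k.+1 v -> Ck k (fun w => wronsk u v w 0 j).
Proof.
move=> hu hv; rewrite (_ : (fun w => _) = fun w => u w * pd j v w - v w * pd j u w).
  exact: (CkB (CkM (CkW hu) (Ck_pd j hv)) (CkM (CkW hv) (Ck_pd j hu))).
by apply/funext => w; rewrite mxE.
Qed.

Lemma Ck_flux k h u v i : Ck 3 h -> Ck 2 u -> Ck 2 v -> Ck 1 (flux k h u v i).
Proof.
move=> hh hu hv; apply: CkM; first exact: (Ck_exp (n - k) (Ck_phi 1)).
rewrite (_ : (fun w => _) = fun w => \sum_j wronsk u v w 0 j * NT k (Sh h w) j i).
  apply: Ck_sum => j; exact: (CkM (Ck_wronsk j hu hv) (Cm_NT k (Cm_Sh hh) j i)).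
by apply/funext => w; rewrite mxE.
Qed.

Lemma pd_wronsk i j u v w : Ck 2 u -> Ck 2 v ->
  pd i (fun w => wronsk u v w 0 j) w = u w * pd i (pd j v) w - v w * pd i (pd j u) w
    + (pd i u w * pd j v w - pd i v w * pd j u w).
Proof.
move=> hu hv; rewrite (_ : (fun w => _) = (u \* pd j v) \+ (fun w => - (v \* pd j u) w)); last first.
  by apply/funext => x; rewrite mxE.
have du x : derivable u x (basisv R i) by apply: Ck_der hu.
have dv x : derivable v x (basisv R i) by apply: Ck_der hv.
have dpu x : derivable (pd j u) x (basisv R i) by apply: Ck_der (Ck_pd j hu).
have dpv x : derivable (pd j v) x (basisv R i) by apply: Ck_der (Ck_pd j hv).
have d1 x : derivable (u \* pd j v) x (basisv R i) by exact: (derivableM (du x) (dpv x)).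
have d2 x : derivable (v \* pd j u) x (basisv R i) by exact: (derivableM (dv x) (dpu x)).
rewrite (pdD d1 (fun x => derivableN (d2 x))) (pdN d2) (pdM du dpv) (pdM dv dpu) /=; ring.
Qed.

Lemma pd_phiX i m w : pd i (fun w => phi w ^+ m) w = - (m%:R * phi w) * w 0 i * phi w ^+ m.
Proof.
elim: m => [|m IH]; first by under eq_fun do rewrite expr0; rewrite pd_cst mul0r oppr0 !mul0r.
have d1 x : derivable phi x (basisv R i) by apply: Ck_der (Ck_phi 1).
have d2 x : derivable (fun w => phi w ^+ m) x (basisv R i) by apply: Ck_der (Ck_exp m (Ck_phi 1)).
rewrite (_ : (fun w => _) = phi \* (fun w => phi w ^+ m)); last by apply/funext => x; rewrite exprS.
by rewrite (pdM d1 d2) /= IH pd_phi -natr1 [phi w ^+ m.+1]exprS; ring.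
Qed.

(* div (phi^m T_k (u grad v - v grad u)) = u L v - v L u, m = n - k. *)
Lemma div_flux k h u v w : polyf h -> (k <= n)%N -> Ck 2 u -> Ck 2 v ->
  divf (flux k h u v) w = u w * Lop k h v w - v w * Lop k h u w.
Proof.
move=> ph kn hu hv; have hh := Ck_polyf 3 ph; set m := (n - k)%N.
set T := NT k (Sh h w); set p := wronsk u v w.
have hT := Cm_NT k (Cm_Sh hh).
have sT : T^T = T by apply: NT_sym; apply: Sh_sym; exact: CkW.
pose pf j w := wronsk u v w 0 j; pose Tf j i w := NT k (Sh h w) j i.
have hp j : Ck 1 (pf j) := Ck_wronsk j hu hv.
have E i : pd i (flux k h u v i) w = - (m%:R * phi w) * w 0 i * phi w ^+ m * (p *m T) 0 i
   + phi w ^+ m * \sum_j (T j i * pd i (pf j) w + p 0 j * pd i (Tf j i) w).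
  have hs : Ck 1 (fun w => \sum_j pf j w * Tf j i w).
    by apply: Ck_sum => j; exact: (CkM (hp j) (hT j i)).
  rewrite (_ : flux k h u v i = (fun w => phi w ^+ m) \* (fun w => \sum_j (pf j \* Tf j i) w)); last first.
    by apply/funext => x; rewrite /flux /= mxE.
  have d1 x : derivable (fun w => phi w ^+ m) x (basisv R i) by apply: Ck_der (Ck_exp m (Ck_phi 1)).
  have d2 x : derivable (fun w => \sum_j (pf j \* Tf j i) w) x (basisv R i) by apply: Ck_der hs.
  have d3 j x : derivable (pf j) x (basisv R i) by apply: Ck_der (hp j).
  have d4 j x : derivable (Tf j i) x (basisv R i) by apply: Ck_der (hT j i).
  rewrite (pdM d1 d2) /= pd_phiX pd_sum; last by move=> j x; exact: (derivableM (d3 j x) (d4 j x)).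
  have -> : (p *m T) 0 i = \sum_j pf j w * Tf j i w by rewrite mxE.
  rewrite addrC; congr (_ + _ * _); first by ring.
  apply: eq_bigr => j _; rewrite (pdM (d3 j) (d4 j)) /=.
  by rewrite /Tf /pf -/T -/p; ring.
rewrite /divf; under eq_bigr do rewrite E; rewrite big_split /= -[X in _ + X]mulr_sumr.
have A1 : \sum_i - (m%:R * phi w) * w 0 i * phi w ^+ m * (p *m T) 0 i =
   - (m%:R * phi w) * phi w ^+ m * (p *m T *m w^T) 0 0.
  rewrite [(_ *m w^T) 0 0]mxE mulr_sumr; apply: eq_bigr => i _; rewrite [w^T _ _]mxE; ring.
have A2 : \sum_i \sum_j (T j i * pd i (pf j) w + p 0 j * pd i (Tf j i) w) =
   \sum_i \sum_j T j i * (u w * hess v w i j - v w * hess u w i j)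
   + (p *m (Divm (fun w => NT k (Sh h w)) w)^T) 0 0.
  under eq_bigr do rewrite big_split /=; rewrite big_split /=; congr (_ + _).
    transitivity (\sum_i \sum_j T j i * (u w * hess v w i j - v w * hess u w i j)
       + \sum_i \sum_j T j i * (pd i u w * pd j v w - pd i v w * pd j u w)).
      rewrite -big_split; apply: eq_bigr => i _; rewrite -big_split; apply: eq_bigr => j _ /=.
      by rewrite (pd_wronsk i j w hu hv) [hess v w i j]mxE [hess u w i j]mxE; ring.
    rewrite -[RHS]addr0; congr (_ + _).
    (* The products of first derivatives are antisymmetric in i and j and vanish against the
       symmetric [T]. *)
    rewrite -[LHS](@mulfK _ 2) // mulr_natr mulr2n {2}exchange_big /= -big_split /= big1 ?mul0r // => i _.
    rewrite -big_split /= big1 // => j _.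
    have -> : T i j = T j i by rewrite -[in LHS]sT mxE.
    ring.
  rewrite [RHS]mxE exchange_big /=; apply: eq_bigr => j _; rewrite -mulr_sumr; congr (_ * _).
  rewrite !mxE; apply: eq_bigr => i _; rewrite mxE; congr (pd i _ w).
  apply/funext => x; have sx : (NT k (Sh h x))^T = NT k (Sh h x).
    by apply: NT_sym; apply: Sh_sym; exact: CkW.
  by rewrite /Tf -[in LHS]sx mxE.
rewrite A1 A2 (Div_NT w ph kn) -/T -/m.
have A3 : (p *m (- (m%:R * phi w) *: (sg k (Sh h w) *: w - w *m T))^T) 0 0 =
   - (m%:R * phi w) * (sg k (Sh h w) * (p *m w^T) 0 0 - (p *m T *m w^T) 0 0).
  have ipZ (c : R) (x : 'rV[R]_n) : (p *m (c *: x)^T) 0 0 = c * (p *m x^T) 0 0.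
    rewrite [LHS]mxE [in RHS]mxE mulr_sumr; apply: eq_bigr => i _; rewrite !mxE; ring.
  have ipB (x y : 'rV[R]_n) : (p *m (x - y)^T) 0 0 = (p *m x^T) 0 0 - (p *m y^T) 0 0.
    rewrite [LHS]mxE [X in _ = X - _]mxE [X in _ = _ - X]mxE -sumrB; apply: eq_bigr => i _; rewrite !mxE; ring.
  by rewrite ipZ ipB ipZ trmx_mul sT mulmxA.
rewrite A3.
(* The remaining multiple of sigma_k times the product of p and w becomes, by this identity, the
   trace parts [phi w * qf] of [Sh v] and [Sh u]. *)
have A4 : (p *m w^T) 0 0 = - (u w * qf v w - v w * qf u w).
  rewrite mxE /qf /euler; under eq_bigr do rewrite !mxE.
  rewrite mulrBr mulrBr !mulr_sumr.
  rewrite (_ : - _ = \sum_i u w * (w 0 i * pd i v w) - \sum_i v w * (w 0 i * pd i u w)); last by ring.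
  by rewrite -sumrB; apply: eq_bigr => i _; ring.
have A5 f : \tr (T *m Sh f w) = \sum_i \sum_j T j i * hess f w i j + m%:R * sg k (Sh h w) * (phi w * qf f w).
  rewrite /Sh mulmxDr linearD /= mul_mx_scalar linearZ /= tr_NT // -/m; congr (_ + _); last by rewrite mulrC.
  by rewrite /mxtrace exchange_big /=; apply: eq_bigr => i _; rewrite mxE.
rewrite A4 /Lop -/T -/m !A5.
have A6 : \sum_i \sum_j T j i * (u w * hess v w i j - v w * hess u w i j) =
   u w * (\sum_i \sum_j T j i * hess v w i j) - v w * (\sum_i \sum_j T j i * hess u w i j).
  rewrite !mulr_sumr -sumrB; apply: eq_bigr => i _; rewrite !mulr_sumr -sumrB.
  by apply: eq_bigr => j _; ring.
rewrite A6; ring.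
Qed.

End ShapeOperator.

(** * Uniform convergence of scalar and matrix fields on cubes *)

Section UniformConvergence.
Variables (R : realType) (n : nat) (a : R).
Implicit Types (F G : 'rV[R]_n -> R) (Fs Gs : nat -> 'rV[R]_n -> R) (w : 'rV[R]_n).

Definition ucv Fs F := [/\ cts F, (forall j, cts (Fs j)) &
  forall e, 0 < e -> exists N, forall j, (N <= j)%N -> forall w, `|w| <= a -> `|Fs j w - F w| <= e].

Lemma ucv_cst F : cts F -> ucv (fun=> F) F.
Proof. by move=> cF; split=> // e e0; exists 0%N => j _ w _; rewrite subrr normr0 ltW. Qed.

Lemma ucvD Fs F Gs G : ucv Fs F -> ucv Gs G -> ucv (fun j w => Fs j w + Gs j w) (fun w => F w + G w).
Proof.
move=> [cF cFs hF] [cG cGs hG]; split=> [|j|e e0]; [by ctn| |].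
  by apply: (@ctsD _ _ (Fs j) (Gs j)).
have e2 : 0 < e / 2 by rewrite divr_gt0.
have [N hN] := hF _ e2; have [M hM] := hG _ e2; exists (maxn N M) => j.
rewrite geq_max => /andP[jN jM] w wa; have := hN j jN w wa; have := hM j jM w wa.
rewrite (_ : Fs j w + Gs j w - (F w + G w) = (Fs j w - F w) + (Gs j w - G w)); last by ring.
by move=> h1 h2; apply: le_trans (ler_normD _ _) _; lra.
Qed.

Lemma ucvM Fs F Gs G : ucv Fs F -> ucv Gs G -> ucv (fun j w => Fs j w * Gs j w) (fun w => F w * G w).
Proof.
move=> [cF cFs hF] [cG cGs hG]; split=> [|j|e e0]; [by ctn| |].
  by apply: (@ctsM _ _ (Fs j) (Gs j)).
have [C hC] := cont_bounded a (ctsE cF); have [D hD] := cont_bounded a (ctsE cG).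
pose K := 2 * (`|C| + `|D| + 1); have K0 : 0 < K by rewrite mulr_gt0 // ltr_wpDl // addr_ge0.
pose d := Num.min 1 (e / K); have d0 : 0 < d by rewrite lt_min ltr01 divr_gt0.
have d1 : d <= 1 by rewrite ge_min lexx.
have dK : d * K <= e by rewrite -ler_pdivlMr // ge_min lexx orbT.
have [N hN] := hF _ d0; have [M hM] := hG _ d0; exists (maxn N M) => j.
rewrite geq_max => /andP[jN jM] w wa; have h1 := hN j jN w wa; have h2 := hM j jM w wa.
rewrite (_ : Fs j w * Gs j w - F w * G w =
  (Fs j w - F w) * (Gs j w - G w) + ((Fs j w - F w) * G w + F w * (Gs j w - G w))); last by ring.
have Cb : `|F w| <= `|C| by apply: le_trans (hC w wa) (ler_norm _).
have Db : `|G w| <= `|D| by apply: le_trans (hD w wa) (ler_norm _).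
have t1 : `|(Fs j w - F w) * (Gs j w - G w)| <= d * 1.
  by rewrite normrM; apply: ler_pM => //; exact: le_trans d1.
have t2 : `|(Fs j w - F w) * G w| <= d * `|D| by rewrite normrM; apply: ler_pM.
have t3 : `|F w * (Gs j w - G w)| <= `|C| * d by rewrite normrM; apply: ler_pM.
have t4 := ler_normD ((Fs j w - F w) * (Gs j w - G w)) ((Fs j w - F w) * G w + F w * (Gs j w - G w)).
have t5 := ler_normD ((Fs j w - F w) * G w) (F w * (Gs j w - G w)).
have d2 : 0 <= d * (`|C| + `|D| + 1) by rewrite mulr_ge0 ?addr_ge0 // ltW.
by move: dK; rewrite /K; lra.
Qed.

Lemma ucv_sum (I : Type) (s : seq I) (Fs : I -> nat -> 'rV[R]_n -> R) (F : I -> 'rV[R]_n -> R) :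
  (forall l, ucv (Fs l) (F l)) -> ucv (fun j w => \sum_(l <- s) Fs l j w) (fun w => \sum_(l <- s) F l w).
Proof.
move=> h; elim: s => [|l s IH].
  rewrite big_nil_fun (_ : (fun _ : nat => _) = fun=> fun=> 0).
    by apply: ucv_cst; exact: cts_cst.
  by apply/funext => j; rewrite big_nil_fun.
rewrite big_cons_fun (_ : (fun j : nat => _) = fun j w => Fs l j w + \sum_(l <- s) Fs l j w).
  exact: (ucvD (h l) IH).
by apply/funext => j; rewrite big_cons_fun.
Qed.

Lemma ucv_ext Fs F Gs G : (forall j w, Fs j w = Gs j w) -> (forall w, F w = G w) -> ucv Fs F -> ucv Gs G.
Proof.
move=> h1 h2; have -> : Fs = Gs by apply/funext => j; apply/funext => w.
by have -> : F = G by apply/funext => w.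
Qed.

Lemma ucvZ c Fs F : ucv Fs F -> ucv (fun j w => c * Fs j w) (fun w => c * F w).
Proof. by move=> h; exact: (ucvM (ucv_cst (cts_cst n c)) h). Qed.

Lemma ucvB Fs F Gs G : ucv Fs F -> ucv Gs G -> ucv (fun j w => Fs j w - Gs j w) (fun w => F w - G w).
Proof.
move=> hF hG; apply: ucv_ext (ucvD hF (ucvZ (-1) hG)) => [j w|w]; by rewrite mulN1r.
Qed.

Implicit Types (Ms Ns : nat -> 'rV[R]_n -> 'M[R]_n) (M N : 'rV[R]_n -> 'M[R]_n).
Definition mucv Ms M := forall b c, ucv (fun j w => Ms j w b c) (fun w => M w b c).

Lemma mucvM Ms M Ns N : mucv Ms M -> mucv Ns N -> mucv (fun j w => Ms j w *m Ns j w) (fun w => M w *m N w).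
Proof.
move=> hM hN b c; have := ucv_sum (index_enum 'I_n) (fun l => ucvM (hM b l) (hN l c)).
by apply: ucv_ext => [j w|w]; rewrite mxE.
Qed.

Lemma mucv_scalar Fs F : ucv Fs F -> mucv (fun j w => (Fs j w)%:M) (fun w => (F w)%:M).
Proof.
move=> h b c; apply: ucv_ext (ucvZ (b == c)%:R h) => [j w|w].
  by rewrite mxE; case: eqP => _; rewrite ?mul1r ?mul0r.
by rewrite mxE; case: eqP => _; rewrite ?mul1r ?mul0r.
Qed.

Lemma mucvB Ms M Ns N : mucv Ms M -> mucv Ns N -> mucv (fun j w => Ms j w - Ns j w) (fun w => M w - N w).
Proof. by move=> hM hN b c; apply: ucv_ext (ucvB (hM b c) (hN b c)) => [j w|w]; rewrite !mxE. Qed.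

Lemma ucv_tr Ms M : mucv Ms M -> ucv (fun j w => \tr (Ms j w)) (fun w => \tr (M w)).
Proof. by move=> h; exact: (ucv_sum (index_enum 'I_n) (fun l => h l l)). Qed.

Lemma mucv_NT k Ms M : mucv Ms M -> mucv (fun j w => NT k (Ms j w)) (fun w => NT k (M w)).
Proof.
move=> h; elim: k => [|k IH].
  by move=> b c; apply: (ucv_cst (F := fun w => (1%:M : 'M[R]_n) b c)); exact: cts_cst.
have t : ucv (fun j w => sg k.+1 (Ms j w)) (fun w => sg k.+1 (M w)).
  apply: ucv_ext (ucvZ k.+1%:R^-1 (ucv_tr (mucvM h IH))) => [j w|w]; exact: mulrC.
exact: (mucvB (mucv_scalar t) (mucvM h IH)).
Qed.

End UniformConvergence.

(** * Green's formula under the Robin condition *)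

Section WS.
Variables (R : realType) (n : nat) (r : R).
Hypothesis r0 : 0 < r.
Implicit Types (u v h g : 'rV[R]_n -> R) (w : 'rV[R]_n) (i j : 'I_n).

Definition robin v := forall w, nsq w = r ^+ 2 -> qf v w = 0.

(** The derivative along the tangent vector [t0] vanishes. Points of the sphere near [w] are reached
    on a rationally parametrised circle through [w], so the first-order expansion
    [partial_increment] suffices. *)
Lemma boundary_gradient v w i j : Ck 1 v -> (forall w, nsq w = r ^+ 2 -> v w = 0) -> nsq w = r ^+ 2 ->
  w 0 i * pd j v w = w 0 j * pd i v w.
Proof.
move=> hv v0 wr; have [->//|ij] := eqVneq i j.
pose t0 : 'rV[R]_n := w 0 i *: basisv R j - w 0 j *: basisv R i.
have r20 : 0 < r ^+ 2 by rewrite exprn_gt0.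
pose s := nsq t0 / r ^+ 2; have s0 : 0 <= s by rewrite divr_ge0 ?nsq_ge0 // ltW.
have tl l : t0 0 l = w 0 i * (j == l)%:R - w 0 j * (i == l)%:R by rewrite !mxE.
have sumt (f : 'I_n -> R) : \sum_l t0 0 l * f l = w 0 i * f j - w 0 j * f i.
  rewrite (bigD1 i) //= (bigD1 j) 1?eq_sym //= big1 => [|l /andP[li lj]]; last first.
    by rewrite tl eq_sym (negbTE lj) eq_sym (negbTE li) /=; ring.
  by rewrite !tl !eqxx [j == i]eq_sym (negbTE ij) /=; ring.
have tw : \sum_l t0 0 l * w 0 l = 0 by rewrite sumt; ring.
pose A := \sum_l t0 0 l * pd l v w; pose B := \sum_l w 0 l * pd l v w.
suff : A = 0 by rewrite /A sumt => /eqP; rewrite subr_eq0 => /eqP.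
apply/eqP; rewrite -normr_le0; apply/ler_addgt0Pr => e0 e00; rewrite add0r.
pose K := 1 + n%:R * (`|t0| + 1); have K0 : 0 < K by rewrite ltr_pwDl // mulr_ge0 // addr_ge0.
pose e := e0 / K; have ee : 0 < e by rewrite divr_gt0.
have [d d0 hd] : exists2 d, 0 < d & forall l x, `|x - w| < d -> `|pd l v x - pd l v w| <= e.
  apply: (@delta_forall R 'I_n (fun l d => forall x, `|x - w| < d -> `|pd l v x - pd l v w| <= e)).
    by move=> l d d' dd h x xa; apply: h; apply: lt_le_trans dd.
  by move=> l; apply: continuous_at_delta => //; exact: (Ck_cont (Ck_pd l hv) (x := w)).
have key t : 0 < t -> 2 * t * (`|t0| + s * t * `|w|) < d ->
    `|A - s * t * B| <= n%:R * e * (`|t0| + s * t * `|w|).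
  move=> tt tsmall; have st0 : 0 <= s * t ^+ 2 by rewrite mulr_ge0 ?sqr_ge0.
  have st : 0 < 1 + s * t ^+ 2 by rewrite ltr_pwDl.
  (* With this [c] the point [y + w] is the second intersection of the sphere with the line through
     [w] in the direction [z]. *)
  pose c := 2 * t / (1 + s * t ^+ 2); have c0 : 0 < c by rewrite divr_gt0 // mulr_gt0.
  have c2t : c <= 2 * t by rewrite ler_pdivrMr // ler_peMr ?mulr_ge0 ?(ltW tt) // lerDl.
  pose z := t0 - (s * t) *: w; pose y := c *: z.
  have nz : `|z| <= `|t0| + s * t * `|w|.
    by apply: le_trans (ler_normB _ _) _; rewrite normrZ ger0_norm ?lexx // mulr_ge0 // ltW.
  have ny : `|y| = c * `|z| by rewrite normrZ gtr0_norm.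
  have yd : `|y| < d.
    rewrite ny; apply: le_lt_trans tsmall; apply: ler_pM => //; exact: ltW.
  have on : nsq (y + w) = r ^+ 2.
    rewrite nsqE (eq_bigr (fun l => c ^+ 2 * (t0 0 l * t0 0 l) + 2 * c * (1 - c * (s * t)) * (t0 0 l * w 0 l)
       + (1 - c * (s * t)) ^+ 2 * (w 0 l * w 0 l))); last by move=> l _; rewrite !mxE; ring.
    rewrite !big_split /= -!mulr_sumr tw -!nsqE wr mulr0 addr0.
    have -> : nsq t0 = s * r ^+ 2 by rewrite /s divfK // gt_eqF.
    by rewrite /c; field; rewrite gt_eqF.
  have := @partial_increment R n v w e d d0 (fun x xd l => conj (@Ck_der _ _ 0 v l x hv) (hd l x xd)) y yd.
  rewrite (v0 _ on) (v0 _ wr) subrr sub0r normrN.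
  have -> : \sum_l y 0 l * pd l v w = c * (A - s * t * B).
    rewrite /A /B mulr_sumr -sumrB mulr_sumr; apply: eq_bigr => l _; rewrite !mxE; ring.
  rewrite normrM (gtr0_norm c0) ny mulrCA ler_pM2l // => h; apply: (le_trans h).
  by apply: ler_wpM2l => //; rewrite mulr_ge0 // ltW.
pose k1 := s * `|B| + 1; pose k2 := s * `|w| + 1; pose k3 := 2 * (`|t0| + 1) + 1.
have k10 : 0 < k1 by rewrite ltr_wpDl // mulr_ge0.
have k20 : 0 < k2 by rewrite ltr_wpDl // mulr_ge0.
have k30 : 0 < k3 by rewrite ltr_wpDl // mulr_ge0 // addr_ge0.
pose t := Num.min (e / k1) (Num.min k2^-1 (d / k3)).
have tt : 0 < t by rewrite !lt_min; apply/and3P; split; [exact: divr_gt0|rewrite invr_gt0|exact: divr_gt0].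
have t1 : t * k1 <= e by rewrite -ler_pdivlMr // ge_min lexx.
have t2 : t * k2 <= 1 by rewrite -ler_pdivlMr // mul1r !ge_min lexx orbT.
have t3 : t * k3 <= d by rewrite -ler_pdivlMr // !ge_min lexx !orbT.
have w1 : s * t * `|w| <= 1 by move: t2; rewrite /k2; have := tt; nra.
have tb : s * t * `|B| <= e by move: t1; rewrite /k1; have := tt; nra.
have := key t tt _; have h0 : 2 * t * (`|t0| + s * t * `|w|) < d.
  apply: lt_le_trans t3; rewrite /k3.
  have : 2 * t * (`|t0| + s * t * `|w|) <= 2 * t * (`|t0| + 1).
    by apply: ler_wpM2l; [rewrite mulr_ge0 // ltW|rewrite lerD2l].
  by have := tt; lra.
move=> /(_ h0) h1.
have h2 : n%:R * e * (`|t0| + s * t * `|w|) <= n%:R * e * (`|t0| + 1).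
  by apply: ler_wpM2l; [rewrite mulr_ge0 // ltW|rewrite lerD2l].
have h3 : `|A| <= `|A - s * t * B| + `|s * t * B|.
  by rewrite -{1}(subrK (s * t * B) A) ler_normD.
have h4 : `|s * t * B| = s * t * `|B| by rewrite normrM ger0_norm // mulr_ge0 // ltW.
have h5 : e * K = e0 by rewrite /e divfK // gt_eqF.
by rewrite -h5 /K; move: h3; rewrite h4; lra.
Qed.

(** By [pd_qf], [w *m hess v w] is minus the gradient of [qf v]. As [qf v] vanishes on the sphere,
    this gradient is radial. *)
Lemma Sh_boundary v w : Ck 2 v -> robin v -> nsq w = r ^+ 2 ->
  exists c, w *m Sh v w = c *: w.
Proof.
move=> hv bv wr; have r20 : 0 < r ^+ 2 by rewrite exprn_gt0.
have g i j := boundary_gradient i j (Ck_qf hv) bv wr.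
pose c := - \sum_l w 0 l * pd l (qf v) w / r ^+ 2 + phi w * qf v w.
exists c; apply/rowP => i.
have -> : (w *m Sh v w) 0 i = - pd i (qf v) w + phi w * qf v w * w 0 i.
  by rewrite (pd_qf _ _ hv) opprK /Sh mulmxDr mul_mx_scalar !mxE.
have -> : (c *: w) 0 i = c * w 0 i by rewrite mxE.
rewrite /c mulrDl; congr (_ + _); rewrite mulNr; congr (- _).
rewrite mulr_suml; under eq_bigr => l _.
  rewrite (_ : w 0 l * pd l (qf v) w / r ^+ 2 * w 0 i = (w 0 i * pd l (qf v) w) * w 0 l / r ^+ 2); last by ring.
  rewrite g (_ : w 0 l * pd i (qf v) w * w 0 l / r ^+ 2 = (w 0 l * w 0 l) * (pd i (qf v) w / r ^+ 2)); last by ring.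
over.
by rewrite -mulr_suml -nsqE wr mulrC divfK // gt_eqF.
Qed.

Lemma NT_eigen k (M : 'M[R]_n) (x : 'rV[R]_n) c : x *m M = c *: x -> exists d, x *m NT k M = d *: x.
Proof.
move=> xM; elim: k => [|k [d IH]]; first by exists 1; rewrite mulmx1 scale1r.
exists (sg k.+1 M - c * d).
by rewrite NTS mulmxBr mul_mx_scalar mulmxA xM -scalemxAl IH scalerA scalerBl.
Qed.

Definition grad g w : 'rV[R]_n := \row_i pd i g w.
Definition pair_T k h (x y : 'rV[R]_n) w : R := phi w ^+ (n - k) * (x *m NT k (Sh h w) *m y^T) 0 0.

Lemma pair_TE k h x y w : pair_T k h x y w =
  phi w ^+ (n - k) * \sum_i \sum_j x 0 i * NT k (Sh h w) i j * y 0 j.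
Proof.
rewrite /pair_T mxE; congr (_ * _).
under eq_bigr do rewrite !mxE mulr_suml; rewrite exchange_big /=.
by apply: eq_bigr => i _; apply: eq_bigr => j _.
Qed.

Lemma pair_T_sym k h x y w : Ck 2 h -> pair_T k h x y w = pair_T k h y x w.
Proof.
move=> hh; have sT : (NT k (Sh h w))^T = NT k (Sh h w) by apply: NT_sym; exact: Sh_sym.
rewrite /pair_T; congr (_ * _); have tr11 (M : 'M[R]_1) : M^T 0 0 = M 0 0 by rewrite mxE.
by rewrite -[LHS]tr11 !trmx_mul trmxK sT mulmxA.
Qed.

Lemma Cm_cts k (M : 'rV[R]_n -> 'M[R]_n) i j : Cm k M -> cts (fun w => M w i j).
Proof. by move=> h; exact: Ck_cts (h i j). Qed.

Lemma cts_phiX m : cts (fun w : 'rV[R]_n => phi w ^+ m).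
Proof. exact: Ck_cts (Ck_exp m (Ck_phi R n 0)). Qed.

Lemma cts_Lop k h v : Ck 2 h -> Ck 2 v -> cts (Lop k h v).
Proof.
move=> hh hv; apply: ctsM; first exact: cts_phiX.
exact: Ck_cts (Ck_tr (CmM (Cm_NT k (Cm_Sh hh)) (Cm_Sh hv))).
Qed.

Lemma cts_pair_T k h (X Y : 'rV[R]_n -> 'rV[R]_n) : Ck 2 h -> (forall i, cts (fun w => X w 0 i)) ->
  (forall i, cts (fun w => Y w 0 i)) -> cts (fun w => pair_T k h (X w) (Y w) w).
Proof.
move=> hh cX cY; have cT i j := Cm_cts i j (Cm_NT k (Cm_Sh hh)).
have -> : (fun w => pair_T k h (X w) (Y w) w) = fun w => phi w ^+ (n - k) *
    \sum_i \sum_j X w 0 i * NT k (Sh h w) i j * Y w 0 j.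
  by apply/funext => w; rewrite pair_TE.
apply: ctsM; first exact: cts_phiX.
apply: cts_sum => i; apply: cts_sum => j; apply: ctsM => //; exact: ctsM.
Qed.

(** Only [h] is replaced by polynomials, because the flux differentiates it three times; [u] and [v]
    enter the flux through first derivatives. For polynomial [h] the identity is [div_flux] for a
    C^1 field, and both sides involve at most second derivatives of [h] in the limit. *)
Lemma WS_weak k h u v g : (k <= n)%N -> Ck 2 h -> Ck 2 u -> Ck 2 v -> Ck 1 g ->
  weak_div r (fun w => g w * (u w * Lop k h v w - v w * Lop k h u w) + pair_T k h (grad g w) (wronsk u v w) w)
             (fun w => g w * pair_T k h (wronsk u v w) w w).
Proof.
move=> kn hh hu hv hg.
have cg := Ck_cts hg; have cu := Ck_cts hu; have cv := Ck_cts hv.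
have cgr i : cts (fun w => grad g w 0 i).
  by rewrite (_ : (fun w => _) = pd i g); [exact: Ck_cts (Ck_pd i hg)|apply/funext => w; rewrite mxE].
have cwr i : cts (fun w => wronsk u v w 0 i) := Ck_cts (Ck_wronsk i hu hv).
have cD f : Ck 2 f -> cts (fun w => g w * (u w * Lop k f v w - v w * Lop k f u w) + pair_T k f (grad g w) (wronsk u v w) w).
  move=> hf; have c1 := cts_Lop k hf hv; have c2 := cts_Lop k hf hu.
  by apply: ctsD; [ctn|exact: cts_pair_T].
have cN f : Ck 2 f -> cts (fun w => g w * pair_T k f (wronsk u v w) w w).
  by move=> hf; apply: ctsM => //; apply: (@cts_pair_T k f (wronsk u v) (fun w => w)) => // i; exact: cts_coord.
apply: weak_div_lim; [exact: r0|exact: cD|exact: cN|].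
have /boolp.choice[P hP] : forall j : nat, exists P, polyf P /\ forall w, `|w| <= r + 2 ->
  [/\ `|P w - h w| <= j.+1%:R^-1, forall i, `|pd i P w - pd i h w| <= j.+1%:R^-1 &
      forall i l, `|pd i (pd l P) w - pd i (pd l h) w| <= j.+1%:R^-1].
  move=> j; have e0 : 0 < j.+1%:R^-1 :> R by rewrite invr_gt0 ltr0Sn.
  by have [P hP hPh] := C2_approx (r + 2) hh e0; exists P.
have small (e : R) : 0 < e -> exists N, forall j : nat, (N <= j)%N -> j.+1%:R^-1 <= e.
  move=> e0; have [N _ hN] := near_infty_natSinv_lt (PosNum e0).
  by exists N => j Nj; apply: ltW; exact: hN.
have cP (j l : nat) : Ck l (P j) := Ck_polyf l (hP j).1.
have u0 : ucv (r + 2) P h.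
  split=> [|j|e /small[N hN]]; [exact: (Ck_cts hh)|exact: (Ck_cts (cP j 0%N))|].
  by exists N => j /hN je w wa; have [h1 _ _] := (hP j).2 w wa; exact: le_trans je.
have u1 i : ucv (r + 2) (fun j : nat => pd i (P j)) (pd i h).
  split=> [|j|e /small[N hN]]; [exact: (Ck_cts (Ck_pd i hh))|exact: (Ck_cts (Ck_pd i (cP j 1%N)))|].
  by exists N => j /hN je w wa; have [_ h1 _] := (hP j).2 w wa; exact: le_trans je.
have u2 i l : ucv (r + 2) (fun j : nat => pd i (pd l (P j))) (pd i (pd l h)).
  split=> [|j|e /small[N hN]]; [exact: (Ck_cts (Ck_pd i (Ck_pd l hh)))|exact: (Ck_cts (Ck_pd i (Ck_pd l (cP j 2%N))))|].
  by exists N => j /hN je w wa; have [_ _ h1] := (hP j).2 w wa; exact: le_trans je.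
have cst_ucv (F : 'rV[R]_n -> R) : cts F -> ucv (r + 2) (fun=> F) F by exact: ucv_cst.
have cphi : cts (@phi R n) := Ck_cts (Ck_phi R n 0).
have uS : mucv (r + 2) (fun j : nat => Sh (P j)) (Sh h).
  have uq : ucv (r + 2) (fun j : nat => qf (P j)) (qf h).
    apply: (ucvB u0); apply: (ucv_sum (index_enum 'I_n)) => i.
    by apply: ucvM (u1 i); apply: cst_ucv; exact: cts_coord.
  move=> b c; have := ucvD (u2 b c) (mucv_scalar (ucvM (cst_ucv _ cphi) uq) b c).
  by apply: ucv_ext => [j' w|w]; rewrite !mxE.
have uT := mucv_NT k uS.
have up (X Y : 'rV[R]_n -> 'rV[R]_n) : (forall i, cts (fun w => X w 0 i)) -> (forall i, cts (fun w => Y w 0 i)) ->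
    ucv (r + 2) (fun (j : nat) w => pair_T k (P j) (X w) (Y w) w) (fun w => pair_T k h (X w) (Y w) w).
  move=> cX cY; have uX i := cst_ucv _ (cX i); have uY i := cst_ucv _ (cY i).
  have := ucvM (cst_ucv _ (cts_phiX (n - k))) (ucv_sum (index_enum 'I_n) (fun i =>
    ucv_sum (index_enum 'I_n) (fun l => ucvM (ucvM (uX i) (uT i l)) (uY l)))).
  by apply: ucv_ext => [j' w|w]; rewrite pair_TE.
have uL f : Ck 2 f -> ucv (r + 2) (fun j : nat => Lop k (P j) f) (Lop k h f).
  move=> hf; have mf : mucv (r + 2) (fun=> Sh f) (Sh f).
    by move=> b c; apply: cst_ucv; exact: Cm_cts (Cm_Sh hf).
  exact: (ucvM (cst_ucv _ (cts_phiX (n - k))) (ucv_tr (mucvM uT mf))).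
have [_ _ UD] := ucvD (ucvM (cst_ucv _ cg) (ucvB (ucvM (cst_ucv _ cu) (uL v hv)) (ucvM (cst_ucv _ cv) (uL u hu))))
   (up _ _ cgr cwr).
have [_ _ UN] := ucvM (cst_ucv _ cg) (up _ (fun w => w) cwr (fun i => cts_coord R i)).
move=> d d0; have [N1 hN1] := UD d d0; have [N2 hN2] := UN d d0; pose j := maxn N1 N2.
exists (fun w => g w * (u w * Lop k (P j) v w - v w * Lop k (P j) u w) + pair_T k (P j) (grad g w) (wronsk u v w) w).
exists (fun w => g w * pair_T k (P j) (wronsk u v w) w w).
split; [exact: cD|exact: cN| |]; last first.
  by move=> w wa; split; [apply: hN1 => //; exact: leq_maxl|apply: hN2 => //; exact: leq_maxr].
pose X i := g \* flux k (P j) u v i.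
have hX i : Ck 1 (X i) := CkM hg (Ck_flux k i (cP j 3%N) hu hv).
have := weak_div_C1 r0 hX.
have pt x y w : pair_T k (P j) x y w = \sum_i (phi w ^+ (n - k) * (x *m NT k (Sh (P j) w)) 0 i) * y 0 i.
  rewrite /pair_T mxE mulr_sumr; apply: eq_bigr => i _; rewrite !mxE; ring.
have -> : (fun w => \sum_i w 0 i * X i w) = fun w => g w * pair_T k (P j) (wronsk u v w) w w.
  apply/funext => w; rewrite pt mulr_sumr; apply: eq_bigr => i _; rewrite /X /= /flux; ring.
suff -> : divf X = fun w => g w * (u w * Lop k (P j) v w - v w * Lop k (P j) u w) +
     pair_T k (P j) (grad g w) (wronsk u v w) w by [].
apply/funext => w; rewrite -(div_flux w (hP j).1 kn hu hv) /divf mulr_sumr.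
have -> : pair_T k (P j) (grad g w) (wronsk u v w) w = \sum_i pd i g w * flux k (P j) u v i w.
  rewrite (pair_T_sym k _ _ w (cP j 2%N)).
  by rewrite pt; apply: eq_bigr => i _; rewrite [grad g w 0 i]mxE /flux; ring.
rewrite -big_split /=; apply: eq_bigr => i _; rewrite pdM /=; first by rewrite [flux _ _ _ _ _ _ * _]mulrC.
  by move=> x; apply: Ck_der hg.
by move=> x; apply: Ck_der (Ck_flux k i (cP j 3%N) hu hv).
Qed.

(** On the sphere [w] is an eigenvector of the Newton tensor, so the normal flux is a multiple of
    [u * qf v - v * qf u], which vanishes there. *)
Theorem WS k h u v g : (k <= n)%N -> Ck 2 h -> Ck 2 u -> Ck 2 v -> Ck 1 g ->
  robin h -> robin u -> robin v ->
  IB r (fun w => g w * (u w * Lop k h v w - v w * Lop k h u w)) =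
  - IB r (fun w => pair_T k h (grad g w) (wronsk u v w) w).
Proof.
move=> kn hh hu hv hg bh bu bv.
have cg := Ck_cts hg; have cu := Ck_cts hu; have cv := Ck_cts hv.
have cgr i : cts (fun w => grad g w 0 i).
  by rewrite (_ : (fun w => _) = pd i g); [exact: Ck_cts (Ck_pd i hg)|apply/funext => w; rewrite mxE].
have cwr i : cts (fun w => wronsk u v w 0 i) := Ck_cts (Ck_wronsk i hu hv).
have c1 := cts_Lop k hh hv; have c2 := cts_Lop k hh hu.
have c3 := cts_pair_T k hh cgr cwr.
have c4 := @cts_pair_T k h (wronsk u v) (fun w => w) hh cwr (fun i => cts_coord R i).
apply/eqP; rewrite -addr_eq0 -IBD //; last by ctn.
apply/eqP; apply: (weak_div_IB0 r0 _ _ (WS_weak kn hh hu hv hg)); [by ctn|by ctn|] => w wr.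
suff -> : pair_T k h (wronsk u v w) w w = 0 by rewrite mulr0.
have [c hc] := Sh_boundary hh bh wr; have [d hd] := NT_eigen k hc.
have sT : (NT k (Sh h w))^T = NT k (Sh h w) by apply: NT_sym; exact: Sh_sym.
rewrite /pair_T -mulmxA -[NT k _]sT -trmx_mul hd linearZ /= -scalemxAr !mxE.
have -> : \sum_i wronsk u v w 0 i * w^T i 0 = - (u w * qf v w - v w * qf u w).
  rewrite /qf /euler; under eq_bigr do rewrite !mxE.
  rewrite mulrBr mulrBr !mulr_sumr.
  rewrite (_ : - _ = \sum_i u w * (w 0 i * pd i v w) - \sum_i v w * (w 0 i * pd i u w)); last by ring.
  by rewrite -sumrB; apply: eq_bigr => i _; ring.
by rewrite bu // bv // !mulr0 subrr oppr0 !mulr0.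
Qed.

End WS.

Section MatrixAlgebra.
Variables (R : realType) (n : nat).
Implicit Types (M N : 'M[R]_n).

(** Newton's identity tr(M T_k) = (k+1) sigma_{k+1} differentiated in the direction [N], combined
    with tr(T_k N) as the derivative of sigma_{k+1}. *)
Lemma tr_dNT_base k M N : M^T = M -> \tr (dNT k M N *m M) = k%:R * \tr (NT k M *m N).
Proof.
move=> sM; have k1 : k.+1%:R != 0 :> R by rewrite pnatr_eq0.
have := dsgE k N sM; rewrite /dsg => /(canRL (divfK k1)).
rewrite [\tr (N *m _)]mxtrace_mulC [\tr (M *m _)]mxtrace_mulC -natr1 => h.
by apply: (addrI (\tr (NT k M *m N))); rewrite h; ring.
Qed.

Lemma dNT_lin k M N P c : dNT k M (c *: N + P) = c *: dNT k M N + dNT k M P.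
Proof.
elim: k => [|k IH]; first by rewrite scaler0 addr0.
rewrite !dNTS.
have -> : dsg k.+1 M (c *: N + P) = c * dsg k.+1 M N + dsg k.+1 M P.
  rewrite /dsg IH mulmxDl mulmxDr -scalemxAl -scalemxAr !linearD !linearZ /=; ring.
rewrite IH mulmxDl mulmxDr -scalemxAl -scalemxAr !scalerBr raddfD /= -scale_scalar_mx.
by apply/matrixP => a b; rewrite !mxE; ring.
Qed.

Lemma dNT_self k M : dNT k M M = k%:R *: NT k M.
Proof.
elim: k => [|k IH]; first by rewrite scale0r.
have k1 : k.+1%:R != 0 :> R by rewrite pnatr_eq0.
rewrite dNTS NTS /dsg IH -!scalemxAr linearZ /= /sg.
apply/matrixP => a b; rewrite !mxE -natr1; case: eqP => _; rewrite ?mulr1n ?mulr0n.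
  by field; rewrite natr1.
by ring.
Qed.

(* Splitting off the component of N along M diagonalises the form tr(dNT M N N). *)
Lemma dNT_split k M N : M^T = M -> sg k.+1 M != 0 ->
  let N' := N - (\tr (NT k M *m N) / (k.+1%:R * sg k.+1 M)) *: M in
  \tr (NT k M *m N') = 0 /\
  \tr (dNT k M N *m N) = \tr (dNT k M N' *m N') + k%:R / k.+1%:R * \tr (NT k M *m N) ^+ 2 / sg k.+1 M.
Proof.
move=> sM s0; set c := \tr (NT k M *m N) / (k.+1%:R * sg k.+1 M); move=> N'.
have k1 : k.+1%:R != 0 :> R by rewrite pnatr_eq0.
have TM : \tr (NT k M *m M) = k.+1%:R * sg k.+1 M by rewrite -NT_comm /sg mulrC divfK.
have t0 : \tr (NT k M *m N') = 0.
  rewrite /N' mulmxBr linearB /= -scalemxAr linearZ /= TM /c divfK ?subrr // mulf_neq0 //.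
split=> //.
have H (X : 'M[R]_n) a : \tr (NT k M *m X) = 0 -> \tr (dNT k M (a *: M + X) *m (a *: M + X)) =
    \tr (dNT k M X *m X) + a ^+ 2 * (k%:R * \tr (NT k M *m M)).
  move=> X0; rewrite dNT_lin dNT_self !mulmxDl !mulmxDr -!scalemxAl -!scalemxAr !linearD /= !linearZ /=.
  by rewrite (tr_dNT_base k X sM) X0; ring.
have e : c *: M + N' = N by rewrite /N' addrC subrK.
have := H N' c t0; rewrite e => ->; congr (_ + _); rewrite TM /c.
have F (x y s kk : R) : s != 0 -> kk != 0 -> (y / (kk * s)) ^+ 2 * (x * (kk * s)) = x / kk * y ^+ 2 / s.
  by move=> s1 kk1; field; rewrite s1 kk1.
exact: F.
Qed.

End MatrixAlgebra.

(** * Ground state substitution and the Bochner identity *)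

Section Bochner.
Variables (R : realType) (n : nat) (r : R).
Hypothesis r0 : 0 < r.
Implicit Types (u v h g : 'rV[R]_n -> R) (w : 'rV[R]_n) (i : 'I_n).

Definition dom v := Ck 2 v /\ robin r v.

Lemma qf_lin c u v w : Ck 1 u -> Ck 1 v -> qf (fun w => c * u w + v w) w = c * qf u w + qf v w.
Proof.
move=> hu hv; have du i x : derivable u x (basisv R i) by apply: Ck_der hu.
have dv i x : derivable v x (basisv R i) by apply: Ck_der hv.
have dc i x : derivable (fun w => c * u w) x (basisv R i) by apply: Ck_der (CkZ c hu).
rewrite /qf /euler; have -> : \sum_i w 0 i * pd i (fun w => c * u w + v w) w =
   c * (\sum_i w 0 i * pd i u w) + \sum_i w 0 i * pd i v w.
  rewrite mulr_sumr -big_split /=; apply: eq_bigr => i _.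
  rewrite (_ : (fun w => _) = (fun w => c * u w) \+ v) // (pdD (dc i) (dv i)) (pdZ c (du i)) /=; ring.
ring.
Qed.

Lemma Sh_lin c u v w : Ck 2 u -> Ck 2 v -> Sh (fun w => c * u w + v w) w = c *: Sh u w + Sh v w.
Proof.
move=> hu hv; apply/matrixP => a b; rewrite !mxE (qf_lin c w (CkW hu) (CkW hv)).
have du i x : derivable u x (basisv R i) by apply: Ck_der hu.
have dv i x : derivable v x (basisv R i) by apply: Ck_der hv.
have dc i x : derivable (fun w => c * u w) x (basisv R i) by apply: Ck_der (CkZ c hu).
have dpu i k x : derivable (pd k u) x (basisv R i) by apply: Ck_der (Ck_pd k hu).
have dpv i k x : derivable (pd k v) x (basisv R i) by apply: Ck_der (Ck_pd k hv).
have dpc i k x : derivable (fun w => c * pd k u w) x (basisv R i) by apply: Ck_der (CkZ c (Ck_pd k hu)).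
rewrite (_ : (fun w => c * u w + v w) = (fun w => c * u w) \+ v) // (pdD (dc b) (dv b)) (pdZ c (du b)).
rewrite (pdD (dpc a b) (dpv a b)) (pdZ c (dpu a b)) /=.
by case: eqP => _; rewrite ?mulr1n ?mulr0n; ring.
Qed.

Lemma Ck_lin k c u v : Ck k u -> Ck k v -> Ck k (fun w => c * u w + v w).
Proof. by move=> hu hv; exact: (CkD (CkZ c hu) hv). Qed.

Lemma dom_lin c u v : dom u -> dom v -> dom (fun w => c * u w + v w).
Proof.
move=> [hu bu] [hv bv]; split; first exact: Ck_lin.
by move=> w wr; rewrite (qf_lin c w (CkW hu) (CkW hv)) bu // bv // mulr0 addr0.
Qed.

Lemma Lop_lin k h c u v w : Ck 2 u -> Ck 2 v ->
  Lop k h (fun w => c * u w + v w) w = c * Lop k h u w + Lop k h v w.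
Proof.
move=> hu hv; rewrite /Lop (Sh_lin c w hu hv) mulmxDr -scalemxAr linearD /= linearZ /=; ring.
Qed.

Lemma Lop_base k h w : Lop k h h w = k.+1%:R * (phi w ^+ (n - k) * sg k.+1 (Sh h w)).
Proof.
rewrite /Lop -NT_comm; have -> : \tr (Sh h w *m NT k (Sh h w)) = k.+1%:R * sg k.+1 (Sh h w).
  by rewrite /sg mulrC divfK // pnatr_eq0.
by ring.
Qed.

Lemma IB_Lop_sym k h u v : (k <= n)%N -> dom h -> dom u -> dom v ->
  IB r (fun w => u w * Lop k h v w) = IB r (fun w => v w * Lop k h u w).
Proof.
move=> kn [hh bh] [hu bu] [hv bv]; have c1 := cts_Lop k hh hv; have c2 := cts_Lop k hh hu.
have cu := Ck_cts hu; have cv := Ck_cts hv.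
have := WS r0 kn hh hu hv (Ck_cst n 1 (1 : R)) bh bu bv.
have -> : (fun w => pair_T k h (grad (fun=> 1) w) (wronsk u v w) w) = fun=> 0.
  apply/funext => w; rewrite /pair_T (_ : grad _ w = 0) ?mul0mx ?mxE ?mulr0 //.
  by apply/rowP => i; rewrite !mxE pd_cst.
rewrite IB0 oppr0; have -> : (fun w => 1 * (u w * Lop k h v w - v w * Lop k h u w)) =
   (fun w => u w * Lop k h v w - v w * Lop k h u w) by apply/funext => w; rewrite mul1r.
rewrite (IBB r0); [|by ctn|by ctn].
by move/eqP; rewrite subr_eq0 => /eqP.
Qed.

Lemma pd_div i u h w : Ck 1 u -> Ck 1 h -> (forall w, h w != 0) ->
  pd i (fun w => u w / h w) w = (h w * pd i u w - u w * pd i h w) / h w ^+ 2.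
Proof.
move=> hu hh h0; have du x : derivable u x (basisv R i) by apply: Ck_der hu.
have dh x : derivable h x (basisv R i) by apply: Ck_der hh.
have dV x : derivable (fun w => (h w)^-1) x (basisv R i) by apply: Ck_der (CkV h0 hh).
rewrite (_ : (fun w => _) = u \* (fun w => (h w)^-1)) // (pdM du dV) /= (pdV h0 dh).
by field; exact: h0.
Qed.

Lemma Ck_div k u h : Ck k u -> Ck k h -> (forall w, h w != 0) -> Ck k (fun w => u w / h w).
Proof. by move=> hu hh h0; exact: (CkM hu (CkV h0 hh)). Qed.

(* Weighted ground-state substitution u = h y. *)
Lemma ground_state_z k h u z : (k <= n)%N -> dom h -> dom u -> Ck 1 z -> (forall w, h w != 0) ->
  IB r (fun w => z w * u w * Lop k h u w) = IB r (fun w => z w * u w ^+ 2 * Lop k h h w / h w)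
  - IB r (fun w => h w ^+ 2 * pair_T k h (grad (fun w => z w * (u w / h w)) w) (grad (fun w => u w / h w) w) w).
Proof.
move=> kn [hh bh] [hu bu] hz h0; have c1 := cts_Lop k hh hu; have c2 := cts_Lop k hh hh.
have cu := Ck_cts hu; have ch := Ck_cts hh; have cz := Ck_cts hz.
have cV : cts (fun w => (h w)^-1) := Ck_cts (CkV h0 hh).
have hy : Ck 1 (fun w => u w / h w) := Ck_div (CkW hu) (CkW hh) h0.
have hg : Ck 1 (fun w => z w * (u w / h w)) := CkM hz hy.
have := WS r0 kn hh hh hu hg bh bh bu.
have -> : (fun w => z w * (u w / h w) * (h w * Lop k h u w - u w * Lop k h h w)) =
   (fun w => z w * u w * Lop k h u w - z w * u w ^+ 2 * Lop k h h w / h w).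
  by apply/funext => w; field; exact: h0.
rewrite (IBB r0); [|by ctn|by ctn].
move=> /(canRL (subrK _)) ->; rewrite addrC; congr (_ - _).
apply: IB_ext => w _; have -> : wronsk h u w = h w ^+ 2 *: grad (fun w => u w / h w) w.
  apply/rowP => i; rewrite !mxE (pd_div _ _ (CkW hu) (CkW hh) h0); field; exact: h0.
by rewrite /pair_T linearZ /= -scalemxAr mxE mulrCA.
Qed.

Lemma ground_state k h u : (k <= n)%N -> dom h -> dom u -> (forall w, h w != 0) ->
  IB r (fun w => u w * Lop k h u w) = IB r (fun w => u w ^+ 2 * Lop k h h w / h w)
  - IB r (fun w => h w ^+ 2 * pair_T k h (grad (fun w => u w / h w) w) (grad (fun w => u w / h w) w) w).
Proof.
move=> kn dh du h0; have := ground_state_z kn dh du (Ck_cst n 1 (1 : R)) h0.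
have E f : (fun w : 'rV[R]_n => 1 * f w) = f by apply/funext => w; rewrite mul1r.
rewrite E; congr (_ = _ - _).
- by congr (IB r _); apply/funext => w; rewrite mul1r.
- by congr (IB r _); apply/funext => w; rewrite mul1r.
Qed.

Let tj (j : nat) : R := j.+1%:R^-1.

(** Difference quotients of [NT] converge uniformly to [dNT]; this lets a family of integral
    identities be differentiated in its parameter. *)
Lemma mucv_dNT a k (M N : 'rV[R]_n -> 'M[R]_n) : Cm 0 M -> Cm 0 N ->
  mucv a (fun j w => (tj j)^-1 *: (NT k (M w + tj j *: N w) - NT k (M w))) (fun w => dNT k (M w) (N w)).
Proof.
move=> hM hN.
have t0 j : tj j != 0 by rewrite /tj invr_eq0 pnatr_eq0.
have cM : mucv a (fun=> M) M by move=> b c; apply: ucv_cst; exact: Cm_cts hM.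
have cN : mucv a (fun=> N) N by move=> b c; apply: ucv_cst; exact: Cm_cts hN.
have ct : ucv a (fun (j : nat) _ => tj j) (fun _ : 'rV[R]_n => 0).
  split=> [|j|e e0]; [exact: cts_cst|exact: cts_cst|].
  have [L _ hL] := near_infty_natSinv_lt (PosNum e0).
  exists L => j Lj w _; rewrite subr0 ger0_norm ?invr_ge0 ?ler0n //; exact: ltW (hL _ Lj).
have cMt : mucv a (fun j w => M w + tj j *: N w) M.
  move=> b c; have := ucvD (cM b c) (ucvM ct (cN b c)).
  by apply: ucv_ext => [j w|w]; rewrite ?mxE ?mul0r ?addr0.
have cNT l := mucv_NT l cMt.
elim: k => [|k IH].
  move=> b c; apply: ucv_ext (ucv_cst a (cts_cst n (0 : R))) => [j w|w]; last by rewrite mxE.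
  by rewrite /NT subrr scaler0 mxE.
have t1 := mucvM cN (cNT k); have t2 := mucvM cM IH.
have t3 := ucvZ k.+1%:R^-1 (ucvD (ucv_tr t1) (ucv_tr t2)).
have t4 := mucvB (mucvB (mucv_scalar t3) t1) t2.
move=> b c; apply: ucv_ext (t4 b c) => [j w|w]; last by rewrite dNTS /dsg mulrC.
congr (fun_of_matrix _ b c); set A := NT k (M w + tj j *: N w); set B := NT k (M w).
have E : (M w + tj j *: N w) *m A - M w *m B = tj j *: (N w *m A + M w *m ((tj j)^-1 *: (A - B))).
  by rewrite mulmxDl scalerDr -scalemxAr scalerA divff // scale1r mulmxBr -scalemxAl; apply/matrixP => x y; rewrite !mxE; ring.
rewrite !NTS -/A -/B.
have -> : sg k.+1 (M w + tj j *: N w) = sg k.+1 (M w) + tj j * (k.+1%:R^-1 * (\tr (N w *m A) + \tr (M w *m ((tj j)^-1 *: (A - B))))).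
  rewrite /sg -/A -/B; have := congr1 (fun Z => \tr Z) E.
  rewrite linearB /= linearZ /= linearD /= => /(canRL (subrK _)) ->.
  by rewrite mulrDl addrC; congr (_ + _); rewrite mulrC mulrCA.
have -> : (M w + tj j *: N w) *m A = M w *m B + tj j *: (N w *m A + M w *m ((tj j)^-1 *: (A - B))).
  by rewrite -E [RHS]addrC subrK.
apply/matrixP => x y; rewrite !mxE; case: eqP => _; rewrite ?mulr1n ?mulr0n; set kk := (k.+1%:R : R)^-1; field; exact: t0.
Qed.

(** The symmetry of the operator with base [h + t * u], tested on [h] and [u], is differentiated at
    t = 0. No derivative of order three appears, so C^2 functions suffice. *)
Lemma bochner k h u : (k <= n)%N -> dom h -> dom u ->
  IB r (fun w => h w * (phi w ^+ (n - k) * \tr (dNT k (Sh h w) (Sh u w) *m Sh u w))) =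
  k%:R * IB r (fun w => u w * Lop k h u w).
Proof.
move=> kn dh du; have [hh bh] := dh; have [hu bu] := du.
have cu := Ck_cts hu; have ch := Ck_cts hh.
have hS := Cm_Sh hh; have hU := Cm_Sh hu.
have cL := cts_Lop k hh hu.
pose E (j : nat) w := (tj j)^-1 *: (NT k (Sh h w + tj j *: Sh u w) - NT k (Sh h w)).
have uE : mucv r E (fun w => dNT k (Sh h w) (Sh u w)) := mucv_dNT r k hS hU.
pose F (j : nat) w := phi w ^+ (n - k) * (h w * \tr (E j w *m Sh u w) - u w * \tr (E j w *m Sh h w)).
pose F0 w := phi w ^+ (n - k) * (h w * \tr (dNT k (Sh h w) (Sh u w) *m Sh u w) - u w * \tr (dNT k (Sh h w) (Sh u w) *m Sh h w)).
have cS b c : cts (fun w => Sh h w b c) := Cm_cts b c hS.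
have cU b c : cts (fun w => Sh u w b c) := Cm_cts b c hU.
have uS : mucv r (fun=> Sh h) (Sh h) by move=> b c; exact: ucv_cst.
have uU : mucv r (fun=> Sh u) (Sh u) by move=> b c; exact: ucv_cst.
have uF : ucv r F F0.
  apply: (ucvM (ucv_cst r (cts_phiX R n (n - k)))); apply: ucvB.
    exact: (ucvM (ucv_cst r ch) (ucv_tr (mucvM uE uU))).
  exact: (ucvM (ucv_cst r cu) (ucv_tr (mucvM uE uS))).
have F1 j : IB r (F j) = 0.
  pose t := tj j; have t0 : t != 0 by rewrite /t /tj invr_eq0 pnatr_eq0.
  pose ht w := t * u w + h w; have dt : dom ht := dom_lin t du dh.
  have St w : Sh ht w = Sh h w + t *: Sh u w by rewrite /ht (Sh_lin t w hu hh) addrC.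
  have e1 := IB_Lop_sym kn dt dh du; have e2 := IB_Lop_sym kn dh dh du.
  have c1 := cts_Lop k dt.1 hu; have c2 := cts_Lop k dt.1 hh; have c3 := cts_Lop k hh hh.
  have -> : F j = fun w => t^-1 * ((h w * Lop k ht u w - u w * Lop k ht h w) - (h w * Lop k h u w - u w * Lop k h h w)).
    apply/funext => w; rewrite /F /E /Lop -/t !St; set A := NT k (_ + _); set B := NT k _.
    have trE (X : 'M[R]_n) : \tr ((t^-1 *: (A - B)) *m X) = t^-1 * (\tr (A *m X) - \tr (B *m X)).
      by rewrite -scalemxAl linearZ /= mulmxBl linearB.
    by rewrite !trE; ring.
  rewrite (IBZ r0); last by ctn.
  rewrite (IBB r0); [|by ctn|by ctn]; rewrite (IBB r0); [|by ctn|by ctn]; rewrite (IBB r0); [|by ctn|by ctn].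
  rewrite e1 e2 !subrr; exact: mulr0.
have [cF0 cF hF] := uF.
have F00 : IB r F0 = 0.
  apply/eqP; rewrite -normr_le0; apply/ler_addgt0Pr => e e0; rewrite add0r.
  have I1 := IB1_gt0 n r0; have [N hN] := hF _ (divr_gt0 e0 I1).
  have := IB_close r0 (cF N) cF0 (fun w wB => hN N (leqnn _) w (ball2_norm r0 wB)).
  by rewrite F1 sub0r normrN divfK // gt_eqF.
have Er : (fun w => k%:R * (u w * Lop k h u w)) = fun w => phi w ^+ (n - k) * (u w * \tr (dNT k (Sh h w) (Sh u w) *m Sh h w)).
  by apply/funext => w; rewrite tr_dNT_base ?Sh_sym // /Lop; ring.
rewrite -(IBZ r0); last by ctn.
rewrite Er; apply/eqP; rewrite -subr_eq0 -(IBB r0).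
- rewrite -[X in _ == X]F00; apply/eqP; congr (IB r _); apply/funext => w; rewrite /F0; ring.
- have := ucvM (ucv_cst r ch) (ucvM (ucv_cst r (cts_phiX R n (n - k))) (ucv_tr (mucvM uE uU))); by case.
- by have := ucvM (ucv_cst r (cts_phiX R n (n - k))) (ucvM (ucv_cst r cu) (ucv_tr (mucvM uE uS))); case.
Qed.

End Bochner.

Lemma compact_pos_min (R : realType) (T : topologicalType) (K : set T) (f : T -> R) :
  compact K -> continuous f -> (forall x, K x -> 0 < f x) ->
  exists2 c, 0 < c & forall x, K x -> c <= f x.
Proof.
move=> cK cf f0; have [K0|/set0P K0] := eqVneq K set0.
  by exists 1 => // x; rewrite K0.
have [p + hp] := @compact_EVT_min _ R f K K0 cK (continuous_subspaceT cf).
rewrite inE => Kp; exists (f p); first exact: f0.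
by move=> x Kx; apply: hp; rewrite inE.
Qed.

Section MatrixContinuity.
Variables (R : realType) (n : nat) (T : topologicalType).
Implicit Types (M N : T -> 'M[R]_n).

Definition mct M := forall a b, continuous (fun x => M x a b).

Lemma tctD (f g : T -> R) : continuous f -> continuous g -> continuous (fun x => f x + g x).
Proof. by move=> cf cg x; exact: (cvgD (cf x) (cg x)). Qed.
Lemma tctM (f g : T -> R) : continuous f -> continuous g -> continuous (fun x => f x * g x).
Proof. by move=> cf cg x; exact: (cvgM (cf x) (cg x)). Qed.
Lemma tctN (f : T -> R) : continuous f -> continuous (fun x => - f x).
Proof. by move=> cf x; exact: (cvgN (cf x)). Qed.
Lemma tctc (c : R) : continuous (fun _ : T => c).
Proof. exact: cst_continuous. Qed.

Lemma mctM M N : mct M -> mct N -> mct (fun x => M x *m N x).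
Proof.
move=> cM cN a b; rewrite (_ : (fun x => _) = fun x => \sum_c M x a c * N x c b).
  by apply: cont_sum => c; exact: (tctM (cM a c) (cN c b)).
by apply/funext => x; rewrite mxE.
Qed.
Lemma mctB M N : mct M -> mct N -> mct (fun x => M x - N x).
Proof.
move=> cM cN a b; rewrite (_ : (fun x => _) = fun x => M x a b + - N x a b).
  exact: (tctD (cM a b) (tctN (cN a b))).
by apply/funext => x; rewrite !mxE.
Qed.
Lemma mct_scalar (f : T -> R) : continuous f -> mct (fun x => (f x)%:M).
Proof.
move=> cf a b; rewrite (_ : (fun x => _) = fun x => (a == b)%:R * f x).
  exact: (tctM (@tctc _) cf).
by apply/funext => x; rewrite !mxE; case: eqP => _; rewrite ?mul1r ?mul0r.
Qed.
Lemma mct_tr M : mct M -> continuous (fun x => \tr (M x)).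
Proof. by move=> cM; apply: cont_sum => a; exact: cM. Qed.
Lemma mct_sgNT k M : mct M -> continuous (fun x => sg k (M x)) /\ mct (fun x => NT k (M x)).
Proof.
move=> cM; elim: k => [|k [_ IH]].
  by split; [exact: tctc|exact: (mct_scalar (@tctc 1))].
have h : continuous (fun x => sg k.+1 (M x)).
  exact: (tctM (mct_tr (mctM cM IH)) (@tctc _)).
by split=> //; exact: (mctB (mct_scalar h) (mctM cM IH)).
Qed.
Lemma mct_dNT k M N : mct M -> mct N -> mct (fun x => dNT k (M x) (N x)).
Proof.
move=> cM cN; elim: k => [|k IH].
  by move=> a b; rewrite (_ : (fun x => _) = fun=> 0); [exact: tctc|apply/funext => x; rewrite mxE].
have cT := (mct_sgNT k cM).2.
have h : continuous (fun x => dsg k.+1 (M x) (N x)).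
  exact: (tctM (tctD (mct_tr (mctM cN cT)) (mct_tr (mctM cM IH))) (@tctc _)).
exact: (mctB (mctB (mct_scalar h) (mctM cN cT)) (mctM cM IH)).
Qed.

End MatrixContinuity.

(** * Ellipticity and Lorentz signature with uniform constants *)

Section Uniform.
Variables (R : realType) (n : nat).
Implicit Types (M N : 'M[R]_n).

Definition frob N : R := \sum_i \sum_j N i j ^+ 2.

Lemma frob_ge0 N : 0 <= frob N.
Proof. by apply: sumr_ge0 => i _; apply: sumr_ge0 => j _; exact: sqr_ge0. Qed.

Lemma frob_nsq N : frob N = nsq (mxvec N).
Proof.
rewrite nsqE (reindex _ (curry_mxvec_bij n n)) /= /frob pair_bigA /=.
by apply: eq_bigr => -[i j] _ /=; rewrite mxvecE expr2.
Qed.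

Lemma frob_eq0 N : frob N = 0 -> N = 0.
Proof.
move=> h; apply/matrixP => i j; rewrite mxE; apply/eqP; rewrite -sqrf_eq0; apply/eqP.
have s0 i' : 0 <= \sum_j N i' j ^+ 2 by apply: sumr_ge0 => j' _; exact: sqr_ge0.
have h1 : \sum_j N i j ^+ 2 = 0 by apply: (psumr_eq0P _ h).
by apply: (psumr_eq0P _ h1) => // l _; exact: sqr_ge0.
Qed.

Lemma frobZ (a : R) N : frob (a *: N) = a ^+ 2 * frob N.
Proof.
rewrite /frob mulr_sumr; apply: eq_bigr => i _; rewrite mulr_sumr; apply: eq_bigr => j _.
by rewrite mxE exprMn.
Qed.

Lemma frobD_le N M : frob (N + M) <= 2 * frob N + 2 * frob M.
Proof.
rewrite /frob !mulr_sumr -big_split; apply: ler_sum => i _; rewrite !mulr_sumr -big_split.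
by apply: ler_sum => j _ /=; rewrite mxE; have := sqr_ge0 (N i j - M i j); lra.
Qed.

Lemma frob_le M C : (forall i j, `|M i j| <= C) -> frob M <= (n * n)%:R * C ^+ 2.
Proof.
move=> h; apply: le_trans (_ : \sum_(i < n) \sum_(j < n) C ^+ 2 <= _).
  apply: ler_sum => i _; apply: ler_sum => j _; rewrite -real_normK ?num_real //.
  by apply: lerXn2r; rewrite ?nnegrE //; apply: le_trans (h i j).
by rewrite !sumr_const !card_ord -mulrnA mulr_natl.
Qed.

Definition Kset k C c M := [/\ M^T = M, forall i j, `|M i j| <= C & forall j, (j <= k)%N -> c <= sg j M].

(** Vectors parametrise matrices so that compactness of cubes applies; symmetrising makes every
    parameter value a symmetric matrix. *)
Let symm (x : 'rV[R]_(n * n)) : 'M[R]_n := 2^-1 *: (vec_mx x + (vec_mx x)^T).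

Let symmK M : M^T = M -> symm (mxvec M) = M.
Proof. by move=> sM; rewrite /symm mxvecK sM; apply/matrixP => i j; rewrite !mxE; field. Qed.

Let symm_sym x : (symm x)^T = symm x.
Proof. by rewrite /symm linearZ /= linearD /= trmxK addrC. Qed.

Let vec_mx_cts i j : continuous (fun x : 'rV[R]_(n * n) => vec_mx x i j).
Proof.
rewrite (_ : (fun x => _) = fun x : 'rV[R]_(n * n) => x 0 (mxvec_index i j)).
  exact: coord_continuous.
by apply/funext => x; rewrite -{2}(vec_mxK x) mxvecE.
Qed.

Let symm_mct (T : topologicalType) (g : T -> 'rV[R]_(n * n)) : continuous g -> mct (fun x => symm (g x)).
Proof.
move=> cg a b; rewrite (_ : (fun x => _) = fun x => 2^-1 * (vec_mx (g x) a b + vec_mx (g x) b a)).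
  apply: tctM; first exact: tctc.
  by apply: tctD => x; apply: (@continuous_comp _ _ _ g (fun y => vec_mx y _ _)); [exact: cg|exact: vec_mx_cts|exact: cg|exact: vec_mx_cts].
by apply/funext => x; rewrite !mxE.
Qed.

Let mxvec_norm M C : (forall i j, `|M i j| <= C) -> 0 <= C -> `|mxvec M| <= C.
Proof.
move=> h C0; apply: norm_le_coord => // l; case/mxvec_indexP: l => i j.
by rewrite mxvecE.
Qed.

Lemma Kcompact k C c m : compact [set p : 'rV[R]_(n * n) * 'rV[R]_m |
   (`|p.1| <= C /\ `|p.2| <= 1) /\ ((forall j, (j <= k)%N -> c <= sg j (symm p.1)) /\ nsq p.2 = 1)].
Proof.
have c1 : continuous (fun p : 'rV[R]_(n * n) * 'rV[R]_m => p.1) by move=> p; exact: cvg_fst.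
have c2 : continuous (fun p : 'rV[R]_(n * n) * 'rV[R]_m => p.2) by move=> p; exact: cvg_snd.
rewrite (_ : [set p | _] = ([set x | `|x| <= C] `*` [set y | `|y| <= 1]) `&`
   ((\bigcap_(j in [set j | (j <= k)%N]) [set p | c <= sg j (symm p.1)]) `&` [set p | nsq p.2 = 1])) //.
apply: compact_closedI; first by apply: compact_setX; exact: cube_compact.
apply: closedI.
  apply: closed_bigI => j _.
  apply: (@closed_comp _ _ (fun p : 'rV[R]_(n * n) * 'rV[R]_m => sg j (symm p.1)) [set x | c <= x]) => [p _|].
    exact: (mct_sgNT j (symm_mct c1)).1.
  exact: closed_ge.
apply: (@closed_comp _ _ (fun p : 'rV[R]_(n * n) * 'rV[R]_m => nsq p.2) [set x | x = 1]) => [p _|].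
  apply: (@continuous_comp _ _ _ snd (@nsq R m)); [exact: c2|exact: (Ck_cont (Ck_nsq R m 0))].
exact: closed_eq.
Qed.

Lemma nsq_norm1 m (y : 'rV[R]_m) : nsq y = 1 -> `|y| <= 1.
Proof. by move=> y1; apply: le_of_sqr => //; rewrite expr1n -y1 norm_sq_le_nsq. Qed.

(** Compactness of [Kset] times the unit sphere turns the pointwise [NT_posdef] into a uniform
    bound, and homogeneity in [x] extends it to all vectors. *)
Lemma elliptic_uniform k C c : 0 <= C -> 0 < c -> exists2 c0, 0 < c0 &
  forall M, Kset k.+1 C c M -> forall x : 'rV[R]_n, c0 * nsq x <= (x *m NT k M *m x^T) 0 0.
Proof.
move=> C0 c0.
pose q (p : 'rV[R]_(n * n) * 'rV[R]_n) := (p.2 *m NT k (symm p.1) *m p.2^T) 0 0.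
have qE p : q p = \sum_i \sum_j p.2 0 i * NT k (symm p.1) i j * p.2 0 j.
  rewrite /q mxE; under eq_bigr do rewrite !mxE mulr_suml.
  by rewrite exchange_big /=; apply: eq_bigr => i _; apply: eq_bigr => j _.
have c1 : continuous (fun p : 'rV[R]_(n * n) * 'rV[R]_n => p.1) by move=> p; exact: cvg_fst.
have c2 i : continuous (fun p : 'rV[R]_(n * n) * 'rV[R]_n => p.2 0 i).
  move=> p; apply: (@continuous_comp _ _ _ snd (fun y : 'rV[R]_n => y 0 i)); [exact: cvg_snd|exact: coord_continuous].
have cq : continuous q.
  rewrite (_ : q = fun p => \sum_i \sum_j p.2 0 i * NT k (symm p.1) i j * p.2 0 j); last by apply/funext.
  apply: cont_sum => i; apply: cont_sum => j.
  exact: (tctM (tctM (c2 i) ((mct_sgNT k (symm_mct c1)).2 i j)) (c2 j)).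
have [p [_ [G1 p1]]|d d0 hd] := compact_pos_min (@Kcompact k.+1 C c n) cq.
  apply: NT_posdef; [exact: symm_sym|by move=> j jk; exact: lt_le_trans (G1 j jk)|].
  by apply/eqP => p0; move: p1; rewrite p0 nsqE big1 => [/eqP|i _]; rewrite ?mxE ?mul0r // eq_sym oner_eq0.
exists d => // M [sM hM GM] x; have [x0|x0] := eqVneq (nsq x) 0.
  rewrite x0 mulr0; suff -> : x = 0 by rewrite !mul0mx mxE.
  apply/rowP => i; rewrite mxE; have h : x 0 i * x 0 i = 0.
    by apply: (psumr_eq0P _ x0) => // l _; rewrite -expr2 sqr_ge0.
  by apply/eqP; move/eqP: h; rewrite mulf_eq0 orbb.
have x1 : 0 < nsq x by rewrite lt_neqAle eq_sym x0 nsq_ge0.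
pose s := Num.sqrt (nsq x); have s0 : 0 < s by rewrite sqrtr_gt0.
have sE : s ^+ 2 = nsq x by rewrite sqr_sqrtr ?nsq_ge0.
pose y := s^-1 *: x.
have y1 : nsq y = 1.
  rewrite nsqE (eq_bigr (fun i => (s^-1) ^+ 2 * (x 0 i * x 0 i))); last by move=> i _; rewrite !mxE; ring.
  by rewrite -mulr_sumr -nsqE -sE; field; rewrite gt_eqF.
have := hd (mxvec M, y); rewrite /q /= symmK // => h.
have -> : x = s *: y by rewrite scalerA divff ?scale1r // gt_eqF.
have -> : nsq (s *: y) = s ^+ 2 * nsq y.
  by rewrite nsqE mulr_sumr; apply: eq_bigr => i _; rewrite !mxE; ring.
clearbody y; have -> : (s *: y)^T = s *: y^T by apply/matrixP => ? ?; rewrite !mxE.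
have sc (a : R) (X : 'M[R]_1) : (a *: X) 0 0 = a * X 0 0 by rewrite mxE.
rewrite y1 mulr1 -!scalemxAl -scalemxAr scalerA sc; set X := (y *m _ *m _) 0 0 in h *.
rewrite (_ : s * s * X = s ^+ 2 * X); last by ring.
rewrite mulrC ler_pM2l ?exprn_gt0 //.
apply: h; split; split=> //; [exact: mxvec_norm|exact: nsq_norm1].
Qed.

(** The same compactness argument for [NT_lorentz]; the constraint that the trace vanishes is
    closed, so it cuts out a compact set. *)
Lemma lorentz_uniform k C c : 0 <= C -> 0 < c -> exists2 c0, 0 < c0 &
  forall M, Kset k.+2 C c M -> forall N, N^T = N -> \tr (NT k.+1 M *m N) = 0 ->
    c0 * frob N <= - \tr (dNT k.+1 M N *m N).
Proof.
move=> C0 c0.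
have c1 : continuous (fun p : 'rV[R]_(n * n) * 'rV[R]_(n * n) => p.1) by move=> p; exact: cvg_fst.
have c2 : continuous (fun p : 'rV[R]_(n * n) * 'rV[R]_(n * n) => p.2) by move=> p; exact: cvg_snd.
pose q (p : 'rV[R]_(n * n) * 'rV[R]_(n * n)) := - \tr (dNT k.+1 (symm p.1) (symm p.2) *m symm p.2).
have cq : continuous q.
  by apply: tctN; apply: mct_tr; apply: mctM; [apply: mct_dNT|]; exact: symm_mct.
pose t (p : 'rV[R]_(n * n) * 'rV[R]_(n * n)) := \tr (NT k.+1 (symm p.1) *m symm p.2).
have ct : continuous t.
  by apply: mct_tr; apply: mctM; [exact: (mct_sgNT _ (symm_mct c1)).2|exact: symm_mct].
pose f2 (p : 'rV[R]_(n * n) * 'rV[R]_(n * n)) := frob (symm p.2).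
have cf2 : continuous f2.
  apply: cont_sum => i; apply: cont_sum => j; under eq_fun do rewrite expr2.
  by apply: tctM; exact: (symm_mct c2).
pose K := [set p : 'rV[R]_(n * n) * 'rV[R]_(n * n) |
   (`|p.1| <= C /\ `|p.2| <= 1) /\ ((forall j, (j <= k.+2)%N -> c <= sg j (symm p.1)) /\ nsq p.2 = 1)]
   `&` ([set p | t p = 0] `&` [set p | f2 p = 1]).
have cK : compact K.
  apply: compact_closedI; first exact: Kcompact.
  apply: closedI.
    by apply: (@closed_comp _ _ t [set x | x = 0]) => [p _|]; [exact: ct|exact: closed_eq].
  by apply: (@closed_comp _ _ f2 [set x | x = 1]) => [p _|]; [exact: cf2|exact: closed_eq].
have [p [[_ [G1 _]] [t0 f21]]|d d0 hd] := compact_pos_min cK cq.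
  rewrite /q oppr_gt0; apply: NT_lorentz; [exact: symm_sym|exact: symm_sym|
    by move=> j jk; exact: lt_le_trans (G1 j jk)|exact: t0|].
  apply/eqP => p0; move: f21; rewrite /f2 /= p0 /frob big1 => [/eqP|i _]; first by rewrite eq_sym oner_eq0.
  by rewrite big1 // => j _; rewrite mxE expr0n.
exists d => // M [sM hM GM] N sN tN; have [N0|N0] := eqVneq (frob N) 0.
  by rewrite N0 mulr0 (frob_eq0 N0) mulmx0 linear0 oppr0.
have N1 : 0 < frob N by rewrite lt_neqAle eq_sym N0 frob_ge0.
pose s := Num.sqrt (frob N); have s0 : 0 < s by rewrite sqrtr_gt0.
have sE : s ^+ 2 = frob N by rewrite sqr_sqrtr ?frob_ge0.
pose Y := s^-1 *: N; have sY : Y^T = Y by rewrite /Y linearZ /= sN.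
have Y1 : frob Y = 1 by rewrite frobZ -sE; field; rewrite gt_eqF.
have NE : N = s *: Y by rewrite scalerA divff ?scale1r // gt_eqF.
have h := hd (mxvec M, mxvec Y); rewrite /q /= !symmK // in h.
have d0N := dNT_lin k.+1 M Y 0 s; rewrite !addr0 in d0N.
have dz : dNT k.+1 M 0 = 0.
  by have := dNT_lin k.+1 M 0 0 1; rewrite !scale1r addr0 => /eqP; rewrite -subr_eq0 opprD addrA subrr sub0r oppr_eq0 => /eqP.
rewrite NE d0N dz addr0 frobZ Y1 mulr1 -scalemxAl mxtraceZ -scalemxAr mxtraceZ.
rewrite (_ : - (s * (s * _)) = s ^+ 2 * - \tr (dNT k.+1 M Y *m Y)); last by ring.
rewrite mulrC.
rewrite ler_pM2l ?exprn_gt0 //; apply: h; split; [split; split|split] => //=.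
- exact: mxvec_norm.
- by apply: nsq_norm1; rewrite -frob_nsq.
- by move=> j jk; rewrite symmK //; exact: GM.
- by rewrite -frob_nsq.
- by rewrite /t /= !symmK // -scalemxAr linearZ /= tN mulr0.
- by rewrite /f2 /= symmK.
Qed.

End Uniform.

(** * Estimates for [Sh u] in the square norm *)

Section Estimates.
Variables (R : realType) (n : nat) (r : R).
Hypothesis r0 : 0 < r.
Implicit Types (u v h : 'rV[R]_n -> R) (w : 'rV[R]_n).

(** The bounds concern the ball only, while [h] must be nonzero everywhere because quotients by [h]
    have to be differentiable on the whole space. *)
Definition admissible k C c h :=
  [/\ dom r h, forall w, h w != 0 & forall w, ball2 r w -> c <= h w <= C /\ Kset k C c (Sh h w)].

Lemma phi_bounds w : ball2 r w -> 2 / (1 + r ^+ 2) <= phi w <= 2.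
Proof.
move=> wB; apply/andP; split.
  by rewrite /phi ler_pM2l // lef_pV2 ?posrE ?ltr_pwDl ?nsq_ge0 ?sqr_ge0 // lerD2l.
by rewrite /phi ler_pdivrMr ?nsq1_gt0 // ler_peMr // lerDl nsq_ge0.
Qed.

Lemma phiX_bounds m : exists2 b, 0 < b & forall w, ball2 r w -> b <= phi w ^+ m <= 2 ^+ m.
Proof.
have q0 : 0 < 2 / (1 + r ^+ 2) by rewrite divr_gt0 // ltr_pwDl ?sqr_ge0.
exists ((2 / (1 + r ^+ 2)) ^+ m); first exact: exprn_gt0.
move=> w /phi_bounds/andP[b1 b2]; apply/andP; split; apply: lerXn2r; rewrite ?nnegrE //.
- exact: ltW.
- by apply: ltW; exact: phi_gt0.
- by apply: ltW; exact: phi_gt0.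
Qed.

Definition Hform k h u w := \tr (dNT k (Sh h w) (Sh u w) *m Sh u w).

Lemma cts_Hform k h u : Ck 2 h -> Ck 2 u -> cts (Hform k h u).
Proof.
move=> hh hu; have hS := Cm_Sh hh; have hU := Cm_Sh hu.
have uU : mucv 0 (fun=> Sh u) (Sh u) by move=> b c; apply: ucv_cst; exact: Cm_cts hU.
by have [] := ucv_tr (mucvM (mucv_dNT 0 k hS hU) uU).
Qed.

(** [Sh u] is split into a multiple of [Sh h] and a part [N'] with tr(T N') = 0. The multiple is
    measured by [Lop k.+1 h u]; the part [N'] is controlled by the definite form of
    [lorentz_uniform], that is by [- Hform] up to a further square of [Lop]. *)
Lemma frob_pointwise k C c : 0 <= C -> 0 < c -> exists K K1, [/\ 0 <= K, 0 <= K1 &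
  forall h u w, admissible k.+2 C c h -> Ck 2 u -> ball2 r w ->
  frob (Sh u w) <= K * Lop k.+1 h u w ^+ 2 - K1 * (h w * (phi w ^+ (n - k.+1) * Hform k.+1 h u w))].
Proof.
move=> C0 c0; have [d d0 hd] := @lorentz_uniform R n k C c C0 c0.
have [b b0 hb] := phiX_bounds (n - k.+1).
set m := (n - k.+1)%N; pose B : R := 2 ^+ m; have B0 : 0 < B by rewrite exprn_gt0.
pose kk : R := k.+2%:R; have kk0 : 0 < kk by rewrite ltr0Sn.
pose K1 := 2 / (d * (c * b)); have K10 : 0 < K1 by rewrite divr_gt0 // mulr_gt0 // mulr_gt0.
pose K2 := C * B / (c * b ^+ 2); have K20 : 0 <= K2.
  apply: divr_ge0; first by apply: mulr_ge0 => //; exact: ltW.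
  by apply: mulr_ge0; [exact: ltW|exact: sqr_ge0].
pose K3 := 2 * ((n * n)%:R * C ^+ 2) / (kk * c * b) ^+ 2.
have K30 : 0 <= K3.
  by apply: divr_ge0; [apply: mulr_ge0 => //; apply: mulr_ge0 => //; exact: sqr_ge0|exact: sqr_ge0].
exists (K1 * K2 + K3), K1; split; [by rewrite addr_ge0 // mulr_ge0 // ltW|exact: ltW|].
move=> h u w [_ _ /(_ w) adm] hu wB; have [/andP[hc hC] KM] := adm wB.
have [sM bM gM] := KM; have /andP[P1 P2] := hb w wB.
set M := Sh h w in KM sM bM gM *; set N := Sh u w; set P := phi w ^+ m in P1 P2 *.
have sN : N^T = N by exact: Sh_sym.
have sgc : c <= sg k.+2 M by exact: gM.
have sg0 : 0 < sg k.+2 M by exact: lt_le_trans sgc.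
have [tN' HE] := dNT_split N sM (lt0r_neq0 sg0).
set t := \tr (NT k.+1 M *m N) in tN' HE; set a := t / _ in tN' HE; set N' := N - a *: M in tN' HE.
have sN' : N'^T = N' by rewrite /N' linearB /= linearZ /= sN sM.
have hN' := hd M KM N' sN' tN'; set H' := \tr (dNT k.+1 M N' *m N') in HE hN'.
have H'0 : 0 <= - H' by apply: le_trans hN'; rewrite mulr_ge0 ?frob_ge0 // ltW.
have PP0 : 0 < P by exact: lt_le_trans P1.
have hw0 : 0 < h w by exact: lt_le_trans hc.
rewrite /Lop /Hform -/M -/N -/m -/P -/t HE -/kk; set x := P * t.
have tx : t ^+ 2 <= x ^+ 2 / b ^+ 2.
  rewrite ler_pdivlMr ?exprn_gt0 // /x exprMn mulrC; apply: ler_wpM2r; first exact: sqr_ge0.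
  by apply: lerXn2r => //; rewrite nnegrE; exact: ltW.
have ts : t ^+ 2 / sg k.+2 M <= x ^+ 2 / b ^+ 2 / c.
  apply: ler_pM => //; [exact: sqr_ge0|by rewrite invr_ge0 ltW|].
  by rewrite lef_pV2 ?posrE.
have ratio : 0 <= k.+1%:R / kk <= 1.
  apply/andP; split; first by apply: divr_ge0; [exact: ler0n|exact: ltW].
  by rewrite ler_pdivrMr // mul1r ler_nat.
have q0 : 0 <= t ^+ 2 / sg k.+2 M by apply: divr_ge0; [exact: sqr_ge0|exact: ltW].
have rq : k.+1%:R / kk * (t ^+ 2 / sg k.+2 M) <= x ^+ 2 / b ^+ 2 / c.
  apply: le_trans ts; move/andP: ratio => [r1 r2]; rewrite -[leRHS]mul1r; exact: ler_pM.
have rq0 : 0 <= k.+1%:R / kk * (t ^+ 2 / sg k.+2 M).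
  by apply: mulr_ge0 => //; case/andP: ratio.
have f1 : frob N <= 2 * frob N' + 2 * (a ^+ 2 * frob M).
  have := frobD_le N' (a *: M); rewrite frobZ; rewrite /N' subrK; exact.
have f2 : 2 * (a ^+ 2 * frob M) <= K3 * x ^+ 2.
  have fM := frob_le bM; have fM0 := frob_ge0 M.
  have a2 : a ^+ 2 <= x ^+ 2 / (kk * c * b) ^+ 2.
    rewrite /a expr_div_n; apply: le_trans (_ : x ^+ 2 / b ^+ 2 / (kk * sg k.+2 M) ^+ 2 <= _).
      by apply: ler_wpM2r => //; rewrite invr_ge0 sqr_ge0.
    rewrite -mulrA -invfM; apply: ler_wpM2l; first exact: sqr_ge0.
    have ks : 0 < b * (kk * sg k.+2 M) := mulr_gt0 b0 (mulr_gt0 kk0 sg0).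
    have kcb : 0 < kk * c * b := mulr_gt0 (mulr_gt0 kk0 c0) b0.
    rewrite -exprMn lef_pV2 ?posrE; [|exact: exprn_gt0|exact: exprn_gt0].
    apply: lerXn2r; rewrite ?nnegrE; [exact: ltW|exact: ltW|].
    by rewrite [b * _]mulrC; apply: ler_wpM2r; [exact: ltW|rewrite ler_pM2l].
  apply: le_trans (_ : 2 * (x ^+ 2 / (kk * c * b) ^+ 2 * ((n * n)%:R * C ^+ 2)) <= _).
    by rewrite ler_pM2l //; apply: ler_pM => //; exact: sqr_ge0.
  by rewrite /K3 le_eqVlt; apply/orP; left; apply/eqP; ring.
have f3 : - H' <= (h w * P * - H') / (c * b).
  rewrite ler_pdivlMr ?mulr_gt0 // mulrC; apply: ler_wpM2r => //; apply: ler_pM => //; exact: ltW.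
have f4 : h w * P * (k.+1%:R / kk * (t ^+ 2 / sg k.+2 M)) <= K2 * x ^+ 2.
  apply: le_trans (_ : C * B * (x ^+ 2 / b ^+ 2 / c) <= _).
    apply: ler_pM => //; first by apply: mulr_ge0; exact: ltW.
    by apply: ler_pM => //; exact: ltW.
  rewrite /K2 le_eqVlt; apply/orP; left; apply/eqP; field; by rewrite !gt_eqF.
have f5 : 2 * frob N' <= K1 * (h w * P * - H').
  have : frob N' <= - H' / d by rewrite ler_pdivlMr // mulrC.
  have : - H' / d <= (h w * P * - H') / (c * b) / d by rewrite ler_pM2r ?invr_gt0.
  rewrite (_ : K1 * _ = 2 * ((h w * P * - H') / (c * b) / d)); first by lra.
  by rewrite /K1; field; rewrite !gt_eqF.
have f6 : K1 * (h w * P * (k.+1%:R / kk * (t ^+ 2 / sg k.+2 M))) <= K1 * (K2 * x ^+ 2) by rewrite ler_pM2l.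
have -> : k.+1%:R / kk * t ^+ 2 / sg k.+2 M = k.+1%:R / kk * (t ^+ 2 / sg k.+2 M) by ring.
set Z := k.+1%:R / kk * _ in f6 *; clear - f1 f2 f5 f6; lra.
Qed.

(** The integral of [frob_pointwise], in which [bochner] evaluates the term with [Hform]. *)
Lemma H2_estimate k C c : (k.+2 <= n)%N -> 0 <= C -> 0 < c -> exists K K1, [/\ 0 <= K, 0 <= K1 &
  forall h u, admissible k.+2 C c h -> dom r u ->
  IB r (fun w => frob (Sh u w)) <= K * IB r (fun w => Lop k.+1 h u w ^+ 2) - K1 * IB r (fun w => u w * Lop k.+1 h u w)].
Proof.
move=> kn C0 c0; have [K [K1 [K0 K10 hK]]] := frob_pointwise k C0 c0.
exists K, (K1 * k.+1%:R); split=> //; first by rewrite mulr_ge0.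
move=> h u adm du; have [dh _ _] := adm; have [hh _] := dh; have [hu _] := du.
have kn' : (k.+1 <= n)%N by exact: ltnW.
have bo : k.+1%:R * IB r (fun w => u w * Lop k.+1 h u w) =
  IB r (fun w => h w * (phi w ^+ (n - k.+1) * Hform k.+1 h u w)) := esym (bochner r0 kn' dh du).
have ch := Ck_cts hh; have cL := cts_Lop k.+1 hh hu; have cH := cts_Hform k.+1 hh hu.
have cp := Ck_cts (Ck_phi R n 0).
have cf : cts (fun w => frob (Sh u w)).
  by rewrite /frob; have cS i j := Cm_cts i j (Cm_Sh hu); apply: cts_sum => i; apply: cts_sum => j; exact: ctsX.
rewrite -mulrA bo.
rewrite -(IBZ r0); last by ctn.
rewrite -(IBZ r0); last by ctn.
rewrite -(IBB r0); [|by ctn|by ctn].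
apply: (IB_le r0) => //; first by ctn.
move=> w wB; exact: hK.
Qed.

(* With m u = m A u, where g = 1 / m, this reads <Au,u> <= |Au|^2 (Bochner). *)
Lemma bochner_le k C c h u g : (k.+2 <= n)%N -> 0 < c -> admissible k.+2 C c h -> dom r u ->
  cts g -> (forall w, ball2 r w -> g w * Lop k.+1 h h w = h w) ->
  IB r (fun w => u w * Lop k.+1 h u w) <= IB r (fun w => g w * Lop k.+1 h u w ^+ 2).
Proof.
move=> kn c0 adm du cg hg; have [dh _ admw] := adm; have [hh _] := dh; have [hu _] := du.
have kn' : (k.+1 <= n)%N by exact: ltnW.
have bo : k.+1%:R * IB r (fun w => u w * Lop k.+1 h u w) =
  IB r (fun w => h w * (phi w ^+ (n - k.+1) * Hform k.+1 h u w)) := esym (bochner r0 kn' dh du).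
have ch := Ck_cts hh; have cL := cts_Lop k.+1 hh hu; have cH := cts_Hform k.+1 hh hu.
have cp := Ck_cts (Ck_phi R n 0).
have kp : 0 < k.+1%:R :> R by rewrite ltr0Sn.
rewrite -(ler_pM2l kp) bo -(IBZ r0); last by ctn.
apply: (IB_le r0); [by ctn|by ctn|] => w wB.
have [/andP[hc hC] [sM bM gM]] := admw w wB; have hw0 : 0 < h w by exact: lt_le_trans hc.
have sg0 : 0 < sg k.+2 (Sh h w) by apply: lt_le_trans (gM k.+2 (leqnn _)).
rewrite /Hform; have [tN' ->] := dNT_split (Sh u w) sM (lt0r_neq0 sg0).
set N' := _ - _ *: _ in tN' *; set t := \tr (NT k.+1 _ *m Sh u w).
have sN' : N'^T = N' by rewrite /N' linearB /= linearZ /= !Sh_sym.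
have H'0 : \tr (dNT k.+1 (Sh h w) N' *m N') <= 0.
  have [->|N0] := eqVneq N' 0; first by rewrite mulmx0 linear0.
  apply: ltW; apply: NT_lorentz => // j jk; exact: lt_le_trans (gM j jk).
set P := phi w ^+ _; have P0 : 0 < P by rewrite exprn_gt0 // phi_gt0.
have kk : k.+2%:R != 0 :> R by rewrite pnatr_eq0.
have gE : g w = h w / (k.+2%:R * (P * sg k.+2 (Sh h w))).
  have PS : P * sg k.+2 (Sh h w) != 0 by rewrite gt_eqF // mulr_gt0.
  by have := hg w wB; rewrite Lop_base -/P => <-; rewrite mulfK // mulf_neq0.
rewrite gE /Lop -/P -/t.
apply: le_trans (_ : h w * (P * (k.+1%:R / k.+2%:R * t ^+ 2 / sg k.+2 (Sh h w))) <= _).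
  by rewrite ler_pM2l // ler_pM2l // gerDr.
rewrite le_eqVlt; apply/orP; left; apply/eqP; field.
by rewrite (gt_eqF sg0) (gt_eqF P0) /= -natrD pnatr_eq0.
Qed.

End Estimates.

(** * The Poincare inequality on the ball *)

Section PolyCalculus.
Variables (R : realType) (n : nat).
Implicit Types (p q g : 'rV[R]_n -> R) (w : 'rV[R]_n) (i : 'I_n).

Definition lap p w := \sum_i pd i (pd i p) w.
Definition gdot p q w := \sum_i pd i p w * pd i q w.

Lemma sum_CS (I : finType) (a b : I -> R) : (\sum_i a i * b i) ^+ 2 <= (\sum_i a i ^+ 2) * (\sum_i b i ^+ 2).
Proof.
rewrite expr2 !mulr_suml; under eq_bigr do rewrite mulr_sumr.
under [in leRHS]eq_bigr do rewrite mulr_sumr.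
have -> : \sum_i \sum_j a i ^+ 2 * b j ^+ 2 =
    \sum_i \sum_j 2^-1 * (a i ^+ 2 * b j ^+ 2 + a j ^+ 2 * b i ^+ 2).
  under [RHS]eq_bigr do rewrite -mulr_sumr big_split /=.
  rewrite -mulr_sumr big_split /= [X in _ * (_ + X)]exchange_big /=; field; by [].
apply: ler_sum => i _; apply: ler_sum => j _.
by have := sqr_ge0 (a i * b j - a j * b i); lra.
Qed.

Lemma euler_CS p w : euler p w ^+ 2 <= nsq w * gdot p p w.
Proof.
have := sum_CS (fun i => w 0 i) (fun i => pd i p w); rewrite /euler /gdot nsqE.
have -> : \sum_i w 0 i ^+ 2 = \sum_i w 0 i * w 0 i by apply: eq_bigr => i _; rewrite expr2.
by have -> : \sum_i pd i p w ^+ 2 = \sum_i pd i p w * pd i p w by apply: eq_bigr => i _; rewrite expr2.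
Qed.

Lemma gdot_ge0 p w : 0 <= gdot p p w.
Proof. by apply: sumr_ge0 => i _; rewrite -expr2 sqr_ge0. Qed.

Lemma pd_lin i c p q w : Ck 1 p -> Ck 1 q -> pd i (fun w => c * p w + q w) w = c * pd i p w + pd i q w.
Proof.
move=> hp hq; have dp x : derivable p x (basisv R i) by apply: Ck_der hp.
have dc x : derivable (fun w => c * p w) x (basisv R i) by apply: Ck_der (CkZ c hp).
have dq x : derivable q x (basisv R i) by apply: Ck_der hq.
by rewrite (_ : (fun w => c * p w + q w) = (fun w => c * p w) \+ q) // (pdD dc dq) (pdZ c dp).
Qed.

Lemma pd_mul i p q w : Ck 1 p -> Ck 1 q -> pd i (fun w => p w * q w) w = p w * pd i q w + q w * pd i p w.
Proof.
move=> hp hq; have dp x : derivable p x (basisv R i) by apply: Ck_der hp.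
have dq x : derivable q x (basisv R i) by apply: Ck_der hq.
by rewrite (_ : (fun w => p w * q w) = p \* q) // (pdM dp dq).
Qed.

Lemma pd_funlin i c p q : Ck 1 p -> Ck 1 q -> pd i (fun w => c * p w + q w) = fun w => c * pd i p w + pd i q w.
Proof. by move=> hp hq; apply/funext => w; exact: pd_lin. Qed.

Lemma lap_lin c p q w : Ck 2 p -> Ck 2 q -> lap (fun w => c * p w + q w) w = c * lap p w + lap q w.
Proof.
move=> hp hq; rewrite /lap mulr_sumr -big_split /=; apply: eq_bigr => i _.
rewrite (pd_funlin i c (CkW hp) (CkW hq)); apply: pd_lin; exact: Ck_pd.
Qed.

Lemma euler_lin c p q w : Ck 1 p -> Ck 1 q -> euler (fun w => c * p w + q w) w = c * euler p w + euler q w.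
Proof.
move=> hp hq; rewrite /euler mulr_sumr -big_split /=; apply: eq_bigr => i _.
by rewrite (pd_lin i c w hp hq); ring.
Qed.

Lemma euler_mul p q w : Ck 1 p -> Ck 1 q -> euler (fun w => p w * q w) w = p w * euler q w + q w * euler p w.
Proof.
move=> hp hq; rewrite /euler !mulr_sumr -big_split /=; apply: eq_bigr => i _.
by rewrite (pd_mul i w hp hq); ring.
Qed.

Lemma lap_mul p q w : Ck 2 p -> Ck 2 q ->
  lap (fun w => p w * q w) w = p w * lap q w + 2 * gdot p q w + q w * lap p w.
Proof.
move=> hp hq; rewrite /lap /gdot !mulr_sumr -!big_split /=; apply: eq_bigr => i _.
have -> : pd i (fun w => p w * q w) = (p \* pd i q) \+ (q \* pd i p).
  by apply/funext => x; rewrite (pd_mul i x (CkW hp) (CkW hq)).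
have h1 := CkM (CkW hp) (Ck_pd i hq); have h2 := CkM (CkW hq) (Ck_pd i hp).
rewrite pdD; [|by move=> x; apply: Ck_der h1|by move=> x; apply: Ck_der h2].
rewrite /= (pd_mul i w (CkW hp) (Ck_pd i hq)) (pd_mul i w (CkW hq) (Ck_pd i hp)); ring.
Qed.

Lemma lap_nsq w : lap (@nsq R n) w = 2 * n%:R.
Proof.
rewrite /lap; under eq_bigr => i _.
  rewrite pd_nsq pdZ; last by move=> x; exact: derivable_coord.
  rewrite pd_coord eqxx mulr1; over.
by rewrite sumr_const card_ord mulr_natr.
Qed.

Lemma gdot_nsq q w : gdot (@nsq R n) q w = 2 * euler q w.
Proof.
rewrite /gdot /euler mulr_sumr; apply: eq_bigr => i _; rewrite pd_nsq; ring.
Qed.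

Lemma Ck_lap k p : Ck k.+2 p -> Ck k (lap p).
Proof. by move=> hp; apply: Ck_sum => i; exact: Ck_pd (Ck_pd i hp). Qed.
Lemma Ck_gdot k p q : Ck k.+1 p -> Ck k.+1 q -> Ck k (gdot p q).
Proof. by move=> hp hq; apply: Ck_sum => i; exact: (CkM (Ck_pd i hp) (Ck_pd i hq)). Qed.

Lemma hpoly_lap m p : hpoly m p -> hpoly m.-2 (lap p).
Proof. by move=> hp; apply: hpoly_sum => i; exact: hpoly_pd (hpoly_pd i hp). Qed.
Lemma polyd_lap d p : polyd d.+1 p -> polyd d (lap p).
Proof.
case: d => [|d] hp.
  have E i : pd i p = fun=> 0 by apply: polyd0_inv; exact: polyd_pd.
  rewrite (_ : lap p = fun=> 0); first exact: polyd0.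
  by apply/funext => w; rewrite /lap big1 // => i _; rewrite E pd_cst.
rewrite /lap; have h i : polyd d.+1 (pd i (pd i p)) by exact: polydW (polyd_pd i (polyd_pd i hp)).
elim: (index_enum _) => [|a s IH]; first by rewrite big_nil_fun; apply: polyd_le (polyd0 _ _).
by rewrite big_cons_fun; exact: polydD.
Qed.

Lemma hpoly_lin m c p q : hpoly m p -> hpoly m q -> hpoly m (fun w => c * p w + q w).
Proof. by move=> hp hq; exact: (hpoly_D (hpolyZ c hp) hq). Qed.
Lemma polyd_lin d c p q : polyd d p -> polyd d q -> polyd d (fun w => c * p w + q w).
Proof. by move=> hp hq; exact: (polydD (polydZ c hp) hq). Qed.
Lemma polyf_lin c p q : polyf p -> polyf q -> polyf (fun w => c * p w + q w).
Proof. by move=> hp hq; exact: (polyfD (polyfZ c hp) hq). Qed.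

Lemma hpoly0_cst p : hpoly 0 p -> exists c, p = fun=> c.
Proof.
move: (erefl 0%N); move: {1 3}0%N => m + hp; elim: hp => [c|l|//|l F G hF IF hG IG] e.
- by exists c.
- by exists 0.
- by have [a ->] := IF e; have [b ->] := IG e; exists (a + b).
Qed.

End PolyCalculus.

Section Poincare.
Variables (R : realType) (n : nat) (r : R).
Hypothesis r0 : 0 < r.
Implicit Types (p q g y : 'rV[R]_n -> R) (w : 'rV[R]_n) (i : 'I_n).

(* div((r^2 - w w^T) grad p): no boundary terms on the ball, and it preserves polynomial degree. *)
Definition Gop p w := r ^+ 2 * lap p w - euler (euler p) w - n%:R * euler p w.

Lemma Ck_Gop p : Ck 3 p -> Ck 1 (Gop p).
Proof.
move=> hp; apply: CkB; last exact: (CkZ _ (Ck_euler (CkW hp))).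
apply: CkB; first exact: (CkZ _ (Ck_lap hp)).
exact: (Ck_euler (Ck_euler hp)).
Qed.

Lemma IB_Gop p g : Ck 3 p -> Ck 1 g ->
  IB r (fun w => g w * Gop p w) = - IB r (fun w => r ^+ 2 * gdot g p w - euler g w * euler p w).
Proof.
move=> hp hg; have hE := Ck_euler hp.
have cg := Ck_cts hg; have cG := Ck_cts (Ck_Gop hp).
have c1 := Ck_cts (Ck_gdot hg (CkW (CkW hp))); have c2 := Ck_cts (Ck_euler hg); have c3 := Ck_cts hE.
pose Y i w := r ^+ 2 * pd i p w + - (w 0 i * euler p w).
have hY i : Ck 1 (Y i).
  by apply: CkD; [exact: (CkZ _ (CkW (Ck_pd i hp)))|exact: CkN (CkM (Ck_coord R 1 i) (CkW hE))].
pose X i := g \* Y i; have hX i : Ck 1 (X i) := CkM hg (hY i).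
have := divergence r0 hX; have E : divf X = fun w => g w * Gop p w + (r ^+ 2 * gdot g p w - euler g w * euler p w).
  apply/funext => w; rewrite /divf.
  have e i : pd i (X i) w = g w * (r ^+ 2 * pd i (pd i p) w - (w 0 i * pd i (euler p) w + euler p w))
      + (r ^+ 2 * (pd i g w * pd i p w) - w 0 i * pd i g w * euler p w).
    rewrite (pd_mul i w hg (hY i)) /Y.
    rewrite (pd_lin i _ w (CkW (Ck_pd i hp)) (CkN (CkM (Ck_coord R 1 i) (CkW hE)))).
    have dm x : derivable ((fun w : 'rV[R]_n => w 0 i) \* euler p) x (basisv R i).
      by apply: Ck_der (CkM (Ck_coord R 1 i) (CkW hE)).
    rewrite (pdN dm) (pd_mul i w (Ck_coord R 1 i) (CkW hE)) pd_coord eqxx /=; ring.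
  under eq_bigr do rewrite e; rewrite big_split /= -mulr_sumr; congr (_ * _ + _).
    rewrite sumrB -mulr_sumr big_split /= /Gop sumr_const card_ord -/(lap p w) -/(euler (euler p) w).
    by rewrite -[euler p w *+ n]mulr_natl; ring.
  by rewrite sumrB -mulr_sumr -mulr_suml.
rewrite E => h; apply/eqP; rewrite -addr_eq0 -(IBD r0); [|by ctn|by ctn].
apply/eqP; apply: h => w wr; under eq_bigr do rewrite /X /Y /=.
rewrite (eq_bigr (fun i => g w * (r ^+ 2 * (w 0 i * pd i p w) - (w 0 i * w 0 i) * euler p w))); last first.
  by move=> i _; ring.
by rewrite -mulr_sumr sumrB -mulr_sumr -mulr_suml -nsqE wr -/(euler p w) subrr mulr0.
Qed.

Lemma IB_Gop_sym p g : Ck 3 p -> Ck 3 g -> IB r (fun w => g w * Gop p w) = IB r (fun w => p w * Gop g w).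
Proof.
move=> hp hg; rewrite (IB_Gop hp (Ck_le (leq_addr 2 1) hg)) (IB_Gop hg (Ck_le (leq_addr 2 1) hp)).
congr (- IB r _); apply/funext => w; rewrite mulrC [euler g w * _]mulrC; congr (_ - _).
by rewrite mulrC; congr (_ * _); apply: eq_bigr => i _; rewrite mulrC.
Qed.

(** The eigenvalues of [- Gop]: on homogeneous polynomials of degree [m], [Gop] is multiplication by
    [- lam m] up to lower degree. *)
Definition lam (m : nat) : R := m%:R * (m + n)%:R.

Lemma Gop_lin c p q w : Ck 2 p -> Ck 2 q -> Gop (fun w => c * p w + q w) w = c * Gop p w + Gop q w.
Proof.
move=> hp hq; rewrite /Gop (lap_lin c w hp hq) (euler_lin c w (CkW hp) (CkW hq)).
have -> : euler (fun w => c * p w + q w) = fun w => c * euler p w + euler q w.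
  by apply/funext => x; exact: euler_lin (CkW hp) (CkW hq).
by rewrite (euler_lin c w (Ck_euler hp) (Ck_euler hq)); ring.
Qed.

Lemma Gop_hpoly m p w : hpoly m p -> Gop p w = r ^+ 2 * lap p w - lam m * p w.
Proof.
move=> hp; rewrite /Gop (hpoly_euler w hp).
have -> : euler p = fun w => m%:R * p w by apply/funext => x; exact: hpoly_euler.
by rewrite (hpoly_euler w (hpolyZ _ hp)) /lam natrD; ring.
Qed.

(** [Gop] is triangular for the degree: the top component is solved by dividing by [mu - lam d], and
    the Laplacian it leaves behind has lower degree and joins the data of the induction. *)
Lemma Gop_solve d g mu : polyd d g -> (forall m, (m < d)%N -> mu != lam m) ->
  exists2 q, polyd d q & forall w, Gop q w + mu * q w = g w.
Proof.
elim: d g => [|d IH] g.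
  move=> /polyd0_inv -> _; exists (fun=> 0); first exact: polyd0.
  move=> w; have := Gop_hpoly w (hpoly_0 R n 0) ; rewrite /lam mul0r mul0r subr0 => ->.
  by rewrite /lap big1 ?mulr0 ?addr0 // => i _; rewrite !pd_cst.
move=> /polydS_inv[G [H [hG hH ->]]] hmu.
pose c := (mu - lam d)^-1; have c0 : mu - lam d != 0 by rewrite subr_eq0 hmu.
have hHd := hpoly_polyd hH; have hL := polyd_lap hHd.
have [||q hq hqE] := IH (fun w => - (c * r ^+ 2) * lap H w + G w).
- exact: polyd_lin.
- by move=> m md; apply: hmu; rewrite ltnS ltnW.
exists (fun w => c * H w + q w).
  by apply: polyd_lin => //; exact: polydW.
move=> w; rewrite (Gop_lin c w (Ck_hpoly 2 hH) (Ck_polyd 2 hq)) (Gop_hpoly w hH) /=.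
transitivity (c * (mu - lam d) * H w + c * (r ^+ 2 * lap H w) + (Gop q w + mu * q w)); first by ring.
by rewrite hqE /c mulVf //; ring.
Qed.

Lemma lam_lt m d : (m < d)%N -> lam m < lam d.
Proof.
move=> md; rewrite /lam -!natrM ltr_nat; apply: (leq_trans (n := (m.+1 * (m + n).+1)%N)); last first.
  by apply: leq_mul => //; rewrite ltn_add2r.
by rewrite mulSn mulnS; lia.
Qed.

(** Splitting off an eigenfunction with the same leading part, orthogonal to all polynomials of
    lower degree, lowers the degree. Every eigenvalue met is at least lam 1 = n + 1, which gives the
    constant. *)
Lemma poincare_poly d p : (0 < d)%N -> polyd d p -> exists c,
  n.+1%:R * IB r (fun w => (p w - c) ^+ 2) <= - IB r (fun w => p w * Gop p w).
Proof.
case: d => // d _; elim: d p => [|d IH] p hp.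
  have [G [H [/polyd0_inv -> /hpoly0_cst[c ->] ->]]] := polydS_inv hp.
  exists c; have -> : (fun=> 0) \+ (fun=> c) = fun _ : 'rV[R]_n => c by apply/funext => w /=; rewrite add0r.
  have E w : Gop (fun _ : 'rV[R]_n => c) w = 0.
    rewrite /Gop /lap big1 => [|i _]; last by rewrite !pd_cst.
    have -> : euler (fun _ : 'rV[R]_n => c) = fun _ : 'rV[R]_n => 0.
      by apply/funext => x; rewrite /euler big1 // => i _; rewrite pd_cst mulr0.
    by rewrite /euler big1 ?mulr0 ?subr0 // => i _; rewrite pd_cst mulr0.
  rewrite (_ : (fun w => _) = fun=> 0); last by apply/funext => w; rewrite /= subrr expr0n.
  rewrite IB0 mulr0 (_ : (fun w => _) = fun=> 0); last by apply/funext => w; rewrite E mulr0.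
  by rewrite IB0 oppr0.
have [G [H [hG hH pE]]] := polydS_inv hp.
have hL : polyd d.+1 (fun w => - (r ^+ 2) * lap H w).
  by apply: polydZ; apply: polyd_lap; exact: hpoly_polyd.
(* The lower-order correction that makes [e], with leading part [H], an eigenfunction. *)
have [|q hq hqE] := Gop_solve hL (mu := lam d.+1).
  by move=> m md; rewrite gt_eqF // lam_lt.
pose e w := 1 * H w + q w.
have Ce k : Ck k e by exact: (Ck_lin 1 (Ck_hpoly k hH) (Ck_polyd k hq)).
have eE w : Gop e w = - lam d.+1 * e w.
  rewrite /e (Gop_lin 1 w (Ck_hpoly 2 hH) (Ck_polyd 2 hq)) (Gop_hpoly w hH).
  have -> : Gop q w = - r ^+ 2 * lap H w - lam d.+1 * q w by rewrite -hqE addrK.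
  ring.
(* [z] is in the range of [Gop + lam d.+1] on lower polynomials, and the symmetric operator moves
   onto [e], which it annihilates. *)
have orth z : polyd d.+1 z -> IB r (fun w => z w * e w) = 0.
  move=> hz; have [|x hx hxE] := Gop_solve hz (mu := lam d.+1).
    by move=> m md; rewrite gt_eqF // lam_lt.
  have Cx k := Ck_polyd k hx; have ce := Ck_cts (Ce 0%N); have cx := Ck_cts (Cx 0%N).
  have cG := Ck_cts (Ck_Gop (Cx 3)).
  have -> : (fun w => z w * e w) = fun w => e w * Gop x w + lam d.+1 * (x w * e w).
    by apply/funext => w; rewrite -hxE; ring.
  rewrite (IBD r0); [|by ctn|by ctn]; rewrite (IB_Gop_sym (Cx 3) (Ce 3)).
  rewrite (IBZ r0); last by ctn.
  rewrite (_ : (fun w => x w * Gop e w) = fun w => - lam d.+1 * (x w * e w)); last first.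
    by apply/funext => w; rewrite eE; ring.
  by rewrite (IBZ r0); [rewrite mulNr addNr|ctn].
pose p' w := -1 * q w + G w; have hp' : polyd d.+1 p' by exact: polyd_lin.
have Cp' k := Ck_polyd k hp'.
have [c hc] := IH p' hp'; exists c.
have pE' : p = fun w => 1 * e w + p' w by apply/funext => w; rewrite pE /e /p' /=; ring.
have ce := Ck_cts (Ce 0%N); have cp' := Ck_cts (Cp' 0%N); have cG := Ck_cts (Ck_Gop (Cp' 3)).
have cGe := Ck_cts (Ck_Gop (Ce 3)).
have o1 : IB r (fun w => p' w * e w) = 0 by exact: orth.
have o2 : IB r (fun w => (p' w - c) * e w) = 0.
  have h : polyd d.+1 (fun w => 1 * p' w + - c).
    by apply: polyd_lin => //; apply: polyd_le (hpoly_polyd (hpoly_cst n (- c))).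
  by rewrite -(orth _ h); congr (IB r _); apply/funext => w; rewrite mul1r.
have o3 : IB r (fun w => e w * Gop p' w) = 0.
  rewrite (IB_Gop_sym (Cp' 3) (Ce 3)) (_ : (fun w => _) = fun w => - lam d.+1 * (p' w * e w)).
    by rewrite (IBZ r0); [rewrite o1 mulr0|ctn].
  by apply/funext => w; rewrite eE; ring.
set S := IB r (fun w => e w ^+ 2).
have S0 : 0 <= S by apply: (IB_ge0 r0) => [|w _]; [ctn|exact: sqr_ge0].
have L1 : IB r (fun w => (p w - c) ^+ 2) = IB r (fun w => (p' w - c) ^+ 2) + S.
  have -> : (fun w => (p w - c) ^+ 2) = fun w => 2 * ((p' w - c) * e w) + ((p' w - c) ^+ 2 + e w ^+ 2).
    by apply/funext => w; rewrite pE'; ring.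
  rewrite (IBD r0); [|by ctn|by ctn]; rewrite (IBZ r0); last by ctn.
  by rewrite o2 mulr0 add0r (IBD r0) //; ctn.
have L2 : IB r (fun w => p w * Gop p w) = IB r (fun w => p' w * Gop p' w) - lam d.+1 * S.
  have -> : (fun w => p w * Gop p w) = fun w => (e w * Gop p' w + - lam d.+1 * (p' w * e w)) +
      (- lam d.+1 * e w ^+ 2 + p' w * Gop p' w).
    apply/funext => w; have -> : Gop p w = - lam d.+1 * e w + Gop p' w.
      by rewrite pE' (Gop_lin 1 w (Ce 2) (Cp' 2)) eE mul1r.
    by rewrite pE'; ring.
  rewrite (IBD r0); [|by ctn|by ctn]; rewrite (IBD r0); [|by ctn|by ctn].
  rewrite o3 (IBZ r0); last by ctn.
  rewrite o1 mulr0 addr0 add0r (IBD r0); [|by ctn|by ctn]; rewrite (IBZ r0); last by ctn.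
  by rewrite mulNr addrC.
have l1 : n.+1%:R <= lam d.+1.
  by rewrite /lam -natrM ler_nat; nia.
rewrite L1 L2 mulrDr opprB; have := ler_wpM2r S0 l1; lra.
Qed.

Lemma IB_ucv (Fs : nat -> 'rV[R]_n -> R) (F : 'rV[R]_n -> R) e : ucv r Fs F -> 0 < e ->
  exists N, forall j, (N <= j)%N -> `|IB r (Fs j) - IB r F| <= e.
Proof.
move=> [cF cFs h] e0; have I1 := IB1_gt0 n r0; have [N hN] := h _ (divr_gt0 e0 I1).
exists N => j /hN hj; have := IB_close r0 (cFs j) cF (fun w wB => hj w (ball2_norm r0 wB)).
by rewrite divfK // gt_eqF.
Qed.

(** For polynomials, the left-hand side is at most the mass times the squared distance to the
    constant of [poincare_poly], and by [IB_Gop] the quadratic form of [Gop] is at most r^2 times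
    the Dirichlet integral. Approximation extends this to C^2. *)
Lemma poincare y : Ck 2 y ->
  n.+1%:R * (IB r (fun _ : 'rV[R]_n => 1) * IB r (fun w => y w ^+ 2) - IB r y ^+ 2) <=
  r ^+ 2 * IB r (fun _ : 'rV[R]_n => 1) * IB r (gdot y y).
Proof.
move=> hy; set I1 := IB r (fun _ : 'rV[R]_n => 1); have I10 : 0 < I1 by exact: IB1_gt0.
have key p : polyf p -> n.+1%:R * (I1 * IB r (fun w => p w ^+ 2) - IB r p ^+ 2) <= r ^+ 2 * I1 * IB r (gdot p p).
  move=> [d hd]; have hd' : polyd d.+1 p by exact: polydW.
  have Cp k := Ck_polyd k hd; have cp := Ck_cts (Cp 0%N).
  have cg := Ck_cts (Ck_gdot (Cp 1%N) (Cp 1%N)); have cE := Ck_cts (Ck_euler (Cp 1%N)).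
  have [c hc] := poincare_poly (ltn0Sn _) hd'.
  have a1 : - IB r (fun w => p w * Gop p w) <= r ^+ 2 * IB r (gdot p p).
    rewrite (IB_Gop (Cp 3) (Cp 1%N)) opprK -(IBZ r0) //; apply: (IB_le r0); [by ctn|by ctn|] => w _.
    by rewrite gerBl -expr2 sqr_ge0.
  have a2 : I1 * IB r (fun w => p w ^+ 2) - IB r p ^+ 2 <= I1 * IB r (fun w => (p w - c) ^+ 2).
    have -> : IB r (fun w => (p w - c) ^+ 2) = IB r (fun w => p w ^+ 2) + (- (2 * c) * IB r p + c ^+ 2 * I1).
      rewrite -(IBZ r0); last by ctn.
      rewrite -(IBZ r0); last by ctn.
      rewrite -(IBD r0); [|by ctn|by ctn].
      by rewrite -(IBD r0); [|by ctn|by ctn]; congr (IB r _); apply/funext => w; ring.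
    by have := sqr_ge0 (I1 * c - IB r p); lra.
  apply: (@le_trans _ _ (n.+1%:R * (I1 * IB r (fun w => (p w - c) ^+ 2)))); first by rewrite ler_pM2l.
  rewrite mulrCA [r ^+ 2 * _]mulrC -mulrA ler_pM2l //; exact: le_trans a1.
have /boolp.choice[P hP] : forall j : nat, exists P, polyf P /\ forall w, `|w| <= r ->
  [/\ `|P w - y w| <= j.+1%:R^-1, forall i, `|pd i P w - pd i y w| <= j.+1%:R^-1 &
      forall i l, `|pd i (pd l P) w - pd i (pd l y) w| <= j.+1%:R^-1].
  move=> j; have e0 : 0 < j.+1%:R^-1 :> R by rewrite invr_gt0 ltr0Sn.
  by have [P hP hPh] := C2_approx r hy e0; exists P.
have small (e : R) : 0 < e -> exists N, forall j : nat, (N <= j)%N -> j.+1%:R^-1 <= e.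
  move=> e0; have [N _ hN] := near_infty_natSinv_lt (PosNum e0).
  by exists N => j Nj; apply: ltW; exact: hN.
have cP (j l : nat) : Ck l (P j) := Ck_polyf l (hP j).1.
have u0 : ucv r P y.
  split=> [|j|e /small[N hN]]; [exact: (Ck_cts hy)|exact: (Ck_cts (cP j 0%N))|].
  by exists N => j /hN je w wa; have [h1 _ _] := (hP j).2 w wa; exact: le_trans je.
have u1 i : ucv r (fun j : nat => pd i (P j)) (pd i y).
  split=> [|j|e /small[N hN]]; [exact: (Ck_cts (Ck_pd i hy))|exact: (Ck_cts (Ck_pd i (cP j 1%N)))|].
  by exists N => j /hN je w wa; have [_ h1 _] := (hP j).2 w wa; exact: le_trans je.
have U2 : ucv r (fun j w => P j w ^+ 2) (fun w => y w ^+ 2).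
  by apply: ucv_ext (ucvM u0 u0) => [j w|w]; rewrite expr2.
have Ug : ucv r (fun j => gdot (P j) (P j)) (gdot y y).
  exact: (ucv_sum (index_enum 'I_n) (fun i => ucvM (u1 i) (u1 i))).
set X := IB r (fun w => y w ^+ 2); set Y := IB r y; set Z := IB r (gdot y y).
apply/ler_addgt0Pr => e0 e00.
pose K := n.+1%:R * (I1 + 2 * `|Y| + 1) + r ^+ 2 * I1 + 1.
have K0 : 0 < K.
  rewrite /K ltr_wpDl // addr_ge0 // ?mulr_ge0 ?addr_ge0 ?mulr_ge0 // ?sqr_ge0 //; exact: ltW.
pose e := Num.min 1 (e0 / K); have ee : 0 < e by rewrite lt_min ltr01 divr_gt0.
have e1 : e <= 1 by rewrite ge_min lexx.
have eK : e * K <= e0 by rewrite -ler_pdivlMr // ge_min lexx orbT.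
have [Na ha] := IB_ucv U2 ee; have [Nb hb] := IB_ucv u0 ee; have [Nc hc] := IB_ucv Ug ee.
pose j := (Na + Nb + Nc)%N.
have := ha j (leq_trans (leq_addr _ _) (leq_addr _ _)); have := hb j (leq_trans (leq_addl _ _) (leq_addr _ _)).
have := hc j (leq_addl _ _); have := key _ (hP j).1.
rewrite -/X -/Y -/Z; set x := IB r (fun w => P j w ^+ 2); set y' := IB r (P j); set z := IB r (gdot _ _).
move=> k0; rewrite !ler_norml => /andP[z1 z2] /andP[y1 y2] /andP[x1 x2].
have yy : y' ^+ 2 <= Y ^+ 2 + e * (2 * `|Y| + 1).
  have -> : y' ^+ 2 = Y ^+ 2 + (2 * Y + (y' - Y)) * (y' - Y) by ring.
  rewrite lerD2l; apply: le_trans (ler_norm _) _; rewrite normrM mulrC.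
  have d1 : `|y' - Y| <= e by rewrite ler_norml; apply/andP.
  apply: ler_pM => //; apply: le_trans (ler_normD _ _) _; rewrite normrM ger0_norm //.
  by rewrite lerD2l; exact: le_trans e1.
have n0 : 0 < n.+1%:R :> R by rewrite ltr0Sn.
have h1 : n.+1%:R * (I1 * X - Y ^+ 2) <= n.+1%:R * (I1 * x - y' ^+ 2) + n.+1%:R * (I1 * e + e * (2 * `|Y| + 1)).
  rewrite -mulrDr ler_pM2l //; have : I1 * X <= I1 * (x + e) by rewrite ler_pM2l //; lra.
  by lra.
have h2 : r ^+ 2 * I1 * z <= r ^+ 2 * I1 * Z + r ^+ 2 * I1 * e.
  by rewrite -mulrDr ler_pM2l ?mulr_gt0 ?exprn_gt0 //; lra.
by move: eK; rewrite /K; lra.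
Qed.

End Poincare.

(** * Quantitative bounds on Newton tensors and on segments in the cone *)

Section EntryBounds.
Variables (R : realType) (n : nat).
Implicit Types (M N P Q : 'M[R]_n) (C D : R).

Definition eb C M := forall i j, `|M i j| <= C.

Lemma eb_le C C' M : C <= C' -> eb C M -> eb C' M.
Proof. by move=> CC h i j; exact: le_trans CC. Qed.
Lemma ebD C C' M N : eb C M -> eb C' N -> eb (C + C') (M + N).
Proof. by move=> h h' i j; rewrite mxE; apply: le_trans (ler_normD _ _) _; exact: lerD. Qed.
Lemma ebB C C' M N : eb C M -> eb C' N -> eb (C + C') (M - N).
Proof. by move=> h h' i j; rewrite !mxE; apply: le_trans (ler_normB _ _) _; exact: lerD. Qed.
Lemma ebM C C' M N : eb C M -> eb C' N -> eb (n%:R * (C * C')) (M *m N).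
Proof.
move=> h h' i j; rewrite mxE; apply: le_trans (ler_norm_sum _ _ _) _.
rewrite mulr_natl -[X in _ *+ X]card_ord -sumr_const; apply: ler_sum => l _; rewrite normrM.
exact: ler_pM.
Qed.
Lemma eb_tr C M : eb C M -> `|\tr M| <= n%:R * C.
Proof.
move=> h; apply: le_trans (ler_norm_sum _ _ _) _.
rewrite mulr_natl -[X in _ *+ X]card_ord -sumr_const; exact: ler_sum.
Qed.
Lemma eb_scalar a C : `|a| <= C -> eb C a%:M.
Proof. by move=> h i j; rewrite mxE; case: eqP => _ //; rewrite normr0; exact: le_trans h. Qed.

Lemma mulmx_diff M N P Q : M *m P - N *m Q = (M - N) *m P + N *m (P - Q).
Proof. by rewrite mulmxBl mulmxBr subrKA. Qed.

(** Constants are propagated through the recursion; the Lipschitz part later measures how the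
    operator varies with its base function. *)
Lemma NT_lipschitz k C : 0 <= C -> exists2 B, 0 <= B & forall M N D, 0 <= D -> eb C M -> eb C N -> eb D (M - N) ->
  [/\ eb B (NT k M), `|sg k.+1 M| <= B, eb (B * D) (NT k M - NT k N) & `|sg k.+1 M - sg k.+1 N| <= B * D].
Proof.
move=> C0; elim: k => [|k [B B0 IH]].
- exists (1 + n%:R * C + n%:R); first by rewrite !addr_ge0 // mulr_ge0.
  move=> M N D D0 hM hN hD; rewrite !sg1 -linearB /=; split.
  + by apply: eb_scalar; rewrite normr1 -addrA lerDl addr_ge0 // mulr_ge0.
  + by apply: le_trans (eb_tr hM) _; rewrite addrAC lerDr addr_ge0.
  + by rewrite subrr => i j; rewrite mxE normr0 mulr_ge0 // !addr_ge0 // mulr_ge0.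
  + by apply: le_trans (eb_tr hD) _; apply: ler_wpM2r => //; rewrite lerDr addr_ge0 // mulr_ge0.
have n0 : 0 <= n%:R :> R by [].
pose B1 := B + n%:R * (C * B); have B10 : 0 <= B1 by rewrite addr_ge0 // mulr_ge0 // mulr_ge0.
pose B2 := B + n%:R * B + n%:R * (C * B); have B20 : 0 <= B2 by rewrite !addr_ge0 // !mulr_ge0.
pose B3 := n%:R * (n%:R * (C * B1)); have B30 : 0 <= B3 by rewrite !mulr_ge0.
pose B4 := n%:R * (n%:R * B1) + n%:R * (n%:R * (C * B2)); have B40 : 0 <= B4 by rewrite addr_ge0 // !mulr_ge0.
exists (B1 + B2 + B3 + B4); first exact: addr_ge0 (addr_ge0 (addr_ge0 B10 B20) B30) B40.
have nk j : (j.+1%:R : R)^-1 <= 1 by rewrite invf_le1 ?ltr0Sn // ler1n.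
have step M N D : 0 <= D -> eb C M -> eb C N -> eb D (M - N) ->
    eb B1 (NT k.+1 M) /\ eb (B2 * D) (NT k.+1 M - NT k.+1 N).
  move=> D0 hM hN hD; have [t1 s1 t2 s2] := IH M N D D0 hM hN hD.
  split.
    by rewrite NTS; apply: ebB (eb_scalar s1) (ebM hM t1).
  rewrite !NTS (_ : _ - _ = (sg k.+1 M - sg k.+1 N)%:M - ((M - N) *m NT k M + N *m (NT k M - NT k N))).
    apply: eb_le (ebB (eb_scalar s2) (ebD (ebM hD t1) (ebM hN t2))).
    by rewrite /B2 le_eqVlt; apply/orP; left; apply/eqP; ring.
  rewrite mulmxBl mulmxBr raddfB /=; apply/matrixP => i j; rewrite !mxE; ring.
move=> M N D D0 hM hN hD; have [u1 u2] := step M N D D0 hM hN hD.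
have l1 : B1 <= B1 + B2 + B3 + B4 by lra.
have l2 : B2 <= B1 + B2 + B3 + B4 by lra.
have l3 : B3 <= B1 + B2 + B3 + B4 by lra.
have l4 : B4 <= B1 + B2 + B3 + B4 by lra.
have sE P : sg k.+2 P = \tr (P *m NT k.+1 P) / k.+2%:R by [].
split.
- exact: eb_le u1.
- rewrite sE normrM [X in _ * X]ger0_norm ?invr_ge0 //; apply: le_trans (_ : B3 * 1 <= _).
    by apply: ler_pM => //; exact: eb_tr (ebM hM u1).
  by rewrite mulr1.
- apply: eb_le u2; exact: ler_wpM2r.
- rewrite !sE -mulrBl -linearB /= normrM [X in _ * X]ger0_norm ?invr_ge0 //.
  apply: le_trans (_ : B4 * D * 1 <= _); last first.
    by rewrite mulr1; exact: ler_wpM2r.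
  apply: ler_pM => //; rewrite mulmx_diff.
  apply: le_trans (eb_tr (ebD (ebM hD u1) (ebM hN u2))) _.
  by rewrite /B4 le_eqVlt; apply/orP; left; apply/eqP; ring.
Qed.

End EntryBounds.

Section Cone.
Variables (R : realType) (n : nat).
Implicit Types (M N P Q : 'M[R]_n) (C a s : R).

Lemma unif_gt0 k (f : nat -> R) : (forall j, (j <= k)%N -> 0 < f j) ->
  exists2 c, 0 < c & forall j, (j <= k)%N -> c <= f j.
Proof.
elim: k => [|k IH] h; first by exists (f 0%N) => [|j]; [exact: h|rewrite leqn0 => /eqP ->].
have [c c0 hc] := IH (fun j jk => h j (leqW jk)).
exists (Num.min c (f k.+1)) => [|j]; first by rewrite lt_min c0 h.
by rewrite leq_eqVlt ge_min => /predU1P[->|/hc ->]; rewrite ?lexx ?orbT.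
Qed.

(** By [sg_le_add] one of the two summands alone gives a lower bound: [M] if t >= 1/2, the scalar
    matrix otherwise. Its weight is then at least 1/2, which explains the factor [2^-1 ^+ j] in
    degree j; the constant depends on neither [M], [a] nor [t]. *)
Lemma Kset_segment k C c a0 a1 : (k <= n)%N -> 0 <= C -> 0 < c -> 0 < a0 -> 
  exists2 c', 0 < c' & forall M (a t : R), Kset k C c M -> a0 <= a <= a1 -> 0 <= t <= 1 ->
    Kset k (C + a1) c' (((1 - t) * a)%:M + t *: M).
Proof.
move=> kn C0 c0 a00.
pose f j := 2^-1 ^+ j * Num.min c (a0 ^+ j * sg j (1%:M : 'M[R]_n)).
have f0 j : (j <= k)%N -> 0 < f j.
  move=> jk; rewrite mulr_gt0 ?exprn_gt0 ?invr_gt0 ?ltr0n // lt_min c0 /= mulr_gt0 ?exprn_gt0 //.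
  by rewrite sg1_gt0 // (leq_trans jk).
have [c' c'0 hc'] := unif_gt0 f0; exists c' => // M a t [sM bM gM] /andP[aa0 aa1] /andP[t0 t1].
have apos : 0 < a by exact: lt_le_trans aa0.
have s1 : (1%:M : 'M[R]_n)^T = 1%:M by rewrite trmx1.
have sa b : (b%:M : 'M[R]_n)^T = b%:M by rewrite tr_scalar_mx.
have sZ b : (b *: M)^T = b *: M by apply/matrixP => i j; rewrite !mxE -[in RHS]sM mxE.
have GM : GamM k M by move=> j jk; exact: lt_le_trans (gM j jk).
have saZ b j : sg j (b%:M : 'M[R]_n) = b ^+ j * sg j (1%:M : 'M[R]_n) by rewrite -(NTZ j b 1%:M).2 scalemx1.
have Ga b : 0 < b -> GamM k (b%:M : 'M[R]_n).
  by move=> b0 j jk; rewrite saZ mulr_gt0 ?exprn_gt0 // sg1_gt0 // (leq_trans jk).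
have b0 : 0 <= (1 - t) * a by rewrite mulr_ge0 ?subr_ge0 // ltW.
have half : 0 < 2^-1 :> R by rewrite invr_gt0 ltr0n.
have m0 j : (j <= k)%N -> 0 <= Num.min c (a0 ^+ j * sg j (1%:M : 'M[R]_n)).
  by move=> jk; have := ltW (f0 j jk); rewrite /f pmulr_rge0 // exprn_gt0.
have low j : (j <= k)%N -> f j <= sg j (((1 - t) * a)%:M + t *: M).
  move=> jk; have [th|th] := lerP 2^-1 t.
    have tp : 0 < t by exact: lt_le_trans th.
    have G2 : GamM j (t *: M) by apply: GamMZ => //; exact: GamM_le GM.
    apply: le_trans (_ : sg j (t *: M) <= _).
      rewrite (NTZ j t M).2 /f; apply: ler_pM.
      - exact: exprn_ge0 (ltW half).
      - exact: m0.
      - by apply: lerXn2r => //; rewrite nnegrE ltW.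
      - by rewrite ge_min gM.
    have [z|z] := eqVneq ((1 - t) * a) 0; first by rewrite z raddf0 add0r.
    rewrite addrC; apply: sg_le_add => //; last exact: GamM_shift.
    by apply: GamM_le (jk) (Ga _ _); rewrite lt_neqAle eq_sym z.
  have bp : 0 < (1 - t) * a by rewrite mulr_gt0 // subr_gt0; apply: lt_le_trans th _; rewrite invf_le1 ?ler1n ?ltr0n.
  have Gb : GamM j (((1 - t) * a)%:M : 'M[R]_n) by exact: GamM_le (jk) (Ga _ bp).
  apply: le_trans (_ : sg j (((1 - t) * a)%:M : 'M[R]_n) <= _).
    rewrite (saZ ((1 - t) * a) j) exprMn /f -mulrA; apply: ler_pM.
    - exact: exprn_ge0 (ltW half).
    - exact: m0.
    - apply: lerXn2r; rewrite ?nnegrE; [exact: ltW|by rewrite subr_ge0|].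
      by rewrite lerBrDl; apply: le_trans (lerD (ltW th) (lexx _)) _; lra.
    - rewrite ge_min; apply/orP; right; apply: ler_wpM2r; first by rewrite ltW // sg1_gt0 // (leq_trans jk).
      by apply: lerXn2r => //; rewrite nnegrE ltW.
  have [->|tz] := eqVneq t 0; first by rewrite scale0r addr0.
  have tp : 0 < t by rewrite lt_neqAle eq_sym tz.
  have G2 : GamM j (t *: M) by apply: GamMZ => //; exact: GamM_le GM.
  by apply: sg_le_add => //; rewrite addrC; exact: GamM_shift.
split.
- by rewrite linearD /= sa sZ.
- move=> i j; rewrite [C + _]addrC; apply: (@ebD _ _ a1 C).
    apply: eb_scalar; rewrite ger0_norm //; apply: le_trans aa1.
    by rewrite ler_piMl ?(ltW apos) // gerBl.
  by move=> i' j'; rewrite mxE normrM ger0_norm //; apply: le_trans (_ : 1 * C <= _); [apply: ler_pM|rewrite mul1r].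
- by move=> j jk; apply: le_trans (hc' j jk) (low j jk).
Qed.

End Cone.

Section Gradient.
Variables (R : realType) (n : nat) (r : R).
Hypothesis r0 : 0 < r.
Implicit Types (u v h : 'rV[R]_n -> R) (w : 'rV[R]_n).

Lemma admissible_Lop_bound k C c : 0 <= C -> 0 < c -> exists2 B, 0 <= B &
  forall h w, admissible r k.+1 C c h -> ball2 r w -> 0 <= Lop k h h w / h w <= B.
Proof.
move=> C0 c0; have [B B0 hB] := @NT_lipschitz R n k C C0.
exists (k.+1%:R * (2 ^+ (n - k) * B) / c).
  by rewrite divr_ge0 ?mulr_ge0 // ?exprn_ge0 // ltW.
move=> h w [_ _ adm] wB; have [/andP[hc hC] [sM bM gM]] := adm w wB.
have h0 : 0 < h w by exact: lt_le_trans hc.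
have [|_ sB _ _] := hB (Sh h w) (Sh h w) 0 (lexx 0) bM bM; first by move=> i j; rewrite subrr mxE normr0.
have s0 : 0 < sg k.+1 (Sh h w) by apply: lt_le_trans (gM k.+1 (leqnn _)).
have [b b0 /(_ w wB)/andP[P1 P2]] := phiX_bounds n r (n - k).
have P0 : 0 < phi w ^+ (n - k) by exact: lt_le_trans P1.
rewrite Lop_base; apply/andP; split; first by rewrite divr_ge0 ?ltW // mulr_gt0 ?ltr0Sn // mulr_gt0.
apply: ler_pM; [by rewrite ltW // mulr_gt0 ?ltr0Sn // mulr_gt0|by rewrite invr_ge0 ltW| |by rewrite lef_pV2].
apply: ler_wpM2l => //; apply: ler_pM => //; [exact: ltW|exact: ltW|].
by apply: le_trans (ler_norm _) sB.
Qed.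

End Gradient.

(** * Density of the range *)

Section BaseProblem.
Variables (R : realType) (n : nat) (r : R).
Hypothesis r0 : 0 < r.
Implicit Types (p q g u v : 'rV[R]_n -> R) (w : 'rV[R]_n) (i : 'I_n).

Lemma C0_approx f (e : R) : cts f -> 0 < e ->
  exists2 P, polyf P & forall w : 'rV[R]_n, ball2 r w -> `|P w - f w| <= e.
Proof.
move=> cf e0; pose b := r + 1; have b1 : 1 <= b by rewrite /b lerDr ltW.
have b0 : 0 < b by apply: lt_le_trans b1.
pose F w := f w * cutf b w.
have cF : continuous F.
  by apply: ctsE; have := Ck_cts (@Ck_cutf R n b) => cc; rewrite /F; ctn.
have F0 w : 2 * b ^+ 2 <= nsq w -> F w = 0 by move=> h; rewrite /F cutf_eq0 ?mulr0.
have [N0 /(_ N0 (leqnn _))[c0 h]] := conv_approx b1 cF F0 e0.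
exists (fun w => (Phi b N0 (cutf (2 * b)) (0 : 'rV[R]_n))^-1 * Phi b N0 F w); first by apply: polyfZ; exact: polyf_Phi.
move=> w wB; have wb : nsq w <= b ^+ 2.
  by apply: le_trans wB _; apply: lerXn2r; rewrite ?nnegrE ?(ltW r0) ?(ltW b0) // /b lerDl.
by have := h w wb; rewrite {2}/F cutf_eq1 ?mulr1.
Qed.

Lemma hpoly_lap_low m g w : hpoly m g -> (m <= 1)%N -> lap g w = 0.
Proof.
move=> hg m1; rewrite /lap big1 // => i _.
have hd : polyd 2 g by apply: polyd_le (hpoly_polyd hg).
by have /polyd0_inv -> := polyd_pd i (polyd_pd i hd).
Qed.

Lemma lap_nsq_mul m Y w : hpoly m Y ->
  lap (fun w => nsq w * Y w) w = (2 * n%:R + 4 * m%:R) * Y w + nsq w * lap Y w.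
Proof.
move=> hY; rewrite (lap_mul w (Ck_nsq R n 2) (Ck_hpoly 2 hY)) lap_nsq gdot_nsq (hpoly_euler w hY); ring.
Qed.

(** Recursion lowering the degree by 2: Z = (g - |w|^2 Y) / c, where Y solves the same equation for
    the Laplacian of g with c increased by 2n + 4(m - 2), the amount that the Laplacian of |w|^2 Y
    contributes. *)
Lemma nsq_lap_solve m g (c : R) : 0 < c -> hpoly m g ->
  exists2 Z, hpoly m Z & forall w, c * Z w + nsq w * lap Z w = g w.
Proof.
elim/ltn_ind: m g c => m IH g c c0 hg; have cn : c != 0 by rewrite gt_eqF.
case: (ltnP 1 m) => m1; last first.
  exists (fun w => c^-1 * g w); first exact: hpolyZ.
  by move=> w; rewrite (hpoly_lap_low w (hpolyZ _ hg) m1) mulr0 addr0 mulVKf.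
have c1 : 0 < c + (2 * n%:R + 4 * (m - 2)%:R).
  by rewrite ltr_pwDl // addr_ge0 // mulr_ge0.
have [||Y hY hYE] := IH (m - 2)%N _ (lap g) _ c1.
- by rewrite ltn_subrL /=; case: (m) m1.
- by rewrite subn2; exact: hpoly_lap.
have hnY : hpoly m (fun w => nsq w * Y w).
  by have := hpolyM (hpoly_nsq R n) hY; rewrite subnKC.
have hZ := hpolyZ c^-1 (hpoly_lin (-1) hnY hg).
exists (fun w => c^-1 * (-1 * (nsq w * Y w) + g w)) => // w.
have h2 (f : 'rV[R]_n -> R) : hpoly m f -> Ck 2 f by exact: Ck_hpoly.
have -> : lap (fun w => c^-1 * (-1 * (nsq w * Y w) + g w)) w =
    c^-1 * (-1 * ((2 * n%:R + 4 * (m - 2)%:R) * Y w + nsq w * lap Y w) + lap g w).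
  have e := lap_lin c^-1 w (h2 _ (hpoly_lin (-1) hnY hg)) (Ck_cst n 2 (0 : R)).
  transitivity (lap (fun w => c^-1 * (-1 * (nsq w * Y w) + g w) + 0) w).
    by congr (lap _ w); apply/funext => x; rewrite addr0.
  rewrite e (lap_lin (-1) w (h2 _ hnY) (h2 _ hg)) (lap_nsq_mul w hY).
  by rewrite /lap [X in _ + X]big1 ?addr0 // => i _; rewrite !pd_cst.
by rewrite -(hYE w); field.
Qed.

(** The top component is the Laplacian of |w|^2 Z for a suitable Z. Subtracting [c * Z] repairs the
    boundary condition, and the resulting error [c * lap Z] has lower degree, so induction absorbs
    it. *)
Lemma poly_poisson_robin d g : (0 < n)%N -> polyd d g ->
  exists2 q, polyf q & (forall w, lap q w = g w) /\ (forall w, nsq w = r ^+ 2 -> euler q w + q w = 0).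
Proof.
move=> n0; elim: d g => [|d IH] g.
  move=> /polyd0_inv ->; exists (fun=> 0); first exact: polyf_cst.
  split=> w; first by rewrite /lap big1 // => i _; rewrite !pd_cst.
  by rewrite /euler big1 ?addr0 // => i _; rewrite pd_cst mulr0.
move=> /polydS_inv[G [H [hG hH gE]]].
have c0 : 0 < 2 * n%:R + 4 * d%:R :> R by rewrite ltr_pwDl ?mulr_ge0 // mulr_gt0 ?ltr0n.
have [Z hZ hZE] := nsq_lap_solve c0 hH.
(* On |w| = r the boundary operator multiplies |w|^2 Z by d + 3 and Z by d + 1; with this [c] the
   two contributions cancel. *)
pose c : R := (d%:R + 3) / (d%:R + 1) * r ^+ 2.
have [q1 hq1 [L1 R1]] := IH (fun w => c * lap Z w + G w) (polyd_lin c (polyd_lap (hpoly_polyd hZ)) hG).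
have hN := hpolyM (hpoly_nsq R n) hZ.
have CZ k := Ck_hpoly k hZ; have CN k := Ck_hpoly k hN; have Cq k := Ck_polyf k hq1.
pose q w := - c * Z w + (1 * (nsq w * Z w) + q1 w).
have Ci k : Ck k (fun w => 1 * (nsq w * Z w) + q1 w) by exact: (Ck_lin 1 (CN k) (Cq k)).
exists q.
  have pZ : polyf Z by exists d.+1; exact: hpoly_polyd.
  by apply: polyf_lin => //; apply: polyf_lin => //; apply: polyfM => //; exact: polyf_nsq.
split=> w.
  rewrite /q (lap_lin (- c) w (CZ 2) (Ci 2)) (lap_lin 1 w (CN 2) (Cq 2)) (lap_nsq_mul w hZ) L1 gE /= -hZE; ring.
move=> wr; rewrite /q (euler_lin (- c) w (CZ 1%N) (Ci 1%N)) (euler_lin 1 w (CN 1%N) (Cq 1%N)).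
rewrite (hpoly_euler w hZ) (hpoly_euler w hN) /= !wr.
have -> : euler q1 w = - q1 w by apply/eqP; rewrite -addr_eq0 R1.
by rewrite /c natrD; field; rewrite natr1 pnatr_eq0.
Qed.

Lemma base_dense f (e : R) : (0 < n)%N -> cts f -> 0 < e ->
  exists q, [/\ polyf q, forall w, nsq w = r ^+ 2 -> euler q w + q w = 0 &
    forall w, ball2 r w -> `|lap q w - f w| <= e].
Proof.
move=> n0 cf e0; have [P [d hP] h] := C0_approx cf e0.
have [q hq [L1 R1]] := poly_poisson_robin n0 hP.
by exists q; split=> // w wB; rewrite L1; exact: h.
Qed.

Lemma euler_sq_le q w : ball2 r w -> euler q w ^+ 2 <= r ^+ 2 * gdot q q w.
Proof.
move=> wB; apply: le_trans (euler_CS q w) _; apply: ler_wpM2r => //; exact: gdot_ge0.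
Qed.

(** Integrate the divergence of q grad q + r^(-2) q^2 w: on the sphere its normal component is q
    (euler q + q), which is 0. The remaining quadratic form is bounded below by completing a square,
    using [n >= 2] and |euler q| <= r |grad q|. *)
Lemma base_coercive q : (2 <= n)%N -> Ck 2 q -> (forall w, nsq w = r ^+ 2 -> euler q w + q w = 0) ->
  IB r (fun w => 3^-1 * gdot q q w + (2 * r ^+ 2)^-1 * q w ^+ 2) <= - IB r (fun w => q w * lap q w).
Proof.
move=> n2 hq bq; have r2 : 0 < r ^+ 2 by rewrite exprn_gt0.
pose X i w := q w * pd i q w + (r ^+ 2)^-1 * (q w * q w * w 0 i).
have hX i : Ck 1 (X i).
  apply: CkD; first exact: (CkM (CkW hq) (Ck_pd i hq)).
  exact: (CkZ _ (CkM (CkM (CkW hq) (CkW hq)) (Ck_coord R 1 i))).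
have cq := Ck_cts hq; have cE := Ck_cts (Ck_euler hq); have cL := Ck_cts (Ck_lap hq).
have cG := Ck_cts (Ck_gdot (CkW hq) (CkW hq)).
have D := divergence r0 hX; have E : divf X = fun w =>
   q w * lap q w + (gdot q q w + (r ^+ 2)^-1 * (n%:R * q w ^+ 2 + 2 * (q w * euler q w))).
  apply/funext => w; rewrite /divf.
  have e i : pd i (X i) w = q w * pd i (pd i q) w + (pd i q w * pd i q w
     + (r ^+ 2)^-1 * (q w ^+ 2 + 2 * (q w * (w 0 i * pd i q w)))).
    have h1 := CkM (CkW hq) (Ck_pd i hq).
    have h2 := CkM (CkM (CkW hq) (CkW hq)) (Ck_coord R 1 i).
    rewrite (_ : X i = fun w => (r ^+ 2)^-1 * (q w * q w * w 0 i) + q w * pd i q w); last first.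
      by apply/funext => x; rewrite /X addrC.
    rewrite (pd_lin i _ w h2 h1) (pd_mul i w (CkW hq) (Ck_pd i hq)).
    rewrite (pd_mul i w (CkM (CkW hq) (CkW hq)) (Ck_coord R 1 i)) (pd_mul i w (CkW hq) (CkW hq)).
    rewrite pd_coord eqxx /=; ring.
  under eq_bigr do rewrite e; rewrite big_split big_split /= -mulr_sumr; congr (_ + (_ + _)).
  rewrite -mulr_sumr big_split /= sumr_const card_ord -!mulr_sumr -/(euler q w).
  by rewrite -[q w ^+ 2 *+ n]mulr_natl.
have bX w : nsq w = r ^+ 2 -> \sum_i w 0 i * X i w = 0.
  move=> wr; rewrite /X (eq_bigr (fun i => q w * (w 0 i * pd i q w) + (r ^+ 2)^-1 * q w ^+ 2 * (w 0 i * w 0 i))).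
    by rewrite big_split /= -!mulr_sumr -nsqE wr -/(euler q w) mulrAC mulVf ?gt_eqF // mul1r -mulrDr bq // mulr0.
  by move=> i _; ring.
have {}D := D bX; rewrite E in D.
have -> : - IB r (fun w => q w * lap q w) =
   IB r (fun w => gdot q q w + (r ^+ 2)^-1 * (n%:R * q w ^+ 2 + 2 * (q w * euler q w))).
  by apply/eqP; rewrite eq_sym -addr_eq0 addrC -(IBD r0); [rewrite D|by ctn|by ctn].
apply: (IB_le r0); [by ctn|by ctn|] => w wB.
have e1 := euler_sq_le q wB.
have nn : 2 <= n%:R :> R by rewrite ler_nat.
have q2 := sqr_ge0 (q w).
have e2 : euler q w ^+ 2 / r ^+ 2 <= gdot q q w by rewrite ler_pdivrMr // mulrC.
have e3 : 0 <= (3 / 2 * q w + euler q w) ^+ 2 / r ^+ 2 by rewrite divr_ge0 ?sqr_ge0 // ltW.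
have e4 : 0 <= (n%:R - 2) * q w ^+ 2 / r ^+ 2 by apply: divr_ge0; [apply: mulr_ge0; rewrite ?subr_ge0|exact: ltW].
rewrite -subr_ge0 (_ : _ - _ = (2 / 3) * (gdot q q w - euler q w ^+ 2 / r ^+ 2)
  + (2 / 3) * ((3 / 2 * q w + euler q w) ^+ 2 / r ^+ 2) + (n%:R - 2) * q w ^+ 2 / r ^+ 2).
  by rewrite !addr_ge0 // mulr_ge0 // subr_ge0.
by field; rewrite gt_eqF.
Qed.

End BaseProblem.

(** * Dense ranges and the continuity method *)

Section DenseRange.
Variables (R : realType) (n : nat) (r : R).
Hypothesis r0 : 0 < r.
Implicit Types (f g u v : 'rV[R]_n -> R) (w : 'rV[R]_n).

Definition dense_range (T : ('rV[R]_n -> R) -> 'rV[R]_n -> R) :=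
  forall f, cts f -> forall e, 0 < e -> exists2 u, dom r u & IB r (fun w => (f w - T u w) ^+ 2) <= e.

Lemma IB_sqD f g : cts f -> cts g ->
  IB r (fun w => (f w + g w) ^+ 2) <= 2 * IB r (fun w => f w ^+ 2) + 2 * IB r (fun w => g w ^+ 2).
Proof.
move=> cf cg; rewrite -(IBZ r0); last by ctn.
rewrite -(IBZ r0); last by ctn.
rewrite -(IBD r0); [|by ctn|by ctn]; apply: (IB_le r0); [by ctn|by ctn|] => w _.
by have := sqr_ge0 (f w - g w); lra.
Qed.

(** The step is repeated on the remainder [f - T u], so the squared errors decrease
    geometrically. *)
Lemma dense_range_halving T : (forall u, dom r u -> cts (T u)) ->
  (forall c u v, dom r u -> dom r v -> forall w, T (fun w => c * u w + v w) w = c * T u w + T v w) ->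
  (forall f, cts f -> 0 < IB r (fun w => f w ^+ 2) ->
    exists2 u, dom r u & IB r (fun w => (f w - T u w) ^+ 2) <= 2^-1 * IB r (fun w => f w ^+ 2)) ->
  dense_range T.
Proof.
move=> cT linT half f cf e e0; set F := IB r (fun w => f w ^+ 2).
have pos g : cts g -> 0 <= IB r (fun w => g w ^+ 2).
  by move=> cg; apply: (IB_ge0 r0) => [|w _]; [ctn|exact: sqr_ge0].
have d0 : dom r (fun _ : 'rV[R]_n => 0).
  split; first exact: (Ck_cst n 2 (0 : R)).
  move=> w _; rewrite /qf /euler big1 ?subr0 // => i _; by rewrite pd_cst mulr0.
have T0 w : T (fun=> 0) w = 0.
  have := linT 1 _ _ d0 d0 w; rewrite (_ : (fun w => _) = fun=> 0); last by apply/funext => x; rewrite mulr0 addr0.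
  by rewrite mul1r => /eqP; rewrite -subr_eq0 opprD addrA subrr sub0r oppr_eq0 => /eqP.
have step (j : nat) : exists2 u, dom r u & IB r (fun w => (f w - T u w) ^+ 2) <= 2^-1 ^+ j * F.
  elim: j => [|j [u du hu]].
    exists (fun=> 0) => //; rewrite expr0 mul1r le_eqVlt; apply/orP; left; apply/eqP.
    by congr (IB r _); apply/funext => w; rewrite T0 subr0.
  have cu := cT u du; have cg : cts (fun w => f w - T u w) by ctn.
  have [z|z] := eqVneq (IB r (fun w => (f w - T u w) ^+ 2)) 0.
    by exists u => //; rewrite z mulr_ge0 ?exprn_ge0 ?invr_ge0 //; exact: pos.
  have [|v dv hv] := half _ cg; first by rewrite lt_neqAle eq_sym z pos.
  exists (fun w => 1 * u w + v w); first exact: dom_lin.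
  rewrite (_ : (fun w => _) = fun w => (f w - T u w - T v w) ^+ 2); last first.
    by apply/funext => w; rewrite linT // mul1r opprD addrA.
  by apply: le_trans hv _; rewrite exprS -mulrA ler_pM2l // invr_gt0.
have F0 : 0 <= F by exact: pos.
have [||N /(_ N (leqnn _)) hN] := @geometric_small R 2^-1 1 1 (e / (F + 1)) _ ltr01.
- by rewrite invr_ge0 ler0n /= invf_lt1 ?ltr1n ?ltr0n.
- by rewrite divr_gt0 // ltr_pwDr.
have [u du hu] := step N; exists u => //; apply: le_trans hu _.
apply: le_trans (_ : e / (F + 1) * F <= _).
  by apply: ler_wpM2r => //; move: hN; rewrite expr1n !mulr1.
by rewrite mulrAC ler_pdivrMr ?ltr_pwDr // ler_pM2l // lerDl.
Qed.

(* Continuity method: the energy [E] absorbs the variation of [T]. *)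
Lemma dense_range_path (T : R -> ('rV[R]_n -> R) -> 'rV[R]_n -> R) (E : ('rV[R]_n -> R) -> R) (K C : R) :
  0 <= K -> 0 <= C ->
  (forall s u, dom r u -> cts (T s u)) ->
  (forall s c u v, dom r u -> dom r v -> forall w, T s (fun w => c * u w + v w) w = c * T s u w + T s v w) ->
  (forall (s t : R) u, 0 <= s <= 1 -> 0 <= t <= 1 -> dom r u ->
     IB r (fun w => (T s u w - T t u w) ^+ 2) <= K * (t - s) ^+ 2 * E u) ->
  (forall (s : R) u, 0 <= s <= 1 -> dom r u -> E u <= C * IB r (fun w => T s u w ^+ 2)) ->
  dense_range (T 0) -> dense_range (T 1).
Proof.
move=> K0 C0 cT linT H1 H2 h0.
have pos g : cts g -> 0 <= IB r (fun w => g w ^+ 2).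
  by move=> cg; apply: (IB_ge0 r0) => [|w _]; [ctn|exact: sqr_ge0].
(* A near-solution for [T s] has squared error F / 16 and passing to [T t] costs at most 3 F / 16;
   twice their sum is F / 2, as halving requires. The threshold 1/16 does not depend on [s], so
   finitely many steps cover the path. *)
have step s t : 0 <= s <= 1 -> 0 <= t <= 1 -> K * C * (t - s) ^+ 2 <= 16^-1 ->
    dense_range (T s) -> dense_range (T t).
  move=> s01 t01 d16 hs; apply: dense_range_halving => [u|c u v|f cf F0]; [exact: cT|exact: linT|].
  set F := IB r _ in F0 *; have F16 : 0 < F / 16 by rewrite divr_gt0.
  have [u du hu] := hs f cf _ F16; exists u => //; have cs := cT s u du; have ct := cT t u du.
  have c1 : cts (fun w => f w - T s u w) by ctn.
  have c2 : cts (fun w => T s u w - T t u w) by ctn.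
  have e1 : IB r (fun w => T s u w ^+ 2) <= 3 * F.
    have c3 : cts (fun w => T s u w - f w) by ctn.
    have := IB_sqD cf c3; rewrite -/F.
    have -> : (fun w => (f w + (T s u w - f w)) ^+ 2) = fun w => T s u w ^+ 2.
      by apply/funext => w; rewrite addrC subrK.
    have -> : (fun w => (T s u w - f w) ^+ 2) = fun w => (f w - T s u w) ^+ 2.
      by apply/funext => w; rewrite -sqrrN opprB.
    by lra.
  have e2 : IB r (fun w => (T s u w - T t u w) ^+ 2) <= 3 / 16 * F.
    apply: le_trans (H1 s t u s01 t01 du) _; have e := H2 s u s01 du.
    have ds : 0 <= K * (t - s) ^+ 2 by rewrite mulr_ge0 ?sqr_ge0.
    apply: le_trans (ler_wpM2l ds e) _.
    rewrite (_ : K * _ * _ = K * C * (t - s) ^+ 2 * IB r (fun w => T s u w ^+ 2)); last by ring.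
    apply: le_trans (_ : 16^-1 * (3 * F) <= _); last by lra.
    by apply: ler_pM => //; [rewrite mulr_ge0 ?sqr_ge0 // mulr_ge0|exact: pos].
  have := IB_sqD c1 c2.
  have -> : (fun w => (f w - T s u w + (T s u w - T t u w)) ^+ 2) = fun w => (f w - T t u w) ^+ 2.
    by apply/funext => w; rewrite addrA subrK.
  by move: hu e2; clearbody F; lra.
pose N := Num.truncn (16 * (K * C)); have Nb : 16 * (K * C) < N.+1%:R.
  by apply: truncnS_gt.
have N0 : 0 < N.+1%:R :> R by rewrite ltr0Sn.
have N1 : 1 <= N.+1%:R :> R by rewrite ler1n.
have ind (j : nat) : (j <= N.+1)%N -> dense_range (T (j%:R / N.+1%:R)).
  elim: j => [|j IH] jN; first by rewrite mul0r.
  have b01 (l : nat) : (l <= N.+1)%N -> 0 <= (l%:R / N.+1%:R : R) <= 1.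
    by move=> lN; rewrite divr_ge0 //= ler_pdivrMr // mul1r ler_nat.
  apply: step (IH (ltnW jN)); [exact: b01 (ltnW jN)|exact: b01|].
  rewrite -mulrBl -natrB ?leqnSn // subSnn mul1r.
  rewrite expr2 mulrA ler_pdivrMr // ler_pdivrMr //.
  apply: le_trans (_ : 16^-1 * N.+1%:R <= _); first by lra.
  by rewrite -mulrA ler_pM2l ?invr_gt0 // ler_peMr // ltW.
by have := ind N.+1 (leqnn _); rewrite divff // gt_eqF.
Qed.

Lemma cts_bounded f : cts f -> exists2 B, 0 <= B & forall w, ball2 r w -> `|f w| <= B.
Proof.
move=> cf; have [B hB] := cont_bounded r (ctsE cf); exists `|B| => // w wB.
by apply: le_trans (ler_norm B); apply: hB; exact: ball2_norm.
Qed.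

End DenseRange.

(** * The reference base function *)

Section EllOperator.
Variables (R : realType) (n : nat) (r : R).
Hypothesis r0 : 0 < r.
Implicit Types (q u v : 'rV[R]_n -> R) (w : 'rV[R]_n).

(** The starting point of the continuity method: it satisfies the Robin condition and [Sh] of it is
    a positive multiple of the identity, so its operator reduces to a weighted trace. *)
Definition ell w : R := r ^+ 2 + nsq w.

Lemma ell_gt0 w : 0 < ell w.
Proof. by rewrite /ell ltr_pwDl ?exprn_gt0 // nsq_ge0. Qed.
Lemma ell_neq0 w : ell w != 0. Proof. by rewrite gt_eqF // ell_gt0. Qed.

Lemma Ck_ell k : Ck k ell.
Proof. exact: CkD (Ck_cst n k (r ^+ 2)) (Ck_nsq R n k). Qed.

Lemma ellE : ell = fun w => 1 * nsq w + r ^+ 2.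
Proof. by apply/funext => w; rewrite mul1r addrC. Qed.

Lemma pd_ell i w : pd i ell w = 2 * w 0 i.
Proof. by rewrite ellE (pd_lin i 1 w (Ck_nsq R n 1) (Ck_cst n 1 (r ^+ 2))) pd_nsq pd_cst; ring. Qed.

Lemma euler_ell w : euler ell w = 2 * nsq w.
Proof. by rewrite /euler nsqE mulr_sumr; apply: eq_bigr => i _; rewrite pd_ell; ring. Qed.

Lemma qf_ell w : qf ell w = r ^+ 2 - nsq w.
Proof. by rewrite /qf euler_ell /ell; ring. Qed.

Lemma dom_ell : dom r ell.
Proof. by split=> [|w wr]; [exact: Ck_ell|rewrite qf_ell wr subrr]. Qed.

Lemma Sh_ell w : Sh ell w = (phi w * (1 + r ^+ 2))%:M.
Proof.
have -> : phi w * (1 + r ^+ 2) = 2 + phi w * (r ^+ 2 - nsq w).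
  by rewrite /phi; field; rewrite gt_eqF // nsq1_gt0.
rewrite /Sh qf_ell raddfD /=; congr (_ + _); apply/matrixP => i j; rewrite !mxE.
have -> : pd j ell = fun w => 2 * w 0 j by apply/funext => x; exact: pd_ell.
rewrite pdZ; last by move=> x; exact: derivable_coord.
by rewrite pd_coord mulr_natr // eq_sym.
Qed.

Lemma tr_Sh v w : \tr (Sh v w) = lap v w + n%:R * (phi w * qf v w).
Proof. by rewrite /Sh linearD /= mxtrace_scalar mulr_natl; congr (_ + _); apply: eq_bigr => i _; rewrite mxE. Qed.

Lemma Lop_ell k : (k < n)%N -> exists2 c, 0 < c & forall v w, Lop k ell v w = c * (phi w ^+ n * \tr (Sh v w)).
Proof.
move=> kn; have [d dE] : exists d, NT k (1%:M : 'M[R]_n) = d%:M.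
  elim: (k) => [|l [d dE]]; first by exists 1.
  by exists (sg l.+1 (1%:M : 'M[R]_n) - d); rewrite NTS mul1mx dE raddfB.
have d0 : 0 < d.
  have := tr_NT (1%:M : 'M[R]_n) (ltnW kn); rewrite dE mxtrace_scalar -[d *+ n]mulr_natl => e.
  have n0 : 0 < n%:R :> R by rewrite ltr0n (leq_ltn_trans _ kn).
  rewrite -(pmulr_rgt0 _ n0) e mulr_gt0 ?sg1_gt0 ?(ltnW kn) // ltr0n subn_gt0.
  exact: kn.
exists ((1 + r ^+ 2) ^+ k * d); first by rewrite mulr_gt0 // exprn_gt0 // ltr_pwDl ?sqr_ge0.
move=> v w; rewrite /Lop Sh_ell -scalemx1 (NTZ k _ _).1 dE scale_scalar_mx mul_scalar_mx mxtraceZ [(phi w * _) ^+ k]exprMn.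
have -> : phi w ^+ n = phi w ^+ (n - k) * phi w ^+ k by rewrite -exprD subnK // ltnW.
ring.
Qed.

Definition al w : R := 8 * ell w - n%:R * phi w * ell w ^+ 2.
Definition be w : R := 4 * n%:R * ell w + 8 * nsq w + n%:R * phi w * (ell w ^+ 2 - 4 * ell w * nsq w).

Lemma qf_ellM q w : Ck 1 q ->
  qf (fun w => ell w ^+ 2 * q w) w = ell w ^+ 2 * q w - ell w ^+ 2 * euler q w - 4 * ell w * nsq w * q w.
Proof.
move=> hq; have he := Ck_ell 1.
have -> : (fun w => ell w ^+ 2 * q w) = fun w => ell w * (ell w * q w) by apply/funext => x; ring.
rewrite /qf (euler_mul (q := fun w => ell w * q w) w he (CkM he hq)) (euler_mul w he hq) euler_ell /=; ring.
Qed.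

Lemma tr_Sh_ellM q w : Ck 2 q -> \tr (Sh (fun w => ell w ^+ 2 * q w) w) =
  ell w ^+ 2 * lap q w + al w * euler q w + be w * q w.
Proof.
move=> hq; rewrite tr_Sh (qf_ellM w (CkW hq)); have he := Ck_ell 2.
have g v : gdot ell v w = 2 * euler v w.
  by rewrite /gdot /euler mulr_sumr; apply: eq_bigr => i _; rewrite pd_ell; ring.
have le : lap ell w = 2 * n%:R.
  by rewrite ellE (lap_lin 1 w (Ck_nsq R n 2) (Ck_cst n 2 (r ^+ 2))) lap_nsq /lap big1 ?mul1r ?addr0 // => i _; rewrite !pd_cst.
have -> : (fun w => ell w ^+ 2 * q w) = fun w => ell w * (ell w * q w) by apply/funext => x; ring.
rewrite (lap_mul (q := fun w => ell w * q w) w he (CkM he hq)) (lap_mul w he hq) !g (euler_mul w (CkW he) (CkW hq)) euler_ell le /al /be /=; ring.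
Qed.

Definition dq v w : R := v w / ell w ^+ 2.

Lemma Ck_dq k v : Ck k v -> Ck k (dq v).
Proof.
move=> hv; apply: Ck_div => //; last by move=> w; rewrite expf_neq0 // ell_neq0.
rewrite (_ : (fun w => _) = ell \* ell); last by apply/funext => w; rewrite expr2.
exact: CkM (Ck_ell k) (Ck_ell k).
Qed.

Lemma dqK v : (fun w => ell w ^+ 2 * dq v w) = v.
Proof. by apply/funext => w; rewrite /dq mulrC divfK // expf_neq0 // ell_neq0. Qed.

Lemma dq_ellM q : dq (fun w => ell w ^+ 2 * q w) = q.
Proof. by apply/funext => w; rewrite /dq mulrC mulKf // expf_neq0 // ell_neq0. Qed.

Lemma dq_lin c u v : dq (fun w => c * u w + v w) = fun w => c * dq u w + dq v w.
Proof. by apply/funext => w; rewrite /dq; ring. Qed.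

Lemma robin_dq v w : dom r v -> nsq w = r ^+ 2 -> euler (dq v) w + dq v w = 0.
Proof.
move=> [hv bv] wr; have := bv w wr; rewrite -{1}(dqK v) (qf_ellM w (Ck_dq (CkW hv))).
have -> : ell w = 2 * nsq w by rewrite /ell wr; ring.
move=> h; apply/eqP; have e0 : (2 * nsq w) ^+ 2 != 0 by rewrite expf_neq0 // mulf_neq0 // wr expf_neq0 // gt_eqF.
rewrite -(inj_eq (mulfI e0)) mulr0; apply/eqP; rewrite -oppr0 -h; ring.
Qed.

Lemma dom_ellM q : Ck 2 q -> (forall w, nsq w = r ^+ 2 -> euler q w + q w = 0) -> dom r (fun w => ell w ^+ 2 * q w).
Proof.
move=> hq bq; split.
  by rewrite (_ : (fun w => _) = fun w => ell w * (ell w * q w)); [exact: CkM (Ck_ell 2) (CkM (Ck_ell 2) hq)|apply/funext => w; ring].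
move=> w wr; rewrite (qf_ellM w (CkW hq)); have -> : ell w = 2 * nsq w by rewrite /ell wr; ring.
have -> : euler q w = - q w by apply/eqP; rewrite -addr_eq0 bq.
by ring.
Qed.

(* In terms of [q = v / ell^2] the boundary condition becomes the coercive one [E q + q = 0]. *)
Lemma ell_dense_range k : (2 <= n)%N -> (k < n)%N -> exists M0, forall m, cts m ->
  (forall w, ball2 r w -> M0 <= m w) -> dense_range r (fun v w => Lop k ell v w - m w * v w).
Proof.
move=> n2 kn; have [c c0 LE] := Lop_ell kn.
have cphi := Ck_cts (Ck_phi R n 0); have cell := Ck_cts (Ck_ell 0).
have cnsq := Ck_cts (Ck_nsq R n 0).
have celV : cts (fun w => (ell w)^-1) := Ck_cts (CkV ell_neq0 (Ck_ell 0)).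
have phi0 w : phi w != 0 :> R by rewrite gt_eqF // phi_gt0.
have cphV : cts (fun w : 'rV[R]_n => (phi w)^-1) := Ck_cts (CkV phi0 (Ck_phi R n 0)).
have cal : cts al by rewrite /al; ctn.
have cbe : cts be by rewrite /be; ctn.
have [A1 A10 hA1] := cts_bounded r0 (f := fun w => al w * (ell w)^-1 ^+ 2) (ltac:(by ctn)).
have [A2 A20 hA2] := cts_bounded r0 (f := fun w => be w * (ell w)^-1 ^+ 2) (ltac:(by ctn)).
(* [A2] absorbs the zeroth-order coefficient; the second summand comes from Young's inequality,
   which pays for the first-order term with one sixth of the squared gradient. The factor
   [c * 2 ^+ n] accounts for phi <= 2 when [m] is divided by [c * phi ^+ n]. *)
pose M1 := A2 + 3 / 2 * r ^+ 2 * A1 ^+ 2; exists (c * 2 ^+ n * M1) => m cm hm.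
pose D w : R := c * (phi w ^+ n * ell w ^+ 2).
have D0 w : 0 < D w by rewrite mulr_gt0 // mulr_gt0 ?exprn_gt0 // ?phi_gt0 // ell_gt0.
have cD : cts D by rewrite /D; ctn.
have cDV : cts (fun w => (D w)^-1).
  rewrite (_ : (fun w => _) = fun w => c^-1 * ((phi w)^-1 ^+ n * (ell w)^-1 ^+ 2)); first by ctn.
  by apply/funext => w; rewrite /D !exprVn -!invfM.
have [B1 B10 hB1] := cts_bounded r0 cD.
have [B2 B20 hB2] := cts_bounded r0 cDV.
have [B3 B30 hB3] := cts_bounded r0 (f := fun w => c * phi w ^+ n * al w) (ltac:(by ctn)).
have [B4 B40 hB4] := cts_bounded r0 (f := fun w => c * phi w ^+ n * be w - m w * ell w ^+ 2) (ltac:(by ctn)).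
(* Path from a weighted Laplacian of [q = dq v] to the operator in question. Its second-order part
   [D * lap q] is constant along the path (see [TE]), so only terms controlled by the first-order
   energy [E] vary. *)
pose T (s : R) v w : R := (1 - s) * (D w * lap (dq v) w) + s * (Lop k ell v w - m w * v w).
have TE (s : R) v w : dom r v -> T s v w = D w * lap (dq v) w +
    s * (c * phi w ^+ n * al w * euler (dq v) w + (c * phi w ^+ n * be w - m w * ell w ^+ 2) * dq v w).
  move=> [hv _]; rewrite /T LE; have {1}-> : \tr (Sh v w) = \tr (Sh (fun w => ell w ^+ 2 * dq v w) w) by rewrite dqK.
  rewrite (tr_Sh_ellM w (Ck_dq hv)) /D.
  have -> : m w * v w = m w * (ell w ^+ 2 * dq v w) by rewrite -{1}(dqK v).
  ring.
pose E v := IB r (fun w => gdot (dq v) (dq v) w + dq v w ^+ 2).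
pose K : R := (B3 ^+ 2 * r ^+ 2 + B4 ^+ 2) * 2.
have K0 : 0 <= K by apply: mulr_ge0 => //; apply: addr_ge0; [apply: mulr_ge0|]; exact: sqr_ge0.
have cT s v : dom r v -> cts (T s v).
  move=> [hv _]; have cv := Ck_cts hv; have c1 := Ck_cts (Ck_lap (Ck_dq hv)); have c2 := cts_Lop k (Ck_ell 2) hv.
  by rewrite /T; ctn.
suff : dense_range r (T 1).
  congr (dense_range r _); apply/funext => v; apply/funext => w; by rewrite /T subrr mul0r add0r mul1r.
have r2 : 0 < r ^+ 2 by rewrite exprn_gt0.
pose C := (6 + 4 * r ^+ 2) * (r ^+ 2 * B2 ^+ 2).
apply: (dense_range_path r0 (T := T) (E := E) (K := K) (C := C)) => //.
- rewrite /C; apply: mulr_ge0; last by apply: mulr_ge0; exact: sqr_ge0.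
  by apply: addr_ge0 => //; apply: mulr_ge0 => //; exact: ltW.
- move=> s a u v [hu _] [hv _] w; rewrite /T dq_lin (lap_lin a w (Ck_dq hu) (Ck_dq hv)).
  by rewrite (Lop_lin k _ a w hu hv); ring.
- move=> s t u _ _ du; have [hu _] := du; have hq := Ck_dq hu.
  have cg := Ck_cts (Ck_gdot (CkW hq) (CkW hq)); have cq := Ck_cts hq; have c1 := cT s u du; have c2 := cT t u du.
  rewrite -(IBZ r0); last by ctn.
  apply: (IB_le r0); [by ctn|by ctn|] => w wB; rewrite !TE //.
  set a := _ * al w; set b := (_ * be w - _); set x := euler _ w; set q := dq u w.
  have e1 : x ^+ 2 <= r ^+ 2 * gdot (dq u) (dq u) w by exact: euler_sq_le.
  have ha : a ^+ 2 <= B3 ^+ 2 by rewrite -real_normK ?num_real //; apply: lerXn2r; rewrite ?nnegrE //; exact: hB3.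
  have hb : b ^+ 2 <= B4 ^+ 2 by rewrite -real_normK ?num_real //; apply: lerXn2r; rewrite ?nnegrE //; exact: hB4.
  set G := gdot _ _ w in e1 *.
  rewrite (_ : (_ - _) ^+ 2 = (t - s) ^+ 2 * (a * x + b * q) ^+ 2); last by ring.
  rewrite (_ : K * _ * _ = (t - s) ^+ 2 * (K * (G + q ^+ 2))); last by ring.
  apply: ler_wpM2l; first exact: sqr_ge0.
  have g0 : 0 <= G by exact: gdot_ge0.
  have q0 := sqr_ge0 q.
  have e2 : a ^+ 2 * x ^+ 2 <= B3 ^+ 2 * (r ^+ 2 * G) by apply: ler_pM => //; exact: sqr_ge0.
  have e3 : b ^+ 2 * q ^+ 2 <= B4 ^+ 2 * q ^+ 2 by apply: ler_wpM2r.
  have e4 := sqr_ge0 (a * x - b * q).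
  have e5 : 0 <= B3 ^+ 2 * (r ^+ 2 * q ^+ 2) by rewrite mulr_ge0 ?sqr_ge0 // mulr_ge0 // sqr_ge0.
  have e6 : 0 <= B4 ^+ 2 * G by rewrite mulr_ge0 ?sqr_ge0.
  by rewrite /K; lra.
- move=> s u /andP[s0 s1] du; have [hu _] := du; have hq := Ck_dq hu.
  have cg := Ck_cts (Ck_gdot (CkW hq) (CkW hq)); have cq := Ck_cts hq; have c1 := cT s u du.
  have cE := Ck_cts (Ck_euler (CkW hq)); have cL := Ck_cts (Ck_lap hq).
  pose q := dq u; rewrite -/q in hq cg cq cE cL.
  have co := base_coercive r0 n2 hq (fun w => @robin_dq u w du).
  pose Q := fun w => 6^-1 * gdot q q w + (4 * r ^+ 2)^-1 * q w ^+ 2.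
  have cQ : cts Q by rewrite /Q; ctn.
  have pw w : ball2 r w -> - (q w * lap q w) + (- (3^-1 * gdot q q w + (2 * r ^+ 2)^-1 * q w ^+ 2))
     <= - Q w + r ^+ 2 * B2 ^+ 2 * T s u w ^+ 2.
    move=> wB; rewrite TE // -/q; set x := euler q w; set y := q w; set L := lap q w.
    set G := gdot q q w; set Tw := _ + s * _.
    have g0 : 0 <= G by exact: gdot_ge0.
    pose a := al w * (ell w)^-1 ^+ 2; pose b := be w * (ell w)^-1 ^+ 2; pose d := m w / (c * phi w ^+ n).
    have ph0 : 0 < phi w ^+ n by rewrite exprn_gt0 // phi_gt0.
    have e1 : Tw / D w = L + s * (a * x + (b - d) * y).
      rewrite /Tw /D /a /b /d; set P := phi w ^+ n in ph0 *; field; by rewrite (gt_eqF c0) (gt_eqF ph0) ell_neq0.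
    have h1 : `|a| <= A1 := hA1 w wB. have h2 : `|b| <= A2 := hA2 w wB.
    have h3 : M1 <= d.
      have M10 : 0 <= M1 by rewrite addr_ge0 // mulr_ge0 ?sqr_ge0 // mulr_ge0 // ltW.
      rewrite /d ler_pdivlMr ?mulr_gt0 //; apply: le_trans (hm w wB).
      rewrite mulrC; apply: ler_wpM2r => //; rewrite ler_pM2l //.
      by have [b' _ /(_ w wB)/andP[]] := phiX_bounds n r n.
    have x2 : x ^+ 2 <= r ^+ 2 * G by exact: euler_sq_le.
    have i1 : y * (a * x) <= G / 6 + 3 / 2 * r ^+ 2 * A1 ^+ 2 * y ^+ 2.
      have a2 : a ^+ 2 <= A1 ^+ 2 by rewrite -real_normK ?num_real //; apply: lerXn2r; rewrite ?nnegrE.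
      have i2 : x ^+ 2 / r ^+ 2 <= G by rewrite ler_pdivrMr // mulrC.
      have i3 : 0 <= (x - 3 * r ^+ 2 * (a * y)) ^+ 2 / r ^+ 2 by rewrite divr_ge0 ?sqr_ge0 // ltW.
      have i4 : a ^+ 2 * y ^+ 2 <= A1 ^+ 2 * y ^+ 2 by apply: ler_wpM2r => //; exact: sqr_ge0.
      have i5 : r ^+ 2 * (a ^+ 2 * y ^+ 2) <= r ^+ 2 * (A1 ^+ 2 * y ^+ 2) by rewrite ler_pM2l.
      have i6 : (x - 3 * r ^+ 2 * (a * y)) ^+ 2 / r ^+ 2 = x ^+ 2 / r ^+ 2 - 6 * (y * (a * x)) + 9 * (r ^+ 2 * (a ^+ 2 * y ^+ 2)).
        by field; rewrite gt_eqF.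
      by rewrite i6 in i3; lra.
    have i7 : y * ((b - d) * y) <= - (3 / 2 * r ^+ 2 * A1 ^+ 2 * y ^+ 2).
      rewrite (_ : y * _ = (b - d) * y ^+ 2); last by ring.
      rewrite -[leRHS]mulNr; apply: ler_wpM2r; first exact: sqr_ge0.
      by move: h2 h3; rewrite ler_norml /M1 => /andP[_]; lra.
    have i8 : s * (y * (a * x + (b - d) * y)) <= G / 6.
      have z : y * (a * x + (b - d) * y) <= G / 6 by rewrite mulrDr; lra.
      have [z0|z0] := lerP 0 (y * (a * x + (b - d) * y)).
        by apply: le_trans z; rewrite ler_piMl.
      by apply: le_trans (mulr_ge0_le0 s0 (ltW z0)) _; exact: divr_ge0.
    have i9 : - (y * (Tw / D w)) <= (4 * r ^+ 2)^-1 * y ^+ 2 + r ^+ 2 * (Tw / D w) ^+ 2.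
      have z : 0 <= (y + 2 * r ^+ 2 * (Tw / D w)) ^+ 2 / (4 * r ^+ 2).
        by rewrite divr_ge0 ?sqr_ge0 // mulr_ge0 // ltW.
      have -> : (4 * r ^+ 2)^-1 * y ^+ 2 + r ^+ 2 * (Tw / D w) ^+ 2 =
          (y + 2 * r ^+ 2 * (Tw / D w)) ^+ 2 / (4 * r ^+ 2) - y * (Tw / D w).
        by field; rewrite (gt_eqF r0) gt_eqF.
      by rewrite lerDr.
    have i10 : r ^+ 2 * (Tw / D w) ^+ 2 <= r ^+ 2 * B2 ^+ 2 * Tw ^+ 2.
      rewrite -mulrA ler_pM2l // exprMn mulrC; apply: ler_wpM2r; first exact: sqr_ge0.
      by rewrite -real_normK ?num_real //; apply: lerXn2r; rewrite ?nnegrE //; exact: hB2.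
    have yL : y * L = y * (Tw / D w) - s * (y * (a * x + (b - d) * y)) by rewrite e1; ring.
    have i11 : (2 * r ^+ 2)^-1 * y ^+ 2 = 2 * ((4 * r ^+ 2)^-1 * y ^+ 2) by field; rewrite gt_eqF.
    rewrite yL /Q -/G -/y i11; clear - i8 i9 i10 g0; lra.
  have I1 : IB r Q <= r ^+ 2 * B2 ^+ 2 * IB r (fun w => T s u w ^+ 2).
    have := IB_le r0 (f := fun w => - (q w * lap q w) + (- (3^-1 * gdot q q w + (2 * r ^+ 2)^-1 * q w ^+ 2)))
      (g := fun w => - Q w + r ^+ 2 * B2 ^+ 2 * T s u w ^+ 2) (ltac:(by ctn)) (ltac:(by ctn)) pw.
    rewrite (IBD r0); [|by ctn|by ctn]; rewrite (IBD r0); [|by ctn|by ctn].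
    rewrite (IBN r0); last by ctn.
    rewrite (IBN r0); last by ctn.
    rewrite (IBN r0) //; rewrite (IBZ r0); last by ctn.
    by move: co; lra.
  apply: le_trans (_ : (6 + 4 * r ^+ 2) * IB r Q <= _); last first.
    by rewrite /C -mulrA; apply: ler_wpM2l => //; rewrite addr_ge0 // mulr_ge0 // ltW.
  rewrite -(IBZ r0) //; apply: (IB_le r0); [by ctn|by ctn|] => w _; rewrite -/q /Q.
  have g0 := gdot_ge0 q w; have q0 := sqr_ge0 (q w).
  have e1 : 0 <= (4 * r ^+ 2)^-1 * q w ^+ 2 by rewrite mulr_ge0 // invr_ge0 mulr_ge0 // ltW.
  have e2 : 0 <= r ^+ 2 * gdot q q w by rewrite mulr_ge0 // ltW.
  rewrite (_ : (6 + _) * _ = gdot q q w + q w ^+ 2 + (6 * ((4 * r ^+ 2)^-1 * q w ^+ 2) + (2 / 3) * (r ^+ 2 * gdot q q w))).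
    by rewrite lerDl addr_ge0 // mulr_ge0.
  by field; rewrite gt_eqF.
move=> f cf e e0; have n0 : (0 < n)%N by exact: ltnW.
have I1 := IB1_gt0 n r0; set I := IB r _ in I1; pose z := B1 ^+ 2 * I + 1.
have z0 : 0 < z by rewrite ltr_pwDr // mulr_ge0 ?sqr_ge0 // ltW.
pose e' := Num.min 1 (e / z); have e'0 : 0 < e' by rewrite lt_min ltr01 divr_gt0.
have e'1 : e' <= 1 by rewrite ge_min lexx.
have e'z : e' * z <= e by rewrite -ler_pdivlMr // ge_min lexx orbT.
have cfD : cts (fun w => f w * (D w)^-1) by ctn.
have [q [hq bq hqE]] := base_dense r0 n0 cfD e'0.
have Cq k' := Ck_polyf k' hq; have cL := Ck_cts (Ck_lap (Cq 2)).
exists (fun w => ell w ^+ 2 * q w); first exact: dom_ellM.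
have -> : (fun w => (f w - T 0 (fun w => ell w ^+ 2 * q w) w) ^+ 2) = fun w => (f w - D w * lap q w) ^+ 2.
  by apply/funext => w; rewrite /T dq_ellM subr0 mul1r mul0r addr0.
apply: le_trans (_ : (B1 ^+ 2 * e') * I <= _).
  rewrite -(IBZ r0); last exact: cts_cst.
  apply: (IB_le r0); [by ctn|by ctn|] => w wB; rewrite mulr1.
  have -> : f w - D w * lap q w = - (D w * (lap q w - f w * (D w)^-1)) by field; rewrite gt_eqF.
  rewrite sqrrN exprMn; apply: ler_pM; [exact: sqr_ge0|exact: sqr_ge0| |].
    by rewrite -real_normK ?num_real //; apply: lerXn2r; rewrite ?nnegrE //; exact: hB1.
  have h := hqE w wB; rewrite -real_normK ?num_real //; apply: le_trans (_ : e' ^+ 2 <= _).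
    by apply: lerXn2r; rewrite ?nnegrE // ltW.
  by rewrite expr2 ler_piMr // ltW.
by apply: le_trans e'z; rewrite /z mulrDr mulr1 mulrAC mulrC mulrA lerDl ltW.
Qed.

End EllOperator.

(** * Density for a general base function *)

Section Resolvent.
Variables (R : realType) (n : nat) (r : R).
Hypothesis r0 : 0 < r.
Implicit Types (f g h u v : 'rV[R]_n -> R) (w : 'rV[R]_n).

Lemma dom0 : dom r (fun _ : 'rV[R]_n => 0).
Proof.
split; first exact: (Ck_cst n 2 (0 : R)).
by move=> w _; rewrite /qf /euler big1 ?subr0 // => i _; rewrite pd_cst mulr0.
Qed.

Lemma dom_comb (a b : R) u v : dom r u -> dom r v -> dom r (fun w => a * u w + b * v w).
Proof.
move=> du dv; have := dom_lin a du (dom_lin b dv dom0); congr (dom r _).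
by apply/funext => w; rewrite addr0.
Qed.

Lemma Sh0 w : Sh (fun _ : 'rV[R]_n => 0) w = 0.
Proof.
have h0 := Ck_cst n 2 (0 : R); have := Sh_lin 1 w h0 h0.
rewrite (_ : (fun w => _) = fun=> 0); last by apply/funext => x; rewrite mulr0 addr0.
by rewrite scale1r => /eqP; rewrite -subr_eq0 opprD addrA subrr sub0r oppr_eq0 => /eqP.
Qed.

Lemma Sh_comb (a b : R) u v w : Ck 2 u -> Ck 2 v -> Sh (fun w => a * u w + b * v w) w = a *: Sh u w + b *: Sh v w.
Proof.
move=> hu hv; have h0 := Ck_cst n 2 (0 : R).
have := Sh_lin a w hu (Ck_lin b hv h0); rewrite (Sh_lin b w hv h0) Sh0 addr0 => <-.
by congr (Sh _ w); apply/funext => x; rewrite addr0.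
Qed.

Lemma tr_mul_le (A N : 'M[R]_n) : N^T = N -> \tr (A *m N) ^+ 2 <= frob A * frob N.
Proof.
move=> sN; have -> : \tr (A *m N) = \sum_(p : 'I_n * 'I_n) A p.1 p.2 * N p.1 p.2.
  rewrite -(pair_bigA _ (fun i j => A i j * N i j)) /=; apply: eq_bigr => i _; rewrite mxE.
  by apply: eq_bigr => j _; rewrite -[in LHS]sN mxE.
rewrite /frob !pair_bigA /=; exact: sum_CS.
Qed.

Lemma tr_mulBl (A B N : 'M[R]_n) : \tr ((A - B) *m N) = \tr (A *m N) - \tr (B *m N).
Proof. by rewrite mulmxBl linearB. Qed.

Lemma Kset_le k C C' c c' (M : 'M[R]_n) : C <= C' -> c' <= c -> Kset k C c M -> Kset k C' c' M.
Proof.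
move=> CC cc [sM bM gM]; split=> // [i j|j jk]; [exact: le_trans (bM i j) CC|exact: le_trans cc (gM j jk)].
Qed.

Definition hseg h (t : R) w := (1 - t) * ell r w + t * h w.

Lemma hseg_admissible k C c h : (k <= n)%N -> 0 <= C -> 0 < c -> (forall w, 0 < h w) -> admissible r k C c h ->
  exists C' c', [/\ 0 <= C', 0 < c' & forall t, 0 <= t <= 1 -> admissible r k C' c' (hseg h t)].
Proof.
move=> kn C0 c0 hp [dh _ admw]; have [hh _] := dh.
have a20 : 0 < 2 :> R by rewrite ltr0n.
pose a1 := 2 * (1 + r ^+ 2); have r2 : 0 < r ^+ 2 by rewrite exprn_gt0.
have a10 : 0 < a1 by rewrite mulr_gt0 // ltr_pwDl // ltW.
have [c1 c10 seg] := @Kset_segment R n k C c 2 a1 kn C0 c0 a20.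
exists (C + a1 + 2 * r ^+ 2), (Num.min c1 (Num.min c (r ^+ 2))); split.
- by apply: addr_ge0; [apply: addr_ge0 => //; exact: ltW|apply: mulr_ge0 => //; exact: ltW].
- by rewrite !lt_min c10 c0 r2.
move=> t t01; have /andP[t0 t1] := t01; have s0 : 0 <= 1 - t by rewrite subr_ge0.
split; first exact: dom_comb (dom_ell n r) dh.
  move=> w; rewrite gt_eqF // /hseg; have [->|tn] := eqVneq t 0; first by rewrite subr0 mul1r mul0r addr0 ell_gt0.
  by rewrite ltr_wpDl // ?mulr_ge0 ?(ltW (ell_gt0 r0 w)) // mulr_gt0 // lt_neqAle eq_sym tn.
move=> w wB; have [/andP[hc hC] KM] := admw w wB; have l0 := ell_gt0 r0 w.
have l1 : r ^+ 2 <= ell r w by rewrite lerDl nsq_ge0.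
have l2 : ell r w <= 2 * r ^+ 2 by rewrite /ell; move: wB; rewrite /ball2; lra.
have m1 : Num.min c1 (Num.min c (r ^+ 2)) <= c by rewrite !ge_min lexx ?orbT.
have m2 : Num.min c1 (Num.min c (r ^+ 2)) <= r ^+ 2 by rewrite !ge_min lexx ?orbT.
split; first apply/andP; first split.
- rewrite /hseg; set m := Num.min _ _ in m1 m2 *.
  have e1 := ler_wpM2l s0 (le_trans m2 l1); have e2 := ler_wpM2l t0 (le_trans m1 hc); lra.
- rewrite /hseg; have e1 := ler_wpM2l s0 l2; have e2 := ler_wpM2l t0 hC.
  have e3 : (1 - t) * (2 * r ^+ 2) <= 2 * r ^+ 2 by apply: ler_piMl; [apply: mulr_ge0 => //; exact: ltW|rewrite gerBl].
  have e4 : t * C <= C by rewrite ler_piMl. by move: a10; lra.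
rewrite /hseg (Sh_comb _ _ w (Ck_ell n r 2) hh) Sh_ell // scale_scalar_mx.
apply: (@Kset_le k (C + a1) _ c1); [by rewrite lerDl mulr_ge0 // ltW|by rewrite ge_min lexx|].
apply: seg => //; have /andP[p1 p2] := phi_bounds wB.
have q0 : 0 < 1 + r ^+ 2 by rewrite ltr_pwDl // ltW.
by rewrite -ler_pdivrMr // p1 /a1 ler_pM2r.
Qed.

Lemma pair_T_ge0 k C c h w (x : 'rV[R]_n) : admissible r k.+1 C c h -> 0 < c -> 0 <= C -> ball2 r w ->
  0 <= pair_T k h x x w.
Proof.
move=> [_ _ adm] c0 C0 wB; have [_ KM] := adm w wB.
have [c1 c10 /(_ _ KM x) h1] := @elliptic_uniform R n k C c C0 c0.
rewrite /pair_T mulr_ge0 ?exprn_ge0 ?(ltW (phi_gt0 w)) //; apply: le_trans h1.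
by rewrite mulr_ge0 ?nsq_ge0 // ltW.
Qed.

Lemma cts_grad_pair k h y : Ck 2 h -> Ck 1 y -> cts (fun w => pair_T k h (grad y w) (grad y w) w).
Proof.
move=> hh hy; apply: (cts_pair_T k hh) => i; have := Ck_cts (Ck_pd i hy); congr (cts _); apply/funext => w; by rewrite mxE.
Qed.

Lemma Lop_upper k C c h u B : (k <= n)%N -> 0 <= C -> 0 < c -> admissible r k.+1 C c h -> dom r u ->
  (forall w, ball2 r w -> Lop k h h w / h w <= B) ->
  IB r (fun w => u w * Lop k h u w) <= B * IB r (fun w => u w ^+ 2).
Proof.
move=> kn C0 c0 adm du hB; have [dh h0 _] := adm; have [hh _] := dh; have [hu _] := du.
have hy : Ck 1 (fun w => u w / h w) := Ck_div (CkW hu) (CkW hh) h0.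
have cu := Ck_cts hu; have ch := Ck_cts hh; have cL := cts_Lop k hh hh.
have cV : cts (fun w => (h w)^-1) := Ck_cts (CkV h0 hh); have cp := cts_grad_pair k hh hy.
rewrite (ground_state r0 kn dh du h0).
apply: le_trans (_ : IB r (fun w => u w ^+ 2 * Lop k h h w / h w) <= _).
  rewrite gerBl; apply: (IB_ge0 r0) => [|w wB]; first by ctn.
  by rewrite mulr_ge0 ?sqr_ge0 //; apply: pair_T_ge0 adm c0 C0 wB.
rewrite -(IBZ r0); last by ctn.
apply: (IB_le r0); [by ctn|by ctn|] => w wB; rewrite -mulrA mulrC; apply: ler_wpM2r; first exact: sqr_ge0.
exact: hB.
Qed.

(** Continuity method along [hseg] from [ell] to [h]. The energy is the integral of [frob (Sh u)]:
    it bounds the variation of the operator because Newton tensors are Lipschitz, and [H2_estimate]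
    bounds it by the operator itself. *)
Lemma resolvent_dense k C c h : (k.+2 <= n)%N -> 0 <= C -> 0 < c -> (forall w, 0 < h w) ->
  admissible r k.+2 C c h -> exists M, forall m, cts m -> (forall w, ball2 r w -> M <= m w) ->
  dense_range r (fun v w => Lop k.+1 h v w - m w * v w).
Proof.
move=> kn C0 c0 hp adm; have kn1 : (k.+1 < n)%N by []. have kn' := ltnW kn1.
have n2 : (2 <= n)%N by exact: leq_trans kn.
have [C1 [c1 [C10 c10 admt]]] := hseg_admissible kn C0 c0 hp adm.
have [M0 base] := ell_dense_range r0 n2 kn1.
have [B B0 hB] := admissible_Lop_bound n r k.+1 C10 c10.
have [K [K1 [K0 K10 H2]]] := H2_estimate r0 kn C10 c10.
have [dh _ _] := adm; have [hh _] := dh.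
(* [M0] serves the starting point [ell]. The quadratic form of every operator on the path is at most
   [B] times the square norm, so [B + 1] makes minus the shifted form dominate the square norm of
   [u]. *)
exists (Num.max M0 (B + 1)) => m cm hm.
have hm0 w : ball2 r w -> M0 <= m w by move=> wB; apply: le_trans (hm w wB); rewrite le_max lexx.
have hm1 w : ball2 r w -> B + 1 <= m w by move=> wB; apply: le_trans (hm w wB); rewrite le_max lexx orbT.
have [Bm Bm0 hBm] := cts_bounded r0 cm.
pose T (t : R) v w : R := Lop k.+1 (hseg h t) v w - m w * v w.
have dseg t : 0 <= t <= 1 -> dom r (hseg h t) by case/admt.
have cT t v : dom r v -> cts (T t v).
  move=> [hv _]; have c1' := cts_Lop k.+1 (dom_comb (1 - t) t (dom_ell n r) dh).1 hv; have cv := Ck_cts hv.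
  by rewrite /T /hseg; ctn.
pose a1 := 2 * (1 + r ^+ 2); have r2 : 0 < 1 + r ^+ 2 by rewrite ltr_pwDl // ltW // exprn_gt0.
have [B5 B50 lip] := @NT_lipschitz R n k.+1 C1 C10.
have hseg1 : hseg h 1 = h by apply/funext => w; rewrite /hseg subrr mul0r add0r mul1r.
have hseg0 : hseg h 0 = ell r by apply/funext => w; rewrite /hseg subr0 mul0r addr0 mul1r.
suff : dense_range r (T 1) by rewrite /T hseg1.
pose E v := IB r (fun w => frob (Sh v w)).
pose KK : R := (2 ^+ (n - k.+1)) ^+ 2 * ((n * n)%:R * (B5 * (2 * C1)) ^+ 2).
pose CC : R := K * (2 + 2 * Bm ^+ 2) + K1.
have pos f : cts f -> 0 <= IB r (fun w => f w ^+ 2).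
  by move=> cf; apply: (IB_ge0 r0) => [|w _]; [ctn|exact: sqr_ge0].
apply: (dense_range_path r0 (T := T) (E := E) (K := KK) (C := CC)) => //.
- by apply: mulr_ge0; [exact: sqr_ge0|apply: mulr_ge0 => //; exact: sqr_ge0].
- by apply: addr_ge0 => //; apply: mulr_ge0 => //; apply: addr_ge0 => //; apply: mulr_ge0 => //; exact: sqr_ge0.
- by move=> s a u v [hu _] [hv _] w; rewrite /T (Lop_lin k.+1 _ a w hu hv); ring.
- move=> s t u s01 t01 du; have [hu _] := du; have c1' := cT s u du; have c2' := cT t u du.
  have cS i j := Cm_cts i j (Cm_Sh hu).
  have cf : cts (fun w => frob (Sh u w)) by rewrite /frob; apply: cts_sum => i; apply: cts_sum => j; exact: ctsX.
  rewrite -(IBZ r0) //; apply: (IB_le r0); [by ctn|by ctn|] => w wB.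
  have [_ _ /(_ w wB)[_ [_ bs _]]] := admt s s01; have [_ _ /(_ w wB)[_ [_ bt _]]] := admt t t01.
  have [_ _ /(_ w wB)[_ [_ b0 _]]] := admt 0 (ltac:(by rewrite lexx ler01)).
  have [_ _ /(_ w wB)[_ [_ b1 _]]] := admt 1 (ltac:(by rewrite lexx ler01)).
  rewrite hseg0 in b0; rewrite hseg1 in b1.
  have bd : eb (`|t - s| * (2 * C1)) (Sh (hseg h s) w - Sh (hseg h t) w).
    rewrite /hseg (Sh_comb _ _ w (Ck_ell n r 2) hh) (Sh_comb _ _ w (Ck_ell n r 2) hh) => i j.
    rewrite [X in `|X|](_ : _ = (t - s) * (Sh (ell r) w i j - Sh h w i j)); last by rewrite !mxE; ring.
    rewrite normrM; apply: ler_wpM2l => //; apply: le_trans (ler_normB _ _) _.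
    by have := b0 i j; have := b1 i j; lra.
  have D0 : 0 <= `|t - s| * (2 * C1) by rewrite !mulr_ge0.
  have [_ _ l3 _] := lip _ _ _ D0 bs bt bd.
  have -> : T s u w - T t u w = phi w ^+ (n - k.+1) * \tr ((NT k.+1 (Sh (hseg h s) w) - NT k.+1 (Sh (hseg h t) w)) *m Sh u w).
    by rewrite /T /Lop (tr_mulBl (NT k.+1 (Sh (hseg h s) w)) (NT k.+1 (Sh (hseg h t) w))); ring.
  rewrite exprMn; set X := NT _ _ - NT _ _ in l3 *; have [b' b'0 /(_ w wB)/andP[p1 p2]] := phiX_bounds n r (n - k.+1).
  have e1 := tr_mul_le X (Sh_sym w hu).
  have e2 := frob_le l3.
  have -> : KK * (t - s) ^+ 2 * frob (Sh u w) = (2 ^+ (n - k.+1)) ^+ 2 *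
     ((n * n)%:R * (B5 * (`|t - s| * (2 * C1))) ^+ 2 * frob (Sh u w)).
    by rewrite /KK -(real_normK (num_real (t - s))); ring.
  apply: ler_pM; [exact: sqr_ge0|exact: sqr_ge0| |].
    by apply: lerXn2r; rewrite ?nnegrE // ltW // exprn_gt0 // phi_gt0.
  by apply: le_trans e1 _; apply: ler_wpM2r => //; exact: frob_ge0.
- move=> s u s01 du; have [hu _] := du; have ad := admt s s01; have [ds _ _] := ad; have [hs _] := ds.
  have c1' := cT s u du; have cu := Ck_cts hu; have cL := cts_Lop k.+1 hs hu.
  set L := Lop k.+1 (hseg h s) u in cL *; have LE : L = fun w => T s u w + m w * u w.
    by apply/funext => w; rewrite /T /L subrK.
  have h2 := H2 _ u ad du; rewrite -/L in h2.
  have up : IB r (fun w => u w * L w) <= B * IB r (fun w => u w ^+ 2).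
    by apply: (Lop_upper kn' C10 c10 ad du) => w wB; case/andP: (hB _ w ad wB).
  have i1 : IB r (fun w => u w * L w) = IB r (fun w => u w * T s u w) + IB r (fun w => m w * u w ^+ 2).
    rewrite -(IBD r0); [|by ctn|by ctn]; congr (IB r _); apply/funext => w; rewrite LE; ring.
  have i2 : (B + 1) * IB r (fun w => u w ^+ 2) <= IB r (fun w => m w * u w ^+ 2).
    rewrite -(IBZ r0); last by ctn.
    by apply: (IB_le r0); [by ctn|by ctn|] => w wB; apply: ler_wpM2r; [exact: sqr_ge0|exact: hm1].
  have i3 : - IB r (fun w => u w * T s u w) <= 2^-1 * IB r (fun w => u w ^+ 2) + 2^-1 * IB r (fun w => T s u w ^+ 2).
    rewrite -(IBZ r0); last by ctn.
    rewrite -(IBZ r0); last by ctn.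
    rewrite -(IBD r0); [|by ctn|by ctn]; rewrite -(IBN r0); last by ctn.
    apply: (IB_le r0); [by ctn|by ctn|] => w _; have := sqr_ge0 (u w + T s u w); lra.
  have u2 := pos u cu; have t2 := pos _ c1'.
  set U := IB r (fun w => u w ^+ 2) in up i2 i3 u2; set TT := IB r (fun w => T s u w ^+ 2) in i3 t2 *.
  have i4 : U <= TT by move: up i1 i2 i3; lra.
  have B1U : 0 <= (B + 1) * U by rewrite mulr_ge0 // addr_ge0.
  have i5 : - IB r (fun w => u w * L w) <= TT by move: i1 i2 i3 i4 B1U; lra.
  have i6 : IB r (fun w => L w ^+ 2) <= (2 + 2 * Bm ^+ 2) * TT.
    have cmu : cts (fun w => m w * u w) by ctn.
    rewrite LE; apply: le_trans (IB_sqD r0 c1' cmu) _; rewrite -/TT.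
    have : IB r (fun w => (m w * u w) ^+ 2) <= Bm ^+ 2 * U.
      rewrite -(IBZ r0); last by ctn.
      apply: (IB_le r0); [by ctn|by ctn|] => w wB; rewrite exprMn; apply: ler_wpM2r; first exact: sqr_ge0.
      by rewrite -real_normK ?num_real //; apply: lerXn2r; rewrite ?nnegrE //; exact: hBm.
    have := ler_wpM2l (sqr_ge0 Bm) i4; lra.
  have := ler_wpM2l K0 i6; have := ler_wpM2l K10 i5; move: h2; rewrite -/(E u) /CC; clear; lra.
- by rewrite /T hseg0; exact: base.
Qed.

End Resolvent.

(** Let e be a unit near-maximiser of the Rayleigh quotient with supremum [la], and v its
    approximate resolvent at [mu]: then s = <e, v> and V = |v|^2, while [x], [z], [eta] are errors.
    Without errors v = e / (mu - la) and A v = la v, so the refuted inequality <A v, v> <= |A v|^2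
    would read la <= la^2. *)
Lemma spectral_arith (R : realType) (la mu : R) : 0 < la < 1 -> 2 <= mu -> exists2 t, 0 < t &
  forall s V x z eta : R, x ^+ 2 <= t ^+ 2 -> z ^+ 2 <= V * t ^+ 2 -> eta <= t -> s ^+ 2 <= V ->
  0 <= s - (mu - la) * V - z -> (1 - (mu - la) * s - x) ^+ 2 <= t ^+ 2 / 4 * (s - (mu - la) * V - z) ->
  ~ (mu * V - s + z <= mu ^+ 2 * V + 1 + eta - 2 * mu * s + 2 * mu * z - 2 * x).
Proof.
move=> /andP[l0 l1] m2; pose om := mu - la; have o1 : 1 <= om by rewrite /om; lra.
have o0 : 0 < om by lra.
have ga : 0 < la - la ^+ 2 by rewrite expr2 -{1}[la]mulr1 -mulrBr mulr_gt0 // subr_gt0.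
(* [Ct] collects the coefficients of [t] in the estimate [key]; [t] is chosen so that [t * Ct] uses
   at most half of la - la^2. *)
pose Ct := mu * (mu - 1) * (2 + 2 * om) + 2 * (2 * mu - 1) * om + om ^+ 2 * (1 + 2 * (2 * mu - 1) + 2).
have mm : 0 <= mu * (mu - 1) by rewrite mulr_ge0 //; lra.
have Ct0 : 0 < Ct.
  rewrite /Ct; apply: ltr_wpDl; last by rewrite mulr_gt0 ?exprn_gt0 //; lra.
  by rewrite addr_ge0 // mulr_ge0 //; try lra; rewrite mulr_ge0 //; lra.
pose t := Num.min 1 ((la - la ^+ 2) / (2 * Ct)).
have t0 : 0 < t by rewrite lt_min ltr01 divr_gt0 // mulr_gt0.
have t1 : t <= 1 by rewrite ge_min lexx.
have tC : t * (2 * Ct) <= la - la ^+ 2 by rewrite -ler_pdivlMr ?mulr_gt0 // ge_min lexx orbT.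
exists t => // s V x z eta hx hz heta hV p0 hq hb; rewrite -/om in p0 hq.
have V0 : 0 <= V by apply: le_trans hV; exact: sqr_ge0.
pose S := Num.sqrt V; have S0 : 0 <= S by exact: sqrtr_ge0.
have VS : V = S ^+ 2 by rewrite sqr_sqrtr.
have ab (a b : R) : 0 <= b -> a ^+ 2 <= b ^+ 2 -> - b <= a <= b.
  by move=> b0 ab; rewrite -ler_norml; apply: le_of_sqr => //; rewrite real_normK ?num_real.
have /andP[x1 x2] : - t <= x <= t by apply: ab hx; exact: ltW.
have /andP[s1 s2] : - S <= s <= S by apply: ab => //; rewrite -VS.
have /andP[z1 z2] : - (S * t) <= z <= S * t.
  by apply: ab; [rewrite mulr_ge0 // ltW|rewrite exprMn -VS].
have St : S * t <= S by rewrite ler_piMr.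
(* A priori bound on the norm of v: otherwise V <= om V <= s - z <= 2 S, against V = S^2. *)
have S2 : S <= 2.
  rewrite leNgt; apply/negP => S2; have : om * V <= 2 * S by lra.
  have e1 : V <= om * V by rewrite ler_peMl.
  have e2 : 2 * S < V by rewrite VS expr2 ltr_pM2r // (lt_trans _ S2).
  by lra.
have z3 : - (2 * t) <= z by apply: le_trans z1; rewrite lerN2; apply: ler_wpM2r => //; exact: ltW.
have z4 : z <= 2 * t by apply: le_trans z2 _; apply: ler_wpM2r => //; exact: ltW.
have oV : 0 <= om * V by rewrite mulr_ge0 // ltW.
have d1 : (1 - om * s - x) ^+ 2 <= t ^+ 2.
  apply: le_trans hq _; rewrite -mulrA ler_piMr ?sqr_ge0 //; lra.
have /andP[d2 d3] := ab _ _ (ltW t0) d1.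
have w1 : om * (om * V) <= 1 + 2 * t + 2 * om * t.
  have e : om * (om * V) <= om * (s - z) by rewrite ler_pM2l //; lra.
  have e2 : om * (- z) <= om * (2 * t) by rewrite ler_pM2l //; lra.
  by lra.
have w2 : 1 - 2 * t <= om * s by lra.
have o2 : 0 < om ^+ 2 by rewrite exprn_gt0.
have hb2 : 0 <= om ^+ 2 * (mu ^+ 2 * V + 1 + eta - 2 * mu * s + 2 * mu * z - 2 * x - (mu * V - s + z)).
  by rewrite mulr_ge0 ?subr_ge0 // ltW.
have f1 : mu * (mu - 1) * (om * (om * V)) <= mu * (mu - 1) * (1 + 2 * t + 2 * om * t) by apply: ler_wpM2l.
have f2 : (2 * mu - 1) * om * (1 - 2 * t) <= (2 * mu - 1) * om * (om * s).
  by apply: ler_wpM2l => //; rewrite mulr_ge0 ?ltW //; lra.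
have f3 : om ^+ 2 * eta <= om ^+ 2 * t by rewrite ler_pM2l.
have f4 : om ^+ 2 * ((2 * mu - 1) * z) <= om ^+ 2 * ((2 * mu - 1) * (2 * t)).
  by rewrite ler_pM2l //; apply: ler_wpM2l => //; lra.
have f5 : om ^+ 2 * (- x) <= om ^+ 2 * t by rewrite ler_pM2l //; lra.
have key : om ^+ 2 * (mu ^+ 2 * V + 1 + eta - 2 * mu * s + 2 * mu * z - 2 * x - (mu * V - s + z)) <=
   - (la - la ^+ 2) + t * Ct.
  apply: (@le_trans _ _ (mu * (mu - 1) * (1 + 2 * t + 2 * om * t) + om ^+ 2 + om ^+ 2 * t
     - (2 * mu - 1) * om * (1 - 2 * t) + om ^+ 2 * ((2 * mu - 1) * (2 * t)) + 2 * (om ^+ 2 * t))).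
    rewrite (_ : om ^+ 2 * _ = mu * (mu - 1) * (om * (om * V)) + om ^+ 2 + om ^+ 2 * eta -
       (2 * mu - 1) * om * (om * s) + om ^+ 2 * ((2 * mu - 1) * z) + 2 * (om ^+ 2 * (- x))); last by ring.
    clear - f1 f2 f3 f4 f5; lra.
  rewrite le_eqVlt; apply/orP; left; apply/eqP; rewrite /Ct /om; ring.
by clear - hb2 key tC ga t0; lra.
Qed.

Arguments Lop : simpl never.

(** * The Alexandrov-Fenchel inequality *)

Lemma psd_CS (R : realFieldType) (A B C : R) : 0 <= A -> (forall t, 0 <= t ^+ 2 * A + 2 * t * B + C) -> B ^+ 2 <= A * C.
Proof.
move=> A0 h; have [AE|An] := eqVneq A 0.
  have [->|Bn] := eqVneq B 0; first by rewrite AE expr0n mul0r.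
  have := h (- (C + 1) / (2 * B)); rewrite AE.
  rewrite (_ : _ + C = -1); first by rewrite ler0N1.
  by field.
have Ap : 0 < A by rewrite lt_neqAle eq_sym An.
have := h (- B / A); rewrite (_ : _ + C = (A * C - B ^+ 2) / A); last by field.
by rewrite pmulr_lge0 ?invr_gt0 // subr_ge0.
Qed.

Section AF.
Variables (R : realType) (n : nat) (r : R).
Hypothesis r0 : 0 < r.
Implicit Types (f g u v : 'rV[R]_n -> R) (w : 'rV[R]_n).
Variables (k : nat) (C c : R) (h : 'rV[R]_n -> R).
Hypotheses (kn : (k.+2 <= n)%N) (C0 : 0 <= C) (c0 : 0 < c) (hp : forall w, 0 < h w) (adm : admissible r k.+2 C c h).
Local Notation L := (Lop k.+1 h).

Let kn' : (k.+1 <= n)%N := ltnW kn.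
Let dh : dom r h. Proof. by case: adm. Qed.
Let hh : Ck 2 h := dh.1.
Let ch : cts h := Ck_cts hh.
Let h0 w : h w != 0. Proof. by rewrite gt_eqF. Qed.

Lemma ctsV f : cts f -> (forall w, f w != 0) -> cts (fun w => (f w)^-1).
Proof. by move=> /ctsE cf f0; split=> w; exact: (cvgV (f0 w) (cf w)). Qed.

(** Outside the ball the weight may vanish or change sign; the maximum with the positive constant
    [b1] is continuous and positive everywhere and coincides with the weight on the ball. *)
Lemma weight_inv : exists g b B, [/\ cts g, 0 < b, 0 < B & forall w, ball2 r w ->
  b <= L h w / h w <= B /\ g w * (L h w / h w) = 1].
Proof.
have [B B0 hB] := admissible_Lop_bound n r k.+1 C0 c0.
have [b b0 hb] := phiX_bounds n r (n - k.+1).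
have [_ _ admw] := adm.
pose b1 := k.+2%:R * (b * c) / (C + 1); have C1 : 0 < C + 1 by rewrite ltr_pwDr.
have b10 : 0 < b1 by rewrite divr_gt0 // mulr_gt0 ?ltr0Sn // mulr_gt0.
have low w : ball2 r w -> b1 <= L h w / h w.
  move=> wB; have [/andP[hc hC] [_ _ gM]] := admw w wB; have /andP[p1 _] := hb w wB.
  have hw := hp w; rewrite Lop_base /b1; apply: ler_pM.
  - by apply: mulr_ge0 => //; rewrite ltW // mulr_gt0.
  - by rewrite invr_ge0 ltW.
  - by apply: ler_wpM2l => //; apply: ler_pM => //; [exact: ltW|exact: ltW|exact: gM].
  - by rewrite lef_pV2 ?posrE //; apply: le_trans hC _; rewrite lerDl.
have cL := cts_Lop k.+1 hh hh; have cV := ctsV ch h0.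
have cq : cts (fun w => L h w / h w) by ctn.
have cm : cts (fun w => Num.max (L h w / h w) b1).
  by split=> w; apply: (@continuous_max _ _ (fun w => L h w / h w) (fun=> b1)); [exact: (ctsE cq)|exact: cst_continuous].
exists (fun w => (Num.max (L h w / h w) b1)^-1), b1, (B + 1); split=> //.
- by apply: ctsV cm _ => w; rewrite gt_eqF // lt_max b10 orbT.
- by rewrite ltr_pwDr.
move=> w wB; have lw := low w wB; have /andP[_ up] := hB h w adm wB; split.
  by rewrite lw /=; apply: le_trans up _; rewrite lerDl.
by rewrite (max_idPl lw) mulVf // gt_eqF // (lt_le_trans b10).
Qed.

Definition mm w : R := L h w / h w.
Definition NN u v := IB r (fun w => mm w * (u w * v w)).
Definition aa u v := IB r (fun w => u w * L v w).

Let cm : cts mm. Proof. by have cL := cts_Lop k.+1 hh hh; have cV := ctsV ch h0; rewrite /mm; ctn. Qed.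
Let mmh w : mm w * h w = L h w. Proof. by rewrite /mm divfK. Qed.

Lemma NN_sym u v : NN u v = NN v u.
Proof. by congr (IB r _); apply/funext => w; rewrite [u w * _]mulrC. Qed.
Lemma aa_sym u v : dom r u -> dom r v -> aa u v = aa v u.
Proof. by move=> du dv; exact: IB_Lop_sym. Qed.
Lemma NN_lin t u v x : cts u -> cts v -> cts x -> NN (fun w => t * u w + v w) x = t * NN u x + NN v x.
Proof.
move=> cu cv cx; rewrite -(IB_lin r0); [|by ctn|by ctn].
by congr (IB r _); apply/funext => w; ring.
Qed.
Lemma aa_lin t u v x : cts u -> cts v -> dom r x -> aa (fun w => t * u w + v w) x = t * aa u x + aa v x.
Proof.
move=> cu cv [hx _]; have cL := cts_Lop k.+1 hh hx.
rewrite -(IB_lin r0); [|by ctn|by ctn].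
by congr (IB r _); apply/funext => w; ring.
Qed.
Lemma domc u : dom r u -> cts u. Proof. by case=> hu _; exact: Ck_cts hu. Qed.

Lemma NN_sq t u v : cts u -> cts v -> NN (fun w => t * u w + v w) (fun w => t * u w + v w) =
  t ^+ 2 * NN u u + 2 * t * NN u v + NN v v.
Proof.
move=> cu cv; rewrite NN_lin //; last by ctn.
rewrite [NN u _]NN_sym [NN v _]NN_sym !NN_lin // [NN v u]NN_sym; ring.
Qed.
Lemma aa_sq t u v : dom r u -> dom r v -> aa (fun w => t * u w + v w) (fun w => t * u w + v w) =
  t ^+ 2 * aa u u + 2 * t * aa u v + aa v v.
Proof.
move=> du dv; have cu := domc du; have cv := domc dv; have duv := dom_lin t du dv.
have e y : dom r y -> aa y (fun w => t * u w + v w) = t * aa y u + aa y v.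
  by move=> dy; rewrite (aa_sym dy duv) (aa_lin t cu cv dy) (aa_sym du dy) (aa_sym dv dy).
rewrite (aa_lin t cu cv duv) (e u du) (e v dv) (aa_sym dv du).
by move: (aa u u) (aa u v) (aa v v) => a1 a2 a3; ring.
Qed.
Lemma aa_h u : dom r u -> aa h u = NN h u.
Proof.
move=> du; rewrite aa_sym //; congr (IB r _); apply/funext => w; rewrite -mmh; ring.
Qed.

Definition perp u := dom r u /\ NN h u = 0.

Lemma perp_lin t u v : perp u -> perp v -> perp (fun w => t * u w + v w).
Proof.
move=> [du hu] [dv hv]; split; first exact: dom_lin.
by rewrite (NN_sym h) (NN_lin t (domc du) (domc dv) ch) (NN_sym u) hu (NN_sym v) hv mulr0 addr0.
Qed.

Lemma NN_bounds : exists b B, [/\ 0 < b, 0 < B & forall u, cts u ->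
   b * IB r (fun w => u w ^+ 2) <= NN u u <= B * IB r (fun w => u w ^+ 2)].
Proof.
have [g [b [B [cg b0 B0 hw]]]] := weight_inv; exists b, B; split=> // u cu.
rewrite -(IBZ r0); last by ctn.
rewrite -(IBZ r0); last by ctn.
by apply/andP; split; apply: (IB_le r0); try (by ctn); move=> w /hw[/andP[l1 l2] _];
  rewrite -expr2; apply: ler_wpM2r => //; exact: sqr_ge0.
Qed.

Lemma NN_ge0 u : cts u -> 0 <= NN u u.
Proof.
move=> cu; have [b [B [b0 B0 /(_ u cu)/andP[+ _]]]] := NN_bounds; apply: le_trans.
by rewrite mulr_ge0 ?(ltW b0) //; apply: (IB_ge0 r0) => [|w _]; [ctn|exact: sqr_ge0].
Qed.

Lemma NN_CS u v : cts u -> cts v -> NN u v ^+ 2 <= NN u u * NN v v.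
Proof.
move=> cu cv; apply: psd_CS => [|t]; first exact: NN_ge0.
by rewrite -NN_sq //; apply: NN_ge0; ctn.
Qed.

Lemma gap : exists2 d, 0 < d & forall u, perp u -> aa u u <= (1 - d) * NN u u.
Proof.
have [_ _ admw] := adm; have [g [b [B [cg b0 B0 hw]]]] := weight_inv.
have [e e0 he] := @elliptic_uniform R n k.+1 C c C0 c0.
have [p p0 hpb] := phiX_bounds n r (n - k.+1).
have C1 : 0 < C + 1 by rewrite ltr_pwDr.
pose P := B * (C + 1) ^+ 2; have P0 : 0 < P by rewrite mulr_gt0 // exprn_gt0.
pose c1 := c ^+ 2 * (p * e); have c10 : 0 < c1 by rewrite mulr_gt0 ?exprn_gt0 // mulr_gt0.
have r2 : 0 < r ^+ 2 by rewrite exprn_gt0.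
have n1 : 0 < n.+1%:R :> R by rewrite ltr0Sn.
exists (c1 * n.+1%:R / (P * r ^+ 2)); first by rewrite divr_gt0 // mulr_gt0.
move=> u [du pu]; have [hu _] := du; have cu := domc du.
pose y w := u w / h w; have hy : Ck 2 y := Ck_div hu hh h0; have cy := Ck_cts hy.
have cg2 := Ck_cts (Ck_gdot (CkW hy) (CkW hy)); have cp := cts_grad_pair k.+1 hh (CkW hy).
have cL := cts_Lop k.+1 hh hh; have cV := ctsV ch h0.
have gs := ground_state r0 kn' dh du h0.
have uE w : u w = h w * y w by rewrite /y mulrC divfK.
have e1 : IB r (fun w => u w ^+ 2 * L h w / h w) = NN u u.
  by congr (IB r _); apply/funext => w; rewrite /mm; ring.
have e2 : c1 * IB r (gdot y y) <= IB r (fun w => h w ^+ 2 * pair_T k.+1 h (grad y w) (grad y w) w).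
  rewrite -(IBZ r0) //; apply: (IB_le r0); [by ctn|by ctn|] => w wB.
  have [/andP[hc hC] KM] := admw w wB; have /andP[p1 _] := hpb w wB.
  rewrite /c1 -mulrA; apply: ler_pM; [exact: sqr_ge0|by rewrite mulr_ge0 ?gdot_ge0 // ltW // mulr_gt0| |].
    by apply: lerXn2r => //; rewrite nnegrE; exact: ltW.
  rewrite /pair_T -mulrA; apply: ler_pM => //; [exact: ltW|by rewrite mulr_ge0 ?gdot_ge0 // ltW|].
  have := he _ KM (grad y w); congr (_ * _ <= _).
  by rewrite nsqE /gdot; apply: eq_bigr => i _; rewrite !mxE.
set I1 := IB r (fun _ : 'rV[R]_n => 1); have I10 : 0 < I1 := IB1_gt0 n r0.
set Y := IB r y; set Y2 := IB r (fun w => y w ^+ 2); pose t := Y / I1.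
have po := poincare r0 hy; rewrite -/I1 -/Y -/Y2 in po.
(* Since [u] is orthogonal to [h], adding a multiple of [h] can only increase its norm. Subtracting
   [t * h], with [t] the mean of [y = u / h], produces the variance that the Poincare inequality
   controls. *)
have e3 : NN u u <= P * (Y2 - Y ^+ 2 / I1).
  have c3 : cts (fun w => mm w * (h w ^+ 2 * (y w - t) ^+ 2)) by ctn.
  apply: le_trans (_ : IB r (fun w => mm w * (h w ^+ 2 * (y w - t) ^+ 2)) <= _).
    have -> : (fun w => mm w * (h w ^+ 2 * (y w - t) ^+ 2)) = fun w => mm w * ((- t * h w + u w) * (- t * h w + u w)).
      by apply/funext => w; rewrite uE; ring.
    rewrite -/(NN _ _) NN_sq // pu mulr0 addr0 lerDr mulr_ge0 ?sqr_ge0 //; exact: NN_ge0.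
  apply: le_trans (_ : IB r (fun w => P * (y w - t) ^+ 2) <= _).
    apply: (IB_le r0) => [//||w wB]; first by ctn.
    rewrite mulrA; apply: ler_wpM2r; first exact: sqr_ge0.
    have [/andP[hc hC] _] := admw w wB; have [/andP[l1 l2] _] := hw w wB.
    apply: ler_pM => //; [by apply: le_trans l1; exact: ltW|exact: sqr_ge0|].
    by apply: lerXn2r; rewrite ?nnegrE ?(ltW C1) ?(ltW (hp w)) //; apply: le_trans hC _; rewrite lerDl.
  rewrite (IBZ r0); last by ctn.
  rewrite ler_pM2l //; have -> : (fun w => (y w - t) ^+ 2) = fun w => 1 * (y w ^+ 2) + (- (2 * t) * y w + t ^+ 2 * 1).
    by apply/funext => w; ring.
  rewrite !(IB_lin r0); [|by ctn|by ctn|by ctn|by ctn]; rewrite (IBZ r0); last exact: cts_cst.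
  rewrite -/I1 -/Y -/Y2 le_eqVlt; apply/orP; left; apply/eqP; rewrite /t; field; by rewrite gt_eqF.
have e4 : n.+1%:R * (Y2 - Y ^+ 2 / I1) <= r ^+ 2 * IB r (gdot y y).
  rewrite -(ler_pM2l I10); move: po; congr (_ <= _); last by ring.
  by field; rewrite gt_eqF.
rewrite /aa gs e1 mulrBl mul1r lerD2l lerN2; apply: le_trans e2.
rewrite mulrAC ler_pdivrMr ?mulr_gt0 // -[leLHS]mulrA -[leRHS]mulrA ler_pM2l //.
apply: le_trans (_ : n.+1%:R * (P * (Y2 - Y ^+ 2 / I1)) <= _); first by rewrite ler_pM2l.
by have := ler_wpM2l (ltW P0) e4; congr (_ <= _); ring.
Qed.

(** [mu] is large enough for [mu * mm] to exceed the threshold of [resolvent_dense]. The approximate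
    solution is then projected to the complement of [h]: as [h] is an eigenvector, the component
    removed is determined by the pairing of [h] with the error, so the projected equation still has
    a small error. *)
Lemma resolvent_approx : exists2 mu, 2 <= mu & forall u, perp u -> forall e, 0 < e ->
  exists v rho, [/\ perp v, cts rho, IB r (fun w => rho w ^+ 2) <= e &
    forall w, L v w = mu * (mm w * v w) - mm w * u w + rho w].
Proof.
have [M hM] := resolvent_dense r0 kn C0 c0 hp adm; have [g [b [B [cg b0 B0 hw]]]] := weight_inv.
pose mu := 2 + `|M| / b; have mu2 : 2 <= mu by rewrite lerDl divr_ge0 // ltW.
exists mu => // u [du pu] e e0; have cu := domc du.
have cmm : cts (fun w => mu * mm w) by ctn.
have ge w : ball2 r w -> M <= mu * mm w.
  move=> wB; have [/andP[l1 _] _] := hw w wB; apply: le_trans (ler_norm M) _.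
  apply: le_trans (_ : `|M| / b * mm w <= _); first by rewrite mulrAC ler_pdivlMr // ler_wpM2l.
  by apply: ler_wpM2r; [apply: le_trans l1; exact: ltW|rewrite lerDr].
set N := NN h h; have N0 : 0 < N.
  have [b' [B' [b'0 _ /(_ h ch)/andP[+ _]]]] := NN_bounds; apply: lt_le_trans; rewrite mulr_gt0 //.
  have w0 : ball2 r (0 : 'rV[R]_n) by rewrite /ball2 nsqE big1 ?sqr_ge0 // => i _; rewrite mxE mul0r.
  by apply: (IB_gt0 r0 (w0 := 0)) => //; [ctn|move=> w _; exact: sqr_ge0|rewrite exprn_gt0].
pose H2 := IB r (fun w => h w ^+ 2); pose K2 := IB r (fun w => (mm w * h w) ^+ 2).
have H20 : 0 <= H2 by apply: (IB_ge0 r0) => [|w _]; [ctn|exact: sqr_ge0].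
have K20 : 0 <= K2 by apply: (IB_ge0 r0) => [|w _]; [ctn|exact: sqr_ge0].
(* The factor by which the projection can enlarge the squared error, hence the tolerance [e / Q]. *)
pose Q := 2 + 2 * (H2 * K2 / N ^+ 2).
have Q0 : 0 < Q by rewrite ltr_pwDl // mulr_ge0 // divr_ge0 ?sqr_ge0 // mulr_ge0.
have cf : cts (fun w => - (mm w * u w)) by ctn.
have [v0 dv0 hv0] := hM _ cmm ge _ cf _ (divr_gt0 e0 Q0); have cv0 := domc dv0.
have cLv0 := cts_Lop k.+1 hh dv0.1.
pose rho0 w := L v0 w - mu * (mm w * v0 w) + mm w * u w.
have crho0 : cts rho0 by rewrite /rho0; ctn.
have hr0 : IB r (fun w => rho0 w ^+ 2) <= e / Q.
  apply: le_trans hv0; rewrite le_eqVlt; apply/orP; left; apply/eqP; congr (IB r _).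
  by apply/funext => w; rewrite /rho0; ring.
pose s := IB r (fun w => h w * rho0 w).
have sE : (mu - 1) * NN h v0 = - s.
  have : aa h v0 = mu * NN h v0 + (-1 * NN h u + s).
    rewrite -!(IB_lin r0); [|by ctn|by ctn|by ctn|by ctn].
    by congr (IB r _); apply/funext => w; rewrite /rho0; ring.
  by rewrite aa_h // pu; lra.
pose al := NN h v0 / N.
exists (fun w => - al * h w + v0 w), (fun w => rho0 w + - (s / N) * (mm w * h w)); split.
- split; first exact: dom_lin.
  rewrite NN_sym NN_lin // -/N [NN v0 h]NN_sym /al; field; by rewrite gt_eqF.
- by ctn.
- have c1 : cts (fun w => - (s / N) * (mm w * h w)) by ctn.
  apply: le_trans (IB_sqD r0 crho0 c1) _.
  have -> : (fun w => (- (s / N) * (mm w * h w)) ^+ 2) = fun w => (s / N) ^+ 2 * (mm w * h w) ^+ 2.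
    by apply/funext => w; ring.
  rewrite (IBZ r0); last by ctn.
  rewrite -/K2; have CS := IB_CS r0 ch crho0; rewrite -/s -/H2 in CS.
  set S := IB r (fun w => rho0 w ^+ 2) in hr0 CS *.
  have j1 : (s / N) ^+ 2 * K2 <= H2 * S / N ^+ 2 * K2.
    rewrite expr_div_n; apply: ler_wpM2r => //; apply: ler_wpM2r => //; by rewrite invr_ge0 sqr_ge0.
  apply: le_trans (_ : Q * S <= _); last by rewrite mulrC -ler_pdivlMr.
  rewrite /Q; move: j1; rewrite (_ : H2 * S / N ^+ 2 * K2 = H2 * K2 / N ^+ 2 * S); last by ring.
  by lra.
move=> w; have -> : L (fun w => - al * h w + v0 w) w = - al * L h w + L v0 w.
  by rewrite (Lop_lin k.+1 _ (- al) w hh dv0.1).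
rewrite -mmh; have -> : s / N = - ((mu - 1) * al).
  by rewrite /al mulrA sE mulNr opprK.
rewrite /rho0; ring.
Qed.

(** If the supremum [la] of the Rayleigh quotient were positive, [gap] would put it in (0, 1). For a
    near-maximiser [x] the form [q] is nonnegative with q(x, x) small, so by Cauchy-Schwarz [x] is
    almost an eigenvector when tested against its approximate resolvent [v]; [bochner_le] for [v]
    then contradicts [spectral_arith]. *)
Lemma perp_neg u : perp u -> aa u u <= 0.
Proof.
move=> pu0; rewrite leNgt; apply/negP => au; have [d d0 hd] := gap.
have [g [b [B [cg b0 B0 hw]]]] := weight_inv.
have sc t v : perp v -> [/\ perp (fun w => t * v w), NN (fun w => t * v w) (fun w => t * v w) = t ^+ 2 * NN v v
    & aa (fun w => t * v w) (fun w => t * v w) = t ^+ 2 * aa v v].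
  move=> pv; have [dv hv] := pv; have cv := domc dv; have d00 := dom0 n r; have c00 := domc d00.
  have p0 : perp (fun _ : 'rV[R]_n => 0).
    split=> //; rewrite /NN (_ : (fun w => _) = fun=> 0) ?IB0 //; by apply/funext => w; rewrite !mulr0.
  have E : (fun w => t * v w) = fun w => t * v w + 0 by apply/funext => w; rewrite addr0.
  have L0 w : L (fun _ : 'rV[R]_n => 0) w = 0 by rewrite /Lop Sh0 mulmx0 linear0 mulr0.
  have z1 : aa v (fun=> 0) = 0.
    by rewrite /aa (_ : (fun w => _) = fun=> 0) ?IB0 //; apply/funext => w; rewrite L0 mulr0.
  have z2 : aa (fun=> 0) (fun=> 0) = 0.
    by rewrite /aa (_ : (fun w => _) = fun=> 0) ?IB0 //; apply/funext => w; rewrite L0 mulr0.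
  have z3 x : NN x (fun=> 0) = 0.
    by rewrite /NN (_ : (fun w => _) = fun=> 0) ?IB0 //; apply/funext => w; rewrite !mulr0.
  rewrite E; split; first exact: perp_lin.
    by rewrite NN_sq // !z3 mulr0 !addr0.
  by rewrite (aa_sq t dv d00) z1 z2 mulr0 !addr0.
have nrm v : perp v -> 0 < NN v v -> exists v', [/\ perp v', NN v' v' = 1 & aa v' v' = aa v v / NN v v].
  move=> pv Nv; have [p1 p2 p3] := sc (Num.sqrt (NN v v))^-1 v pv.
  exists (fun w => (Num.sqrt (NN v v))^-1 * v w); split=> //.
    by rewrite p2 exprVn sqr_sqrtr ?(ltW Nv) // mulVf // gt_eqF.
  by rewrite p3 exprVn sqr_sqrtr ?(ltW Nv) // mulrC.
pose S := [set x : R | exists v, [/\ perp v, NN v v = 1 & aa v v = x]].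
have Nu : 0 < NN u u.
  rewrite lt_neqAle NN_ge0 ?andbT; last exact: domc pu0.1.
  by apply/eqP => Z; have := hd u pu0; rewrite -Z mulr0 leNgt au.
have [u1 [pu1 Nu1 au1]] := nrm u pu0 Nu.
have Sub : ubound S (1 - d).
  by move=> x [v [pv Nv <-]]; have := hd v pv; rewrite Nv mulr1.
have hS : has_sup S by split; [exists (aa u1 u1), u1|exists (1 - d)].
set la := sup S.
have laub x : S x -> x <= la by move=> Sx; exact: (sup_upper_bound hS).
have la0 : 0 < la by apply: lt_le_trans (laub (aa u1 u1) _); [rewrite au1 divr_gt0|exists u1].
have la1 : la < 1 by apply: le_lt_trans (sup_le_ub hS.1 Sub) _; rewrite gtrBl.
pose q x y := la * NN x y - aa x y.
have q0 v : perp v -> 0 <= q v v.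
  move=> pv; have [Z|Z] := eqVneq (NN v v) 0.
    by rewrite /q Z mulr0 sub0r oppr_ge0; have := hd v pv; rewrite Z mulr0.
  have Nv : 0 < NN v v by rewrite lt_neqAle eq_sym Z; apply: NN_ge0; exact: domc pv.1.
  have [v' [pv' Nv' av']] := nrm v pv Nv; have := laub _ (ex_intro _ v' (And3 pv' Nv' erefl)).
  by rewrite av' ler_pdivrMr // /q subr_ge0.
have qCS x y : perp x -> perp y -> q x y ^+ 2 <= q x x * q y y.
  move=> px py; apply: psd_CS => [|t]; first exact: q0.
  have := q0 _ (perp_lin t px py); rewrite {1}/q NN_sq ?aa_sq; [|exact: px.1|exact: py.1|exact: domc px.1|exact: domc py.1].
  by rewrite /q; move: (aa x x) (aa x y) (aa y y) (NN x x) (NN x y) (NN y y) => a1 a2 a3 a4 a5 a6; congr (_ <= _); ring.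
have [mu mu2 res] := resolvent_approx.
have [t t0 contra] := spectral_arith (introT andP (conj la0 la1)) mu2.
have e0 : 0 < t ^+ 2 / 4 by rewrite divr_gt0 // exprn_gt0.
have [_ [x [px Nx <-]] hx] := sup_adherent e0 hS; rewrite -/la in hx.
have [Bg Bg0 hBg] := cts_bounded r0 cg.
have [b1 [B1 [b10 _ hNb]]] := NN_bounds.
pose e1 := Num.min (t ^+ 2 * b1) (t / (Bg + 1)).
have Bg1 : 0 < Bg + 1 by rewrite ltr_pwDr.
have e10 : 0 < e1 by rewrite lt_min; apply/andP; split; [apply: mulr_gt0 => //; exact: exprn_gt0|exact: divr_gt0].
have [v [rho [pv crho hrho Lv]]] := res x px e1 e10.
have [dx _] := px; have [dv _] := pv; have cx := domc dx; have cv := domc dv.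
have cLv := cts_Lop k.+1 hh dv.1.
have r1 : IB r (fun w => rho w ^+ 2) <= t ^+ 2 * b1 by apply: le_trans hrho _; rewrite ge_min lexx.
have r2 : IB r (fun w => rho w ^+ 2) * (Bg + 1) <= t by rewrite -ler_pdivlMr //; apply: le_trans hrho _; rewrite ge_min lexx orbT.
have rp : 0 <= IB r (fun w => rho w ^+ 2) by apply: (IB_ge0 r0) => [|w _]; [ctn|exact: sqr_ge0].
have CSr y : cts y -> IB r (fun w => y w * rho w) ^+ 2 <= NN y y * t ^+ 2.
  move=> cy; apply: le_trans (IB_CS r0 cy crho) _.
  have yp : 0 <= IB r (fun w => y w ^+ 2) by apply: (IB_ge0 r0) => [|w _]; [ctn|exact: sqr_ge0].
  have /andP[n1 _] := hNb y cy; apply: le_trans (ler_wpM2l yp r1) _.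
  by have := ler_wpM2r (sqr_ge0 t) n1; congr (_ <= _); ring.
pose s := NN x v; pose V := NN v v; pose X := IB r (fun w => x w * rho w); pose Z := IB r (fun w => v w * rho w).
pose eta := IB r (fun w => g w * rho w ^+ 2).
have axv : aa x v = mu * s - 1 + X.
  rewrite -Nx; transitivity (mu * s + (-1 * NN x x + X)); last by ring.
  rewrite -!(IB_lin r0); [|by ctn|by ctn|by ctn|by ctn].
  by congr (IB r _); apply/funext => w; rewrite Lv; ring.
have avv : aa v v = mu * V - s + Z.
  rewrite /s NN_sym; transitivity (mu * V + (-1 * NN v x + Z)); last by ring.
  rewrite -!(IB_lin r0); [|by ctn|by ctn|by ctn|by ctn].
  by congr (IB r _); apply/funext => w; rewrite Lv; ring.
have boch : aa v v <= mu ^+ 2 * V + 1 + eta - 2 * mu * s + 2 * mu * Z - 2 * X.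
  have gL w : ball2 r w -> g w * L h w = h w.
    by move=> wB; have [_ gm] := hw w wB; rewrite -mmh mulrA gm mul1r.
  apply: le_trans (bochner_le r0 kn c0 adm dv cg gL) _.
  apply: le_trans (_ : mu ^+ 2 * V + (1 * NN x x + (1 * eta + (- (2 * mu) * NN v x + (2 * mu * Z + - 2 * X)))) <= _); last first.
    by rewrite le_eqVlt; apply/orP; left; apply/eqP; rewrite /s (NN_sym x v) Nx; ring.
  rewrite -[- 2 * X](IBZ r0); last by ctn.
  rewrite -!(IB_lin r0); try (by ctn).
  rewrite le_eqVlt; apply/orP; left; apply/eqP; apply: IB_ext.
  move=> w wB; have [_ gm] := hw w wB; rewrite Lv -/(mm w) in gm *.
  transitivity (mu ^+ 2 * ((g w * mm w) * mm w * (v w * v w)) + ((g w * mm w) * mm w * (x w * x w)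
    + (g w * rho w ^+ 2 + (- (2 * mu) * ((g w * mm w) * mm w * (v w * x w)) + (2 * mu * ((g w * mm w) * (v w * rho w))
    + - 2 * ((g w * mm w) * (x w * rho w))))))); first by ring.
  by rewrite gm; ring.
apply: (contra s V X Z eta).
- by have := CSr x cx; rewrite Nx mul1r.
- exact: CSr.
- apply: le_trans r2; rewrite mulrC -(IBZ r0); last by ctn.
  apply: (IB_le r0); [by ctn|by ctn|] => w wB; apply: ler_wpM2r; first exact: sqr_ge0.
  apply: le_trans (ler_norm _) _; apply: le_trans (hBg w wB) _; by rewrite lerDl.
- by have := NN_CS cx cv; rewrite Nx mul1r.
- have := q0 v pv; rewrite /q avv -/V; congr (_ <= _); ring.
- have := qCS x v px pv; rewrite {1}/q axv -/s => h1.
  rewrite (_ : _ - X = la * s - (mu * s - 1 + X)); last by ring.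
  apply: le_trans h1 _; rewrite (_ : s - _ - Z = q v v); last by rewrite /q avv -/V; ring.
  apply: ler_wpM2r; first exact: q0.
  by rewrite /q Nx mulr1 lerBlDr -lerBlDl; exact: ltW.
- by rewrite -avv.
Qed.

(** Subtracting from [u] its component along [h] leaves an element of the complement, where the form
    is nonpositive. *)
Theorem alexandrov_fenchel u : dom r u -> aa u u * aa h h <= aa u h ^+ 2.
Proof.
move=> du; have cu := domc du; have ahh : 0 < aa h h.
  rewrite aa_h //; have [b' [B' [b'0 _ /(_ h ch)/andP[+ _]]]] := NN_bounds; apply: lt_le_trans; rewrite mulr_gt0 //.
  have w0 : ball2 r (0 : 'rV[R]_n) by rewrite /ball2 nsqE big1 ?sqr_ge0 // => i _; rewrite mxE mul0r.
  by apply: (IB_gt0 r0 (w0 := 0)) => //; [ctn|move=> w _; exact: sqr_ge0|rewrite exprn_gt0].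
pose t := - (aa u h / aa h h); have d1 := dom_lin t dh du.
have p : perp (fun w => t * h w + u w).
  split=> //; rewrite NN_sym NN_lin // -(aa_h dh) [NN u h]NN_sym -(aa_h du) [aa h u]aa_sym // /t.
  by field; rewrite gt_eqF.
have := perp_neg p; rewrite (aa_sq t dh du) (aa_sym dh du) -(pmulr_lle0 _ ahh) => le0.
rewrite -subr_le0; move: le0 ahh; rewrite /t; move: (aa u u) (aa u h) (aa h h) => a1 a2 a3 le0 a30.
by move: le0; congr (_ <= _); field; rewrite gt_eqF.
Qed.

End AF.

(** * Constants by compactness, and Alexandrov-Fenchel in all orders *)

Section Admissible.
Variables (R : realType) (n : nat) (r : R).
Hypothesis r0 : 0 < r.
Implicit Types (f g h u v : 'rV[R]_n -> R) (w : 'rV[R]_n).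

Lemma ball2_compact : compact [set w : 'rV[R]_n | ball2 r w].
Proof.
rewrite (_ : [set w | _] = cube r `&` [set w : 'rV[R]_n | nsq w <= r ^+ 2]); last first.
  by apply/seteqP; split=> w /= => [wB|[]//]; split=> //; exact: ball2_norm.
apply: compact_closedI; first exact: cube_compact.
apply: (@closed_comp _ _ (@nsq R n) [set x | x <= r ^+ 2]) => [w _|]; last exact: closed_le.
exact: (Ck_cont (Ck_nsq R n 0)).
Qed.

Lemma ball2_pos_min f : cts f -> (forall w, ball2 r w -> 0 < f w) ->
  exists2 c, 0 < c & forall w, ball2 r w -> c <= f w.
Proof. by move=> cf f0; exact: (compact_pos_min ball2_compact (ctsE cf) f0). Qed.

Lemma admissible_of k h : dom r h -> (forall w, 0 < h w) -> (forall w, ball2 r w -> GamM k (Sh h w)) ->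
  exists C c, [/\ 0 <= C, 0 < c & admissible r k C c h].
Proof.
move=> dh hp G; have [hh _] := dh; have hS := Cm_Sh hh; have ch := Ck_cts hh.
have [B1 B10 hB1] := cts_bounded r0 ch.
have /boolp.choice[B2 hB2] (ij : 'I_n * 'I_n) : exists B, 0 <= B /\ forall w, ball2 r w -> `|Sh h w ij.1 ij.2| <= B.
  by have [B B0 hB] := cts_bounded r0 (Cm_cts ij.1 ij.2 hS); exists B.
have [c1 c10 hc1] := ball2_pos_min ch (fun w _ => hp w).
have /boolp.choice[c2 hc2] (j : nat) : exists c, 0 < c /\ ((j <= k)%N -> forall w, ball2 r w -> c <= sg j (Sh h w)).
  have [jk|jk] := leqP j k; last by exists 1.
  have [c c0 hc] := ball2_pos_min (Ck_cts (Ck_sg j hS)) (fun w wB => G w wB j jk).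
  by exists c.
have [c c0 hc] := @unif_gt0 R k c2 (fun j _ => (hc2 j).1).
have S0 : 0 <= \sum_ij B2 ij by apply: sumr_ge0 => ij _; exact: (hB2 ij).1.
exists (B1 + \sum_ij B2 ij), (Num.min c1 c); split; [exact: addr_ge0|by rewrite lt_min c10 c0|].
split=> [//|w|w wB]; first by rewrite gt_eqF.
split.
  rewrite ge_min hc1 //=; apply: le_trans (_ : B1 <= _); last by rewrite lerDl.
  by apply: le_trans (ler_norm _) _; exact: hB1.
split=> [|i j|j jk]; first exact: Sh_sym.
  apply: le_trans ((hB2 (i, j)).2 w wB) _; rewrite (bigD1 (i, j)) //= addrCA lerDl addr_ge0 //.
  by apply: sumr_ge0 => ij _; exact: (hB2 ij).1.
by rewrite ge_min (le_trans (hc j jk)) ?orbT // (hc2 j).2.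
Qed.

Lemma ball2_0 : ball2 r (0 : 'rV[R]_n).
Proof. by rewrite /ball2 nsqE big1 ?sqr_ge0 // => i _; rewrite mxE mul0r. Qed.

Lemma IB_base_gt0 k h : dom r h -> (forall w, 0 < h w) -> (forall w, ball2 r w -> GamM k.+1 (Sh h w)) ->
  0 < IB r (fun w => h w * Lop k h h w).
Proof.
move=> dh hp G; have ch := Ck_cts dh.1; have cL := cts_Lop k dh.1 dh.1.
have pos w : ball2 r w -> 0 < h w * Lop k h h w.
  move=> wB; rewrite Lop_base mulr_gt0 // mulr_gt0 ?ltr0Sn // mulr_gt0 ?exprn_gt0 ?phi_gt0 //.
  exact: (G w wB k.+1 (leqnn _)).
by apply: (IB_gt0 r0 (w0 := 0)); [ctn|move=> w wB; exact: ltW (pos w wB)|exact: ball2_0|exact: pos ball2_0].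
Qed.

(** For k = 0 the operator does not involve its base and is a positive multiple of the first-order
    operator with base [ell], since Newton tensors of scalar matrices are scalar. The inequality for
    [ell] shows that the form is nonpositive on the complement of [ell]; testing it on the
    combination of [u] and [h] in that complement gives the inequality for [h]. *)
Lemma af_gen k C c h u : (2 <= n)%N -> (k < n)%N -> 0 <= C -> 0 < c -> (forall w, 0 < h w) ->
  admissible r k.+1 C c h -> dom r u ->
  IB r (fun w => u w * Lop k h u w) * IB r (fun w => h w * Lop k h h w) <= IB r (fun w => u w * Lop k h h w) ^+ 2.
Proof.
case: k => [|k] n2 kn C0 c0 hp adm du; last exact: (alexandrov_fenchel r0 kn C0 c0 hp adm du).
have dl := dom_ell n r.
have [C1 [c1 [C10 c10 adml]]] : exists C c, [/\ 0 <= C, 0 < c & admissible r 2 C c (ell r : 'rV[R]_n -> R)].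
  apply: admissible_of dl (fun w => ell_gt0 r0 w) _ => w _ j j2.
  rewrite Sh_ell // -scalemx1; apply: (GamMZ (k := j)) => //; last by move=> i ij; rewrite sg1_gt0 // (leq_trans ij) // (leq_trans j2).
  by rewrite mulr_gt0 ?phi_gt0 // ltr_pwDl // sqr_ge0.
have [d d0 LE] := Lop_ell r n2.
have [dh _ admw] := adm; have [hh _] := dh; have ch := Ck_cts hh; have cu := Ck_cts du.1.
pose a f g := IB r (fun w => f w * Lop 0 h g w).
have L0 g w : Lop 1 (ell r) g w = d * Lop 0 h g w.
  by rewrite LE /Lop subn0; congr (_ * (_ * _)); rewrite /NT mul1mx.
have aE f g : dom r f -> dom r g -> aa r 0 (ell r) f g = d * a f g.
  move=> df dg; have cf := Ck_cts df.1; have cL := cts_Lop 0 hh dg.1.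
  rewrite -(IBZ r0); last by ctn.
  by congr (IB r _); apply/funext => w; rewrite L0; ring.
have AF g : dom r g -> a g g * a (ell r) (ell r) <= a g (ell r) ^+ 2.
  move=> dg; have := alexandrov_fenchel r0 (k := 0) n2 C10 c10 (fun w => ell_gt0 r0 w) adml dg.
  rewrite !aE // => z; have d2 : 0 < d ^+ 2 by rewrite exprn_gt0.
  rewrite -(ler_pM2l d2); move: z; move: (a g g) (a (ell r) (ell r)) (a g (ell r)) => a1 a2 a3.
  by congr (_ <= _); ring.
have H0 : 0 < a h h.
  by apply: (IB_base_gt0 (k := 0)) => // w wB j j1; have [_ [_ _ gM]] := admw w wB; exact: lt_le_trans (gM j j1).
have l0 : 0 < a (ell r) (ell r).
  rewrite -(pmulr_rgt0 _ d0) -aE //; apply: (IB_base_gt0 (k := 1)) => // [w|w wB j j1]; first exact: ell_gt0.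
  by have [_ _ /(_ w wB)[_ [_ _ gM]]] := adml; exact: lt_le_trans (gM j j1).
have b0 : a h (ell r) != 0.
  by apply/eqP => z; have := AF h dh; rewrite z expr0n /= leNgt mulr_gt0.
have dn : d != 0 by rewrite gt_eqF.
have sym f g : dom r f -> dom r g -> a f g = a g f.
  by move=> df dg; exact: (IB_Lop_sym r0 (leq0n n) dh df dg).
pose t := - (a u (ell r) / a h (ell r)); have dg := dom_lin t dh du.
have g0 : a (fun w => t * h w + u w) (ell r) = 0.
  apply: (mulfI dn); rewrite -aE // mulr0 (aa_lin r0 adml t ch cu dl) !aE // /t.
  by move: b0; move: (a h (ell r)) (a u (ell r)) => a1 a2 a10; field.
have := AF _ dg; rewrite g0 expr0n /= pmulr_lle0 //.
have -> : a (fun w => t * h w + u w) (fun w => t * h w + u w) = t ^+ 2 * a h h + 2 * t * a u h + a u u.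
  apply: (mulfI dn); rewrite -aE // (aa_sq r0 n2 adml t dh du) !aE // (sym h u) //.
  by move: (a h h) (a u h) (a u u) => a1 a2 a3; ring.
rewrite -/(a u u) -/(a h h) -/(a u h); move: (a u u) (a u h) H0; move: (a h h) => H U P H0 le0.
have := mulr_ge0_le0 (ltW H0) le0; have := sqr_ge0 (t * H + P).
by rewrite (_ : H * _ = (t * H + P) ^+ 2 + U * H - P ^+ 2); [lra|ring].
Qed.

End Admissible.

(** * Uniqueness on the ball *)

Section Uniqueness.
Variable R : realType.

(** With al = (p - 1) / K the hypothesis says x^al <= t, so x t is at least x^(1 + al), and the
    left-hand side is the tangent of this convex function at m. The tangent inequality is Young's
    inequality with exponents 1 + al and (1 + al) / al. *)
Lemma tangent_line (x m t p : R) (K : nat) : 0 < x -> 0 < m -> 0 <= t -> (0 < K)%N -> 1 < p ->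
  x `^ (p - 1) <= t ^+ K ->
  (1 + (p - 1) / K%:R) * m `^ ((p - 1) / K%:R) * x - (p - 1) / K%:R * m `^ (1 + (p - 1) / K%:R) <= x * t.
Proof.
move=> x0 m0 t0 K0 p1 h; set al := (p - 1) / K%:R; have Kp : 0 < K%:R :> R by rewrite ltr0n.
have al0 : 0 < al by rewrite divr_gt0 // subr_gt0.
have a1 : 0 < 1 + al by rewrite ltr_wpDl.
have xt : x `^ al <= t.
  have : (x `^ al) ^+ K <= t ^+ K by rewrite -powR_mulrn ?powR_ge0 // -powRrM /al divfK // gt_eqF.
  by rewrite ler_pXn2r // nnegrE powR_ge0.
have q0 : 0 < (1 + al) / al by rewrite divr_gt0.
have c1 : (1 + al)^-1 + ((1 + al) / al)^-1 = 1 by field; rewrite !gt_eqF.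
have := conjugate_powR (ltW x0) (powR_ge0 m al) a1 q0 c1.
rewrite -powRrM (_ : al * _ = 1 + al); last by field; rewrite gt_eqF.
have xE : x `^ (1 + al) = x * x `^ al by rewrite powRD ?powRr1 ?(ltW x0) // (gt_eqF x0) implybT.
rewrite xE => y; have xx : x * x `^ al <= x * t by rewrite ler_pM2l.
have := ler_wpM2l (ltW a1) y.
rewrite (_ : (1 + al) * (_ + _) = x * x `^ al + al * m `^ (1 + al)); last by field; rewrite !gt_eqF.
by rewrite mulrA; lra.
Qed.

(** Dividing by m leaves m^al <= m with al < 1, which excludes m < 1. The bound al < 1 is the form
    in which the upper bound on p is used. *)
Lemma powR_le_sq (m al : R) : 0 < m -> al < 1 -> m `^ (1 + al) <= m ^+ 2 -> 1 <= m.
Proof.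
move=> m0 a1; rewrite powRD ?(gt_eqF m0) ?implybT // powRr1 ?(ltW m0) // expr2 ler_pM2l // => h.
rewrite leNgt; apply/negP => m1; move: h; rewrite leNgt => /negP; apply.
rewrite /powR (gt_eqF m0) -{1}(lnK m0) ltr_expR.
have := ln_lt0 (introT andP (conj m0 m1)); set l := ln m => l0.
have : 0 < (1 - al) * - l by rewrite mulr_gt0 ?subr_gt0 // oppr_gt0.
by lra.
Qed.

Variables (n : nat) (r : R).
Hypothesis r0 : 0 < r.
Implicit Types (h : 'rV[R]_n -> R) (w : 'rV[R]_n).

(** Gaarding's inequality and [tangent_line] are combined pointwise and integrated. At m = a12 / a22
    the lower bound collapses to m^(1 + al) a22 <= a11, while Alexandrov-Fenchel gives a11 <= m^2
    a22; hence m >= 1. *)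
Lemma af_garding k (p : R) F h1 h2 : (2 <= n)%N -> (k < n)%N -> 1 < p < k.+1%:R + 1 ->
  dom r h1 -> dom r h2 -> (forall w, 0 < h1 w) -> (forall w, 0 < h2 w) ->
  (forall w, ball2 r w -> GamM k.+1 (Sh h1 w)) -> (forall w, ball2 r w -> GamM k.+1 (Sh h2 w)) ->
  (forall w, ball2 r w -> [/\ 0 < F w, sg k.+1 (Sh h1 w) = F w * h1 w `^ (p - 1) &
     sg k.+1 (Sh h2 w) = F w * h2 w `^ (p - 1)]) ->
  0 <= IB r (fun w => (h1 w - h2 w) * Lop k h2 h2 w).
Proof.
move=> n2 kn /andP[p1 pk] d1 d2 p1h p2h G1 G2 eqn.
have [C [c [C0 c0 adm]]] := admissible_of r0 d2 p2h G2.
have AF := af_gen r0 n2 kn C0 c0 p2h adm d1.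
have c1 := Ck_cts d1.1; have c2 := Ck_cts d2.1; have cL := cts_Lop k d2.1 d2.1; have cL1 := cts_Lop k d2.1 d1.1.
have L2 w : ball2 r w -> 0 < Lop k h2 h2 w.
  by move=> wB; rewrite Lop_base mulr_gt0 ?ltr0Sn // mulr_gt0 ?exprn_gt0 ?phi_gt0 //; exact: (G2 w wB k.+1 (leqnn _)).
set a11 := IB r (fun w => h1 w * Lop k h2 h1 w) in AF; set a22 := IB r (fun w => h2 w * Lop k h2 h2 w) in AF.
set a12 := IB r _ in AF.
have a220 : 0 < a22 by exact: (IB_base_gt0 r0 d2 p2h G2).
have a120 : 0 < a12.
  apply: (IB_gt0 r0 (w0 := 0)); [by ctn|by move=> w wB; rewrite ltW // mulr_gt0 // L2|exact: ball2_0|].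
  by rewrite mulr_gt0 // L2 //; exact: ball2_0.
pose al := (p - 1) / k.+1%:R; have K0 : 0 < k.+1%:R :> R by rewrite ltr0Sn.
have al1 : al < 1 by rewrite /al ltr_pdivrMr // mul1r; lra.
(* The tangent point is the mean of [h1 / h2] for the weight [h2 * Lop k h2 h2], as in Jensen's
   inequality. *)
pose m := a12 / a22; have m0 : 0 < m by rewrite divr_gt0.
have low : (1 + al) * m `^ al * a12 - al * m `^ (1 + al) * a22 <= a11.
  rewrite -(IBZ r0); last by ctn.
  rewrite -(IBZ r0); last by ctn.
  rewrite -(IBB r0); [|by ctn|by ctn]; apply: (IB_le r0); [by ctn|by ctn|] => w wB.
  have [F0 e1 e2] := eqn w wB; have h10 := p1h w; have h20 := p2h w.
  have s1 := Sh_sym w d1.1; have s2 := Sh_sym w d2.1.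
  have [t0 gd] := garding_mx s1 s2 (G1 w wB) (G2 w wB).
  have S20 : 0 < sg k.+1 (Sh h2 w) by exact: (G2 w wB k.+1 (leqnn _)).
  set tr := \tr _ in t0 gd; set S2 := sg k.+1 (Sh h2 w) in e2 gd S20.
  pose x := h1 w / h2 w; have x0 : 0 < x by rewrite divr_gt0.
  have xE : h1 w = x * h2 w by rewrite divfK // gt_eqF.
  pose t := tr / (k.+1%:R * S2); have tt0 : 0 <= t by rewrite divr_ge0 ?ltW // mulr_gt0.
  have hx : x `^ (p - 1) <= t ^+ k.+1.
    have -> : x `^ (p - 1) = sg k.+1 (Sh h1 w) / S2.
      rewrite e1 e2 xE powRM ?(ltW x0) ?(ltW h20) //; field.
      by rewrite !gt_eqF // powR_gt0.
    have -> : t ^+ k.+1 = (tr / k.+1%:R) ^+ k.+1 / S2 ^+ k.+1.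
      by rewrite /t invfM mulrA expr_div_n.
    rewrite ler_pdivlMr ?exprn_gt0 // exprS mulrA divfK ?gt_eqF //.
  have := tangent_line x0 m0 tt0 (ltn0Sn k) p1 hx; rewrite -/al => tl.
  have LE : h1 w * Lop k h2 h1 w = h2 w * Lop k h2 h2 w * (x * t).
    rewrite Lop_base /Lop -/tr -/S2 xE /t; field; by rewrite (gt_eqF S20) /= addrC natr1 pnatr_eq0.
  have b0 : 0 <= h2 w * Lop k h2 h2 w by rewrite ltW // mulr_gt0 // L2.
  rewrite LE; apply: le_trans (ler_wpM2l b0 tl); rewrite {1}xE le_eqVlt; apply/orP; left; apply/eqP; ring.
have mE : a12 = m * a22 by rewrite divfK // gt_eqF.
have lowE : (1 + al) * m `^ al * a12 - al * m `^ (1 + al) * a22 = m `^ (1 + al) * a22.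
  by rewrite mE powRD ?(gt_eqF m0) ?implybT // powRr1 ?(ltW m0) //; ring.
rewrite lowE in low.
have m1 : 1 <= m.
  apply: (powR_le_sq m0 al1); have a222 : 0 < a22 ^+ 2 by rewrite exprn_gt0.
  rewrite -(ler_pM2r a222) -exprMn -mE; apply: le_trans AF; rewrite expr2 mulrA; apply: ler_wpM2r => //; exact: ltW.
have -> : (fun w => (h1 w - h2 w) * Lop k h2 h2 w) = fun w => h1 w * Lop k h2 h2 w - h2 w * Lop k h2 h2 w.
  by apply/funext => w; ring.
rewrite (IBB r0); [|by ctn|by ctn]; rewrite -/a12 -/a22 mE subr_ge0; apply: ler_peMl => //; exact: ltW.
Qed.

Theorem ball_unique k (p : R) F h1 h2 : (2 <= n)%N -> (k < n)%N -> 1 < p < k.+1%:R + 1 ->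
  dom r h1 -> dom r h2 -> (forall w, 0 < h1 w) -> (forall w, 0 < h2 w) ->
  (forall w, ball2 r w -> GamM k.+1 (Sh h1 w)) -> (forall w, ball2 r w -> GamM k.+1 (Sh h2 w)) ->
  (forall w, ball2 r w -> [/\ 0 < F w, sg k.+1 (Sh h1 w) = F w * h1 w `^ (p - 1) &
     sg k.+1 (Sh h2 w) = F w * h2 w `^ (p - 1)]) ->
  forall w, ball2 r w -> h1 w = h2 w.
Proof.
move=> n2 kn pk d1 d2 p1h p2h G1 G2 eqn.
have eqn' w : ball2 r w -> [/\ 0 < F w, sg k.+1 (Sh h2 w) = F w * h2 w `^ (p - 1) &
     sg k.+1 (Sh h1 w) = F w * h1 w `^ (p - 1)] by move=> /eqn[].
have i1 := af_garding n2 kn pk d1 d2 p1h p2h G1 G2 eqn.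
have i2 := af_garding n2 kn pk d2 d1 p2h p1h G2 G1 eqn'.
have c1 := Ck_cts d1.1; have c2 := Ck_cts d2.1; have cL1 := cts_Lop k d1.1 d1.1; have cL2 := cts_Lop k d2.1 d2.1.
(* By the equations [D] is a positive weight times (h1 - h2)(h1^(p-1) - h2^(p-1)), nonnegative
   because p > 1, whereas the two inequalities make its integral nonpositive. *)
pose D w := (h1 w - h2 w) * (Lop k h1 h1 w - Lop k h2 h2 w).
have pp : 0 < p - 1 by case/andP: pk; rewrite subr_gt0.
have DE w : ball2 r w -> D w = k.+1%:R * (phi w ^+ (n - k) * F w) * ((h1 w - h2 w) * (h1 w `^ (p - 1) - h2 w `^ (p - 1))).
  by move=> /eqn[F0 e1 e2]; rewrite /D !Lop_base e1 e2; ring.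
have cf0 w : ball2 r w -> 0 < k.+1%:R * (phi w ^+ (n - k) * F w).
  by move=> /eqn[F0 _ _]; rewrite mulr_gt0 ?ltr0Sn // mulr_gt0 // exprn_gt0 // phi_gt0.
have mono (x y : R) : 0 < x -> 0 < y -> x != y -> 0 < (x - y) * (x `^ (p - 1) - y `^ (p - 1)).
  move=> x0 y0; case: (ltgtP x y) => // xy _.
    rewrite -mulrNN mulr_gt0 // oppr_gt0 subr_lt0 //; by apply: gt0_ltr_powR; rewrite ?nnegrE ?ltW.
  rewrite mulr_gt0 // subr_gt0 //; by apply: gt0_ltr_powR; rewrite ?nnegrE ?ltW.
have D0 w : ball2 r w -> 0 <= D w.
  move=> wB; rewrite (DE w wB); have [->|ne] := eqVneq (h1 w) (h2 w); first by rewrite !subrr mul0r mulr0.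
  by rewrite ltW // mulr_gt0 ?cf0 // mono.
have cD : cts D by rewrite /D; ctn.
have ID : IB r D = 0.
  apply/eqP; rewrite eq_le (IB_ge0 r0 cD D0) andbT -oppr_ge0.
  have -> : - IB r D = IB r (fun w => (h1 w - h2 w) * Lop k h2 h2 w) + IB r (fun w => (h2 w - h1 w) * Lop k h1 h1 w).
    rewrite -(IBD r0); [|by ctn|by ctn]; rewrite -(IBN r0) //; congr (IB r _); apply/funext => w; rewrite /D; ring.
  exact: addr_ge0.
move=> w wB; apply/eqP; apply/negPn/negP => ne.
have := IB_eq0 r0 cD D0 ID wB; rewrite (DE w wB) => /eqP.
by rewrite gt_eqF // mulr_gt0 ?cf0 // mono.
Qed.

End Uniqueness.

(** * The stereographic chart of the cap *)

Section Cutoff.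
Variables (R : realType) (m : nat).
Implicit Types (F G h chi : 'rV[R]_m -> R) (x y : 'rV[R]_m) (U S : set 'rV[R]_m).

Lemma Ck_on_cont U k F x : Ck_on U k F -> U x -> {for x, continuous F}.
Proof. by move=> h Ux; exact: (h [::] (leq0n k) x Ux).1. Qed.

Lemma Ck_on_der U k F x i : Ck_on U k.+1 F -> U x -> derivable F x (basisv R i).
Proof. by move=> h Ux; exact: (h [::] (leq0n k.+1) x Ux).2. Qed.

Lemma Ck_on_pd U k F i : Ck_on U k.+1 F -> Ck_on U k (pd i F).
Proof.
move=> h s sk x Ux; have := h (rcons s i); rewrite size_rcons => /(_ sk x Ux).
have -> : Defs.iterD (rcons s i) F = Defs.iterD s (pd i F).
  rewrite /Defs.iterD -cats1 foldr_cat /=; congr (foldr _ _ s); by apply/funext => y; rewrite pdE.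
by rewrite ltnS => -[].
Qed.

Lemma Ck_onW U k F : Ck_on U k.+1 F -> Ck_on U k F.
Proof.
move=> h s sk x Ux; have [h1 h2] := h s (leqW sk) x Ux; split=> // sk' i; apply: h2; exact: leqW.
Qed.

Lemma near_open U x (P : 'rV[R]_m -> Prop) : open U -> U x -> (forall y, U y -> P y) -> \forall y \near x, P y.
Proof. by move=> oU Ux h; near=> y; apply: h; near: y; exact: open_nbhs_nbhs. Unshelve. all: by end_near. Qed.

Lemma pd_vanish i chi S x : closed S -> (forall y, ~ S y -> chi y = 0) -> ~ S x -> pd i chi x = 0.
Proof.
move=> cS h Sx; rewrite (@pd_on _ m (~` S) i chi (fun=> 0) x) ?pd_cst //; exact: closed_openC.
Qed.

Lemma cont_near F G x : (\forall y \near x, F y = G y) -> {for x, continuous F} -> {for x, continuous G}.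
Proof.
move=> FG cF; have GF : G x = F x by have := nbhs_singleton FG.
suff : G @ x --> G x by [].
by rewrite GF; exact: (cvg_trans (near_eq_cvg FG) cF).
Qed.

(** Near a point outside [U] the product is identically zero, since [S] is closed; inside [U] both
    factors are differentiable. *)
Lemma Ck_cut k U S chi h : open U -> closed S -> S `<=` U -> Ck k chi -> (forall y, ~ S y -> chi y = 0) ->
  Ck_on U k h -> Ck k (chi \* h).
Proof.
move=> oU cS SU; elim: k chi h => [|k IH] chi h hc c0 hh.
  split=> // x; have [Ux|Ux] := pselect (U x).
    exact: (cvgM (Ck_cont hc (x := x)) (Ck_on_cont hh Ux)).
  have oS : open (~` S) by exact: closed_openC.
  apply: (@cont_near (fun=> 0)); last exact: cst_continuous.
  by apply: (near_open oS) => [/SU//|y Sy]; rewrite /= c0 ?mul0r.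
have oS : open (~` S) by exact: closed_openC.
have zero x : ~ U x -> \forall y \near x, 0 = (chi \* h) y.
  by move=> Ux; apply: (near_open oS) => [/SU//|y Sy]; rewrite /= c0 ?mul0r.
have dchi x i : derivable chi x (basisv R i) by apply: Ck_der hc.
split.
  exact: (Ck_cont (IH chi h (CkW hc) c0 (Ck_onW hh))).
move=> i; split.
  move=> x; have [Ux|Ux] := pselect (U x).
    by apply: derivableM; [exact: dchi|exact: Ck_on_der hh Ux].
  by apply: (near_eq_derivable (zero x Ux)); exact: derivable_cst.
have -> : pd i (chi \* h) = (chi \* pd i h) \+ (pd i chi \* h).
  apply/funext => x /=; have [Ux|Ux] := pselect (U x).
    have dh : derivable h x (basisv R i) by exact: Ck_on_der hh Ux.
    by rewrite !pdE (deriveM (dchi x i) dh) /= /GRing.scale /= [h x * _]mulrC.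
  have Sx : ~ S x by move/SU.
  rewrite c0 // (pd_vanish i cS c0 Sx) !mul0r addr0.
  by rewrite (@pd_on _ m (~` S) i _ (fun=> 0) x) ?pd_cst // => y Sy /=; rewrite c0 ?mul0r.
apply: CkD.
  by apply: IH (CkW hc) c0 _; exact: Ck_on_pd.
apply: IH (Ck_pd i hc) _ (Ck_onW hh) => y Sy; exact: pd_vanish cS c0 Sy.
Qed.

Lemma derive_on U F G x v : open U -> U x -> (forall y, U y -> F y = G y) -> 'D_v F x = 'D_v G x.
Proof. by move=> oU Ux h; apply: near_eq_derive; exact: near_open oU Ux h. Qed.

Lemma iterD_on U F G i j x : open U -> U x -> (forall y, U y -> F y = G y) ->
  'D_(basisv R i) ('D_(basisv R j) F) x = pd i (pd j G) x.
Proof.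
move=> oU Ux h; rewrite pdE; apply: (derive_on _ oU Ux) => y Uy.
by rewrite pdE; exact: (derive_on _ oU Uy h).
Qed.

End Cutoff.

Section Extension.
Variables (R : realType) (n : nat) (theta : R).
Implicit Types (y : 'rV[R]_n.+1).
Local Notation ctr := (capcenter n theta : 'rV[R]_n.+1).

Definition capq y : R := nsq (y - ctr).

Lemma Ck_capq k : Ck k capq.
Proof.
rewrite (_ : capq = fun y => \sum_i (y 0 i - ctr 0 i) * (y 0 i - ctr 0 i)).
  apply: Ck_sum => i; have h : Ck k (fun y => y 0 i - ctr 0 i) by exact: CkB (Ck_coord R k i) (Ck_cst _ k _).
  exact: (CkM h h).
by apply/funext => y; rewrite /capq nsqE; apply: eq_bigr => i _; rewrite !mxE.
Qed.

Lemma capP y : cap n theta y <-> 0 <= y 0 ord_max /\ capq y = 1.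
Proof.
rewrite /cap /= /capq nsqE /dotp; split=> -[h1 h2]; split=> //.
Qed.

(** A nonnegative continuous function vanishing exactly on the cap: |t| - t is twice the negative
    part of the height t. *)
Definition capgap y : R := (capq y - 1) * (capq y - 1) + (`|y 0 ord_max| - y 0 ord_max) * (`|y 0 ord_max| - y 0 ord_max).

Lemma cts_capgap : cts capgap.
Proof.
have c1 := Ck_cts (Ck_capq 0); have c2 : cts (fun y : 'rV[R]_n.+1 => y 0 ord_max) by exact: cts_coord.
have c3 : cts (fun y : 'rV[R]_n.+1 => `|y 0 ord_max|).
  split=> x; apply: (@continuous_comp _ _ _ (fun y : 'rV[R]_n.+1 => y 0 ord_max) (fun z : R => `|z|)).
    exact: (ctsE c2).
  exact: norm_continuous.
by rewrite /capgap; ctn.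
Qed.

Lemma capgap_gt0 y : ~ cap n theta y -> 0 < capgap y.
Proof.
move=> h; rewrite lt_neqAle addr_ge0 -?expr2 ?sqr_ge0 // andbT eq_sym; apply/eqP => /eqP.
rewrite /capgap -!expr2 paddr_eq0 ?sqr_ge0 // !sqrf_eq0 !subr_eq0 => /andP[/eqP q1 /eqP l1].
by apply: h; apply/capP; split; rewrite // -l1.
Qed.

Lemma capq_bounded y : capq y <= 4 -> `|y| <= 2 + `|ctr|.
Proof.
move=> h; have -> : y = (y - ctr) + ctr by rewrite subrK.
apply: le_trans (ler_normD _ _) _; rewrite lerD2r; apply: le_of_sqr => //.
by apply: le_trans (norm_sq_le_nsq _) _; apply: le_trans h _; rewrite -natrX.
Qed.

(** A product of two cutoffs, in the distance to the sphere and in the height, makes [h] global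
    without changing it near the cap. The support of the cutoff stays in [U] because [capgap] has a
    positive minimum on the bounded part of the complement of [U]. *)
Lemma cap_extension U h : open U -> cap n theta `<=` U -> Ck_on U 2 h ->
  exists H (V : set 'rV[R]_n.+1), [/\ Ck 2 H, open V, cap n theta `<=` V & forall y, V y -> H y = h y].
Proof.
move=> oU capU hh.
have cq := Ck_cts (Ck_capq 0).
have cK : compact ([set y : 'rV[R]_n.+1 | `|y| <= 2 + `|ctr|] `&` ([set y | capq y <= 4] `&` ~` U)).
  apply: compact_closedI; first exact: cube_compact.
  apply: closedI; last exact: open_closedC.
  by apply: (@closed_comp _ _ capq [set x | x <= 4]) => [y _|]; [exact: (ctsE cq)|exact: closed_le].
have [|d d0 hd] := compact_pos_min cK (ctsE cts_capgap).
  by move=> y [_ [_ Uy]]; apply: capgap_gt0 => /capU.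
(* On the support of the cutoff [capgap] is at most 2 e + 16 e, which must stay below the minimum
   [d]. *)
pose e := Num.min 1 (d / 20); have e0 : 0 < e by rewrite lt_min ltr01 divr_gt0.
have e1 : e <= 1 by rewrite ge_min lexx.
have ed : e * 20 <= d by rewrite -ler_pdivlMr // ge_min lexx orbT.
have e2 : 0 < e ^+ 2 by rewrite exprn_gt0.
have ee : e ^+ 2 <= e by rewrite expr2 ler_piMr // ltW.
pose S := [set y : 'rV[R]_n.+1 | (capq y - 1) ^+ 2 <= 2 * e ^+ 2] `&` [set y | - (2 * e) <= y 0 ord_max].
have cf1 : cts (fun y => (capq y - 1) ^+ 2) by ctn.
have cl : cts (fun y : 'rV[R]_n.+1 => y 0 ord_max) by exact: cts_coord.
have cS : closed S.
  apply: closedI.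
    by apply: (@closed_comp _ _ (fun y => (capq y - 1) ^+ 2) [set x | x <= 2 * e ^+ 2]) => [y _|]; [exact: (ctsE cf1)|exact: closed_le].
  by apply: (@closed_comp _ _ (fun y : 'rV[R]_n.+1 => y 0 ord_max) [set x | - (2 * e) <= x]) => [y _|]; [exact: (ctsE cl)|exact: closed_ge].
have SU : S `<=` U.
  move=> y [/= s1 s2]; apply: contrapT => Uy.
  have q4 : capq y <= 4.
    rewrite leNgt; apply/negP => q4; have : 3 ^+ 2 < (capq y - 1) ^+ 2.
      by rewrite ltr_pXn2r ?nnegrE //; lra.
    by rewrite ltNge => /negP; apply; apply: le_trans s1 _; lra.
  have : d <= capgap y by apply: hd; split=> //; exact: capq_bounded.
  apply/negP; rewrite -ltNge /capgap -!expr2; apply: le_lt_trans (_ : 18 * e < _); last by lra.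
  apply: le_trans (_ : 2 * e + 16 * e <= _); last by lra.
  apply: lerD; first by apply: le_trans s1 _; rewrite ler_pM2l.
  have : 0 <= `|y 0 ord_max| - y 0 ord_max <= 4 * e.
    rewrite subr_ge0 ler_norm /=; case: (ger0P (y 0 ord_max)) => _; lra.
  move=> /andP[a1 a2]; apply: le_trans (_ : (4 * e) ^+ 2 <= _); last by rewrite exprMn; lra.
  by apply: lerXn2r; rewrite ?nnegrE // mulr_ge0 // ltW.
pose chi y := smoothstep (2 - (capq y - 1) ^+ 2 / e ^+ 2) * smoothstep (2 + y 0 ord_max / e).
have hchi : Ck 2 chi.
  apply: CkM.
    apply: (Ck_smoothstep (F := fun y => 2 - (capq y - 1) ^+ 2 / e ^+ 2)).
    rewrite (_ : (fun y => _) = fun y => 2 - (e ^+ 2)^-1 * ((capq y - 1) * (capq y - 1))).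
      have h1 : Ck 2 (fun y => capq y - 1) by exact: CkB (Ck_capq 2) (Ck_cst _ 2 _).
      exact: CkB (Ck_cst _ 2 _) (CkZ _ (CkM h1 h1)).
    by apply/funext => y; rewrite mulrC expr2.
  apply: (Ck_smoothstep (F := fun y : 'rV[R]_n.+1 => 2 + y 0 ord_max / e)).
  rewrite (_ : (fun y => _) = fun y : 'rV[R]_n.+1 => 2 + e^-1 * y 0 ord_max).
    exact: CkD (Ck_cst _ 2 _) (CkZ _ (Ck_coord R 2 ord_max)).
  by apply/funext => y; rewrite mulrC.
have chi0 y : ~ S y -> chi y = 0.
  move=> Sy; rewrite /chi; have [h1|h1] := lerP ((capq y - 1) ^+ 2) (2 * e ^+ 2).
    have h2 : y 0 ord_max < - (2 * e) by rewrite ltNge; apply/negP => h2; apply: Sy.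
    rewrite [X in _ * X]smoothstep_le0 ?mulr0 //; have : y 0 ord_max / e <= - 2 by rewrite ler_pdivrMr //; lra.
    by lra.
  rewrite smoothstep_le0 ?mul0r //; have : 2 <= (capq y - 1) ^+ 2 / e ^+ 2 by rewrite ler_pdivlMr // ltW.
  by lra.
exists (chi \* h), ([set y | (capq y - 1) ^+ 2 < e ^+ 2] `&` [set y : 'rV[R]_n.+1 | - e < y 0 ord_max]); split.
- exact: Ck_cut oU cS SU hchi chi0 hh.
- apply: openI.
    by apply: (@open_comp _ _ (fun y => (capq y - 1) ^+ 2) [set x | x < e ^+ 2]) => [y _|]; [exact: (ctsE cf1)|exact: open_lt].
  by apply: (@open_comp _ _ (fun y : 'rV[R]_n.+1 => y 0 ord_max) [set x | - e < x]) => [y _|]; [exact: (ctsE cl)|exact: open_gt].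
- move=> y /capP[y0 q1]; split=> /=; first by rewrite q1 subrr expr0n.
  by apply: lt_le_trans y0; rewrite oppr_lt0.
move=> y [/= h1 h2]; rewrite /chi !smoothstep_ge1 ?mul1r //.
  have : - 1 <= y 0 ord_max / e by rewrite ler_pdivlMr //; lra.
  by lra.
have : (capq y - 1) ^+ 2 / e ^+ 2 <= 1 by rewrite ler_pdivrMr // mul1r ltW.
by lra.
Qed.

End Extension.

(** * Inverse stereographic projection *)

Section Chart.
Variables (R : realType) (n : nat) (theta : R).
Implicit Types (w : 'rV[R]_n) (i j l : 'I_n) (a b : 'I_n.+1) (H : 'rV[R]_n.+1 -> R).
Local Notation lf := (lift (ord_max : 'I_n.+1)).
Local Notation ctr := (capcenter n theta : 'rV[R]_n.+1).

Lemma sum_lift (V : nmodType) (F : 'I_n.+1 -> V) : \sum_a F a = \sum_i F (lf i) + F ord_max.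
Proof.
rewrite big_ord_recr /=; congr (_ + _); apply: eq_bigr => i _; congr F; apply: val_inj => /=.
by rewrite /bump leqNgt ltn_ord.
Qed.

Lemma ord_liftP (P : 'I_n.+1 -> Prop) : (forall i, P (lf i)) -> P ord_max -> forall a, P a.
Proof. by move=> h1 h2 a; case: (unliftP ord_max a) => [i ->|->]. Qed.

(** The point of the unit sphere that is projected to [w] from the south pole; the origin
    corresponds to the north pole. *)
Definition nrm w : 'rV[R]_n.+1 := \row_a (if unlift ord_max a is Some i then phi w * w 0 i else phi w - 1).
Definition chart w : 'rV[R]_n.+1 := nrm w + ctr.
Definition Jm w : 'M[R]_(n, n.+1) := \matrix_(i, a)
  (if unlift ord_max a is Some j then (i == j)%:R * phi w - phi w ^+ 2 * (w 0 i * w 0 j) else - phi w ^+ 2 * w 0 i).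

Lemma nrm_lift w i : nrm w 0 (lf i) = phi w * w 0 i. Proof. by rewrite mxE liftK. Qed.
Lemma nrm_max w : nrm w 0 ord_max = phi w - 1. Proof. by rewrite mxE unlift_none. Qed.
Lemma Jm_lift w i j : Jm w i (lf j) = (i == j)%:R * phi w - phi w ^+ 2 * (w 0 i * w 0 j).
Proof. by rewrite mxE liftK. Qed.
Lemma Jm_max w i : Jm w i ord_max = - phi w ^+ 2 * w 0 i. Proof. by rewrite mxE unlift_none. Qed.
Lemma ctr_max : ctr 0 ord_max = - cos theta.
Proof. by rewrite !mxE eqxx mulrN1. Qed.

Lemma phi_nsq w : phi w * nsq w = 2 - phi w.
Proof. by rewrite /phi; field; rewrite gt_eqF // nsq1_gt0. Qed.

Lemma Ck_nrm k a : Ck k (fun w => nrm w 0 a).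
Proof.
elim/ord_liftP: a => [i|].
  rewrite (_ : (fun w => _) = @phi R n \* (fun w => w 0 i)); last by apply/funext => w; rewrite nrm_lift.
  exact: (CkM (Ck_phi R n k) (Ck_coord R k i)).
rewrite (_ : (fun w => _) = fun w => phi w - 1); last by apply/funext => w; rewrite nrm_max.
exact: CkB (Ck_phi R n k) (Ck_cst n k 1).
Qed.

Lemma Ck_chart k a : Ck k (fun w => chart w 0 a).
Proof.
rewrite (_ : (fun w => _) = fun w => nrm w 0 a + ctr 0 a); last by apply/funext => w; rewrite [LHS]mxE.
exact: CkD (Ck_nrm k a) (Ck_cst n k _).
Qed.

Lemma pd_nrm w i a : pd i (fun w => nrm w 0 a) w = Jm w i a.
Proof.
elim/ord_liftP: a => [j|].
  rewrite (_ : (fun w => _) = fun w => phi w * w 0 j); last by apply/funext => x; rewrite nrm_lift.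
  rewrite (pd_mul i w (Ck_phi R n 1) (Ck_coord R 1 j)) pd_coord pd_phi Jm_lift; ring.
rewrite (_ : (fun w => _) = fun w => 1 * phi w + -1); last by apply/funext => x; rewrite nrm_max mul1r.
by rewrite (pd_lin i 1 w (Ck_phi R n 1) (Ck_cst n 1 (-1 : R))) pd_cst pd_phi Jm_max; ring.
Qed.

Lemma pd_chart w i a : pd i (fun w => chart w 0 a) w = Jm w i a.
Proof.
rewrite -pd_nrm (_ : (fun w => _) = fun w => 1 * nrm w 0 a + ctr 0 a); last first.
  by apply/funext => x; rewrite [LHS]mxE mul1r.
by rewrite (pd_lin i 1 w (Ck_nrm 1 a) (Ck_cst n 1 (ctr 0 a))) pd_cst; ring.
Qed.

Lemma Ck_Jm k i a : Ck k (fun w => Jm w i a).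
Proof.
rewrite (_ : (fun w => _) = pd i (fun w => chart w 0 a)); last by apply/funext => w; rewrite pd_chart.
exact: Ck_pd (Ck_chart k.+1 a).
Qed.

Lemma chart_differentiable w : differentiable chart w.
Proof.
rewrite (_ : chart = \sum_a (fun w => chart w 0 a *: basisv R a)).
  apply: differentiable_sum => a; apply: differentiableZl.
  exact: (Ck_derivable_dir w 0 (Ck_chart 1 a)).1.
apply/funext => x; rewrite fct_sumE; apply/rowP => b; rewrite summxE (bigD1 b) //= big1 => [|a ab].
  by rewrite !mxE eqxx mulr1 addr0.
by rewrite !mxE (negbTE ab) mulr0.
Qed.

Lemma pd_comp H i w : Ck 1 H -> derivable (H \o chart) w (basisv R i) /\
  pd i (H \o chart) w = \sum_a Jm w i a * pd a H (chart w).
Proof.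
move=> hH; have dc := chart_differentiable w; have [dH _] := Ck_derivable_dir (chart w) 0 hH.
have dcomp := differentiable_comp dc dH; split; first exact: diff_derivable.
rewrite pdE (deriveE _ dcomp) (diff_comp dc dH) /= -(deriveE _ dc) -(deriveE _ dH).
rewrite (Ck_derivable_dir (chart w) _ hH).2; apply: eq_bigr => a _; congr (_ * _).
have dd : derivable chart w (basisv R i) by exact: diff_derivable.
by rewrite (derive_mx dd) mxE -pd_chart pdE.
Qed.

Lemma Ck_comp k H : Ck k H -> Ck k (H \o chart).
Proof.
elim: k H => [|k IH] H hH.
  split=> // w; apply: continuous_comp; last exact: (Ck_cont hH).
  exact: differentiable_continuous (chart_differentiable w).
have h1 : Ck 1 H by exact: Ck_le hH.
split; first exact: (Ck_cont (IH H (CkW hH))).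
move=> i; split; first by move=> w; exact: (pd_comp i w h1).1.
rewrite (_ : pd i _ = fun w => \sum_a Jm w i a * (pd a H \o chart) w); last first.
  by apply/funext => w; rewrite (pd_comp i w h1).2.
by apply: Ck_sum => a; exact: (CkM (Ck_Jm k i a) (IH _ (Ck_pd a hH))).
Qed.

Definition Etan w a := \sum_i w 0 i * Jm w i a.

Lemma Etan_lift w j : Etan w (lf j) = (phi w - 1) * nrm w 0 (lf j).
Proof.
rewrite /Etan nrm_lift; under eq_bigr do rewrite Jm_lift.
rewrite (eq_bigr (fun i => phi w * (w 0 i * (i == j)%:R) - phi w ^+ 2 * w 0 j * (w 0 i * w 0 i))); last by move=> i _; ring.
rewrite sumrB -!mulr_sumr -nsqE (bigD1 j) //= big1 => [|i ij]; last by rewrite (negbTE ij) mulr0.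
have -> : phi w ^+ 2 * w 0 j * nsq w = phi w * w 0 j * (phi w * nsq w) by ring.
by rewrite phi_nsq eqxx mulr1; ring.
Qed.

Lemma Etan_max w : Etan w ord_max = - phi w * (2 - phi w).
Proof.
rewrite /Etan; under eq_bigr do rewrite Jm_max.
rewrite (eq_bigr (fun i => - phi w ^+ 2 * (w 0 i * w 0 i))); last by move=> i _; ring.
by rewrite -mulr_sumr -nsqE -phi_nsq; ring.
Qed.

(** Second derivatives of the chart: the tangential part consists of the Christoffel symbols of the
    metric [phi ^+ 2], the part along [nrm] is the second fundamental form of the sphere. *)
Lemma pd_Jm w l i a : pd l (fun w => Jm w i a) w =
  - phi w * (w 0 l * Jm w i a + w 0 i * Jm w l a - (l == i)%:R * Etan w a) - phi w ^+ 2 * (l == i)%:R * nrm w 0 a.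
Proof.
have hp := Ck_phi R n 1.
have hp2 : Ck 1 (fun w : 'rV[R]_n => phi w * phi w) by exact: (CkM hp hp).
have pp2 : pd l (fun w : 'rV[R]_n => phi w * phi w) w = - 2 * phi w ^+ 3 * w 0 l.
  by rewrite (pd_mul l w hp hp) pd_phi; ring.
elim/ord_liftP: a => [j|].
  rewrite (_ : (fun w => _) = fun w => (i == j)%:R * phi w + -1 * (phi w * phi w * (w 0 i * w 0 j))); last first.
    by apply/funext => x; rewrite Jm_lift; ring.
  have hc : Ck 1 (fun w : 'rV[R]_n => w 0 i * w 0 j) by exact: (CkM (Ck_coord R 1 i) (Ck_coord R 1 j)).
  have hm : Ck 1 (fun w : 'rV[R]_n => -1 * (phi w * phi w * (w 0 i * w 0 j))) by exact: CkZ _ (CkM hp2 hc).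
  rewrite (pd_lin l _ w hp hm).
  have -> : pd l (fun w : 'rV[R]_n => -1 * (phi w * phi w * (w 0 i * w 0 j))) w = - pd l (fun w : 'rV[R]_n => phi w * phi w * (w 0 i * w 0 j)) w.
    rewrite pdZ ?mulN1r // => x; exact: Ck_der (CkM hp2 hc).
  rewrite (pd_mul l w hp2 hc) pp2 pd_phi (pd_mul l w (Ck_coord R 1 i) (Ck_coord R 1 j)) !pd_coord.
  by rewrite Etan_lift !Jm_lift nrm_lift; ring.
rewrite (_ : (fun w => _) = fun w => -1 * (phi w * phi w * w 0 i)); last by apply/funext => x; rewrite Jm_max; ring.
rewrite pdZ; last by move=> x; exact: Ck_der (CkM hp2 (Ck_coord R 1 i)).
by rewrite (pd_mul l w hp2 (Ck_coord R 1 i)) pp2 pd_coord Etan_max !Jm_max nrm_max; ring.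
Qed.

Lemma JmJ w : Jm w *m (Jm w)^T = (phi w ^+ 2)%:M.
Proof.
apply/matrixP => i l; rewrite [LHS]mxE [RHS]mxE sum_lift [(Jm w)^T ord_max l]mxE; under eq_bigr do rewrite [(Jm w)^T _ l]mxE !Jm_lift.
rewrite !Jm_max.
rewrite (eq_bigr (fun j => phi w ^+ 2 * ((i == j)%:R * (l == j)%:R) - phi w ^+ 3 * w 0 l * ((i == j)%:R * w 0 j)
   - phi w ^+ 3 * w 0 i * ((l == j)%:R * w 0 j) + phi w ^+ 4 * (w 0 i * w 0 l) * (w 0 j * w 0 j))); last by move=> j _; ring.
rewrite !big_split /= !sumrN -!mulr_sumr -nsqE.
have d1 (x : 'I_n) (f : 'I_n -> R) : \sum_j (x == j)%:R * f j = f x.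
  rewrite (bigD1 x) //= eqxx mul1r big1 ?addr0 // => j jx; by rewrite eq_sym (negbTE jx) mul0r.
rewrite !d1 eq_sym -mulr_natr.
have -> : phi w ^+ 4 * (w 0 i * w 0 l) * nsq w = phi w ^+ 3 * (w 0 i * w 0 l) * (phi w * nsq w) by ring.
by rewrite phi_nsq; ring.
Qed.

Lemma JmN w : Jm w *m (nrm w)^T = 0.
Proof.
apply/matrixP => i o; rewrite ord1 [LHS]mxE [RHS]mxE sum_lift [(nrm w)^T ord_max 0]mxE; under eq_bigr do rewrite [(nrm w)^T _ 0]mxE Jm_lift nrm_lift.
rewrite Jm_max nrm_max.
rewrite (eq_bigr (fun j => phi w ^+ 2 * ((i == j)%:R * w 0 j) - phi w ^+ 3 * w 0 i * (w 0 j * w 0 j))); last by move=> j _; ring.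
rewrite sumrB -!mulr_sumr -nsqE (bigD1 i) //= eqxx mul1r big1 => [|j ji]; last by rewrite eq_sym (negbTE ji) mul0r.
have -> : phi w ^+ 3 * w 0 i * nsq w = phi w ^+ 2 * w 0 i * (phi w * nsq w) by ring.
by rewrite phi_nsq; ring.
Qed.

Lemma nrm1 w : nsq (nrm w) = 1.
Proof.
rewrite nsqE sum_lift nrm_max; under eq_bigr do rewrite nrm_lift.
rewrite (eq_bigr (fun j => phi w ^+ 2 * (w 0 j * w 0 j))); last by move=> j _; ring.
rewrite -mulr_sumr -nsqE; have -> : phi w ^+ 2 * nsq w = phi w * (phi w * nsq w) by ring.
by rewrite phi_nsq; ring.
Qed.

Definition pull H w := (1 + nsq w) / 2 * H (chart w).

Lemma pullE H w : H (chart w) = phi w * pull H w.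
Proof. by rewrite /pull /phi; field; rewrite gt_eqF // nsq1_gt0. Qed.

Lemma Ck_pull k H : Ck k H -> Ck k (pull H).
Proof.
move=> hH; rewrite (_ : pull H = fun w => (2^-1 * (1 + nsq w)) * (H \o chart) w); last by apply/funext => w; rewrite /pull [_ / 2]mulrC.
by apply: (CkM (CkZ _ (CkD (Ck_cst n k 1) (Ck_nsq R n k))) (Ck_comp hH)).
Qed.

Local Notation u H := (H \o chart).

Lemma pd_pull H i w : Ck 1 H -> pd i (pull H) w = (1 + nsq w) / 2 * pd i (u H) w + w 0 i * u H w.
Proof.
move=> hH; have hs : Ck 1 (fun w : 'rV[R]_n => 2^-1 * nsq w + 2^-1) by exact: (Ck_lin _ (Ck_nsq R n 1) (Ck_cst n 1 _)).
rewrite (_ : pull H = fun w => (2^-1 * nsq w + 2^-1) * u H w); last by apply/funext => x; rewrite /pull /=; ring.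
rewrite (pd_mul i w hs (Ck_comp hH)) (pd_lin i _ w (Ck_nsq R n 1) (Ck_cst n 1 _)) pd_nsq pd_cst.
by field.
Qed.

Lemma euler_pull H w : Ck 1 H -> euler (pull H) w = (1 + nsq w) / 2 * euler (u H) w + nsq w * u H w.
Proof.
move=> hH; rewrite /euler; under eq_bigr do rewrite (pd_pull _ _ hH).
rewrite (eq_bigr (fun i => (1 + nsq w) / 2 * (w 0 i * pd i (u H) w) + u H w * (w 0 i * w 0 i))); last by move=> i _; ring.
by rewrite big_split /= -!mulr_sumr -nsqE mulrC [u H w * _]mulrC mulrC.
Qed.

Lemma pd2_pull H l i w : Ck 2 H -> pd l (pd i (pull H)) w = (1 + nsq w) / 2 * pd l (pd i (u H)) w
  + (w 0 l * pd i (u H) w + w 0 i * pd l (u H) w) + (l == i)%:R * u H w.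
Proof.
move=> hH; have hu := Ck_comp hH.
have hs : Ck 1 (fun w : 'rV[R]_n => 2^-1 * nsq w + 2^-1) by exact: (Ck_lin _ (Ck_nsq R n 1) (Ck_cst n 1 _)).
rewrite (_ : pd i (pull H) = fun w => 1 * ((2^-1 * nsq w + 2^-1) * pd i (u H) w) + w 0 i * u H w); last first.
  by apply/funext => x; rewrite (pd_pull i x (CkW hH)); ring.
rewrite (pd_lin l 1 w (CkM hs (Ck_pd i hu)) (CkM (Ck_coord R 1 i) (CkW hu))).
rewrite (pd_mul l w hs (Ck_pd i hu)) (pd_mul l w (Ck_coord R 1 i) (CkW hu)).
by rewrite (pd_lin l _ w (Ck_nsq R n 1) (Ck_cst n 1 _)) pd_nsq pd_cst pd_coord; field.
Qed.

Definition amb H w : 'M[R]_n.+1 := \matrix_(a, b) pd a (pd b H) (chart w).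
Definition nder H w := \sum_a nrm w 0 a * pd a H (chart w).

Lemma Sh_pull H w : Ck 2 H ->
  phi w *: Sh (pull H) w = Jm w *m amb H w *m (Jm w)^T + (phi w ^+ 2 * (H (chart w) - nder H w))%:M.
Proof.
move=> hH; have h1 := CkW hH; apply/matrixP => l i; rewrite [LHS]mxE [RHS]mxE.
have uE j : pd j (u H) w = \sum_a Jm w j a * pd a H (chart w) := (pd_comp j w h1).2.
have u2 : pd l (pd i (u H)) w = \sum_a pd l (fun w => Jm w i a) w * pd a H (chart w) + (Jm w *m amb H w *m (Jm w)^T) l i.
  rewrite (_ : pd i (u H) = fun w => \sum_a Jm w i a * (pd a H \o chart) w); last first.
    by apply/funext => x; exact: (pd_comp i x h1).2.
  have hm a : Ck 1 (fun w => Jm w i a * (pd a H \o chart) w) := CkM (Ck_Jm 1 i a) (Ck_comp (Ck_pd a hH)).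
  rewrite pd_sum; last by move=> a x; exact: Ck_der (hm a).
  rewrite [X in _ = _ + X]mxE; under [X in _ = _ + X]eq_bigr do rewrite mxE [X in _ * X]mxE.
  rewrite -big_split; apply: eq_bigr => a _ /=.
  have -> : \sum_b Jm w l b * amb H w b a = \sum_b Jm w l b * pd b (pd a H) (chart w).
    by apply: eq_bigr => b _; rewrite [amb _ _ _ _]mxE.
  by rewrite (pd_mul l w (Ck_Jm 1 i a) (Ck_comp (Ck_pd a hH))) (pd_comp l w (Ck_pd a hH)).2 /=; ring.
have eu : euler (u H) w = \sum_a Etan w a * pd a H (chart w).
  rewrite /euler; under eq_bigr do rewrite uE mulr_sumr; rewrite exchange_big; apply: eq_bigr => a _ /=.
  by rewrite /Etan mulr_suml; apply: eq_bigr => j _; rewrite mulrA.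
have u3 : \sum_a pd l (fun w => Jm w i a) w * pd a H (chart w) =
    - phi w * (w 0 l * pd i (u H) w + w 0 i * pd l (u H) w - (l == i)%:R * euler (u H) w) - phi w ^+ 2 * (l == i)%:R * nder H w.
  rewrite !uE eu /nder !mulr_sumr -big_split /= -sumrB mulr_sumr -sumrB; apply: eq_bigr => a _.
  by rewrite pd_Jm; ring.
rewrite [Sh _ _ _ _]mxE [hess _ _ _ _]mxE [X in _ * (_ + X)]mxE [X in _ = _ + X]mxE.
have qE : qf (pull H) w = (1 + nsq w) / 2 * H (chart w) - ((1 + nsq w) / 2 * euler (u H) w + nsq w * H (chart w)).
  by rewrite /qf (euler_pull w h1).
rewrite (pd2_pull l i w hH) u2 u3 qE; clear u2 u3 qE eu uE.
set X := (_ *m _ *m _) l i; move: X (nder H w) (euler (u H) w) (pd i (u H) w) (pd l (u H) w) => X N E p q.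
rewrite /=; move: (H (chart w)) => U; have z0 : 1 + nsq w != 0 by rewrite gt_eqF // nsq1_gt0.
by case: (l == i); rewrite ?mulr1n ?mulr0n /phi; field.
Qed.

Lemma euler_comp H w : Ck 1 H -> euler (u H) w = \sum_a Etan w a * pd a H (chart w).
Proof.
move=> hH; rewrite /euler; under eq_bigr do rewrite (pd_comp _ w hH).2 mulr_sumr.
rewrite exchange_big; apply: eq_bigr => a _ /=.
by rewrite /Etan mulr_suml; apply: eq_bigr => j _; rewrite mulrA.
Qed.

End Chart.

Section Positive.
Variables (R : realType) (n : nat) (r : R).
Hypothesis r0 : 0 < r.
Implicit Types (v : 'rV[R]_n -> R) (w : 'rV[R]_n).

(** Later divisions require positivity on the whole space. With [c] a positive lower bound on the
    ball, [v] is blended with the constant 1 between the levels [c / 2] and [c / 4], which are not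
    reached on the ball. *)
Lemma positive_modification v : Ck 2 v -> (forall w, ball2 r w -> 0 < v w) ->
  exists V, [/\ Ck 2 V, forall w, 0 < V w & forall w, ball2 r w ->
    [/\ V w = v w, qf V w = qf v w & Sh V w = Sh v w]].
Proof.
move=> hv vp; have cv := Ck_cts hv; have [c c0 hc] := ball2_pos_min r0 cv vp.
pose s w := smoothstep (4 / c * v w - 1).
have hs : Ck 2 s.
  apply: (Ck_smoothstep (F := fun w => 4 / c * v w - 1)); exact: CkB (CkZ _ hv) (Ck_cst n 2 1).
pose V w := s w * v w + (1 - s w).
have hV : Ck 2 V by exact: CkD (CkM hs hv) (CkB (Ck_cst n 2 1) hs).
have oO : open [set w | c / 2 < v w].
  by apply: (@open_comp _ _ v [set x | c / 2 < x]) => [w _|]; [exact: (ctsE cv)|exact: open_gt].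
have eq0 w : c / 2 < v w -> V w = v w.
  move=> h; rewrite /V /s smoothstep_ge1 ?mul1r ?subrr ?addr0 //.
  have : 2 <= 4 / c * v w by rewrite mulrAC ler_pdivlMr //; lra.
  by lra.
have inO w : ball2 r w -> c / 2 < v w by move=> /hc; apply: lt_le_trans; lra.
have eq1 i w : c / 2 < v w -> pd i V w = pd i v w by move=> h; exact: (@pd_on _ _ _ i V v w oO eq0 h).
have eq2 i j w : c / 2 < v w -> pd i (pd j V) w = pd i (pd j v) w.
  by move=> h; exact: (@pd_on _ _ _ i _ _ w oO (eq1 j) h).
exists V; split=> // [w|w /inO wO].
  have s0 := smoothstep_ge0 (4 / c * v w - 1); have s1 := smoothstep_le1 (4 / c * v w - 1).
  have [h|h] := lerP (v w) (c / 4).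
    rewrite /V /s smoothstep_le0 ?mul0r ?subr0 ?add0r //.
    have : 4 / c * v w <= 1 by rewrite mulrAC ler_pdivrMr //; lra.
    by lra.
  have vw : 0 < v w by apply: lt_trans h; rewrite divr_gt0.
  have [z|z] := eqVneq (s w) 0; first by rewrite /V z mul0r subr0 add0r.
  rewrite /V ltr_pwDl ?subr_ge0 // mulr_gt0 // lt_neqAle eq_sym z.
  exact: s0.
have q : qf V w = qf v w.
  by rewrite /qf (eq0 w wO) /euler; congr (_ - _); apply: eq_bigr => i _; rewrite eq1.
split; [exact: eq0|exact: q|].
by rewrite /Sh q; congr (_ + _); apply/matrixP => i j; rewrite !mxE eq2.
Qed.

End Positive.

(** * From the cap to the ball *)

Section Transfer.
Variables (R : realType) (n : nat) (theta : R).
Hypothesis th : 0 < theta < pi.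
Implicit Types (w : 'rV[R]_n) (xi : 'rV[R]_n.+1).
Local Notation c := (cos theta).
Local Notation lf := (lift (ord_max : 'I_n.+1)).

Lemma cos_bound : -1 < c < 1.
Proof.
have := sin_gt0_pi th; have := cos2Dsin2 theta => e s0; have s2 : 0 < sin theta ^+ 2 by rewrite exprn_gt0.
have c2 : c ^+ 2 < 1 ^+ 2 by rewrite expr1n; lra.
by rewrite -ltr_norml; rewrite -(@ltr_pXn2r _ 2) ?nnegrE // real_normK ?num_real.
Qed.

(** This is tan(theta / 2): the height phi - 1 - cos theta of a point of the chart is nonnegative
    exactly for |w| <= rad in the Euclidean norm. *)
Definition rad := Num.sqrt ((1 - c) / (1 + c)).

Lemma rad2 : rad ^+ 2 = (1 - c) / (1 + c).
Proof. by have /andP[h1 h2] := cos_bound; rewrite sqr_sqrtr // divr_ge0; lra. Qed.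

Lemma rad_gt0 : 0 < rad.
Proof. by have /andP[h1 h2] := cos_bound; rewrite sqrtr_gt0 divr_gt0; lra. Qed.

Lemma chart_sub w : capnormal theta (chart theta w) = nrm w.
Proof. by rewrite /capnormal /chart addrK. Qed.

Lemma chart_max w : chart theta w 0 ord_max = phi w - 1 - c.
Proof. by rewrite /chart mxE nrm_max ctr_max. Qed.

Lemma chart_max_ge0 w : (0 <= chart theta w 0 ord_max) = (nsq w <= rad ^+ 2).
Proof.
have /andP[h1 h2] := cos_bound; have c1 : 0 < 1 + c by lra.
have n1 := nsq1_gt0 w.
rewrite chart_max rad2 /phi ler_pdivlMr // -subr_ge0 -(pmulr_lge0 _ n1).
by rewrite -[RHS]subr_ge0; congr (0 <= _); field; rewrite gt_eqF.
Qed.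

Lemma chart_cap w : ball2 rad w -> cap n theta (chart theta w).
Proof.
move=> wB; apply/capP; split; first by rewrite chart_max_ge0.
by rewrite /capq -/(capnormal theta _) chart_sub nrm1.
Qed.

Lemma chart_bdry w : nsq w = rad ^+ 2 -> phi w = 1 + c.
Proof.
move=> wr; have /andP[h1 h2] := cos_bound; rewrite /phi wr rad2; field.
by rewrite gt_eqF; lra.
Qed.

Lemma chart_surj xi : cap n theta xi -> exists2 w, ball2 rad w & chart theta w = xi.
Proof.
move=> cx; have /capP[x0 q1] := cx; have /andP[h1 h2] := cos_bound.
pose N := capnormal theta xi; have Nm : N 0 ord_max = xi 0 ord_max + c by rewrite mxE mxE ctr_max opprK.
have N1 : 0 < 1 + N 0 ord_max by rewrite Nm; lra.
pose w : 'rV[R]_n := \row_i (N 0 (lf i) / (1 + N 0 ord_max)).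
have sN : \sum_i N 0 (lf i) * N 0 (lf i) = 1 - N 0 ord_max ^+ 2.
  by move: q1; rewrite /capq -/(capnormal theta xi) -/N nsqE sum_lift => <-; ring.
have sw : nsq w = (1 - N 0 ord_max) / (1 + N 0 ord_max).
  rewrite nsqE (eq_bigr (fun i => (1 + N 0 ord_max)^-1 ^+ 2 * (N 0 (lf i) * N 0 (lf i)))); last by move=> i _; rewrite !mxE; ring.
  by rewrite -mulr_sumr sN; field; rewrite gt_eqF.
have pw : phi w = 1 + N 0 ord_max.
  rewrite /phi (_ : 1 + nsq w = 2 / (1 + N 0 ord_max)); first by field; rewrite gt_eqF.
  by rewrite sw; field; rewrite gt_eqF.
have nE : nrm w = N.
  apply/rowP; elim/ord_liftP => [i|]; last by rewrite nrm_max pw addrC addKr.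
  have wi : w 0 i = N 0 (lf i) / (1 + N 0 ord_max) by rewrite mxE.
  by rewrite nrm_lift pw wi; field; rewrite gt_eqF.
have cE : chart theta w = xi by rewrite /chart nE subrK.
by exists w => //; rewrite /ball2 -chart_max_ge0 cE.
Qed.

(** [Sh V] is [phi] times the tangential matrix in an orthonormal frame, which yields the factor
    [phi ^+ k.+1]; the other power of [phi] comes from h = phi V in the right-hand side of the
    equation. *)
Lemma transfer k (p : R) f h : pos_smooth_on_cap n theta f -> pos_admissible_solution n k.+1 theta p f h ->
  exists V, [/\ dom rad V, forall w, 0 < V w,
    forall w, ball2 rad w -> GamM k.+1 (Sh V w) /\
      sg k.+1 (Sh V w) = phi w ^+ k.+1 * f (chart theta w) * phi w `^ (p - 1) * V w `^ (p - 1) &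
    forall w, ball2 rad w -> h (chart theta w) = phi w * V w].
Proof.
move=> hf [[U [oU [capU hU]]] [heq hbd]].
have [H [Y [hH oO capO HO]]] := cap_extension oU capU hU; have h1 := CkW hH.
have HOE y : Y y -> h y = H y by move=> /HO.
have inO w : ball2 rad w -> Y (chart theta w) by move=> /chart_cap/capO.
pose v := pull theta H; have hv : Ck 2 v := Ck_pull theta hH.
have hE w : ball2 rad w -> h (chart theta w) = phi w * v w.
  by move=> wB; rewrite HOE ?(pullE theta H w) //; exact: inO.
have vp w : ball2 rad w -> 0 < v w.
  move=> wB; have [h0 _] := heq _ (chart_cap wB).
  by rewrite -(pmulr_rgt0 _ (phi_gt0 w)) -hE.
have [V [hV Vp VE]] := positive_modification rad_gt0 hv vp.
have dirE w x : ball2 rad w -> 'D_x h (chart theta w) = \sum_a x 0 a * pd a H (chart theta w).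
  by move=> wB; rewrite (derive_on x oO (inO w wB) HOE) (Ck_derivable_dir _ _ h1).2.
exists V; split=> //.
- split=> // w wr; have wB : ball2 rad w by rewrite /ball2 wr.
  have [_ -> _] := VE w wB; have ph := chart_bdry wr; have /andP[c1 c2] := cos_bound.
  have cb : capbdry n theta (chart theta w) by split; [exact: chart_cap|rewrite chart_max ph; ring].
  have s0 := sin_gt0_pi th.
  have eu : euler (H \o chart theta) w = c * H (chart theta w).
    rewrite (euler_comp theta w h1) -HOE; last exact: inO.
    (* On the boundary the radial derivative of the chart is sin theta times the outward conormal,
       so the cotangent in the boundary condition becomes a cosine. *)
    have cn a : Etan w a = sin theta * conormal theta (chart theta w) 0 a.
      rewrite /conormal chart_sub [RHS]mulrC mxE mulrAC mulVf ?gt_eqF // mul1r.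
      elim/ord_liftP: a => [i|].
        rewrite Etan_lift ph !mxE (_ : _ == lf i = false) ?subr0; last by apply/negbTE; exact: neq_lift.
        by rewrite liftK addrAC subrr add0r ph.
      have eE : Elast R n 0 ord_max = 1 by rewrite mxE eqxx.
      by rewrite Etan_max [RHS]mxE [X in _ = X + _]mxE [X in _ = _ + X]mxE eE nrm_max ph; ring.
    under eq_bigr do rewrite cn -mulrA; rewrite -mulr_sumr -(dirE w _ wB) (hbd _ cb).
    by field; rewrite gt_eqF.
  rewrite /qf (euler_pull theta w h1) eu /v /pull wr rad2 /=; field.
  by rewrite gt_eqF; lra.
- move=> w wB; have [VEw _ ->] := VE w wB; have cx := chart_cap wB.
  have [h0 [lam [te [ga sk]]]] := heq _ cx.
  set xi := chart theta w in cx h0 te sk *.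
  have p0 := phi_gt0 w; have pn : phi w != 0 by rewrite gt_eqF.
  (* The rows of [Jm w] have length [phi w]; dividing by it gives an orthonormal frame, in which [B]
     is the tangential block of [W]. *)
  pose B := (phi w)^-1 *: Sh v w; have sB : B^T = B.
    by apply/matrixP => i j; rewrite !mxE; congr (_ * _); have := Sh_sym w hv => /matrixP/(_ i j); rewrite !mxE.
  have ShE : Sh v w = phi w *: B by rewrite scalerA divff // scale1r.
  set W := Wmat theta h xi in te; pose A := amb theta H w + (H xi - nder theta H w)%:M.
  have WE : W = tanproj theta xi *m A *m tanproj theta xi.
    rewrite /W /Wmat /A; congr (_ *m (_ + _%:M) *m _).
      by apply/matrixP => a b; rewrite !mxE; exact: iterD_on oO (inO w wB) HOE.
    by rewrite HOE ?(dirE w _ wB) ?chart_sub //; exact: inO.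
  have tE : tanproj theta xi = 1%:M - (nrm w)^T *m nrm w by rewrite /tanproj chart_sub.
  have N1 : nrm w *m (nrm w)^T = 1%:M.
    apply/matrixP => a b; rewrite !ord1 !mxE eqxx /= -[RHS](nrm1 w) nsqE.
    by apply: eq_bigr => i _; rewrite [X in _ * X]mxE.
  have NP : nrm w *m tanproj theta xi = 0.
    by rewrite tE mulmxBr mulmx1 mulmxA N1 mul1mx subrr.
  have PN : tanproj theta xi *m (nrm w)^T = 0.
    by rewrite tE mulmxBl mul1mx -mulmxA N1 mulmx1 subrr.
  have JP : Jm w *m tanproj theta xi = Jm w.
    by rewrite tE mulmxBr mulmx1 mulmxA JmN mul0mx subr0.
  have PJ : tanproj theta xi *m (Jm w)^T = (Jm w)^T.
    have NJ : nrm w *m (Jm w)^T = 0 by rewrite -[LHS]trmxK trmx_mul trmxK JmN trmx0.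
    by rewrite tE mulmxBl mul1mx -mulmxA NJ mulmx0 subr0.
  have JWJ : Jm w *m W *m (Jm w)^T = phi w ^+ 2 *: B.
    rewrite WE !mulmxA JP -!mulmxA PJ mulmxA /A mulmxDr mulmxDl mul_mx_scalar -scalemxAl JmJ.
    rewrite /B scalerA (_ : phi w ^+ 2 * (phi w)^-1 = phi w); last by field.
    by rewrite (Sh_pull theta w hH) scale_scalar_mx mulrC.
  have NW : nrm w *m W = 0 by rewrite WE !mulmxA NP !mul0mx.
  have WN : W *m (nrm w)^T = 0 by rewrite WE -!mulmxA PN !mulmx0.
  have cp := char_poly_tangent pn N1 (JmJ w) (JmN w) NW WN JWJ.
  have cpB : char_poly B = \prod_(i < n) ('X - (lam i)%:P).
    by apply: (mulfI (negbT (polyX_eq0 R))); rewrite -cp; exact: te.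
  have sgE j : sg j (Sh v w) = phi w ^+ j * sigmak j lam.
    by rewrite ShE (NTZ j _ _).2 (sg_char_poly j sB cpB).
  split.
    case=> [|j] jk; first exact: ltr01.
    by rewrite sgE mulr_gt0 ?exprn_gt0 //; exact: ga.
  by rewrite sgE sk hE // VEw powRM ?(ltW p0) ?(ltW (vp w wB)) // !mulrA.
by move=> w wB; have [-> _ _] := VE w wB; exact: hE.
Qed.

End Transfer.

Theorem theorem5p4 (R : realType) (n k : nat) (theta p : R)
  (f h1 h2 : 'rV[R]_n.+1 -> R) :
  (2 <= n)%N -> (1 <= k <= n)%N ->
  0 < theta < pi ->
  1 < p < k%:R + 1 ->
  pos_smooth_on_cap n theta f ->
  pos_admissible_solution n k theta p f h1 ->
  pos_admissible_solution n k theta p f h2 ->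
  forall xi, cap n theta xi -> h1 xi = h2 xi.
Proof.
move=> n2 + th + hf; case: k => [|k] //= kn pk s1 s2 xi cx.
have [V1 [d1 p1 e1 r1]] := transfer th hf s1; have [V2 [d2 p2 e2 r2]] := transfer th hf s2.
have [w wB <-] := chart_surj th cx; rewrite r1 // r2 //; congr (_ * _).
pose F w := phi w ^+ k.+1 * f (chart theta w) * phi w `^ (p - 1).
apply: (ball_unique (rad_gt0 th) (F := F) n2 kn pk d1 d2 p1 p2) => // [x xB|x xB|x xB].
- exact: (e1 x xB).1.
- exact: (e2 x xB).1.
split; [|exact: (e1 x xB).2|exact: (e2 x xB).2].
by rewrite mulr_gt0 ?powR_gt0 ?phi_gt0 // mulr_gt0 ?exprn_gt0 ?phi_gt0 //; apply: hf.2; exact: chart_cap.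
Qed.
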